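(* Assume the setting of the context and suppose $v_1<0$, $v_2>0$ (in particular $\gamma$ reaches $\{\theta=0\}$) and $v_3<0$. Then for every integer $k\ge0$ there exists a periodic orbit, of some period $T$, such that $\theta(0)=-\pi/2$, $v(0)=0$, during $(0,T/4)$ the function $\theta$ crosses the partial-collision line $\{\theta=-\pi/2\}$ $k$ times, and at $s=T/4$ the orbit hits an Eulerian line orthogonally: $v(T/4)=0$, with $\theta(T/4)=0$ if $k$ is even and $\theta(T/4)=-\pi$ if $k$ is odd.
   Context: Let $c:\mathbb R\to(0,\infty)$ be either $c(\theta)=\frac14(1+\sin^2\theta)^2$ or $c(\theta)=1+\cos^2\theta$. Let $V:\mathbb R\setminus(\frac\pi2+\pi\mathbb Z)\to(0,\infty)$ be smooth, even and $\pi$-periodic, such that $\mathcal W(\theta):=\cos^2\theta\,V(\theta)$ extends to a smooth positive function on $\mathbb R$, and such that on $(-\pi/2,\pi/2)$ the function $V$ has exactly three critical points $-\theta^*<0<\theta^*$, all non-degenerate. (This is the shape potential of a Lagrangian system $\frac12\dot r^2+\frac12r^2\dot\theta^2\cos^2\theta/c(\theta)+V(\theta)/r$; the lines $\theta\in\frac\pi2+\pi\mathbb Z$ are regularized partial-collision configurations, the lines $\theta\in\pi\mathbb Z$ the ''Eulerian'' configurations.) With energy fixed at $-1$, $v=r^{1/2}\dot r$, $w=\dot\theta\,r^{3/2}\cos^2\theta/c(\theta)$ and time change $dt/ds=r^{3/2}\cos^2\theta$, the regularized equations are ($'=d/ds$): $r'=rv\cos^2\theta$, $v'=\frac12v^2\cos^2\theta+w^2c(\theta)-\mathcal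 W(\theta)$, $\theta'=w\,c(\theta)$, $w'=\mathcal W'(\theta)-\frac12vw\cos^2\theta+\cos\theta\sin\theta(2r+v^2)-\frac12w^2c'(\theta)$, on the energy manifold $\mathcal P_1=\{r\ge0,\ \frac12v^2\cos^2\theta+\frac12w^2c(\theta)-\mathcal W(\theta)=-r\cos^2\theta\}$; the collision manifold $\mathcal P_1\cap\{r=0\}$ is invariant. Let $v^*=\sqrt{2V(\theta^* )}$ and consider the equilibria $L_-=(r,v,\theta,w)=(0,-v^*,\theta^*-\pi,0)$ and $L'_-=(0,-v^*,-\theta^*,0)$. Within the collision manifold each has a one-dimensional unstable manifold; let $\gamma$ (resp. $\gamma'$) be the branch of the unstable manifold of $L_-$ (resp. $L'_-$) in the collision manifold along which initially $w\ge0$. Let $v_1$ be the $v$-coordinate of the first intersection of $\gamma$ with $\{\theta=-\pi/2\}$, $v_2$ the $v$-coordinate of the first intersection of $\gamma$ with $\{\theta=0\}$, and $v_3$ the $v$-coordinate of the first intersection of $\gamma'$ with $\{\theta=0\}$. A periodic orbit means a periodic solution $s\mapsto(r,v,\theta,w)(s)$ of the regularized system on $\mathcal P_1$ with $r>0$; ''crossing'' a line $\{\theta=a\}$ means $\theta(s)$ passes through $a$.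
   Formalization: ''Periodic'' is taken with θ as an angle: r, v, w are T-periodic and θ(s+T) = θ(s) + 2πm for some integer m; exact periodicity of a real-valued θ is impossible, since the symmetries and the stated conditions at 0 and T/4 force θ(s+T) = θ(s) ± 2π. *)

(* Defs.v *)
From Stdlib Require Export Reals Lra List ZArith.
From Coquelicot Require Export Coquelicot.
Open Scope R_scope.

Definition c_a (t : R) : R := / 4 * (1 + (sin t) ^ 2) ^ 2.
Definition c_b (t : R) : R := 1 + (cos t) ^ 2.

Definition smooth (f : R -> R) : Prop := forall (n : nat) (x : R), ex_derive_n f n x.
Definition smooth_on (D : R -> Prop) (f : R -> R) : Prop :=
  forall (n : nat) (x : R), D x -> ex_derive_n f n x.

(** Standing assumptions on the shape potential V (defined off the lines
    cos t = 0; its values there are irrelevant) and its regularization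
    W(t) = cos^2 t V(t), which extends to a smooth positive function on R.
    ths is the positive critical point theta^* of V on (-pi/2, pi/2). *)
Definition shape_potential (V W : R -> R) (ths : R) : Prop :=
  smooth_on (fun t => cos t <> 0) V /\
  (forall t, cos t <> 0 -> 0 < V t) /\
  (forall t, cos t <> 0 -> V (- t) = V t) /\
  (forall t, cos t <> 0 -> V (t + PI) = V t) /\
  smooth W /\
  (forall t, 0 < W t) /\
  (forall t, cos t <> 0 -> W t = (cos t) ^ 2 * V t) /\
  0 < ths < PI / 2 /\
  (forall t, - (PI / 2) < t < PI / 2 ->
     (Derive V t = 0 <-> (t = - ths \/ t = 0 \/ t = ths))) /\
  Derive_n V 2 (- ths) <> 0 /\ Derive_n V 2 0 <> 0 /\ Derive_n V 2 ths <> 0.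

Definition reg_solution (c W : R -> R) (r v th w : R -> R) : Prop :=
  forall s : R,
    is_derive r s (r s * v s * (cos (th s)) ^ 2) /\
    is_derive v s (/ 2 * (v s) ^ 2 * (cos (th s)) ^ 2 + (w s) ^ 2 * c (th s) - W (th s)) /\
    is_derive th s (w s * c (th s)) /\
    is_derive w s (Derive W (th s) - / 2 * v s * w s * (cos (th s)) ^ 2
                   + cos (th s) * sin (th s) * (2 * r s + (v s) ^ 2)
                   - / 2 * (w s) ^ 2 * Derive c (th s)).

Definition on_P1 (c W : R -> R) (r v th w : R -> R) : Prop :=
  forall s : R, 0 <= r s /\
    / 2 * (v s) ^ 2 * (cos (th s)) ^ 2 + / 2 * (w s) ^ 2 * c (th s) - W (th s)
      = - r s * (cos (th s)) ^ 2.

(** (r, v, th, w) is (a time-parametrization of) the branch of the unstable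
    manifold, inside the collision manifold, of the equilibrium
    (0, v0, th0, 0) along which initially w >= 0. *)
Definition unstable_branch_wpos (c W : R -> R) (v0 th0 : R) (r v th w : R -> R) : Prop :=
  reg_solution c W r v th w /\ on_P1 c W r v th w /\
  (forall s, r s = 0) /\
  is_lim v m_infty v0 /\ is_lim th m_infty th0 /\ is_lim w m_infty 0 /\
  ~ (forall s, v s = v0 /\ th s = th0 /\ w s = 0) /\
  (exists s0, forall s, s <= s0 -> 0 <= w s).

Definition first_hit (th : R -> R) (a s1 : R) : Prop :=
  th s1 = a /\ forall s, s < s1 -> th s <> a.

Definition crosses (th : R -> R) (a s : R) : Prop :=
  th s = a /\ exists eps, 0 < eps /\
    forall h, 0 < h < eps -> (th (s - h) - a) * (th (s + h) - a) < 0.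

(* Main.v *)
Require Import Defs.
From Stdlib Require Import Reals Lra List ZArith Lia Psatz Classical ClassicalEpsilon.
From Coquelicot Require Import Coquelicot.
Open Scope R_scope.

(** Shoot from the line [theta = - PI / 2] with [v = 0], [w > 0] and parameter [r > 0]. An orbit either reaches the Euler line [theta = 0], or turns
    back before [- ths] and returns to the section (up to reflection), or is asymptotic to the lower Lagrange equilibrium; the first two
    outcomes are open. Near an asymptotic orbit, the orbits that pass follow [gamma'] and reach the Euler line with [v] near [v3 < 0], while
    those that return follow [gamma] and come back near [v1], hence reach the Euler line with [v] near [v2 > 0]. For small [r] the orbit reaches
    the Euler line; for large [r] it oscillates about the line [- PI / 2] as often as desired. Going down in [r], one finds for each [k >= 1] an
    interval of parameters with [k] returns, at one end of which [v > 0] on the Euler line; where this stops being so, [v = 0] there. The reversors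
    about the two lines then close the orbit after four times the transit time.

    For [k = 0] the orbits of small [r] may all reach the Euler line with [v < 0]. The collision orbit from [r = v = 0] is then asymptotic to
    the Euler equilibrium, and comparing it with [gamma] and [gamma'] shows that [gamma'] reaches [PI / 2] with [v > - v1]. In that case one shoots
    for orbits that pass the Euler line, turn beyond [PI / 2], turn again, and meet the Euler line with [v = 0] on the way back. *)

(** Orbits asymptotic to an equilibrium linger there for an unbounded time, so continuity in time
    says nothing about where their neighbours go afterwards. No linearization or invariant manifold
    theorem is used: orbits are compared at equal angles, the angle being a valid parameter while
    [w > 0], and over an angular range of at most [PI] errors grow by a bounded factor however long
    the passage takes. Three sign facts carry the qualitative part: [q = cos ^ 3 * V'] is the force
    at rest; [En = r + v ^ 2 / 2] never exceeds [V], equals it at stops, and varies with the sign of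
    [v]; on the collision manifold [v] never decreases. The case [k = 0] is special because its
    parameter interval starts at [r = 0], where nothing gives the sign of [v] on the Euler line; for
    [k >= 1] it starts at an asymptotic orbit. The estimate on [gam'] rests on an identity: for
    collision orbits at equal angles, [(v_b - v) / (w + w_b)] has a logarithmic derivative in which,
    besides a term depending on the first orbit only, there is just [q] divided by [w_b]. *)

Ltac rmin a b := pose proof (Rmin_l a b); pose proof (Rmin_r a b).

Ltac rminp a b := assert (0 < Rmin a b) by (apply Rmin_glb_lt; lra); rmin a b.

Ltac pos := first [lra | assumption | apply exp_pos | apply pow2_ge_0
  | apply Rmin_glb_lt; pos | apply Rmult_lt_0_compat; pos | apply Rmult_le_pos; pos
  | apply Rdiv_lt_0_compat; pos | apply Rdiv_le_0_compat; pos | apply pow_lt; pos].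

Create HintDb continuity.

Ltac cont := cbv beta; lazymatch goal with
  | |- continuous (fun _ => ?k) _ => apply continuous_const
  | |- continuous (fun s => - @?f s) _ => apply (continuous_opp f); cont
  | |- continuous (fun s => @?f s - @?g s) _ => apply (continuous_minus f g); cont
  | |- continuous (fun s => @?f s + @?g s) _ => apply (continuous_plus f g); cont
  | |- continuous (fun s => @?f s * @?g s) _ => apply (continuous_mult f g); cont
  | |- _ => auto with continuity
  end.


(** * Calculus on the line: first zeros, monotonicity, Gronwall, inverse functions *)

Lemma is_derive_continuous (f : R -> R) (x l : R) : is_derive f x l -> continuous f x.
Proof. intros H. apply (ex_derive_continuous (V := R_NormedModule)). now exists l. Qed.

Lemma continuous_eps (f : R -> R) (x : R) :
  continuous f x -> forall e, 0 < e -> exists d, 0 < d /\ forall y, Rabs (y - x) < d -> Rabs (f y - f x) < e.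
Proof.
  intros H e He.
  destruct (proj1 (filterlim_locally f (f x)) H (mkposreal e He)) as [d Hd]. exists d. split; [apply cond_pos|].
  intros y Hy. exact (Hd y Hy).
Qed.

Lemma sign_near (f : R -> R) (x : R) :
  continuous f x -> 0 < f x -> exists d, 0 < d /\ forall y, Rabs (y - x) < d -> 0 < f y.
Proof.
  intros H Hp. destruct (continuous_eps f x H (f x) Hp) as [d [Hd H1]].
  exists d; split; auto. intros y Hy. specialize (H1 y Hy).
  apply Rabs_def2 in H1. lra.
Qed.

Lemma first_zero (f : R -> R) (a b : R) :
  a <= b -> (forall s, a <= s <= b -> continuous f s) -> f a < 0 -> 0 <= f b ->
  exists t, a < t <= b /\ f t = 0 /\ forall s, a <= s < t -> f s < 0.
Proof.
  intros Hab Hc Ha Hb.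
  (* The supremum of the initial segments on which [f] stays negative is the first zero. *)
  set (E := fun s => a <= s <= b /\ forall u, a <= u <= s -> f u < 0).
  destruct (completeness E) as [t [Ht1 Ht2]].
  { exists b. intros s [Hs _]. lra. }
  { exists a. split; [lra|]. intros u Hu. now replace u with a by lra. }
  assert (Hat : a <= t). { apply Ht1. split; [lra|]. intros u Hu. now replace u with a by lra. }
  assert (Htb : t <= b). { apply Ht2. intros s [Hs _]. lra. }
  assert (Hbelow : forall s, a <= s < t -> f s < 0).
  { intros s Hs. destruct (Rlt_dec (f s) 0) as [|Hn]; auto. exfalso.
    assert (t <= s); [|lra]. apply Ht2. intros u [Hu1 Hu2].
    destruct (Rle_dec u s); auto. exfalso. apply Hn. apply Hu2. lra. }
  assert (Hft : f t = 0).
  { destruct (Rtotal_order (f t) 0) as [Hn|[He|Hp]]; auto; exfalso.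
    - destruct (sign_near (fun s => - f s) t) as [d [Hd H1]]; [|lra|].
      { apply (continuous_opp f). apply Hc. lra. }
      assert (Htb' : t < b). { destruct Htb as [|Heq]; auto. subst. lra. }
      set (u := Rmin b (t + d / 2)).
      assert (Hu : t < u <= b) by (unfold u; split; [pos| apply Rmin_l]).
      assert (u <= t + d / 2) by apply Rmin_r.
      assert (E u).
      { split; [lra|]. intros z Hz. destruct (Rlt_dec z t). apply Hbelow; lra.
        assert (0 < - f z); [apply H1; apply Rabs_def1; lra|lra]. }
      specialize (Ht1 u H0). lra.
    - destruct (sign_near f t) as [d [Hd H1]]; [apply Hc; lra|auto|].
      assert (a < t). { destruct Hat as [|Heq]; auto. subst. lra. }
      set (u := Rmax a (t - d / 2)).
      assert (Hu : a <= u < t) by (unfold u; split; [apply Rmax_l|apply Rmax_lub_lt; lra]).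
      assert (t - d / 2 <= u) by apply Rmax_r.
      assert (0 < f u) by (apply H1; apply Rabs_def1; lra).
      specialize (Hbelow u Hu). lra. }
  exists t. split; [|split]; auto. split; auto. destruct Hat as [|Heq]; auto. subst; lra.
Qed.

Lemma ivt (f : R -> R) (a b y : R) :
  a <= b -> (forall s, a <= s <= b -> continuous f s) -> f a < y -> y <= f b ->
  exists t, a < t <= b /\ f t = y /\ forall s, a <= s < t -> f s < y.
Proof.
  intros Hab Hc Ha Hb.
  destruct (first_zero (fun s => f s - y) a b) as [t [H1 [H2 H3]]]; auto; try lra.
  { intros s Hs. apply (continuous_minus f (fun _ => y)); auto. apply continuous_const. }
  exists t. split; auto. split; [lra|]. intros s Hs. specialize (H3 s Hs). lra.
Qed.

Lemma mean_value (f f' : R -> R) (a b : R) :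
  a < b -> (forall s, a <= s <= b -> is_derive f s (f' s)) ->
  exists t, a < t < b /\ f b - f a = f' t * (b - a).
Proof.
  intros Hab Hd.
  destruct (MVT_cor2 f f' a b Hab) as [t [H1 H2]].
  { intros s Hs. apply is_derive_Reals. auto. }
  exists t. auto.
Qed.

Lemma nondecr (f f' : R -> R) (a b : R) :
  a <= b -> (forall s, a <= s <= b -> is_derive f s (f' s)) ->
  (forall s, a < s < b -> 0 <= f' s) -> f a <= f b.
Proof.
  intros [Hab|Hab] Hd Hp; [|subst; lra].
  destruct (mean_value f f' a b Hab Hd) as [t [H1 H2]].
  specialize (Hp t H1). nra.
Qed.

Lemma incr (f f' : R -> R) (a b : R) :
  a < b -> (forall s, a <= s <= b -> is_derive f s (f' s)) ->
  (forall s, a < s < b -> 0 < f' s) -> f a < f b.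
Proof.
  intros Hab Hd Hp.
  destruct (mean_value f f' a b Hab Hd) as [t [H1 H2]].
  specialize (Hp t H1). nra.
Qed.

Lemma nonincr (f f' : R -> R) (a b : R) :
  a <= b -> (forall s, a <= s <= b -> is_derive f s (f' s)) ->
  (forall s, a < s < b -> f' s <= 0) -> f b <= f a.
Proof.
  intros [Hab|Hab] Hd Hp; [|subst; lra].
  destruct (mean_value f f' a b Hab Hd) as [t [H1 H2]].
  specialize (Hp t H1). nra.
Qed.

Lemma gronwall (f f' : R -> R) (K a b : R) :
  a <= b -> (forall s, a <= s <= b -> is_derive f s (f' s)) ->
  (forall s, a < s < b -> f' s <= K * f s) -> f b <= f a * exp (K * (b - a)).
Proof.
  intros Hab Hd Hp.
  assert (H : f b * exp (- K * (b - a)) <= f a * exp (- K * (a - a))).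
  { apply (nonincr (fun s => f s * exp (- K * (s - a)))
      (fun s => (f' s - K * f s) * exp (- K * (s - a)))); auto.
    - intros s Hs. evar_last.
      { apply (is_derive_mult f (fun s => exp (- K * (s - a)))); [now apply Hd| |intros; apply Rmult_comm].
        instantiate (1 := - K * exp (- K * (s - a))). auto_derive; [exact I|unfold Rminus; ring]. }
      unfold plus, mult; simpl; ring.
    - intros s Hs. specialize (Hp s Hs). assert (0 < exp (- K * (s - a))) by apply exp_pos. nra. }
  replace (- K * (a - a)) with 0 in H by ring. rewrite exp_0, Rmult_1_r in H.
  replace (K * (b - a)) with (- (- K * (b - a))) by ring. rewrite exp_Ropp.
  assert (0 < exp (- K * (b - a))) by apply exp_pos.
  apply Rmult_le_reg_r with (exp (- K * (b - a))); auto.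
  rewrite Rmult_assoc, Rinv_l; lra.
Qed.

(** Reparametrizes one orbit by the angle of another. Choice makes the inverse a total function,
    arbitrary outside [(f p, f q)]; once it is known to be continuous, its derivative comes from
    inverting difference quotients. *)
Lemma incr_continuous_inverse (f : R -> R) (f' : R -> R) (p q : R) :
  p < q -> (forall s, p <= s <= q -> is_derive f s (f' s)) ->
  (forall s, p <= s <= q -> 0 < f' s) ->
  exists g : R -> R, forall x, f p < x < f q ->
    p < g x < q /\ f (g x) = x /\ is_derive g x (/ f' (g x)).
Proof.
  intros Hpq Hd Hp.
  assert (Hinc : forall u v, p <= u -> u < v -> v <= q -> f u < f v).
  { intros u v H1 H2 H3. apply (incr f f'); auto; intros; [apply Hd|apply Hp]; lra. }
  assert (Hex : forall x, exists s, f p < x < f q -> p < s < q /\ f s = x).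
  { intros x. destruct (classic (f p < x < f q)) as [Hx|Hx]; [|exists 0; tauto].
    destruct (ivt f p q x) as [t [H1 [H2 H3]]]; try lra.
    { intros s Hs. eapply is_derive_continuous. apply Hd; auto. }
    exists t. intros _. split; auto. split; [lra|].
    destruct H1 as [_ [H1|H1]]; auto. subst. lra. }
  set (g := fun x => proj1_sig (constructive_indefinite_description _ (Hex x))).
  assert (Hg : forall x, f p < x < f q -> p < g x < q /\ f (g x) = x).
  { intros x. unfold g. destruct (constructive_indefinite_description _ (Hex x)); auto. }
  exists g. intros x Hx. destruct (Hg x Hx) as [Hgx Hfg]. split; auto. split; auto.
  assert (Hcont : forall e, 0 < e -> exists d, 0 < d /\ forall y, Rabs (y - x) < d -> Rabs (g y - g x) < e /\ f p < y < f q).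
  { intros e He.
    set (u := Rmax p (g x - e)). set (v := Rmin q (g x + e)).
    assert (Hu : p <= u < g x) by (unfold u; split; [apply Rmax_l|apply Rmax_lub_lt; lra]).
    assert (Hv : g x < v <= q) by (unfold v; split; [pos|apply Rmin_l]).
    assert (Hu2 : g x - e <= u) by apply Rmax_r.
    assert (Hv2 : v <= g x + e) by apply Rmin_r.
    assert (f u < x) by (rewrite <- Hfg; apply Hinc; lra).
    assert (x < f v) by (rewrite <- Hfg; apply Hinc; lra).
    assert (f p <= f u) by (destruct (proj1 Hu) as [h|h]; [left; apply Hinc; lra|right; now rewrite h]).
    assert (f v <= f q) by (destruct (proj2 Hv) as [h|h]; [left; apply Hinc; lra|right; now rewrite h]).
    exists (Rmin (x - f u) (f v - x)). split; [pos|].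
    intros y Hy. apply Rabs_def2 in Hy.
    rmin (x - f u) (f v - x).
    assert (Hy' : f p < y < f q) by lra. split; auto.
    destruct (Hg y Hy') as [Hgy Hfgy].
    apply Rabs_def1.
    - destruct (Rlt_dec (g y) v); [lra|]. exfalso. assert (f v <= f (g y)); [|lra].
      destruct (Rle_lt_or_eq_dec v (g y)) as [h|h]; [lra| |]; [left; apply Hinc; lra|right; now rewrite <- h].
    - destruct (Rlt_dec u (g y)); [lra|]. exfalso. assert (f (g y) <= f u); [|lra].
      destruct (Rle_lt_or_eq_dec (g y) u) as [h|h]; [lra| |]; [left; apply Hinc; lra|right; now rewrite h]. }
  apply is_derive_Reals. 
  assert (Hdx : derivable_pt_lim f (g x) (f' (g x))) by (apply is_derive_Reals; apply Hd; lra).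
  assert (Hm : 0 < f' (g x)) by (apply Hp; lra).
  set (m := f' (g x)) in *.
  intros e He.
  (* With [z] the difference quotient of [f], [/ z - / m = (m - z) / (z * m)]: the first bound gives
     [z > m / 2], after which the second makes this smaller than [e]. *)
  assert (He2 : 0 < Rmin (m / 2) (e * m * m / 2)).
  { apply Rmin_glb_lt; [lra|]. apply Rdiv_lt_0_compat; [|lra]. pos. }
  destruct (Hdx _ He2) as [d Hdd].
  destruct (Hcont d (cond_pos d)) as [d2 [Hd2 Hc2]].
  exists (mkposreal d2 Hd2). intros h Hh0 Hh. simpl in Hh.
  destruct (Hc2 (x + h)) as [H1 H2]. { now replace (x + h - x) with h by ring. }
  destruct (Hg _ H2) as [H3 H4].
  set (k := g (x + h) - g x) in *.
  assert (Hk0 : k <> 0).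
  { intro Hk. assert (g (x + h) = g x) by (unfold k in Hk; lra). rewrite H in H4. lra. }
  specialize (Hdd k Hk0 H1).
  replace (g x + k) with (g (x + h)) in Hdd by (unfold k; ring).
  rewrite H4, Hfg in Hdd. replace (x + h - x) with h in Hdd by ring.
  rmin (m / 2) (e * m * m / 2).
  set (z := h / k) in *.
  assert (Hz : Rabs (z - m) < m / 2) by lra. apply Rabs_def2 in Hz.
  replace (k / h) with (/ z) by (unfold z; field; auto).
  replace (/ z - / m) with (- (z - m) / (z * m)) by (field; lra).
  unfold Rdiv. rewrite Rabs_mult, Rabs_Ropp, Rabs_inv, (Rabs_pos_eq (z * m)) by nra.
  apply Rmult_lt_reg_r with (z * m); [nra|].
  rewrite Rmult_assoc, Rinv_l by nra.
  assert (e * m * m / 2 < e * (z * m)).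
  { replace (e * m * m / 2) with (e * m * (m / 2)) by field. replace (e * (z * m)) with (e * m * z) by ring.
    apply Rmult_lt_compat_l; nra. }
  lra.
Qed.

#[export] Hint Resolve continuous_id : continuity.

(** * Global solutions for bounded Lipschitz fields *)

Lemma lipschitz_continuous (f : R -> R) (K x : R) :
  (forall y z, Rabs (f y - f z) <= K * Rabs (y - z)) -> continuous f x.
Proof.
  intros H. apply filterlim_locally. intros e.
  assert (HK : 0 < Rabs K + 1) by (pose proof (Rabs_pos K); lra).
  assert (He : 0 < e / (Rabs K + 1)) by (apply Rdiv_lt_0_compat; [apply cond_pos|auto]).
  exists (mkposreal _ He). intros y Hy. change (Rabs (f y - f x) < e).
  assert (Hy' : Rabs (y - x) < e / (Rabs K + 1)) by exact Hy.
  eapply Rle_lt_trans; [apply H|].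
  apply Rmult_lt_compat_l with (r := Rabs K + 1) in Hy'; auto.
  replace ((Rabs K + 1) * (e / (Rabs K + 1))) with (pos e) in Hy' by (field; lra).
  pose proof (Rabs_pos (y - x)). pose proof (Rle_abs K). nra.
Qed.

Lemma primitive_derive (f : R -> R) :
  (forall x, continuous f x) -> forall t, is_derive (fun t => RInt f 0 t) t (f t).
Proof.
  intros H t. apply (is_derive_RInt f (fun t => RInt f 0 t) 0); auto.
  exists (mkposreal 1 Rlt_0_1). intros y _. apply (@RInt_correct R_CompleteNormedModule).
  apply (@ex_RInt_continuous R_CompleteNormedModule). auto.
Qed.

Lemma derive_bounded_lipschitz (f f' : R -> R) (B : R) :
  (forall t, is_derive f t (f' t)) -> (forall t, Rabs (f' t) <= B) ->
  forall x y, Rabs (f x - f y) <= B * Rabs (x - y).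
Proof.
  intros Hd Hb.
  assert (H : forall x y, x < y -> Rabs (f y - f x) <= B * Rabs (y - x)).
  { intros x y Hxy. destruct (mean_value f f' x y Hxy) as [t [_ Ht]]; [auto|].
    rewrite Ht, Rabs_mult. apply Rmult_le_compat_r; auto. apply Rabs_pos. }
  intros x y. destruct (Rtotal_order x y) as [h|[h|h]].
  - rewrite Rabs_minus_sym, (Rabs_minus_sym x). auto.
  - subst. rewrite !Rminus_diag, Rabs_R0. lra.
  - auto.
Qed.

(** Both [A * exp (K * t) - f t] and [A * exp (K * t) + f t] are nondecreasing. Measured against the
    weight [exp (K * t)], integration gains a factor [/ K], so Picard iteration contracts on the
    whole line at once. *)
Lemma exp_dominated_pos (f f' : R -> R) (A K : R) :
  0 < K -> f 0 = 0 -> (forall t, is_derive f t (f' t)) ->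
  (forall t, 0 <= t -> Rabs (f' t) <= A * K * exp (K * t)) ->
  forall t, 0 <= t -> Rabs (f t) <= A * exp (K * t) - A.
Proof.
  intros HK H0 Hd Hb t Ht.
  assert (He : forall s, is_derive (fun s => A * exp (K * s)) s (A * K * exp (K * s))).
  { intros s. auto_derive; auto. ring. }
  assert (H1 : A * exp (K * 0) - f 0 <= A * exp (K * t) - f t).
  { apply (nondecr (fun s => A * exp (K * s) - f s) (fun s => A * K * exp (K * s) - f' s)); auto.
    - intros s Hs. apply (is_derive_minus (fun s => A * exp (K * s)) f); auto.
    - intros s Hs. specialize (Hb s). assert (0 <= s) as h by lra. specialize (Hb h).
      pose proof (Rle_abs (f' s)). lra. }
  assert (H2 : A * exp (K * 0) + f 0 <= A * exp (K * t) + f t).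
  { apply (nondecr (fun s => A * exp (K * s) + f s) (fun s => A * K * exp (K * s) + f' s)); auto.
    - intros s Hs. apply (is_derive_plus (fun s => A * exp (K * s)) f); auto.
    - intros s Hs. specialize (Hb s). assert (0 <= s) as h by lra. specialize (Hb h).
      pose proof (Rle_abs (- f' s)). rewrite Rabs_Ropp in H. lra. }
  rewrite Rmult_0_r, exp_0, H0 in H1, H2. apply Rabs_le. lra.
Qed.

Lemma is_derive_reflect (f : R -> R) (a t l : R) :
  is_derive f (a - t) l -> is_derive (fun s => f (a - s)) t (- l).
Proof.
  intros H. evar_last.
  { apply (is_derive_comp f (fun s => a - s) t); [exact H|].
    instantiate (1 := -1). auto_derive; auto; ring. }
  unfold scal; simpl; unfold mult; simpl. ring.
Qed.

Lemma exp_dominated (f f' : R -> R) (A K : R) :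
  0 < K -> f 0 = 0 -> 0 <= A -> (forall t, is_derive f t (f' t)) ->
  (forall t, Rabs (f' t) <= A * K * exp (K * Rabs t)) ->
  forall t, Rabs (f t) <= A * exp (K * Rabs t).
Proof.
  intros HK H0 HA Hd Hb t. destruct (Rle_dec 0 t) as [h|h].
  - rewrite (Rabs_pos_eq t) by auto.
    pose proof (exp_dominated_pos f f' A K HK H0 Hd) as H.
    assert (forall t, 0 <= t -> Rabs (f' t) <= A * K * exp (K * t)) as h2.
    { intros s Hs. specialize (Hb s). now rewrite (Rabs_pos_eq s) in Hb by auto. }
    specialize (H h2 t h). lra.
  - pose proof (exp_dominated_pos (fun s => f (0 - s)) (fun s => - f' (0 - s)) A K HK) as H.
    cbv beta in H. rewrite Rminus_0_r in H. specialize (H H0).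
    assert (forall s, is_derive (fun s => f (0 - s)) s (- f' (0 - s))) as h1.
    { intros s. apply is_derive_reflect. auto. }
    specialize (H h1).
    assert (forall t, 0 <= t -> Rabs (- f' (0 - t)) <= A * K * exp (K * t)) as h2.
    { intros s Hs. specialize (Hb (0 - s)). rewrite Rabs_Ropp.
      replace (0 - s) with (- s) in * by ring. now rewrite Rabs_Ropp, (Rabs_pos_eq s) in Hb by auto. }
    specialize (H h2 (- t)). replace (0 - - t) with t in H by ring.
    rewrite (Rabs_left t) by lra. assert (0 <= - t) as h3 by lra. specialize (H h3). lra.
Qed.

(** States are functions of an index here, so that one iteration treats the four equations
    uniformly. *)
Definition l1 (X Y : nat -> R) : R :=
  Rabs (X 0%nat - Y 0%nat) + Rabs (X 1%nat - Y 1%nat) + Rabs (X 2%nat - Y 2%nat) + Rabs (X 3%nat - Y 3%nat).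

Lemma l1_le (X Y : nat -> R) (e : R) : (forall j, Rabs (X j - Y j) <= e) -> l1 X Y <= 4 * e.
Proof. intros H. unfold l1. pose proof (H 0%nat); pose proof (H 1%nat); pose proof (H 2%nat); pose proof (H 3%nat). lra. Qed.

Section Picard.
Variable G : nat -> (nat -> R) -> R.
Variables L B : R.
Hypothesis HL : 0 < L.
Hypothesis HG : forall i X Y, Rabs (G i X - G i Y) <= L * l1 X Y.
Hypothesis HB : forall i X, Rabs (G i X) <= B.
Variable x0 : nat -> R.

Fixpoint picard_iter (n i : nat) (t : R) : R :=
  match n with
  | O => x0 i
  | S n => x0 i + RInt (fun s => G i (fun j => picard_iter n j s)) 0 t
  end.

Lemma field_lipschitz (X : nat -> R -> R) (i : nat) :
  (forall j y z, Rabs (X j y - X j z) <= B * Rabs (y - z)) ->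
  forall y z, Rabs (G i (fun j => X j y) - G i (fun j => X j z)) <= (4 * L * B) * Rabs (y - z).
Proof.
  intros H y z. eapply Rle_trans; [apply HG|].
  pose proof (l1_le (fun j => X j y) (fun j => X j z) (B * Rabs (y - z))) as h.
  assert (l1 (fun j => X j y) (fun j => X j z) <= 4 * (B * Rabs (y - z))) as h1 by (apply h; intros; apply H).
  apply Rmult_le_compat_l with (r := L) in h1; lra.
Qed.

Lemma field_continuous (X : nat -> R -> R) (i : nat) :
  (forall j y z, Rabs (X j y - X j z) <= B * Rabs (y - z)) ->
  forall t, continuous (fun s => G i (fun j => X j s)) t.
Proof. intros H t. eapply lipschitz_continuous. apply field_lipschitz. auto. Qed.

Lemma picard_step (X : nat -> R -> R) (i : nat) :
  (forall j y z, Rabs (X j y - X j z) <= B * Rabs (y - z)) ->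
  forall t, is_derive (fun t => x0 i + RInt (fun s => G i (fun j => X j s)) 0 t) t (G i (fun j => X j t)).
Proof.
  intros H t. evar_last.
  { apply (is_derive_plus (fun _ => x0 i)); [apply is_derive_const|].
    apply primitive_derive. apply field_continuous; auto. }
  unfold plus, zero; simpl; ring.
Qed.

(** The bound [B] on the field passes to every iterate; this supplies the continuity of all
    integrands. *)
Lemma picard_iter_lipschitz n : forall i y z,
  Rabs (picard_iter n i y - picard_iter n i z) <= B * Rabs (y - z).
Proof.
  induction n as [|n IH]; intros i y z.
  - simpl. rewrite Rminus_diag, Rabs_R0. apply Rmult_le_pos; [|apply Rabs_pos].
    eapply Rle_trans; [apply Rabs_pos|apply (HB 0 (fun _ => 0))].
  - apply (derive_bounded_lipschitz (picard_iter (S n) i) (fun t => G i (fun j => picard_iter n j t))).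
    + intros t. apply (picard_step (picard_iter n)). auto.
    + intros t. apply HB.
Qed.

(** The Lipschitz bound sums four coordinates, so one step multiplies the weighted distance by
    [4 * L / K]; this [K] makes the factor one half. *)
Let K := 8 * L.
Let A0 := B / K.

Lemma picard_iter_diff n : forall i t,
  Rabs (picard_iter (S n) i t - picard_iter n i t) <= A0 * (/ 2) ^ n * exp (K * Rabs t).
Proof.
  assert (HB0 : 0 <= B) by (eapply Rle_trans; [apply Rabs_pos|apply (HB 0 (fun _ => 0))]).
  assert (HK : 0 < K) by (unfold K; lra).
  assert (HA : 0 <= A0) by pos.
  induction n as [|n IH]; intros i t.
  - apply (exp_dominated (fun t => picard_iter 1 i t - picard_iter 0 i t) (fun t => G i (fun j => picard_iter 0 j t))); auto.
    + simpl. rewrite RInt_point. unfold zero; simpl. ring.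
    + simpl; lra.
    + intros s. evar_last.
      { apply (is_derive_minus (picard_iter 1 i) (fun _ => x0 i)); [|apply is_derive_const].
        apply (picard_step (picard_iter 0)). apply picard_iter_lipschitz. }
      unfold minus, plus, opp, zero; simpl; ring.
    + intros s. eapply Rle_trans; [apply HB|]. unfold A0. simpl.
      replace (B / K * 1 * K) with B by (field; lra).
      assert (1 <= exp (K * Rabs s)); [|nra].
      rewrite <- exp_0. pose proof (Rabs_pos s).
      destruct (Rle_lt_or_eq_dec 0 (K * Rabs s)) as [h|h]; [nra| |rewrite <- h; lra].
      left. apply exp_increasing; auto.
  - assert (Hp : 0 < (/ 2) ^ n) by (apply pow_lt; lra).
    apply (exp_dominated (fun t => picard_iter (S (S n)) i t - picard_iter (S n) i t)
       (fun t => G i (fun j => picard_iter (S n) j t) - G i (fun j => picard_iter n j t))); auto.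
    + simpl. rewrite !RInt_point. unfold zero; simpl. ring.
    + simpl. nra.
    + intros s. apply (is_derive_minus (picard_iter (S (S n)) i) (picard_iter (S n) i)).
      * apply (picard_step (picard_iter (S n))). apply picard_iter_lipschitz.
      * apply (picard_step (picard_iter n)). apply picard_iter_lipschitz.
    + intros s. eapply Rle_trans; [apply HG|].
      pose proof (l1_le (fun j => picard_iter (S n) j s) (fun j => picard_iter n j s) _ (fun j => IH j s)) as h.
      apply Rmult_le_compat_l with (r := L) in h; [|lra].
      unfold K at 1. simpl pow. lra.
Qed.

Lemma geometric_cauchy (u : nat -> R) (C : R) :
  (forall n, Rabs (u (S n) - u n) <= C * (/ 2) ^ n) ->
  exists l : R, is_lim_seq u l /\ forall n, Rabs (l - u n) <= 2 * C * (/ 2) ^ n.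
Proof.
  intros H.
  assert (HC : 0 <= C) by (specialize (H 0%nat); simpl in H; pose proof (Rabs_pos (u 1%nat - u 0%nat)); lra).
  assert (Hk : forall n k, Rabs (u (n + k)%nat - u n) <= 2 * C * (/ 2) ^ n * (1 - (/ 2) ^ k)).
  { intros n k. induction k as [|k IH].
    - rewrite Nat.add_0_r, Rminus_diag, Rabs_R0. simpl. lra.
    - replace (n + S k)%nat with (S (n + k)) by lia.
      pose proof (H (n + k)%nat) as h. rewrite pow_add in h.
      replace (u (S (n + k)) - u n) with ((u (S (n + k)) - u (n + k)%nat) + (u (n + k)%nat - u n)) by ring.
      eapply Rle_trans; [apply Rabs_triang|]. simpl. nra. }
  assert (Hp : forall n, 0 < (/ 2) ^ n) by (intros; apply pow_lt; lra).
  assert (Hk2 : forall n k, Rabs (u (n + k)%nat - u n) <= 2 * C * (/ 2) ^ n).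
  { intros n k. eapply Rle_trans; [apply Hk|]. pose proof (Hp k). pose proof (Hp n). 
    assert (0 <= C * (/2)^n * (/2)^k) by pos. nra. }
  assert (Hcv : ex_finite_lim_seq u).
  { apply ex_lim_seq_cauchy_corr. intros e.
    destruct (pow_lt_1_zero (/ 2)) with (y := e / (4 * C + 1)) as [N HN].
    { rewrite Rabs_pos_eq; lra. } { apply Rdiv_lt_0_compat; [apply cond_pos|lra]. }
    exists N. intros n m Hn Hm.
    replace n with (N + (n - N))%nat by lia. replace m with (N + (m - N))%nat by lia.
    pose proof (Hk2 N (n - N)%nat) as h1. pose proof (Hk2 N (m - N)%nat) as h2.
    specialize (HN N (le_n N)). rewrite Rabs_pos_eq in HN by (left; auto).
    apply Rmult_lt_compat_l with (r := 4 * C + 1) in HN; [|lra].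
    replace ((4 * C + 1) * (e / (4 * C + 1))) with (pos e) in HN by (field; lra).
    replace (u (N + (n - N))%nat - u (N + (m - N))%nat) with
      ((u (N + (n - N))%nat - u N) - (u (N + (m - N))%nat - u N)) by ring.
    eapply Rle_lt_trans; [apply Rabs_triang|]. rewrite Rabs_Ropp. pose proof (Hp N). lra. }
  destruct Hcv as [l Hl]. exists l. split; auto. intros n.
  apply (is_lim_seq_le (fun k => Rabs (u (n + k)%nat - u n)) (fun _ => 2 * C * (/ 2) ^ n) (Rabs (l - u n)) (2 * C * (/ 2) ^ n)); auto.
  - apply (is_lim_seq_abs _ (l - u n)). apply (is_lim_seq_minus' _ _ l (u n)); [|apply is_lim_seq_const].
    apply (is_lim_seq_incr_n u n) in Hl. eapply is_lim_seq_ext; [|apply Hl]. intros k. simpl. now rewrite Nat.add_comm.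
  - apply is_lim_seq_const.
Qed.

Theorem picard_lindelof : exists X : nat -> R -> R,
  forall i, X i 0 = x0 i /\ forall t, is_derive (X i) t (G i (fun j => X j t)).
Proof.
  assert (HB0 : 0 <= B) by (eapply Rle_trans; [apply Rabs_pos|apply (HB 0 (fun _ => 0))]).
  assert (HK : 0 < K) by (unfold K; lra).
  assert (HA : 0 <= A0) by pos.
  assert (Hex : forall i t, exists l : R, is_lim_seq (fun n => picard_iter n i t) l /\
     forall n, Rabs (l - picard_iter n i t) <= 2 * (A0 * exp (K * Rabs t)) * (/ 2) ^ n).
  { intros i t. apply geometric_cauchy. intros n. eapply Rle_trans; [apply picard_iter_diff|]. lra. }
  set (X := fun i t => proj1_sig (constructive_indefinite_description _ (Hex i t))).
  assert (HX : forall i t, is_lim_seq (fun n => picard_iter n i t) (X i t) /\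
     forall n, Rabs (X i t - picard_iter n i t) <= 2 * (A0 * exp (K * Rabs t)) * (/ 2) ^ n).
  { intros i t. unfold X. destruct (constructive_indefinite_description _ (Hex i t)); auto. }
  assert (Hlip : forall j y z, Rabs (X j y - X j z) <= B * Rabs (y - z)).
  { intros j y z.
    apply (is_lim_seq_le (fun n => Rabs (picard_iter n j y - picard_iter n j z)) (fun _ => B * Rabs (y - z))
      (Rabs (X j y - X j z)) (B * Rabs (y - z))).
    - intros n. apply picard_iter_lipschitz.
    - apply (is_lim_seq_abs _ (X j y - X j z)). apply is_lim_seq_minus'; apply HX.
    - apply is_lim_seq_const. }
  (* The integral equation is the limit of the recursion: replacing the iterate by its limit under
     the integral makes an error that is again dominated exponentially and tends to zero with
     [n]. *)
  assert (Heq : forall i t, X i t = x0 i + RInt (fun s => G i (fun j => X j s)) 0 t).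
  { intros i t.
    assert (Hl : is_lim_seq (fun n => picard_iter (S n) i t) (x0 i + RInt (fun s => G i (fun j => X j s)) 0 t)).
    { apply is_lim_seq_spec. intros e.
      destruct (pow_lt_1_zero (/ 2)) with (y := e / (A0 * exp (K * Rabs t) + 1)) as [N HN].
      { rewrite Rabs_pos_eq; lra. }
      { apply Rdiv_lt_0_compat; [apply cond_pos|]. pose proof (exp_pos (K * Rabs t)). nra. }
      exists N. intros n Hn. specialize (HN n Hn).
      assert (Hp : 0 < (/ 2) ^ n) by (apply pow_lt; lra).
      rewrite Rabs_pos_eq in HN by lra.
      pose proof (exp_pos (K * Rabs t)) as He.
      apply Rmult_lt_compat_l with (r := A0 * exp (K * Rabs t) + 1) in HN; [|nra].
      replace ((A0 * exp (K * Rabs t) + 1) * (e / (A0 * exp (K * Rabs t) + 1))) with (pos e) in HN by (field; nra).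
      eapply Rle_lt_trans; [|apply HN].
      apply Rle_trans with (A0 * (/ 2) ^ n * exp (K * Rabs t)); [|nra].
      apply (exp_dominated (fun t => picard_iter (S n) i t - (x0 i + RInt (fun s => G i (fun j => X j s)) 0 t))
        (fun t => G i (fun j => picard_iter n j t) - G i (fun j => X j t))); auto.
      - simpl. rewrite !RInt_point. unfold zero; simpl. ring.
      - nra.
      - intros s. apply (is_derive_minus (picard_iter (S n) i) (fun t => x0 i + RInt (fun s => G i (fun j => X j s)) 0 t)).
        + apply (picard_step (picard_iter n)). apply picard_iter_lipschitz.
        + apply (picard_step X). auto.
      - intros s. eapply Rle_trans; [apply HG|].
        assert (h : l1 (fun j => picard_iter n j s) (fun j => X j s) <= 4 * (2 * (A0 * exp (K * Rabs s)) * (/ 2) ^ n)).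
        { apply l1_le. intros j. rewrite Rabs_minus_sym. apply HX. }
        apply Rmult_le_compat_l with (r := L) in h; [|lra].
        unfold K at 1. lra. }
    destruct (HX i t) as [H1 _]. apply is_lim_seq_incr_1 in H1.
    pose proof (is_lim_seq_unique _ _ H1) as e1. pose proof (is_lim_seq_unique _ _ Hl) as e2.
    rewrite e1 in e2. now injection e2. }
  exists X. intros i. split.
  - rewrite Heq, RInt_point. unfold zero; simpl. ring.
  - intros t. apply is_derive_ext with (f := fun t => x0 i + RInt (fun s => G i (fun j => X j s)) 0 t).
    + intros s. symmetry. apply Heq.
    + apply (picard_step X). auto.
Qed.
End Picard.

(** * Periodic coefficients and the abstract form of the system *)

Lemma periodic_Z (f : R -> R) (p : R) : (forall t, f (t + p) = f t) -> forall (z : Z) t, f (t + IZR z * p) = f t.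
Proof.
  intros H. assert (Hn : forall (n : nat) t, f (t + INR n * p) = f t).
  { induction n as [|n IH]; intros t.
    - simpl. f_equal. ring.
    - rewrite S_INR. replace (t + (INR n + 1) * p) with ((t + INR n * p) + p) by ring. rewrite H. apply IH. }
  intros z t. destruct (Z_le_dec 0 z) as [h|h].
  - rewrite <- (Z2Nat.id z h), <- INR_IZR_INZ. apply Hn.
  - rewrite <- (Hn (Z.to_nat (- z)) (t + IZR z * p)). f_equal.
    rewrite INR_IZR_INZ, Z2Nat.id, opp_IZR by lia. ring.
Qed.

Lemma periodic_bounded (f : R -> R) :
  (forall t, continuous f t) -> (forall t, f (t + PI) = f t) -> exists B, 0 < B /\ forall t, Rabs (f t) <= B.
Proof.
  intros Hc Hp.
  assert (HPI := PI_RGT_0).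
  destruct (continuity_ab_maj (fun t => Rabs (f t)) 0 PI) as [m [Hm _]]; [lra| |].
  { intros x _. apply continuity_pt_filterlim. apply (continuous_comp f Rabs); auto. apply continuous_Rabs. }
  exists (Rabs (f m) + 1). split; [pose proof (Rabs_pos (f m)); lra|]. intros t.
  destruct (archimed (- t / PI)) as [h1 h2].
  set (z := up (- t / PI)) in *.
  rewrite <- (periodic_Z f PI Hp z t).
  assert (0 <= t + IZR z * PI <= PI).
  { replace t with (- (- t / PI) * PI) by (field; lra). split; nra. }
  specialize (Hm _ H). lra.
Qed.

Record state := St { sr : R; sv : R; sth : R; sw : R }.

Definition co (x : state) (i : nat) : R :=
  match i with 0%nat => sr x | 1%nat => sv x | 2%nat => sth x | 3%nat => sw x | _ => 0 end.


(** As [cos t * W1 t + 2 * sin t * W t] is [cos t ^ 3] times the derivative of [V = W / cos ^ 2],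
    the last two fields say that [V] decreases before [- ths] and increases from [- ths] to [0]. *)
Class system := {
  c : R -> R; c1 : R -> R; c2 : R -> R; W : R -> R; W1 : R -> R; W2 : R -> R; ths : R;
  c_d : forall t, is_derive c t (c1 t);
  c1_d : forall t, is_derive c1 t (c2 t);
  c2_cont : forall t, continuous c2 t;
  W_d : forall t, is_derive W t (W1 t);
  W1_d : forall t, is_derive W1 t (W2 t);
  W2_cont : forall t, continuous W2 t;
  c_pos : forall t, 0 < c t;
  W_pos : forall t, 0 < W t;
  c_per : forall t, c (t + PI) = c t;
  W_per : forall t, W (t + PI) = W t;
  c_even : forall t, c (- t) = c t;
  W_even : forall t, W (- t) = W t;
  ths_int : 0 < ths < PI / 2;
  q_neg : forall t, - (PI / 2) <= t < - ths -> cos t * W1 t + 2 * sin t * W t < 0;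
  q_pos : forall t, - ths < t < 0 -> 0 < cos t * W1 t + 2 * sin t * W t
}.

Section System.
Context {S : system}.

Definition Fr (x : state) := sr x * sv x * (cos (sth x)) ^ 2.
Definition Fv (x : state) := / 2 * (sv x) ^ 2 * (cos (sth x)) ^ 2 + (sw x) ^ 2 * c (sth x) - W (sth x).
Definition Fth (x : state) := sw x * c (sth x).
Definition Fw (x : state) := W1 (sth x) - / 2 * sv x * sw x * (cos (sth x)) ^ 2
   + cos (sth x) * sin (sth x) * (2 * sr x + (sv x) ^ 2) - / 2 * (sw x) ^ 2 * c1 (sth x).

Definition energy (x : state) :=
  / 2 * (sv x) ^ 2 * (cos (sth x)) ^ 2 + / 2 * (sw x) ^ 2 * c (sth x) - W (sth x) + sr x * (cos (sth x)) ^ 2.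

Definition P1 (x : state) : Prop := 0 <= sr x /\ energy x = 0.

Definition motion (x : R -> state) (s : R) : Prop :=
  is_derive (fun s => sr (x s)) s (Fr (x s)) /\ is_derive (fun s => sv (x s)) s (Fv (x s)) /\
  is_derive (fun s => sth (x s)) s (Fth (x s)) /\ is_derive (fun s => sw (x s)) s (Fw (x s)).

Definition sol (x : R -> state) : Prop := (forall s, motion x s) /\ forall s, P1 (x s).

Lemma is_derive_affine (f f' : R -> R) (a b t : R) :
  (forall t, is_derive f t (f' t)) -> is_derive (fun t => f (a * t + b)) t (a * f' (a * t + b)).
Proof.
  intros H. evar_last.
  { apply (is_derive_comp f (fun s => a * s + b) t); [apply H|].
    instantiate (1 := a). auto_derive; auto; ring. }
  unfold scal; simpl; unfold mult; simpl; ring.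
Qed.

(** Differentiate the identity. One lemma covers periodicity ([a = 1], [b = PI]) and parity
    ([a = -1], [b = 0]). *)
Lemma derive_symmetry (f f' : R -> R) (a b e : R) :
  (forall t, is_derive f t (f' t)) -> (forall t, f (a * t + b) = e * f t) ->
  forall t, a * f' (a * t + b) = e * f' t.
Proof.
  intros Hd He t.
  assert (H1 : is_derive (fun t => f (a * t + b)) t (a * f' (a * t + b))) by (apply is_derive_affine; auto).
  assert (H2 : is_derive (fun t => f (a * t + b)) t (e * f' t)).
  { apply is_derive_ext with (f := fun t => e * f t); [intros; symmetry; apply He|].
    apply (is_derive_scal f t e). apply Hd. }
  rewrite <- (is_derive_unique _ _ _ H1). now rewrite <- (is_derive_unique _ _ _ H2).
Qed.

Lemma c1_per t : c1 (t + PI) = c1 t.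
Proof. pose proof (derive_symmetry c c1 1 PI 1 c_d) as H. 
  assert (forall t, c (1 * t + PI) = 1 * c t) as h by (intros; rewrite !Rmult_1_l; apply c_per).
  specialize (H h t). now rewrite !Rmult_1_l in H. Qed.
Lemma W1_per t : W1 (t + PI) = W1 t.
Proof. pose proof (derive_symmetry W W1 1 PI 1 W_d) as H. 
  assert (forall t, W (1 * t + PI) = 1 * W t) as h by (intros; rewrite !Rmult_1_l; apply W_per).
  specialize (H h t). now rewrite !Rmult_1_l in H. Qed.
Lemma c2_per t : c2 (t + PI) = c2 t.
Proof. pose proof (derive_symmetry c1 c2 1 PI 1 c1_d) as H. 
  assert (forall t, c1 (1 * t + PI) = 1 * c1 t) as h by (intros; rewrite !Rmult_1_l; apply c1_per).
  specialize (H h t). now rewrite !Rmult_1_l in H. Qed.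
Lemma W2_per t : W2 (t + PI) = W2 t.
Proof. pose proof (derive_symmetry W1 W2 1 PI 1 W1_d) as H. 
  assert (forall t, W1 (1 * t + PI) = 1 * W1 t) as h by (intros; rewrite !Rmult_1_l; apply W1_per).
  specialize (H h t). now rewrite !Rmult_1_l in H. Qed.
Lemma c1_odd t : c1 (- t) = - c1 t.
Proof. pose proof (derive_symmetry c c1 (-1) 0 1 c_d) as H.
  assert (forall t, c (-1 * t + 0) = 1 * c t) as h by (intros; rewrite Rmult_1_l, <- c_even; f_equal; ring).
  specialize (H h t). replace (-1 * t + 0) with (- t) in H by ring. lra. Qed.
Lemma W1_odd t : W1 (- t) = - W1 t.
Proof. pose proof (derive_symmetry W W1 (-1) 0 1 W_d) as H.
  assert (forall t, W (-1 * t + 0) = 1 * W t) as h by (intros; rewrite Rmult_1_l, <- W_even; f_equal; ring).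
  specialize (H h t). replace (-1 * t + 0) with (- t) in H by ring. lra. Qed.

Lemma c_cont t : continuous c t. Proof. eapply is_derive_continuous, c_d. Qed.
Lemma c1_cont t : continuous c1 t. Proof. eapply is_derive_continuous, c1_d. Qed.
Lemma W_cont t : continuous W t. Proof. eapply is_derive_continuous, W_d. Qed.
Lemma W1_cont t : continuous W1 t. Proof. eapply is_derive_continuous, W1_d. Qed.

Lemma positive_bounds (f : R -> R) : (forall t, continuous f t) -> (forall t, f (t + PI) = f t) ->
  (forall t, 0 < f t) -> exists m M, 0 < m /\ 0 < M /\ forall t, m <= f t <= M.
Proof.
  intros Hc Hp Hpos.
  destruct (periodic_bounded f Hc Hp) as [M [HM1 HM]].
  destruct (periodic_bounded (fun t => / f t)) as [m [Hm1 Hm]].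
  - intros t. apply (continuous_comp f Rinv); auto. apply continuous_Rinv. specialize (Hpos t). lra.
  - intros t. now rewrite Hp.
  - exists (/ m), M. split; [now apply Rinv_0_lt_compat|split; auto]. intros t. split.
    + specialize (Hm t). rewrite Rabs_pos_eq in Hm by (left; apply Rinv_0_lt_compat; auto).
      rewrite <- (Rinv_inv (f t)). apply Rinv_le_contravar; auto. now apply Rinv_0_lt_compat.
    + specialize (HM t). pose proof (Rle_abs (f t)). lra.
Qed.

(** * Symmetries and flow of the regularized system *)

Definition shift (x : state) := St (sr x) (sv x) (sth x + PI) (sw x).
Definition mir (x : state) := St (sr x) (sv x) (- sth x) (- sw x).
Definition rev (x : state) := St (sr x) (- sv x) (sth x) (- sw x).

Lemma P1_shift x : P1 x -> P1 (shift x).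
Proof. intros [H1 H2]. split; auto. unfold energy in *; simpl. rewrite neg_cos, c_per, W_per. lra. Qed.
Lemma P1_mir x : P1 x -> P1 (mir x).
Proof. intros [H1 H2]. split; auto. unfold energy in *; simpl. rewrite cos_neg, c_even, W_even. lra. Qed.
Lemma P1_rev x : P1 x -> P1 (rev x).
Proof. intros [H1 H2]. split; auto. unfold energy in *; simpl. lra. Qed.

Lemma is_derive_eq (f : R -> R) (x l l' : R) : is_derive f x l -> l = l' -> is_derive f x l'.
Proof. intros H <-. exact H. Qed.

Lemma sol_shift x : sol x -> sol (fun s => shift (x s)).
Proof.
  intros [H1 H2]; split; [|intros; apply P1_shift, H2]. intros s. destruct (H1 s) as (a & b & d & e).
  unfold motion, Fr, Fv, Fth, Fw in *. simpl. rewrite neg_cos, neg_sin, c_per, W_per, c1_per, W1_per.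
  split; [|split; [|split]].
  - eapply is_derive_eq; [exact a|ring].
  - eapply is_derive_eq; [exact b|ring].
  - eapply is_derive_eq.
    { apply (is_derive_plus (fun s => sth (x s)) (fun _ => PI)); [exact d|apply is_derive_const]. }
    unfold plus, zero; simpl; ring.
  - eapply is_derive_eq; [exact e|ring].
Qed.

Lemma sol_mir x : sol x -> sol (fun s => mir (x s)).
Proof.
  intros [H1 H2]; split; [|intros; apply P1_mir, H2]. intros s. destruct (H1 s) as (a & b & d & e).
  unfold motion, Fr, Fv, Fth, Fw in *. simpl. rewrite cos_neg, sin_neg, c_even, W_even, c1_odd, W1_odd.
  split; [|split; [|split]].
  - eapply is_derive_eq; [exact a|ring].
  - eapply is_derive_eq; [exact b|ring].
  - eapply is_derive_eq; [apply (is_derive_opp (fun s => sth (x s))); exact d|]. unfold opp; simpl; ring.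
  - eapply is_derive_eq; [apply (is_derive_opp (fun s => sw (x s))); exact e|]. unfold opp; simpl; ring.
Qed.

Lemma sol_rev x a : sol x -> sol (fun s => rev (x (a - s))).
Proof.
  intros [H1 H2]; split; [|intros; apply P1_rev, H2]. intros s. destruct (H1 (a - s)) as (h1 & h2 & h3 & h4).
  unfold motion, Fr, Fv, Fth, Fw in *. simpl.
  apply is_derive_reflect in h1. apply is_derive_reflect in h2. apply is_derive_reflect in h3. apply is_derive_reflect in h4.
  split; [|split; [|split]].
  - eapply is_derive_eq; [exact h1|ring].
  - eapply is_derive_eq; [apply (is_derive_opp (fun s => sv (x (a - s)))); exact h2|]. unfold opp; simpl; ring.
  - eapply is_derive_eq; [exact h3|ring].
  - eapply is_derive_eq; [apply (is_derive_opp (fun s => sw (x (a - s)))); exact h4|]. unfold opp; simpl; ring.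
Qed.

Lemma is_derive_translate (f : R -> R) (a t l : R) :
  is_derive f (t + a) l -> is_derive (fun s => f (s + a)) t l.
Proof.
  intros H. eapply is_derive_eq.
  { apply (is_derive_comp f (fun s => s + a) t); [exact H|].
    instantiate (1 := 1). auto_derive; auto; ring. }
  unfold scal; simpl; unfold mult; simpl. ring.
Qed.

Lemma sol_translate x a : sol x -> sol (fun s => x (s + a)).
Proof.
  intros [H1 H2]; split; [|intros; apply H2]. intros s. destruct (H1 (s + a)) as (h1 & h2 & h3 & h4).
  split; [|split; [|split]].
  - now apply (is_derive_translate (fun s => sr (x s))).
  - now apply (is_derive_translate (fun s => sv (x s))).
  - now apply (is_derive_translate (fun s => sth (x s))).
  - now apply (is_derive_translate (fun s => sw (x s))).
Qed.

(** * Truncation of the field to a bounded Lipschitz one *)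

Definition bl (f : (nat -> R) -> R) : Prop :=
  exists L B, 0 < L /\ 0 < B /\ (forall X Y, Rabs (f X - f Y) <= L * l1 X Y) /\ forall X, Rabs (f X) <= B.

Lemma l1_pos X Y : 0 <= l1 X Y.
Proof. unfold l1. repeat apply Rplus_le_le_0_compat; apply Rabs_pos. Qed.

Lemma bl_const k : bl (fun _ => k).
Proof.
  exists 1, (Rabs k + 1). pose proof (Rabs_pos k). repeat split; try lra.
  - intros. rewrite Rminus_diag, Rabs_R0. pose proof (l1_pos X Y). lra.
  - intros; lra.
Qed.

Lemma bl_plus f g : bl f -> bl g -> bl (fun X => f X + g X).
Proof.
  intros (L & B & HL & HB & h1 & h2) (L' & B' & HL' & HB' & h1' & h2').
  exists (L + L'), (B + B'). repeat split; try lra.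
  - intros X Y. replace (f X + g X - (f Y + g Y)) with ((f X - f Y) + (g X - g Y)) by ring.
    eapply Rle_trans; [apply Rabs_triang|]. specialize (h1 X Y). specialize (h1' X Y). lra.
  - intros X. eapply Rle_trans; [apply Rabs_triang|]. specialize (h2 X). specialize (h2' X). lra.
Qed.

Lemma bl_mult f g : bl f -> bl g -> bl (fun X => f X * g X).
Proof.
  intros (L & B & HL & HB & h1 & h2) (L' & B' & HL' & HB' & h1' & h2').
  exists (L * B' + B * L'), (B * B'). repeat split; try nra.
  - intros X Y. replace (f X * g X - f Y * g Y) with ((f X - f Y) * g X + f Y * (g X - g Y)) by ring.
    eapply Rle_trans; [apply Rabs_triang|]. rewrite !Rabs_mult. pose proof (Rabs_pos (f X - f Y)). pose proof (Rabs_pos (g X - g Y)).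
    pose proof (Rabs_pos (f Y)). pose proof (Rabs_pos (g X)).
    assert (Rabs (f X - f Y) * Rabs (g X) <= L * l1 X Y * B') by (apply Rmult_le_compat; auto).
    assert (Rabs (f Y) * Rabs (g X - g Y) <= B * (L' * l1 X Y)) by (apply Rmult_le_compat; auto).
    lra.
  - intros X. rewrite Rabs_mult. apply Rmult_le_compat; auto; apply Rabs_pos.
Qed.

Lemma bl_opp f : bl f -> bl (fun X => - f X).
Proof.
  intros (L & B & HL & HB & h1 & h2). exists L, B. repeat split; auto.
  - intros X Y. replace (- f X - - f Y) with (- (f X - f Y)) by ring. now rewrite Rabs_Ropp.
  - intros X. now rewrite Rabs_Ropp.
Qed.

Lemma bl_minus f g : bl f -> bl g -> bl (fun X => f X - g X).
Proof. intros H1 H2. apply (bl_plus f (fun X => - g X)); auto. now apply bl_opp. Qed.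

Lemma bl_pow2 f : bl f -> bl (fun X => (f X) ^ 2).
Proof. intros H. simpl. apply bl_mult; auto. apply bl_mult; auto. apply bl_const. Qed.

Lemma bl_coord (f : R -> R) (L B : R) (i : nat) : (i < 4)%nat -> 0 < L -> 0 < B ->
  (forall x y, Rabs (f x - f y) <= L * Rabs (x - y)) -> (forall x, Rabs (f x) <= B) -> bl (fun X => f (X i)).
Proof.
  intros Hi HL HB h1 h2. exists L, B. repeat split; auto. intros X Y.
  eapply Rle_trans; [apply h1|]. apply Rmult_le_compat_l; [lra|]. unfold l1.
  pose proof (Rabs_pos (X 0%nat - Y 0%nat)); pose proof (Rabs_pos (X 1%nat - Y 1%nat)); pose proof (Rabs_pos (X 2%nat - Y 2%nat)); pose proof (Rabs_pos (X 3%nat - Y 3%nat)).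
  destruct i as [|[|[|[|i]]]]; try lia; lra.
Qed.

Lemma bl_periodic (f f' : R -> R) : (forall t, is_derive f t (f' t)) -> (forall t, continuous f' t) ->
  (forall t, f (t + PI) = f t) -> (forall t, f' (t + PI) = f' t) -> bl (fun X => f (X 2%nat)).
Proof.
  intros Hd Hc Hp Hp'.
  destruct (periodic_bounded f) as [B [HB1 HB]]; auto. { intros t. eapply is_derive_continuous; apply Hd. }
  destruct (periodic_bounded f') as [L [HL1 HL]]; auto.
  apply (bl_coord f L B); auto. apply (derive_bounded_lipschitz f f'); auto.
Qed.

Lemma bl_cos : bl (fun X => cos (X 2%nat)).
Proof.
  apply (bl_coord cos 1 1); [lia|lra|lra| |].
  - apply (derive_bounded_lipschitz cos (fun t => - sin t)); [apply is_derive_cos|].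
    intros t. rewrite Rabs_Ropp. apply Rabs_le. apply SIN_bound.
  - intros t. apply Rabs_le, COS_bound.
Qed.

Lemma bl_sin : bl (fun X => sin (X 2%nat)).
Proof.
  apply (bl_coord sin 1 1); [lia|lra|lra| |].
  - apply (derive_bounded_lipschitz sin cos); [apply is_derive_sin|].
    intros t. apply Rabs_le. apply COS_bound.
  - intros t. apply Rabs_le, SIN_bound.
Qed.

Definition clamp (M x : R) := Rmax (- M) (Rmin M x).
Definition bump (M x : R) := Rmax 0 (Rmin 1 (2 - Rabs x / M)).

Lemma clamp_id M x : Rabs x <= M -> clamp M x = x.
Proof. intros H. unfold clamp. pose proof (Rle_abs x). pose proof (Rle_abs (- x)). rewrite Rabs_Ropp in H1.
  rewrite Rmin_right, Rmax_right; lra. Qed.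

Lemma bl_clamp M i : 0 < M -> (i < 4)%nat -> bl (fun X => clamp M (X i)).
Proof.
  intros HM Hi. apply (bl_coord (clamp M) 1 M); auto; try lra.
  - intros x y. unfold clamp, Rmax, Rmin. repeat destruct Rle_dec; unfold Rabs; repeat destruct Rcase_abs; lra.
  - intros x. unfold clamp, Rmax, Rmin. repeat destruct Rle_dec; unfold Rabs; repeat destruct Rcase_abs; lra.
Qed.

Lemma bl_bump M i : 0 < M -> (i < 4)%nat -> bl (fun X => bump M (X i)).
Proof.
  intros HM Hi. apply (bl_coord (bump M) (/ M) 1); auto; try lra.
  - now apply Rinv_0_lt_compat.
  - intros x y. unfold bump.
    assert (h : forall a b, Rabs (Rmax 0 (Rmin 1 (2 - a)) - Rmax 0 (Rmin 1 (2 - b))) <= Rabs (a - b)).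
    { intros a b. unfold Rmax, Rmin. repeat destruct Rle_dec; unfold Rabs; repeat destruct Rcase_abs; lra. }
    eapply Rle_trans; [apply h|]. replace (Rabs x / M - Rabs y / M) with (/ M * (Rabs x - Rabs y)) by (field; lra).
    rewrite Rabs_mult, (Rabs_pos_eq (/ M)) by (left; now apply Rinv_0_lt_compat).
    apply Rmult_le_compat_l; [left; now apply Rinv_0_lt_compat|]. apply Rabs_triang_inv2.
  - intros x. unfold bump. apply Rabs_le. split.
    + apply Rle_trans with 0; [lra|apply Rmax_l].
    + apply Rmax_lub; [lra|apply Rmin_l].
Qed.

Lemma bump_range M x : 0 <= bump M x <= 1.
Proof. unfold bump. split; [apply Rmax_l|apply Rmax_lub; [lra|apply Rmin_l]]. Qed.

Lemma bump_one M x : 0 < M -> Rabs x <= M -> bump M x = 1.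
Proof.
  intros HM H. unfold bump. assert (Rabs x / M <= 1) by (apply Rmult_le_reg_r with M; auto; unfold Rdiv; rewrite Rmult_assoc, Rinv_l; lra).
  rewrite Rmin_left, Rmax_right; lra.
Qed.

Lemma bump_zero M x : 0 < M -> 2 * M < Rabs x -> bump M x = 0.
Proof.
  intros HM H. unfold bump. assert (2 < Rabs x / M) by (apply Rmult_lt_reg_r with M; auto; unfold Rdiv; rewrite Rmult_assoc, Rinv_l; lra).
  rewrite Rmin_right, Rmax_left; lra.
Qed.

Definition ost (X : nat -> R) : state := St (X 0%nat) (X 1%nat) (X 2%nat) (X 3%nat).
Definition cut (M : R) (X : nat -> R) : R := bump M (X 0%nat) * (bump M (X 1%nat) * bump M (X 3%nat)).
Definition field (i : nat) (x : state) : R :=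
  match i with 0%nat => Fr x | 1%nat => Fv x | 2%nat => Fth x | 3%nat => Fw x | _ => 0 end.
Definition clampst (M : R) (X : nat -> R) : state :=
  St (clamp (2 * M) (X 0%nat)) (clamp (2 * M) (X 1%nat)) (X 2%nat) (clamp (2 * M) (X 3%nat)).
(** The truncation is a scalar in [[0, 1]] times the true field, so that the energy manifold stays
    invariant. Clamping at [2 * M] does not change the product, as the scalar vanishes beyond, but
    makes the other factor bounded and Lipschitz. The angle is left alone, since the field depends
    on it through periodic functions. *)
Definition cutfield (M : R) (i : nat) (X : nat -> R) : R := cut M X * field i (clampst M X).

Lemma cutfield_eq M i X : 0 < M -> cutfield M i X = cut M X * field i (ost X).
Proof.
  intros HM. unfold cutfield, clampst, ost, cut.
  destruct (Rle_dec (Rabs (X 0%nat)) (2 * M)) as [h0|h0]; [|rewrite (bump_zero M (X 0%nat)); lra].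
  destruct (Rle_dec (Rabs (X 1%nat)) (2 * M)) as [h1|h1]; [|rewrite (bump_zero M (X 1%nat)); lra].
  destruct (Rle_dec (Rabs (X 3%nat)) (2 * M)) as [h3|h3]; [|rewrite (bump_zero M (X 3%nat)); lra].
  now rewrite !clamp_id.
Qed.

Lemma bl_cutfield M i : 0 < M -> bl (cutfield M i).
Proof.
  intros HM. unfold cutfield. apply bl_mult.
  { unfold cut. repeat apply bl_mult; apply bl_bump; auto; lia. }
  assert (h0 : bl (fun X => clamp (2 * M) (X 0%nat))) by (apply bl_clamp; [lra|lia]).
  assert (h1 : bl (fun X => clamp (2 * M) (X 1%nat))) by (apply bl_clamp; [lra|lia]).
  assert (h3 : bl (fun X => clamp (2 * M) (X 3%nat))) by (apply bl_clamp; [lra|lia]).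
  assert (hc : bl (fun X => c (X 2%nat))) by (apply (bl_periodic c c1); auto using c_d, c1_cont, c_per, c1_per).
  assert (hc1 : bl (fun X => c1 (X 2%nat))) by (apply (bl_periodic c1 c2); auto using c1_d, c2_cont, c1_per, c2_per).
  assert (hW : bl (fun X => W (X 2%nat))) by (apply (bl_periodic W W1); auto using W_d, W1_cont, W_per, W1_per).
  assert (hW1 : bl (fun X => W1 (X 2%nat))) by (apply (bl_periodic W1 W2); auto using W1_d, W2_cont, W1_per, W2_per).
  pose proof bl_cos. pose proof bl_sin.
  destruct i as [|[|[|[|i]]]]; simpl; [| | | |apply bl_const];
  unfold Fr, Fv, Fth, Fw; cbn [sr sv sth sw clampst]; 
  repeat first [assumption | apply bl_minus | apply bl_plus | apply bl_pow2 | apply bl_mult | apply bl_const].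
Qed.

Lemma cutfield_bl M : 0 < M -> exists L B, 0 < L /\ (forall i X Y, Rabs (cutfield M i X - cutfield M i Y) <= L * l1 X Y) /\
  (forall i X, Rabs (cutfield M i X) <= B).
Proof.
  intros HM.
  destruct (bl_cutfield M 0 HM) as (L0 & B0 & ? & ? & h0 & k0).
  destruct (bl_cutfield M 1 HM) as (L1 & B1 & ? & ? & h1 & k1).
  destruct (bl_cutfield M 2 HM) as (L2 & B2 & ? & ? & h2 & k2).
  destruct (bl_cutfield M 3 HM) as (L3 & B3 & ? & ? & h3 & k3).
  exists (L0 + L1 + L2 + L3), (B0 + B1 + B2 + B3). split; [lra|split].
  - intros i X Y. pose proof (l1_pos X Y). destruct i as [|[|[|[|i]]]].
    + specialize (h0 X Y). nra.
    + specialize (h1 X Y). nra.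
    + specialize (h2 X Y). nra.
    + specialize (h3 X Y). nra.
    + unfold cutfield; simpl. replace (cut M X * 0 - cut M Y * 0) with 0 by ring. rewrite Rabs_R0. nra.
  - intros i X. destruct i as [|[|[|[|i]]]].
    + specialize (k0 X). lra.
    + specialize (k1 X). lra.
    + specialize (k2 X). lra.
    + specialize (k3 X). lra.
    + unfold cutfield; simpl. rewrite Rmult_0_r, Rabs_R0. lra.
Qed.
End System.

(** * Invariance of the energy manifold, global flow, continuous dependence *)

Lemma gronwall_back (f f' : R -> R) (K a b : R) :
  a <= b -> (forall s, a <= s <= b -> is_derive f s (f' s)) ->
  (forall s, a < s < b -> - K * f s <= f' s) -> f a <= f b * exp (K * (b - a)).
Proof.
  intros Hab Hd Hp.
  pose proof (gronwall (fun s => f (b - s)) (fun s => - f' (b - s)) K 0 (b - a)) as H.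
  cbv beta in H. rewrite !Rminus_0_r in H. replace (b - (b - a)) with a in H by ring.
  apply H; [lra| |].
  - intros s Hs. apply is_derive_reflect. apply Hd. lra.
  - intros s Hs. assert (a < b - s < b) as h by lra. specialize (Hp _ h). lra.
Qed.

Lemma linear_zero (f a : R -> R) (K p q t0 : R) :
  p <= t0 <= q -> (forall s, p <= s <= q -> is_derive f s (a s * f s)) ->
  (forall s, p <= s <= q -> Rabs (a s) <= K) -> f t0 = 0 -> forall s, p <= s <= q -> f s = 0.
Proof.
  intros Ht Hd Ha H0 s Hs.
  assert (Hd2 : forall s, p <= s <= q -> is_derive (fun s => f s * f s) s (2 * a s * (f s * f s))).
  { intros u Hu. eapply is_derive_eq; [apply (is_derive_mult f f); [now apply Hd|now apply Hd|apply Rmult_comm]|].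
    unfold plus, mult; simpl; ring. }
  assert (Hb : forall s, p <= s <= q -> - (2 * K) * (f s * f s) <= 2 * a s * (f s * f s) <= 2 * K * (f s * f s)).
  { intros u Hu. specialize (Ha u Hu). apply Rabs_le_between in Ha. split; nra. }
  assert (f s * f s <= 0); [|nra].
  destruct (Rle_dec t0 s).
  - pose proof (gronwall (fun s => f s * f s) (fun s => 2 * a s * (f s * f s)) (2 * K) t0 s) as h.
    cbv beta in h. rewrite H0 in h. eapply Rle_trans; [apply h; auto|lra].
    + intros; apply Hd2; lra.
    + intros; apply Hb; lra.
  - pose proof (gronwall_back (fun s => f s * f s) (fun s => 2 * a s * (f s * f s)) (2 * K) s t0) as h.
    cbv beta in h. rewrite H0 in h. eapply Rle_trans; [apply h; auto|lra]; [lra| |].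
    + intros; apply Hd2; lra.
    + intros; apply Hb; lra.
Qed.

Definition near (e : R) (x y : state) : Prop :=
  Rabs (sr x - sr y) < e /\ Rabs (sv x - sv y) < e /\ Rabs (sth x - sth y) < e /\ Rabs (sw x - sw y) < e.

Definition inbox (M : R) (x : state) : Prop := Rabs (sr x) <= M /\ Rabs (sv x) <= M /\ Rabs (sw x) <= M.

Definition sqd (x y : state) : R :=
  (sr x - sr y) ^ 2 + (sv x - sv y) ^ 2 + (sth x - sth y) ^ 2 + (sw x - sw y) ^ 2.

Lemma near_sym e x y : near e x y -> near e y x.
Proof. unfold near. rewrite (Rabs_minus_sym (sr x)), (Rabs_minus_sym (sv x)), (Rabs_minus_sym (sth x)), (Rabs_minus_sym (sw x)). auto. Qed.

Lemma near_trans e1 e2 x y z : near e1 x y -> near e2 y z -> near (e1 + e2) x z.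
Proof.
  intros (a & b & d & f) (a' & b' & d' & f').
  apply Rabs_def2 in a, b, d, f, a', b', d', f'.
  unfold near. split; [|split; [|split]]; apply Rabs_def1; lra.
Qed.

Lemma near_weaken e1 e2 x y : e1 <= e2 -> near e1 x y -> near e2 x y.
Proof. unfold near. intros H (a & b & d & f). repeat split; lra. Qed.

Lemma near_elim e x y : near e x y ->
  - e < sr x - sr y < e /\ - e < sv x - sv y < e /\ - e < sth x - sth y < e /\ - e < sw x - sw y < e.
Proof. intros (a & b & d & f). apply Rabs_def2 in a, b, d, f. lra. Qed.

Lemma near_intro e x y :
  - e < sr x - sr y < e -> - e < sv x - sv y < e -> - e < sth x - sth y < e -> - e < sw x - sw y < e -> near e x y.
Proof. intros. split; [|split; [|split]]; apply Rabs_def1; lra. Qed.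

Lemma state_eq x y : sr x = sr y -> sv x = sv y -> sth x = sth y -> sw x = sw y -> x = y.
Proof. destruct x, y; simpl; intros; subst; auto. Qed.

Lemma derive_energy (r v k w p q : R -> R) (r' v' k' w' p' q' s : R) :
  is_derive r s r' -> is_derive v s v' -> is_derive k s k' -> is_derive w s w' -> is_derive p s p' -> is_derive q s q' ->
  is_derive (fun s => / 2 * (v s) ^ 2 * (k s) ^ 2 + / 2 * (w s) ^ 2 * p s - q s + r s * (k s) ^ 2) s
    (v s * v' * k s ^ 2 + v s ^ 2 * k s * k' + w s * w' * p s + / 2 * w s ^ 2 * p' - q' + r' * k s ^ 2 + 2 * r s * k s * k').
Proof.
  intros a b d e f g. eapply is_derive_eq.
  { auto_derive; [|reflexivity]. repeat split; try exact I; eexists; eauto. }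
  rewrite (is_derive_unique r _ _ a : Derive (fun x : R => r x) s = _), (is_derive_unique v _ _ b : Derive (fun x : R => v x) s = _), (is_derive_unique k _ _ d : Derive (fun x : R => k x) s = _),
    (is_derive_unique w _ _ e : Derive (fun x : R => w x) s = _), (is_derive_unique p _ _ f : Derive (fun x : R => p x) s = _), (is_derive_unique q _ _ g : Derive (fun x : R => q x) s = _).
  field.
Qed.

Lemma derive_sq_diff (f g : R -> R) (f' g' s : R) : is_derive f s f' -> is_derive g s g' ->
  is_derive (fun s => (f s - g s) ^ 2) s (2 * (f s - g s) * (f' - g')).
Proof.
  intros a b. eapply is_derive_eq.
  { auto_derive; [|reflexivity]. repeat split; try exact I; eexists; eauto. }
  rewrite (is_derive_unique f _ _ a : Derive (fun x : R => f x) s = _), (is_derive_unique g _ _ b : Derive (fun x : R => g x) s = _). ring.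
Qed.

Section Flow.
Context {S : system}.

Lemma W_bounds : exists m M, 0 < m /\ 0 < M /\ forall t, m <= W t <= M.
Proof. apply positive_bounds; [apply W_cont|apply W_per|apply W_pos]. Qed.
Lemma c_bounds : exists m M, 0 < m /\ 0 < M /\ forall t, m <= c t <= M.
Proof. apply positive_bounds; [apply c_cont|apply c_per|apply c_pos]. Qed.

Lemma P1_bounds x : P1 x -> 0 <= sr x /\ 0 <= / 2 * (sv x) ^ 2 * (cos (sth x)) ^ 2 <= W (sth x) /\
  0 <= / 2 * (sw x) ^ 2 * c (sth x) <= W (sth x) /\ 0 <= sr x * (cos (sth x)) ^ 2 <= W (sth x).
Proof.
  intros [H1 H2]. unfold energy in H2.
  assert (h0 := pow2_ge_0 (cos (sth x))).
  assert (h1 : 0 <= / 2 * (sv x) ^ 2 * (cos (sth x)) ^ 2).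
  { apply Rmult_le_pos; auto. pose proof (pow2_ge_0 (sv x)). lra. }
  assert (h2 : 0 <= / 2 * (sw x) ^ 2 * c (sth x)).
  { apply Rmult_le_pos; [|left; apply c_pos]. pose proof (pow2_ge_0 (sw x)). lra. }
  assert (h3 : 0 <= sr x * (cos (sth x)) ^ 2) by pos.
  lra.
Qed.

(** Motion at a variable speed [chi]. The true system ([chi = 1]) and its truncation both have this
    form, so invariance and a priori bounds are proved once. *)
Definition scaled (chi : R -> R) (x : R -> state) (s : R) : Prop :=
  is_derive (fun s => sr (x s)) s (chi s * Fr (x s)) /\ is_derive (fun s => sv (x s)) s (chi s * Fv (x s)) /\
  is_derive (fun s => sth (x s)) s (chi s * Fth (x s)) /\ is_derive (fun s => sw (x s)) s (chi s * Fw (x s)).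

Lemma motion_scaled x s : motion x s -> scaled (fun _ => 1) x s.
Proof. intros (a & b & d & e). unfold scaled. rewrite !Rmult_1_l. split; [|split; [|split]]; auto. Qed.

(** The energy obeys a homogeneous linear equation even off its zero level, whence the invariance of
    that level at any speed. *)
Lemma scaled_energy chi x s : scaled chi x s ->
  is_derive (fun s => energy (x s)) s (chi s * sv (x s) * (cos (sth (x s))) ^ 2 * energy (x s)).
Proof.
  intros (a & b & d & e).
  unfold energy. eapply is_derive_eq.
  { apply (derive_energy (fun s => sr (x s)) (fun s => sv (x s)) (fun s => cos (sth (x s))) (fun s => sw (x s))
      (fun s => c (sth (x s))) (fun s => W (sth (x s)))); eauto.
    - apply (is_derive_comp cos (fun s => sth (x s))); [apply is_derive_cos|exact d].
    - apply (is_derive_comp c (fun s => sth (x s))); [apply c_d|exact d].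
    - apply (is_derive_comp W (fun s => sth (x s))); [apply W_d|exact d]. }
  unfold scal; simpl; unfold mult; simpl.
  unfold Fr, Fv, Fth, Fw. field.
Qed.

(** On the energy manifold [Fv] is bounded, so [v] grows at most linearly and [r] at most
    exponentially, while energy bounds [w]. The box does not depend on [chi], which breaks a circle:
    the truncation radius can be chosen as the bound satisfied by the truncated solution itself. *)
Lemma scaled_box : forall T R0, 0 <= T -> 0 <= R0 -> exists M, 0 < M /\ forall chi x,
  (forall s, 0 <= chi s <= 1) -> (forall s, scaled chi x s) -> (forall s, P1 (x s)) ->
  Rabs (sr (x 0)) <= R0 -> Rabs (sv (x 0)) <= R0 -> forall s, Rabs s <= T -> inbox M (x s).
Proof.
  intros T R0 HT HR0.
  destruct W_bounds as (Wm & WM & HWm & HWM & HW). destruct c_bounds as (cm & cM & Hcm & HcM & Hc).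
  set (V := R0 + 2 * WM * T). assert (HV : 0 <= V) by (unfold V; nra).
  exists (R0 * exp (V * T) + V + (2 * WM / cm + 1)).
  assert (He := exp_pos (V * T)).
  assert (Hwc : 0 < 2 * WM / cm) by pos.
  assert (He2 : 0 <= R0 * exp (V * T)) by pos.
  split; [lra|].
  intros chi x Hchi Hx HP hr hv.
  assert (Hv : forall s, Rabs s <= T -> Rabs (sv (x s)) <= V).
  { intros s Hs.
    assert (h : Rabs (sv (x s) - sv (x 0)) <= 2 * WM * Rabs (s - 0)).
    { apply (derive_bounded_lipschitz (fun s => sv (x s)) (fun s => chi s * Fv (x s))).
      - intros t. apply (Hx t).
      - intros t. destruct (P1_bounds _ (HP t)) as (h0 & h1 & h2 & h3). specialize (HW (sth (x t))).
        specialize (Hchi t).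
        assert (Rabs (Fv (x t)) <= 2 * WM).
        { unfold Fv. apply Rabs_le. lra. }
        rewrite Rabs_mult, (Rabs_pos_eq (chi t)) by lra. nra. }
    rewrite Rminus_0_r in h. replace (sv (x s)) with ((sv (x s) - sv (x 0)) + sv (x 0)) by ring.
    eapply Rle_trans; [apply Rabs_triang|]. unfold V. nra. }
  assert (Hco : forall s, Rabs s <= T -> - V * sr (x s) <= chi s * Fr (x s) <= V * sr (x s)).
  { intros s Hs. specialize (Hv s Hs). specialize (Hchi s). destruct (HP s) as [Hr _].
    unfold Fr. set (k := cos (sth (x s))). assert (hk : 0 <= k ^ 2 <= 1).
    { split; [apply pow2_ge_0|]. unfold k. pose proof (COS_bound (sth (x s))). nra. }
    assert (h : Rabs (chi s * (sv (x s) * k ^ 2)) <= V).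
    { rewrite !Rabs_mult, (Rabs_pos_eq (chi s)), (Rabs_pos_eq (k ^ 2)) by lra.
      pose proof (Rabs_pos (sv (x s))). 
      assert (Rabs (sv (x s)) * k ^ 2 <= V * 1) by (apply Rmult_le_compat; lra).
      nra. }
    apply Rabs_le_between in h.
    replace (chi s * (sr (x s) * sv (x s) * k ^ 2)) with (chi s * (sv (x s) * k ^ 2) * sr (x s)) by ring.
    nra. }
  assert (Hr0 : sr (x 0) <= R0) by (eapply Rle_trans; [apply Rle_abs|auto]).
  intros s Hs. split; [|split].
  - rewrite Rabs_pos_eq by apply HP.
    assert (hh : forall u, 0 <= u <= T -> exp (V * u) <= exp (V * T)).
    { intros u [Hu1 Hu2]. destruct (Rle_lt_or_eq_dec (V * u) (V * T)) as [h|h]; [nra| |rewrite h; lra].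
      left; apply exp_increasing; auto. }
    assert (sr (x s) <= R0 * exp (V * T)); [|lra].
    destruct (Rle_dec 0 s) as [h|h].
    + rewrite Rabs_pos_eq in Hs by auto.
      pose proof (gronwall (fun s => sr (x s)) (fun s => chi s * Fr (x s)) V 0 s h) as G. cbv beta in G.
      eapply Rle_trans; [apply G|].
      * intros t Ht. apply (Hx t).
      * intros t Ht. apply Hco. rewrite Rabs_pos_eq; lra.
      * rewrite Rminus_0_r. apply Rmult_le_compat; [apply HP|left; apply exp_pos|auto|apply hh; lra].
    + rewrite Rabs_left in Hs by lra.
      pose proof (gronwall_back (fun s => sr (x s)) (fun s => chi s * Fr (x s)) V s 0) as G. cbv beta in G.
      eapply Rle_trans; [apply G|].
      * lra.
      * intros t Ht. apply (Hx t).
      * intros t Ht. apply Hco. rewrite Rabs_left; lra.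
      * apply Rmult_le_compat; [apply HP|left; apply exp_pos|auto|apply hh; lra].
  - specialize (Hv s Hs). lra.
  - destruct (P1_bounds _ (HP s)) as (h0 & h1 & h2 & h3). specialize (HW (sth (x s))). specialize (Hc (sth (x s))).
    assert (hw : (sw (x s)) ^ 2 <= 2 * WM / cm).
    { apply Rmult_le_reg_r with cm; auto. unfold Rdiv. rewrite Rmult_assoc, Rinv_l by lra. nra. }
    rewrite <- pow2_abs in hw. nra.
Qed.

Lemma sol_box : forall T R0, 0 <= T -> 0 <= R0 -> exists M, 0 < M /\ forall x, sol x ->
  Rabs (sr (x 0)) <= R0 -> Rabs (sv (x 0)) <= R0 -> forall s, Rabs s <= T -> inbox M (x s).
Proof.
  intros T R0 HT HR. destruct (scaled_box T R0 HT HR) as [M [HM H]]. exists M. split; auto.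
  intros x [Hx HP] h1 h2. apply (H (fun _ => 1)); auto; [intros; lra|]. intros s. apply motion_scaled; auto.
Qed.

Lemma scaled_P1 (chi : R -> R) x K : (forall s, scaled chi x s) -> P1 (x 0) ->
  (forall s, Rabs (chi s * sv (x s) * cos (sth (x s)) ^ 2) <= K) -> forall s, P1 (x s).
Proof.
  intros Hx [Hr He] HK s. split.
  - destruct (Rle_dec 0 (sr (x s))) as [|Hn]; auto. exfalso.
    assert (Hz : exists t, sr (x t) = 0).
    { destruct (Rle_dec 0 s) as [h|h].
      - destruct (first_zero (fun t => - sr (x t)) 0 s) as [t [_ [Ht _]]]; auto; try lra.
        + intros u _. apply (continuous_opp (fun t => sr (x t))). eapply is_derive_continuous. exact (proj1 (Hx u)).
        + destruct Hr as [Hr|Hr]; [lra|]. exfalso. apply Hn.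
          rewrite (linear_zero (fun s => sr (x s)) (fun s => chi s * sv (x s) * cos (sth (x s)) ^ 2) K 0 s 0); try lra; auto.
          intros u _. eapply is_derive_eq; [exact (proj1 (Hx u))|]. unfold Fr; ring.
        + exists t. lra.
      - destruct (first_zero (fun t => sr (x t)) s 0) as [t [_ [Ht _]]]; auto; try lra.
        + intros u _. eapply is_derive_continuous. exact (proj1 (Hx u)).
        + exists t. lra. }
    destruct Hz as [t Ht]. apply Hn. right. symmetry.
    apply (linear_zero (fun s => sr (x s)) (fun s => chi s * sv (x s) * cos (sth (x s)) ^ 2) K (Rmin s t) (Rmax s t) t).
    + split; [apply Rmin_r|apply Rmax_r].
    + intros u _. eapply is_derive_eq; [exact (proj1 (Hx u))|]. unfold Fr; ring.
    + auto.
    + auto.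
    + split; [apply Rmin_l|apply Rmax_l].
  - apply (linear_zero (fun s => energy (x s)) (fun s => chi s * sv (x s) * cos (sth (x s)) ^ 2) K (Rmin s 0) (Rmax s 0) 0).
    + split; [apply Rmin_r|apply Rmax_r].
    + intros u _. apply scaled_energy. auto.
    + auto.
    + auto.
    + split; [apply Rmin_l|apply Rmax_l].
Qed.

Lemma cut_range M X : 0 <= cut M X <= 1.
Proof.
  unfold cut. pose proof (bump_range M (X 0%nat)). pose proof (bump_range M (X 1%nat)). pose proof (bump_range M (X 3%nat)).
  assert (0 <= bump M (X 1%nat) * bump M (X 3%nat) <= 1) by (split; nra). split; nra.
Qed.

Lemma local_existence x0 T : P1 x0 -> 0 <= T ->
  exists x, x 0 = x0 /\ (forall s, Rabs s <= T -> motion x s) /\ forall s, P1 (x s).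
Proof.
  intros H0 HT.
  set (R0 := Rabs (sr x0) + Rabs (sv x0)).
  assert (HR0 : 0 <= R0) by (unfold R0; pose proof (Rabs_pos (sr x0)); pose proof (Rabs_pos (sv x0)); lra).
  destruct (scaled_box T R0 HT HR0) as [M [HM Hbox]].
  destruct (cutfield_bl M HM) as (L & B & HL & HG & HB).
  destruct (picard_lindelof (cutfield M) L B HL HG HB (co x0)) as [X HX].
  set (x := fun s => ost (fun j => X j s)).
  set (chi := fun s => cut M (fun j => X j s)).
  assert (Hx0 : x 0 = x0).
  { apply state_eq; simpl; apply HX. }
  assert (Hsc : forall s, scaled chi x s).
  { intros s. unfold scaled, chi. simpl.
    split; [|split; [|split]].
    - pose proof (proj2 (HX 0%nat) s) as h. now rewrite (cutfield_eq M 0 _ HM) in h.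
    - pose proof (proj2 (HX 1%nat) s) as h. now rewrite (cutfield_eq M 1 _ HM) in h.
    - pose proof (proj2 (HX 2%nat) s) as h. now rewrite (cutfield_eq M 2 _ HM) in h.
    - pose proof (proj2 (HX 3%nat) s) as h. now rewrite (cutfield_eq M 3 _ HM) in h. }
  assert (HP : forall s, P1 (x s)).
  { apply (scaled_P1 chi x (2 * M)); auto; [now rewrite Hx0|].
    intros s. unfold chi. simpl.
    pose proof (cut_range M (fun j => X j s)) as h1.
    assert (hk : 0 <= cos (X 2%nat s) ^ 2 <= 1).
    { split; [apply pow2_ge_0|]. pose proof (COS_bound (X 2%nat s)). nra. }
    destruct (Rle_dec (Rabs (X 1%nat s)) (2 * M)) as [h|h].
    - rewrite !Rabs_mult, (Rabs_pos_eq (cut M (fun j => X j s))) by lra.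
      change (cos (X 2%nat s) * (cos (X 2%nat s) * 1)) with (cos (X 2%nat s) ^ 2).
      pose proof (Rabs_pos (X 1%nat s)).
      assert (0 <= Rabs (cos (X 2%nat s) ^ 2) <= 1) by (rewrite Rabs_pos_eq; lra).
      rewrite <- !Rabs_mult. change (cos (X 2%nat s) * (cos (X 2%nat s) * 1)) with (cos (X 2%nat s) ^ 2).
      assert (cut M (fun j => X j s) * Rabs (X 1%nat s) <= 1 * (2 * M)) by (apply Rmult_le_compat; lra).
      nra.
    - unfold cut. rewrite (bump_zero M (X 1%nat s)); try lra. rewrite Rmult_0_l, Rmult_0_r, !Rmult_0_l, Rabs_R0. lra. }
  exists x. split; auto. split; auto.
  intros s Hs. destruct (Hsc s) as (a & b & d & e).
  (* Up to time [T] the solution stays in the box of size [M], where the truncation is inactive. *)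
  assert (h1 : chi s = 1).
  { destruct (Hbox chi x) with (s := s) as (k1 & k2 & k3); auto.
    - intros; apply cut_range.
    - rewrite Hx0. unfold R0. pose proof (Rabs_pos (sv x0)). lra.
    - rewrite Hx0. unfold R0. pose proof (Rabs_pos (sr x0)). lra.
    - unfold chi, cut. simpl in k1, k2, k3. rewrite !bump_one; auto. lra. }
  rewrite h1, Rmult_1_l in a, b, d, e. split; [|split; [|split]]; auto.
Qed.

Lemma sqd_pos x y : 0 <= sqd x y.
Proof. unfold sqd. repeat apply Rplus_le_le_0_compat; apply pow2_ge_0. Qed.

Lemma dependence M : 0 < M -> exists L, 0 < L /\ forall T x y,
  (forall s, Rabs s <= T -> motion x s /\ motion y s /\ inbox M (x s) /\ inbox M (y s)) ->
  forall s, Rabs s <= T -> sqd (x s) (y s) <= sqd (x 0) (y 0) * exp (L * Rabs s).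
Proof.
  intros HM. destruct (cutfield_bl M HM) as (L & B & HL & HG & HB).
  (* The derivative of the squared distance is at most [2 * L] times the square of the l1 distance,
     which is at most four times the squared distance. *)
  exists (8 * L). split; [lra|]. intros T x y H.
  assert (Hcut : forall z, inbox M z -> forall i, field i z = cutfield M i (co z)).
  { intros z (k1 & k2 & k3) i. rewrite cutfield_eq by auto. unfold cut. simpl. rewrite !bump_one by auto.
    replace (ost (co z)) with z by (apply state_eq; reflexivity). ring. }
  set (D' := fun s => 2 * (sr (x s) - sr (y s)) * (Fr (x s) - Fr (y s)) + 2 * (sv (x s) - sv (y s)) * (Fv (x s) - Fv (y s))
     + 2 * (sth (x s) - sth (y s)) * (Fth (x s) - Fth (y s)) + 2 * (sw (x s) - sw (y s)) * (Fw (x s) - Fw (y s))).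
  assert (Hd : forall s, Rabs s <= T -> is_derive (fun s => sqd (x s) (y s)) s (D' s)).
  { intros s Hs. destruct (H s Hs) as ((a & b & d & e) & (a' & b' & d' & e') & _).
    unfold sqd, D'.
    apply (is_derive_plus (fun s => (sr (x s) - sr (y s)) ^ 2 + (sv (x s) - sv (y s)) ^ 2 + (sth (x s) - sth (y s)) ^ 2));
      [|apply (derive_sq_diff (fun s => sw (x s)) (fun s => sw (y s))); auto].
    apply (is_derive_plus (fun s => (sr (x s) - sr (y s)) ^ 2 + (sv (x s) - sv (y s)) ^ 2));
      [|apply (derive_sq_diff (fun s => sth (x s)) (fun s => sth (y s))); auto].
    apply (is_derive_plus (fun s => (sr (x s) - sr (y s)) ^ 2));
      [|apply (derive_sq_diff (fun s => sv (x s)) (fun s => sv (y s))); auto].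
    apply (derive_sq_diff (fun s => sr (x s)) (fun s => sr (y s))); auto. }
  assert (Hb : forall s, Rabs s <= T -> - (8 * L) * sqd (x s) (y s) <= D' s <= 8 * L * sqd (x s) (y s)).
  { intros s Hs. destruct (H s Hs) as (_ & _ & hx & hy).
    assert (h : forall i, Rabs (field i (x s) - field i (y s)) <= L * l1 (co (x s)) (co (y s))).
    { intros i. rewrite !Hcut by auto. apply HG. }
    pose proof (h 0%nat) as q0. pose proof (h 1%nat) as q1. pose proof (h 2%nat) as q2. pose proof (h 3%nat) as q3.
    unfold l1 in q0, q1, q2, q3. simpl in q0, q1, q2, q3. unfold D', sqd.
    set (a0 := sr (x s) - sr (y s)) in *. set (a1 := sv (x s) - sv (y s)) in *.
    set (a2 := sth (x s) - sth (y s)) in *. set (a3 := sw (x s) - sw (y s)) in *.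
    set (Sm := Rabs a0 + Rabs a1 + Rabs a2 + Rabs a3) in *.
    assert (HS2 : Sm * Sm <= 4 * (a0 ^ 2 + a1 ^ 2 + a2 ^ 2 + a3 ^ 2)).
    { rewrite <- (pow2_abs a0), <- (pow2_abs a1), <- (pow2_abs a2), <- (pow2_abs a3). unfold Sm.
      generalize (Rabs a0) (Rabs a1) (Rabs a2) (Rabs a3). intros u0 u1 u2 u3.
      pose proof (pow2_ge_0 (u0 - u1)); pose proof (pow2_ge_0 (u0 - u2)); pose proof (pow2_ge_0 (u0 - u3)).
      pose proof (pow2_ge_0 (u1 - u2)); pose proof (pow2_ge_0 (u1 - u3)); pose proof (pow2_ge_0 (u2 - u3)). lra. }
    assert (Hp : forall a f, Rabs f <= L * Sm -> - (Rabs a * (L * Sm)) <= a * f <= Rabs a * (L * Sm)).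
    { intros a f Hf. apply Rabs_le_between. rewrite Rabs_mult. apply Rmult_le_compat_l; auto. apply Rabs_pos. }
    apply (Hp a0) in q0. apply (Hp a1) in q1. apply (Hp a2) in q2. apply (Hp a3) in q3.
    assert (HH : Rabs a0 * (L * Sm) + Rabs a1 * (L * Sm) + Rabs a2 * (L * Sm) + Rabs a3 * (L * Sm) = L * (Sm * Sm)) by (unfold Sm; ring).
    assert (L * (Sm * Sm) <= L * (4 * (a0 ^ 2 + a1 ^ 2 + a2 ^ 2 + a3 ^ 2))) by (apply Rmult_le_compat_l; lra).
    split; lra. }
  intros s Hs. destruct (Rle_dec 0 s) as [h|h].
  - rewrite (Rabs_pos_eq s) in * by auto.
    pose proof (gronwall (fun s => sqd (x s) (y s)) D' (8 * L) 0 s h) as G. cbv beta in G.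
    rewrite Rminus_0_r in G. apply G.
    + intros t Ht. apply Hd. rewrite Rabs_pos_eq; lra.
    + intros t Ht. apply Hb. rewrite Rabs_pos_eq; lra.
  - rewrite (Rabs_left s) in * by lra.
    pose proof (gronwall_back (fun s => sqd (x s) (y s)) D' (8 * L) s 0) as G. cbv beta in G.
    replace (0 - s) with (- s) in G by ring. apply G; [lra| |].
    + intros t Ht. apply Hd. unfold Rabs; destruct Rcase_abs; lra.
    + intros t Ht. apply Hb. unfold Rabs; destruct Rcase_abs; lra.
Qed.

Lemma sqd_zero x y : sqd x y <= 0 -> x = y.
Proof.
  unfold sqd. intros H.
  pose proof (pow2_ge_0 (sr x - sr y)); pose proof (pow2_ge_0 (sv x - sv y)); pose proof (pow2_ge_0 (sth x - sth y)); pose proof (pow2_ge_0 (sw x - sw y)).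
  apply state_eq; nra.
Qed.

Lemma motion_continuous x s : motion x s -> continuous (fun s => sr (x s)) s /\ continuous (fun s => sv (x s)) s /\
  continuous (fun s => sth (x s)) s /\ continuous (fun s => sw (x s)) s.
Proof. intros (a & b & d & e). split; [|split; [|split]]; eapply is_derive_continuous; eauto. Qed.

Lemma continuous_bounded (f : R -> R) (a b : R) : a <= b -> (forall s, a <= s <= b -> continuous f s) ->
  exists B, forall s, a <= s <= b -> Rabs (f s) <= B.
Proof.
  intros Hab Hc. destruct (continuity_ab_maj (fun t => Rabs (f t)) a b) as [m [Hm _]]; auto.
  { intros x Hx. apply continuity_pt_filterlim. apply (continuous_comp f Rabs); auto. apply continuous_Rabs. }
  now exists (Rabs (f m)).
Qed.

Lemma motion_inbox x T : 0 <= T -> (forall s, Rabs s <= T -> motion x s) ->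
  exists M, 0 < M /\ forall s, Rabs s <= T -> inbox M (x s).
Proof.
  intros HT H.
  assert (Hs : forall s, - T <= s <= T -> motion x s) by (intros s Hs; apply H; apply Rabs_le; lra).
  destruct (continuous_bounded (fun s => sr (x s)) (- T) T) as [B1 HB1]; [lra|intros s h; apply (motion_continuous x s (Hs s h))|].
  destruct (continuous_bounded (fun s => sv (x s)) (- T) T) as [B2 HB2]; [lra|intros s h; apply (motion_continuous x s (Hs s h))|].
  destruct (continuous_bounded (fun s => sw (x s)) (- T) T) as [B3 HB3]; [lra|intros s h; apply (motion_continuous x s (Hs s h))|].
  exists (Rabs B1 + Rabs B2 + Rabs B3 + 1).
  pose proof (Rabs_pos B1); pose proof (Rabs_pos B2); pose proof (Rabs_pos B3).
  pose proof (Rle_abs B1); pose proof (Rle_abs B2); pose proof (Rle_abs B3).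
  split; [lra|]. intros s h. apply Rabs_le_between in h. specialize (HB1 s h). specialize (HB2 s h). specialize (HB3 s h).
  unfold inbox. lra.
Qed.

Lemma uniqueness x y T : 0 <= T -> (forall s, Rabs s <= T -> motion x s /\ motion y s) -> x 0 = y 0 ->
  forall s, Rabs s <= T -> x s = y s.
Proof.
  intros HT H H0 s Hs.
  destruct (motion_inbox x T HT) as [M1 [HM1 h1]]; [intros; apply H; auto|].
  destruct (motion_inbox y T HT) as [M2 [HM2 h2]]; [intros; apply H; auto|].
  destruct (dependence (M1 + M2)) as [L [HL HD]]; [lra|].
  apply sqd_zero.
  eapply Rle_trans; [apply (HD T); auto|].
  - intros t Ht. destruct (H t Ht). specialize (h1 t Ht). specialize (h2 t Ht). unfold inbox in *.
    split; auto. split; auto. lra.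
  - rewrite H0. unfold sqd. rewrite !Rminus_diag. right; ring.
Qed.

Lemma sol_unique x y t0 : sol x -> sol y -> x t0 = y t0 -> forall s, x s = y s.
Proof.
  intros Hx Hy H s.
  pose proof (uniqueness (fun u => x (u + t0)) (fun u => y (u + t0)) (Rabs (s - t0))) as h.
  cbv beta in h. replace s with ((s - t0) + t0) by ring. apply h.
  - apply Rabs_pos.
  - intros u _. split; [apply (sol_translate x t0 Hx)|apply (sol_translate y t0 Hy)].
  - now rewrite Rplus_0_l.
  - lra.
Qed.

Lemma global_existence x0 : P1 x0 -> exists x, x 0 = x0 /\ sol x.
Proof.
  intros H0.
  assert (Hex : forall n : nat, exists x, x 0 = x0 /\ (forall s, Rabs s <= INR n -> motion x s) /\ forall s, P1 (x s)).
  { intros n. apply local_existence; auto. apply pos_INR. }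
  set (xs := fun n => proj1_sig (constructive_indefinite_description _ (Hex n))).
  assert (Hxs : forall n, xs n 0 = x0 /\ (forall s, Rabs s <= INR n -> motion (xs n) s) /\ forall s, P1 (xs n s)).
  { intros n. unfold xs. destruct (constructive_indefinite_description _ (Hex n)); auto. }
  assert (Hag : forall n m s, Rabs s <= INR n -> Rabs s <= INR m -> xs n s = xs m s).
  { intros n m s h1 h2. apply (uniqueness (xs n) (xs m) (Rmin (INR n) (INR m))).
    - apply Rmin_glb; apply pos_INR.
    - intros u Hu. rmin (INR n) (INR m).
      split; apply Hxs; lra.
    - rewrite (proj1 (Hxs n)), (proj1 (Hxs m)). auto.
    - apply Rmin_glb; auto. }
  assert (HN : forall s, exists n, Rabs s <= INR n).
  { intros s. destruct (nfloor_ex (Rabs s) (Rabs_pos s)) as [n Hn]. exists (Datatypes.S n). rewrite S_INR. lra. }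
  set (N := fun s => proj1_sig (constructive_indefinite_description _ (HN s))).
  assert (HNs : forall s, Rabs s <= INR (N s)).
  { intros s. unfold N. destruct (constructive_indefinite_description _ (HN s)); auto. }
  exists (fun s => xs (N s) s). split; [apply Hxs|]. split; [|intros; apply Hxs].
  intros s. destruct (HN (Rabs s + 1)) as [n Hn].
  assert (hs : Rabs s + 1 <= INR n) by (pose proof (Rle_abs (Rabs s + 1)); lra).
  assert (Hloc : locally s (fun u => xs n u = xs (N u) u)).
  { exists (mkposreal 1 Rlt_0_1). intros u Hu. change (Rabs (u - s) < 1) in Hu. apply Hag; [|apply HNs].
    replace u with ((u - s) + s) by ring. eapply Rle_trans; [apply Rabs_triang|lra]. }
  assert (Hm : motion (xs n) s) by (apply Hxs; lra).
  assert (He : xs (N s) s = xs n s) by (apply Hag; auto; lra).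
  destruct Hm as (a & b & d & e). unfold motion; cbv beta. rewrite He. split; [|split; [|split]].
  - apply (is_derive_ext_loc (fun s => sr (xs n s))); auto. eapply filter_imp; [|apply Hloc]. intros u ->; auto.
  - apply (is_derive_ext_loc (fun s => sv (xs n s))); auto. eapply filter_imp; [|apply Hloc]. intros u ->; auto.
  - apply (is_derive_ext_loc (fun s => sth (xs n s))); auto. eapply filter_imp; [|apply Hloc]. intros u ->; auto.
  - apply (is_derive_ext_loc (fun s => sw (xs n s))); auto. eapply filter_imp; [|apply Hloc]. intros u ->; auto.
Qed.

Lemma flow_exists : exists flow : state -> R -> state, forall x0, P1 x0 -> flow x0 0 = x0 /\ sol (flow x0).
Proof.
  assert (H : forall x0, exists x, P1 x0 -> x 0 = x0 /\ sol x).
  { intros x0. destruct (classic (P1 x0)) as [h|h].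
    - destruct (global_existence x0 h) as [x Hx]. exists x; auto.
    - exists (fun _ => x0). tauto. }
  exists (fun x0 => proj1_sig (constructive_indefinite_description _ (H x0))).
  intros x0 h. destruct (constructive_indefinite_description _ (H x0)); auto.
Qed.

(** A choice of solutions; its values carry no information off [P1]. *)
Definition flow : state -> R -> state := proj1_sig (constructive_indefinite_description _ flow_exists).

Lemma flow_spec x0 : P1 x0 -> flow x0 0 = x0 /\ sol (flow x0).
Proof. unfold flow. destruct (constructive_indefinite_description _ flow_exists); auto. Qed.

Lemma sol_flow x t s : sol x -> flow (x t) s = x (s + t).
Proof.
  intros Hx. assert (HP : P1 (x t)) by apply Hx.
  destruct (flow_spec (x t) HP) as [h1 h2].
  apply (sol_unique (flow (x t)) (fun s => x (s + t)) 0); auto.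
  - now apply sol_translate.
  - now rewrite Rplus_0_l.
Qed.

Lemma continuous_dependence x T e : sol x -> 0 <= T -> 0 < e ->
  exists d, 0 < d /\ forall y, sol y -> near d (x 0) (y 0) -> forall s, Rabs s <= T -> near e (x s) (y s).
Proof.
  intros Hx HT He.
  set (R0 := Rabs (sr (x 0)) + Rabs (sv (x 0)) + 1).
  assert (HR0 : 0 <= R0) by (unfold R0; pose proof (Rabs_pos (sr (x 0))); pose proof (Rabs_pos (sv (x 0))); lra).
  destruct (sol_box T R0 HT HR0) as [M [HM Hbox]].
  destruct (dependence M HM) as [L [HL HD]].
  assert (Hex := exp_pos (L * T)).
  set (d := Rmin 1 (e / (2 * (exp (L * T) + 1)))).
  assert (Hd : 0 < e / (2 * (exp (L * T) + 1))) by pos.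
  exists d. split; [unfold d; pos|].
  intros y Hy Hn s Hs.
  assert (Hd1 : d <= 1) by apply Rmin_l. assert (Hd2 : d <= e / (2 * (exp (L * T) + 1))) by apply Rmin_r.
  assert (Hd0 : 0 < d) by (unfold d; pos).
  assert (hx : forall u, Rabs u <= T -> inbox M (x u)).
  { apply Hbox; auto; unfold R0; pose proof (Rabs_pos (sr (x 0))); pose proof (Rabs_pos (sv (x 0))); lra. }
  assert (hy : forall u, Rabs u <= T -> inbox M (y u)).
  { destruct Hn as (n1 & n2 & _). apply Hbox; auto; unfold R0.
    - replace (sr (y 0)) with (sr (x 0) - (sr (x 0) - sr (y 0))) by ring.
      eapply Rle_trans; [apply Rabs_triang|]. rewrite Rabs_Ropp. pose proof (Rabs_pos (sv (x 0))). lra.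
    - replace (sv (y 0)) with (sv (x 0) - (sv (x 0) - sv (y 0))) by ring.
      eapply Rle_trans; [apply Rabs_triang|]. rewrite Rabs_Ropp. pose proof (Rabs_pos (sr (x 0))). lra. }
  assert (h : sqd (x s) (y s) <= sqd (x 0) (y 0) * exp (L * Rabs s)).
  { apply (HD T); auto. intros u Hu. split; [apply Hx|split; [apply Hy|split; auto]]. }
  assert (h0 : sqd (x 0) (y 0) <= 4 * d ^ 2).
  { destruct (near_elim _ _ _ Hn) as (n1 & n2 & n3 & n4). unfold sqd. nra. }
  assert (hexp : exp (L * Rabs s) <= exp (L * T)).
  { destruct (Rle_lt_or_eq_dec (L * Rabs s) (L * T)) as [k|k]; [nra| |rewrite k; lra]. left; apply exp_increasing; auto. }
  assert (hf : sqd (x s) (y s) < e ^ 2).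
  { set (E := exp (L * T)) in *.
    assert (4 * d ^ 2 * E < e ^ 2).
    { assert (d * (2 * (E + 1)) <= e).
      { apply Rmult_le_compat_r with (r := 2 * (E + 1)) in Hd2; [|lra].
        unfold Rdiv in Hd2. rewrite Rmult_assoc, Rinv_l in Hd2; lra. }
      assert ((d * (2 * (E + 1))) ^ 2 <= e ^ 2) by (apply pow_incr; split; [pos|auto]).
      assert (4 * d ^ 2 * E < (d * (2 * (E + 1))) ^ 2); [|lra].
      replace ((d * (2 * (E + 1))) ^ 2) with (4 * d ^ 2 * ((E + 1) ^ 2)) by ring.
      apply Rmult_lt_compat_l; nra. }
    assert (sqd (x 0) (y 0) * exp (L * Rabs s) <= 4 * d ^ 2 * E); [|lra].
    apply Rmult_le_compat; auto; [apply sqd_pos|left; apply exp_pos]. }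
  unfold sqd in hf.
  pose proof (pow2_ge_0 (sr (x s) - sr (y s))); pose proof (pow2_ge_0 (sv (x s) - sv (y s)));
  pose proof (pow2_ge_0 (sth (x s) - sth (y s))); pose proof (pow2_ge_0 (sw (x s) - sw (y s))).
  assert (hab : forall u, u ^ 2 < e ^ 2 -> - e < u < e) by (intros u Hu; split; nra).
  apply near_intro; apply hab; lra.
Qed.

End Flow.

(** * The force [q], the potential, and orbits that stop or converge *)

Lemma first_hit_deriv (f : R -> R) (a t l : R) : a < t -> (forall s, a <= s < t -> f s < 0) -> f t = 0 ->
  is_derive f t l -> 0 <= l.
Proof.
  intros Hat Hneg H0 Hd. apply Rnot_lt_le. intros Hn.
  apply is_derive_Reals in Hd. destruct (Hd (- l / 2)) as [d Hdd]; [lra|].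
  set (h := - Rmin (d / 2) (t - a)).
  assert (Hd0 := cond_pos d).
  assert (Hm : 0 < Rmin (d / 2) (t - a)) by pos.
  assert (Hm1 := Rmin_l (d / 2) (t - a)). assert (Hm2 := Rmin_r (d / 2) (t - a)).
  assert (Hh : h <> 0) by (unfold h; lra).
  specialize (Hdd h Hh). rewrite H0, Rminus_0_r in Hdd.
  assert (Rabs h < d) as Hh2 by (unfold h; rewrite Rabs_Ropp, Rabs_pos_eq; lra).
  specialize (Hdd Hh2). apply Rabs_def2 in Hdd.
  assert (f (t + h) < 0) as Hf by (apply Hneg; unfold h; lra).
  assert (0 < f (t + h) / h).
  { replace (f (t + h) / h) with ((- f (t + h)) / (- h)) by (field; auto). apply Rdiv_lt_0_compat; unfold h in *; lra. }
  lra.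
Qed.

Lemma scaled_square_bound (a w k K : R) : 0 < k <= K -> - (K * (a ^ 2 + w ^ 2)) <= 2 * a * (w * k).
Proof.
  intros Hk. pose proof (pow2_ge_0 (a + w)). pose proof (pow2_ge_0 a). pose proof (pow2_ge_0 w).
  assert (- (k * (a ^ 2 + w ^ 2)) <= 2 * a * (w * k)).
  { replace (2 * a * (w * k)) with (k * (2 * a * w)) by ring. replace (- (k * (a ^ 2 + w ^ 2))) with (k * - (a ^ 2 + w ^ 2)) by ring.
    apply Rmult_le_compat_l; lra. }
  assert (k * (a ^ 2 + w ^ 2) <= K * (a ^ 2 + w ^ 2)) by (apply Rmult_le_compat_r; lra). lra.
Qed.

Section Basic.
Context {S : system}.

(** [q] is [cos ^ 3] times the derivative of [V]; unlike the latter it is regular on the collinear lines. *)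
Definition q (t : R) := cos t * W1 t + 2 * sin t * W t.
Definition q' (t : R) := sin t * W1 t + cos t * W2 t + 2 * cos t * W t.

Lemma q_derive t : is_derive q t (q' t).
Proof.
  unfold q, q'. eapply is_derive_eq.
  { apply (is_derive_plus (fun t => cos t * W1 t) (fun t => 2 * sin t * W t)).
    - apply (is_derive_mult cos W1); [apply is_derive_cos|apply W1_d|apply Rmult_comm].
    - apply (is_derive_mult (fun t => 2 * sin t) W); [|apply W_d|apply Rmult_comm].
      apply (is_derive_scal sin t 2). apply is_derive_sin. }
  unfold plus, mult; simpl. ring.
Qed.

Lemma q_cont t : continuous q t.
Proof. eapply is_derive_continuous, q_derive. Qed.

Lemma q_odd t : q (- t) = - q t.
Proof. unfold q. rewrite cos_neg, sin_neg, W1_odd, W_even. ring. Qed.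

Lemma q_ths : q (- ths) = 0.
Proof.
  destruct ths_int as [h1 h2]. pose proof (q_cont (- ths)) as hc.
  destruct (Rtotal_order (q (- ths)) 0) as [h|[h|h]]; auto; exfalso.
  - destruct (sign_near (fun t => - q t) (- ths)) as [d [Hd H]]; [apply (continuous_opp q); auto|lra|].
    set (y := - ths + Rmin (d / 2) (ths / 2)).
    rminp (d / 2) (ths / 2).
    assert (0 < - q y) by (apply H; unfold y; apply Rabs_def1; lra).
    assert (0 < q y) by (apply q_pos; unfold y; lra). lra.
  - destruct (sign_near q (- ths)) as [d [Hd H]]; auto.
    set (y := - ths - Rmin (d / 2) (PI / 2 - ths)).
    rminp (d / 2) (PI / 2 - ths).
    assert (0 < q y) by (apply H; unfold y; apply Rabs_def1; lra).
    assert (q y < 0) by (apply q_neg; unfold y; lra). lra.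
Qed.

Lemma q_zero : q 0 = 0.
Proof. pose proof (q_odd 0) as h. rewrite Ropp_0 in h. lra. Qed.

Lemma q_ths' : q ths = 0.
Proof. rewrite <- (Ropp_involutive ths), q_odd, q_ths. ring. Qed.

Lemma q_neg' t : 0 < t < ths -> q t < 0.
Proof. intros h. rewrite <- (Ropp_involutive t), q_odd. assert (0 < q (- t)) by (apply q_pos; lra). lra. Qed.

Lemma q_pos' t : ths < t <= PI / 2 -> 0 < q t.
Proof. intros h. rewrite <- (Ropp_involutive t), q_odd. assert (q (- t) < 0) by (apply q_neg; lra). lra. Qed.

Lemma q_bound : exists K, 0 < K /\ (forall t, Rabs (q t) <= K) /\ forall x y, Rabs (q x - q y) <= K * Rabs (x - y).
Proof.
  destruct (periodic_bounded W) as [B0 [HB0 h0]]; [apply W_cont|apply W_per|].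
  destruct (periodic_bounded W1) as [B1 [HB1 h1]]; [apply W1_cont|apply W1_per|].
  destruct (periodic_bounded W2) as [B2 [HB2 h2]]; [apply W2_cont|apply W2_per|].
  assert (Hm : forall a b k B, - 1 <= a <= 1 -> 0 <= k -> Rabs b <= B -> Rabs (k * a * b) <= k * B).
  { intros a b k B Ha Hk Hb. rewrite !Rabs_mult, (Rabs_pos_eq k) by auto.
    assert (Rabs a <= 1) by (apply Rabs_le; auto). pose proof (Rabs_pos a); pose proof (Rabs_pos b).
    assert (Rabs a * Rabs b <= 1 * B) by (apply Rmult_le_compat; auto). rewrite Rmult_assoc. apply Rmult_le_compat_l; lra. }
  exists (2 * B0 + B1 + B2). split; [lra|]. split.
  - intros t. unfold q. eapply Rle_trans; [apply Rabs_triang|].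
    pose proof (Hm (cos t) (W1 t) 1 B1 (COS_bound t) Rle_0_1 (h1 t)) as e1. rewrite !Rmult_1_l in e1.
    assert (Rabs (2 * sin t * W t) <= 2 * B0) by (apply Hm; auto; [apply SIN_bound|lra]). lra.
  - apply (derive_bounded_lipschitz q q'); [apply q_derive|]. intros t. unfold q'.
    eapply Rle_trans; [apply Rabs_triang|]. 
    pose proof (Rabs_triang (sin t * W1 t) (cos t * W2 t)).
    pose proof (Hm (sin t) (W1 t) 1 B1 (SIN_bound t) Rle_0_1 (h1 t)) as e1. rewrite !Rmult_1_l in e1.
    pose proof (Hm (cos t) (W2 t) 1 B2 (COS_bound t) Rle_0_1 (h2 t)) as e2. rewrite !Rmult_1_l in e2.
    assert (Rabs (2 * cos t * W t) <= 2 * B0) by (apply Hm; auto; [apply COS_bound|lra]). lra.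
Qed.

(** Recovered from [W]. On the collinear lines this is a default value of division by zero, hence
    the recurring hypothesis [cos t <> 0]. *)
Definition V (t : R) := W t / (cos t) ^ 2.

Lemma V_even t : V (- t) = V t.
Proof. unfold V. now rewrite W_even, cos_neg. Qed.

Lemma W_V t : cos t <> 0 -> W t = V t * (cos t) ^ 2.
Proof. intros h. unfold V. field. auto. Qed.

Lemma V_derive t : cos t <> 0 -> is_derive V t (q t / (cos t) ^ 3).
Proof.
  intros h. unfold V. eapply is_derive_eq.
  { apply (is_derive_div W (fun t => (cos t) ^ 2) t (W1 t) (2 * cos t * (- sin t))); [apply W_d| |].
    - eapply is_derive_eq; [apply (is_derive_pow cos 2 t (- sin t)); apply is_derive_cos|]. simpl. ring.
    - apply pow_nonzero; auto. }
  unfold q. field. auto.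
Qed.

Lemma V_cont t : cos t <> 0 -> continuous V t.
Proof. intros h. eapply is_derive_continuous, V_derive; auto. Qed.

Lemma cos_pos t : - (PI / 2) < t < PI / 2 -> 0 < cos t.
Proof. intros [h1 h2]. apply cos_gt_0; auto. Qed.

Lemma V_min_neg t : - (PI / 2) < t <= 0 -> t <> - ths -> V ths < V t.
Proof.
  intros Ht Hn. destruct ths_int as [h1 h2]. rewrite <- (V_even ths).
  destruct (Rlt_dec t (- ths)) as [h|h].
  - assert (- V t < - V (- ths)); [|lra].
    apply (incr (fun t => - V t) (fun t => - (q t / (cos t) ^ 3))); auto.
    + intros s Hs. apply (is_derive_opp V). apply V_derive. assert (0 < cos s) by (apply cos_pos; lra). lra.
    + intros s Hs. assert (0 < cos s) by (apply cos_pos; lra). assert (q s < 0) by (apply q_neg; lra).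
      assert (0 < (cos s) ^ 3) by (apply pow_lt; auto).
      replace (- (q s / cos s ^ 3)) with ((- q s) / cos s ^ 3) by (field; lra). pos.
  - apply (incr V (fun t => q t / (cos t) ^ 3)); [lra| |].
    + intros s Hs. apply V_derive. assert (0 < cos s) by (apply cos_pos; lra). lra.
    + intros s Hs. assert (0 < cos s) by (apply cos_pos; lra). assert (0 < q s) by (apply q_pos; lra).
      apply Rdiv_lt_0_compat; auto. apply pow_lt; auto.
Qed.

Lemma V_min t : - (PI / 2) < t < PI / 2 -> t <> ths -> t <> - ths -> V ths < V t.
Proof.
  intros Ht h1 h2. destruct (Rle_dec t 0); [apply V_min_neg; auto; lra|].
  rewrite <- (V_even t). apply V_min_neg; lra.
Qed.

Lemma V_min_le t : - (PI / 2) < t < PI / 2 -> V ths <= V t.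
Proof.
  intros Ht. destruct (Req_dec t ths) as [->|h1]; [lra|]. destruct (Req_dec t (- ths)) as [->|h2].
  - rewrite V_even; lra.
  - left; apply V_min; auto.
Qed.

Lemma V_ths_pos : 0 < V ths.
Proof.
  destruct ths_int. assert (0 < cos ths) by (apply cos_pos; lra).
  apply Rdiv_lt_0_compat; [apply W_pos|apply pow_lt; auto].
Qed.

(** The Lagrange equilibria on the collision manifold have angle [ths] or [- ths], [w = 0], and
    [v = vs] (upper) or [v = - vs] (lower). *)
Definition vs := sqrt (2 * V ths).
Lemma vs_pos : 0 < vs.
Proof. apply sqrt_lt_R0. pose proof V_ths_pos. lra. Qed.
Lemma vs_sq : vs * vs = 2 * V ths.
Proof. apply sqrt_sqrt. pose proof V_ths_pos. lra. Qed.

(** The kinetic term in [w] is nonnegative, so [En <= V] off the collinear lines, with equality when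
    [w = 0]; and [En] rises or falls according to the sign of [v]. Most impossible outcomes are
    excluded by these two facts. *)
Definition En (x : state) := sr x + / 2 * (sv x) ^ 2.

Lemma En_eq x : P1 x -> / 2 * (sw x) ^ 2 * c (sth x) = W (sth x) - En x * (cos (sth x)) ^ 2.
Proof. intros [_ H]. unfold energy in H. unfold En. lra. Qed.

Lemma En_V x : P1 x -> cos (sth x) <> 0 -> / 2 * (sw x) ^ 2 * c (sth x) = (V (sth x) - En x) * (cos (sth x)) ^ 2.
Proof. intros H h. rewrite (En_eq x H), (W_V _ h). ring. Qed.

Lemma En_le_V x : P1 x -> cos (sth x) <> 0 -> En x <= V (sth x).
Proof.
  intros H h. pose proof (En_V x H h) as e. destruct (P1_bounds x H) as (_ & _ & h2 & _).
  assert (0 < (cos (sth x)) ^ 2) by (apply pow2_gt_0; auto). nra.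
Qed.

Lemma En_turn x : P1 x -> cos (sth x) <> 0 -> sw x = 0 -> En x = V (sth x).
Proof.
  intros H h h0. pose proof (En_V x H h) as e. rewrite h0 in e.
  assert (0 < (cos (sth x)) ^ 2) by (apply pow2_gt_0; auto). nra.
Qed.

Lemma Fv_eq x : P1 x -> Fv x = / 2 * c (sth x) * (sw x) ^ 2 - sr x * (cos (sth x)) ^ 2.
Proof. intros [_ H]. unfold energy in H. unfold Fv. lra. Qed.

(** Multiplying by [cos] allows the energy relation to eliminate [r]; what remains is the force [q]
    plus terms that vanish with [w]. *)
Lemma Fw_eq x : P1 x -> cos (sth x) * Fw x = q (sth x) - / 2 * sv x * (cos (sth x)) ^ 3 * sw x
   - (sw x) ^ 2 * (c (sth x) * sin (sth x) + / 2 * c1 (sth x) * cos (sth x)).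
Proof.
  intros H. pose proof (En_eq x H) as e. unfold En in e. unfold Fw, q.
  set (k := cos (sth x)) in *. set (z := sin (sth x)) in *.
  assert (e2 : k * k * (2 * sr x + sv x ^ 2) = 2 * W (sth x) - sw x ^ 2 * c (sth x)) by nra.
  replace (k * (W1 (sth x) - / 2 * sv x * sw x * k ^ 2 + k * z * (2 * sr x + sv x ^ 2) - / 2 * sw x ^ 2 * c1 (sth x)))
   with (k * W1 (sth x) - / 2 * sv x * sw x * k ^ 3 + z * (k * k * (2 * sr x + sv x ^ 2)) - / 2 * sw x ^ 2 * c1 (sth x) * k) by ring.
  rewrite e2. ring.
Qed.

Lemma sol_cont x s : sol x -> continuous (fun s => sr (x s)) s /\ continuous (fun s => sv (x s)) s /\
  continuous (fun s => sth (x s)) s /\ continuous (fun s => sw (x s)) s.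
Proof. intros [H _]. apply motion_continuous. auto. Qed.

Lemma sol_cv x s : sol x -> continuous (fun s => sv (x s)) s.
Proof. apply sol_cont. Qed.
Lemma sol_cr x s : sol x -> continuous (fun s => sr (x s)) s.
Proof. apply sol_cont. Qed.
Lemma sol_cth x s : sol x -> continuous (fun s => sth (x s)) s.
Proof. apply sol_cont. Qed.
Lemma sol_cw x s : sol x -> continuous (fun s => sw (x s)) s.
Proof. apply sol_cont. Qed.

Lemma sol_dr x s : sol x -> is_derive (fun s => sr (x s)) s (Fr (x s)).
Proof. intros [H _]. apply (H s). Qed.
Lemma sol_dv x s : sol x -> is_derive (fun s => sv (x s)) s (Fv (x s)).
Proof. intros [H _]. apply (H s). Qed.
Lemma sol_dth x s : sol x -> is_derive (fun s => sth (x s)) s (Fth (x s)).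
Proof. intros [H _]. apply (H s). Qed.
Lemma sol_dw x s : sol x -> is_derive (fun s => sw (x s)) s (Fw (x s)).
Proof. intros [H _]. apply (H s). Qed.
Lemma sol_P1 x s : sol x -> P1 (x s).
Proof. intros [_ H]. auto. Qed.

Lemma En_derive x s : sol x -> is_derive (fun s => En (x s)) s (/ 2 * sv (x s) * c (sth (x s)) * (sw (x s)) ^ 2).
Proof.
  intros H. unfold En. eapply is_derive_eq.
  { apply (is_derive_plus (fun s => sr (x s)) (fun s => / 2 * (sv (x s)) ^ 2)); [apply sol_dr; auto|].
    apply (is_derive_scal (fun s => (sv (x s)) ^ 2) s (/ 2)). apply (is_derive_pow (fun s => sv (x s)) 2). apply sol_dv; auto. }
  unfold plus; simpl. rewrite (Fv_eq _ (sol_P1 x s H)). unfold Fr. field.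
Qed.

(** Uniform on the whole energy manifold although [r] and [v] are unbounded there: [r] has been
    eliminated, and [v] enters only through [v * cos], which energy bounds. *)
Lemma Fw_est : exists K wM, 0 < K /\ 0 < wM /\ forall x, P1 x ->
  Rabs (cos (sth x) * Fw x - q (sth x)) <= K * Rabs (sw x) /\ Rabs (sw x) <= wM.
Proof.
  destruct W_bounds as (Wm & WM & HWm & HWM & HW). destruct c_bounds as (cm & cM & Hcm & HcM & Hc).
  destruct (periodic_bounded c1) as [B1 [HB1 hc1]]; [apply c1_cont|apply c1_per|].
  set (wM := 2 * WM / cm + 1). set (vM := 2 * WM + 1).
  assert (HwM : 0 < wM) by (unfold wM; assert (0 < 2 * WM / cm) by pos; lra).
  exists (vM + wM * (cM + B1)), wM. split; [unfold vM; nra|]. split; auto.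
  intros x HP. destruct (P1_bounds x HP) as (h0 & h1 & h2 & h3).
  specialize (HW (sth x)). specialize (Hc (sth x)). specialize (hc1 (sth x)).
  assert (hw : Rabs (sw x) <= wM).
  { assert (hw : (sw x) ^ 2 <= 2 * WM / cm).
    { apply Rmult_le_reg_r with cm; auto. unfold Rdiv. rewrite Rmult_assoc, Rinv_l by lra. nra. }
    rewrite <- pow2_abs in hw. unfold wM. nra. }
  split; auto. rewrite Fw_eq by auto.
  set (k := cos (sth x)) in *. set (z := sin (sth x)) in *.
  assert (hk : Rabs k <= 1) by (apply Rabs_le, COS_bound). assert (hz : Rabs z <= 1) by (apply Rabs_le, SIN_bound).
  assert (hk0 := Rabs_pos k).
  replace (q (sth x) - / 2 * sv x * k ^ 3 * sw x - sw x ^ 2 * (c (sth x) * z + / 2 * c1 (sth x) * k) - q (sth x))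
   with (- (/ 2 * (sv x * k) * (k * k) + sw x * (c (sth x) * z + / 2 * c1 (sth x) * k)) * sw x) by ring.
  rewrite Rabs_mult, Rabs_Ropp. apply Rmult_le_compat_r; [apply Rabs_pos|].
  assert (hv : Rabs (sv x * k) <= vM).
  { assert (hv : (sv x * k) ^ 2 <= 2 * WM) by (rewrite Rpow_mult_distr; nra).
    rewrite <- pow2_abs in hv. unfold vM. nra. }
  eapply Rle_trans; [apply Rabs_triang|]. apply Rplus_le_compat.
  - rewrite !Rabs_mult in *. rewrite (Rabs_pos_eq (/ 2)) by lra.
    pose proof (Rabs_pos (sv x)). assert (0 <= Rabs (sv x) * Rabs k) by nra. assert (Rabs k * Rabs k <= 1) by nra. nra.
  - rewrite Rabs_mult. apply Rmult_le_compat; auto; try apply Rabs_pos.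
    eapply Rle_trans; [apply Rabs_triang|]. rewrite !Rabs_mult, (Rabs_pos_eq (c (sth x))), (Rabs_pos_eq (/ 2)) by lra. apply Rplus_le_compat; nra.
Qed.

(** At a zero [b] of [q] the set [theta = b], [w = 0] is invariant: it carries the homothetic
    motions. The pair [(theta - b, w)] obeys a linear differential inequality, so backward Gronwall
    shows that an orbit at rest there was at rest shortly before. This contradicts [w > 0] up to
    that time. *)
Lemma no_stop x t b : sol x -> q b = 0 -> cos b <> 0 -> sth (x t) = b -> sw (x t) = 0 ->
  exists e, 0 < e /\ forall s, t - e <= s <= t -> sw (x s) = 0.
Proof.
  intros Hx Hq Hc Hth Hw.
  destruct Fw_est as (K & wM & HK & HwM & HF). destruct q_bound as (Kq & HKq & _ & Hlip).
  destruct c_bounds as (cm & cM & Hcm & HcM & Hcb).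
  assert (hcont : continuous (fun s => Rabs (cos (sth (x s)))) t).
  { apply (continuous_comp (fun s => sth (x s)) (fun u => Rabs (cos u))); [apply sol_cont; auto|].
    apply (continuous_comp cos Rabs); [apply continuous_cos|apply continuous_Rabs]. }
  set (k := Rabs (cos b)). assert (hk : 0 < k) by (apply Rabs_pos_lt; auto).
  destruct (continuous_eps _ _ hcont (k / 2)) as [d [Hd hd]]; [lra|].
  assert (hcos : forall s, t - d / 2 <= s <= t -> k / 2 <= Rabs (cos (sth (x s)))).
  { intros s Hs. assert (h : Rabs (s - t) < d) by (apply Rabs_def1; lra). specialize (hd s h).
    rewrite Hth in hd. fold k in hd. apply Rabs_def2 in hd. lra. }
  set (K2 := 2 * (K + Kq) / k). assert (HK2 : 0 < K2) by pos.
  assert (hF : forall s, t - d / 2 <= s <= t -> Rabs (Fw (x s)) <= K2 * (Rabs (sth (x s) - b) + Rabs (sw (x s)))).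
  { intros s Hs. specialize (hcos s Hs). destruct (HF (x s) (sol_P1 x s Hx)) as [h1 _].
    specialize (Hlip (sth (x s)) b). rewrite Hq, Rminus_0_r in Hlip.
    assert (h2 : Rabs (cos (sth (x s)) * Fw (x s)) <= K * Rabs (sw (x s)) + Kq * Rabs (sth (x s) - b)).
    { replace (cos (sth (x s)) * Fw (x s)) with ((cos (sth (x s)) * Fw (x s) - q (sth (x s))) + q (sth (x s))) by ring.
      eapply Rle_trans; [apply Rabs_triang|]. lra. }
    rewrite Rabs_mult in h2. pose proof (Rabs_pos (Fw (x s))). pose proof (Rabs_pos (sw (x s))). pose proof (Rabs_pos (sth (x s) - b)).
    apply Rmult_le_reg_l with (k / 2); [lra|].
    replace (k / 2 * (K2 * (Rabs (sth (x s) - b) + Rabs (sw (x s))))) with ((K + Kq) * (Rabs (sth (x s) - b) + Rabs (sw (x s))))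
      by (unfold K2; field; lra).
    nra. }
  exists (d / 2). split; [lra|]. intros s Hs.
  pose proof (gronwall_back (fun s => (sth (x s) - b) ^ 2 + (sw (x s) - 0) ^ 2)
    (fun s => 2 * (sth (x s) - b) * (Fth (x s) - 0) + 2 * (sw (x s) - 0) * (Fw (x s) - 0)) (cM + 4 * K2) s t) as G.
  cbv beta in G. rewrite Hth, Hw in G.
  assert (h : (sth (x s) - b) ^ 2 + (sw (x s) - 0) ^ 2 <= ((b - b) ^ 2 + (0 - 0) ^ 2) * exp ((cM + 4 * K2) * (t - s))).
  { apply G; [lra| |].
    - intros u Hu. apply (is_derive_plus (fun s => (sth (x s) - b) ^ 2) (fun s => (sw (x s) - 0) ^ 2)).
      + apply (derive_sq_diff (fun s => sth (x s)) (fun _ => b)); [apply sol_dth; auto|apply (is_derive_const b)].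
      + apply (derive_sq_diff (fun s => sw (x s)) (fun _ => 0)); [apply sol_dw; auto|apply (is_derive_const 0)].
    - intros u Hu. assert (hu : t - d / 2 <= u <= t) by lra.
      unfold Fth. rewrite !Rminus_0_r. specialize (Hcb (sth (x u))).
      set (a := sth (x u) - b) in *. set (w := sw (x u)) in *. set (cc := c (sth (x u))) in *.
      assert (h1 : - (cM * (a ^ 2 + w ^ 2)) <= 2 * a * (w * cc)) by (apply scaled_square_bound; lra).
      assert (h2 : - (4 * K2 * (a ^ 2 + w ^ 2)) <= 2 * w * Fw (x u)).
      { assert (Rabs (w * Fw (x u)) <= Rabs w * (K2 * (Rabs a + Rabs w))).
        { rewrite Rabs_mult. apply Rmult_le_compat_l; auto. apply Rabs_pos. }
        apply Rabs_le_between in H. rewrite <- (pow2_abs a), <- (pow2_abs w).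
        assert (Rabs w * (K2 * (Rabs a + Rabs w)) <= 2 * K2 * (Rabs a ^ 2 + Rabs w ^ 2)); [|lra].
        replace (2 * K2 * (Rabs a ^ 2 + Rabs w ^ 2)) with (K2 * (2 * (Rabs a ^ 2 + Rabs w ^ 2))) by ring.
        replace (Rabs w * (K2 * (Rabs a + Rabs w))) with (K2 * (Rabs w * (Rabs a + Rabs w))) by ring.
        apply Rmult_le_compat_l; nra. }
      lra. }
  rewrite !Rminus_diag, Rminus_0_r in h. pose proof (pow2_ge_0 (sth (x s) - b)). simpl in h. nra.
Qed.

Lemma th_incr x a b : sol x -> a < b -> (forall s, a < s < b -> 0 < sw (x s)) -> sth (x a) < sth (x b).
Proof.
  intros Hx Hab Hw. apply (incr (fun s => sth (x s)) (fun s => Fth (x s))); auto.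
  - intros s _. apply sol_dth; auto.
  - intros s Hs. unfold Fth. apply Rmult_lt_0_compat; [auto|apply c_pos].
Qed.

#[local] Hint Resolve sol_cv sol_cr sol_cth sol_cw : continuity.

Lemma th_mono x a b : sol x -> a <= b -> (forall s, a < s < b -> 0 < sw (x s)) -> sth (x a) <= sth (x b).
Proof. intros Hx [h| ->] Hw; [left; apply th_incr; auto|right; auto]. Qed.

Lemma th_ivt x a b y : sol x -> a <= b -> sth (x a) < y -> y <= sth (x b) ->
  exists t, a < t <= b /\ sth (x t) = y /\ forall s, a <= s < t -> sth (x s) < y.
Proof. intros Hx Hab. apply (ivt (fun s => sth (x s))); auto. intros; cont. Qed.

Lemma w_stop x a b : sol x -> a <= b -> 0 < sw (x a) -> sw (x b) <= 0 ->
  exists t, a < t <= b /\ sw (x t) = 0 /\ forall s, a <= s < t -> 0 < sw (x s).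
Proof.
  intros Hx Hab Ha Hb. destruct (first_zero (fun s => - sw (x s)) a b) as [t [h1 [h2 h3]]]; try lra.
  { intros; cont. }
  exists t. split; auto. split; [lra|]. intros s hs. specialize (h3 s hs). cbv beta in h3. lra.
Qed.

Lemma th_injective b p p' u u' : sol b -> (forall s, p <= s <= p' -> 0 < sw (b s)) -> p <= u <= p' -> p <= u' <= p' ->
  sth (b u) = sth (b u') -> u = u'.
Proof.
  intros Hb Hw hu hu' h. destruct (Rtotal_order u u') as [k|[k|k]]; auto; exfalso.
  - assert (sth (b u) < sth (b u')); [|lra]. apply th_incr; auto. intros; apply Hw; lra.
  - assert (sth (b u') < sth (b u)); [|lra]. apply th_incr; auto. intros; apply Hw; lra.
Qed.

Lemma th_order b p p' u u' : sol b -> (forall s, p <= s <= p' -> 0 < sw (b s)) -> p <= u <= p' -> p <= u' <= p' ->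
  sth (b u) < sth (b u') -> u < u'.
Proof.
  intros Hb Hw hu hu' h. apply Rnot_le_lt. intros hn.
  destruct (Req_dec u u') as [k|k]; [subst; lra|]. assert (sth (b u') < sth (b u)); [|lra]. apply th_incr; auto; [lra|]. intros; apply Hw; lra.
Qed.

Lemma th_reach b p p' t : sol b -> p <= p' -> sth (b p) <= t <= sth (b p') -> exists u, p <= u <= p' /\ sth (b u) = t.
Proof.
  intros Hb Hp [[h|h] h']; [|exists p; split; [lra|auto]].
  destruct (ivt (fun s => sth (b s)) p p' t) as [u [h1 [h2 h3]]]; auto; [intros; apply sol_cth; auto|]. exists u. split; [lra|auto].
Qed.

Lemma En_nonincr x a b : sol x -> a <= b -> (forall s, a < s < b -> sv (x s) <= 0) -> En (x b) <= En (x a).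
Proof.
  intros Hx Hab Hv. apply (nonincr (fun s => En (x s)) _ a b Hab (fun s _ => En_derive x s Hx)). intros s hs. specialize (Hv s hs).
  assert (0 <= - sv (x s) * (c (sth (x s)) * sw (x s) ^ 2)) by (pose proof (c_pos (sth (x s))); pos). lra.
Qed.

Lemma En_nondecr x a b : sol x -> a <= b -> (forall s, a < s < b -> 0 <= sv (x s)) -> En (x a) <= En (x b).
Proof.
  intros Hx Hab Hv. apply (nondecr (fun s => En (x s)) _ a b Hab (fun s _ => En_derive x s Hx)). intros s hs. specialize (Hv s hs).
  pose proof (c_pos (sth (x s))). pos.
Qed.

Lemma th_lower_speed x a b m cm : sol x -> a <= b -> 0 < m -> 0 < cm -> (forall t, cm <= c t) ->
  (forall s, a <= s <= b -> m <= sw (x s)) -> sth (x a) + m * cm * (b - a) <= sth (x b).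
Proof.
  intros Hx Hab Hm Hcm Hc Hw.
  assert (sth (x a) - m * cm * a <= sth (x b) - m * cm * b); [|lra].
  apply (nondecr (fun s => sth (x s) - m * cm * s) (fun s => Fth (x s) - m * cm)); auto.
  - intros s _. apply (is_derive_minus (fun s => sth (x s)) (fun s => m * cm * s)); [apply sol_dth; auto|].
    auto_derive; auto; ring.
  - intros s Hs. unfold Fth. specialize (Hc (sth (x s))). assert (h : a <= s <= b) by lra. specialize (Hw s h). nra.
Qed.

(** Only an upper bound is put on [w]; its positivity is carried separately. *)
Definition tends (x : R -> state) (b : R) : Prop :=
  (forall s, 0 <= s -> sth (x s) < b) /\
  (forall e, 0 < e -> exists s0, 0 <= s0 /\ forall s, s0 <= s -> b - e < sth (x s) /\ sw (x s) < e).

Lemma limit_exists x b : sol x -> (forall s, 0 < s -> 0 < sw (x s)) -> (forall s, 0 <= s -> sth (x s) < b) ->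
  exists l, l <= b /\ (forall s, 0 <= s -> sth (x s) < l) /\
   forall e, 0 < e -> exists s0, 0 <= s0 /\ forall s, s0 <= s -> l - e < sth (x s).
Proof.
  intros Hx Hw Hb.
  destruct (completeness (fun y => exists s, 0 <= s /\ y = sth (x s))) as [l [Hl1 Hl2]].
  { exists b. intros y [s [Hs ->]]. left; auto. }
  { exists (sth (x 0)), 0. split; [lra|auto]. }
  exists l. split; [|split].
  - apply Hl2. intros y [s [Hs ->]]. left; auto.
  - intros s Hs. apply Rlt_le_trans with (sth (x (s + 1))).
    + apply th_incr; auto; [lra|]. intros; apply Hw; lra.
    + apply Hl1. exists (s + 1). split; [lra|auto].
  - intros e He. destruct (classic (exists s0, 0 <= s0 /\ l - e < sth (x s0))) as [[s0 [h1 h2]]|Hn].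
    + exists s0. split; auto. intros s Hs. destruct Hs as [Hs|<-]; auto.
      assert (sth (x s0) < sth (x s)); [|lra]. apply th_incr; auto. intros; apply Hw; lra.
    + exfalso. assert (l <= l - e); [|lra]. apply Hl2. intros y [s [Hs ->]].
      apply Rnot_lt_le. intros hn. apply Hn. exists s. split; auto; lra.
Qed.

(** The angle increases to a limit [l]. If [q l] were nonzero the force would keep a sign for small
    [w]: a positive one holds [w] away from zero and the angle escapes, a negative one drives [w]
    through zero. The limit [PI / 2] is excluded because [q] is positive there. *)
Lemma stuck x b : sol x -> (forall s, 0 < s -> 0 < sw (x s)) -> (forall s, 0 <= s -> sth (x s) < b) ->
  - (PI / 2) <= sth (x 0) -> b <= PI / 2 ->
  exists l, sth (x 0) < l <= b /\ q l = 0 /\ 0 < cos l /\ tends x l.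
Proof.
  intros Hx Hw Hb H0 Hb2.
  destruct (limit_exists x b Hx Hw Hb) as (l & Hlb & Hl1 & Hl2).
  destruct Fw_est as (K & wM & HK & HwM & HF). destruct q_bound as (Kq & HKq & Hqb & Hlip).
  destruct c_bounds as (cm & cM & Hcm & HcM & Hcb).
  assert (H0l : sth (x 0) < l) by (apply Hl1; lra).
  assert (Hgt : forall s, 0 < s -> sth (x 0) < sth (x s)).
  { intros s Hs. apply th_incr; auto. intros; apply Hw; lra. }
  assert (Hcos : forall s, 0 < s -> 0 < cos (sth (x s)) <= 1).
  { intros s Hs. split; [|apply COS_bound]. apply cos_pos. specialize (Hgt s Hs). assert (0 <= s) as h by lra. specialize (Hl1 s h). lra. }
  assert (Hnever : forall s1 m, 0 <= s1 -> 0 < m -> (forall s, s1 <= s -> m <= sw (x s)) -> False).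
  { intros s1 m Hs1 Hm Hmw. set (D := (l - sth (x s1)) / (m * cm)).
    assert (Hmc : 0 < m * cm) by nra.
    assert (HD : 0 < D) by (apply Rdiv_lt_0_compat; auto; specialize (Hl1 s1 Hs1); lra).
    pose proof (th_lower_speed x s1 (s1 + D) m cm Hx) as h.
    assert (sth (x s1) + m * cm * (s1 + D - s1) <= sth (x (s1 + D))).
    { apply h; auto; [lra|apply Hcb|]. intros; apply Hmw; lra. }
    replace (m * cm * (s1 + D - s1)) with (l - sth (x s1)) in H by (unfold D; field; lra).
    assert (0 <= s1 + D) as h2 by lra. specialize (Hl1 _ h2). lra. }
  assert (Hq : q l = 0).
  { destruct (Req_dec (q l) 0) as [|Hne]; auto. exfalso.
    set (de := Rabs (q l) / 4). assert (Hde : 0 < de) by (pose proof (Rabs_pos_lt _ Hne); unfold de; lra).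
    destruct (Hl2 (de / Kq)) as [s0 [Hs0 Hs0']]; [pos|].
    assert (Hqs : forall s, s0 <= s -> Rabs (q (sth (x s)) - q l) <= de).
    { intros s Hs. eapply Rle_trans; [apply Hlip|]. assert (0 <= s) as h by lra. specialize (Hl1 s h). specialize (Hs0' s Hs).
      rewrite Rabs_left by lra. replace de with (Kq * (de / Kq)) by (field; lra). apply Rmult_le_compat_l; lra. }
    set (om := de / K). assert (Hom : 0 < om) by pos.
    assert (Hsmall : forall s, s0 <= s -> 0 < s -> sw (x s) <= om -> Rabs (cos (sth (x s)) * Fw (x s) - q l) <= 2 * de).
    { intros s Hs Hsp Hsw. destruct (HF (x s) (sol_P1 x s Hx)) as [h _]. specialize (Hqs s Hs). specialize (Hw s Hsp).
      rewrite (Rabs_pos_eq (sw (x s))) in h by lra.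
      assert (K * sw (x s) <= de). { replace de with (K * om) by (unfold om; field; lra). apply Rmult_le_compat_l; lra. }
      replace (cos (sth (x s)) * Fw (x s) - q l) with ((cos (sth (x s)) * Fw (x s) - q (sth (x s))) + (q (sth (x s)) - q l)) by ring.
      eapply Rle_trans; [apply Rabs_triang|]. lra. }
    destruct (Rlt_dec 0 (q l)) as [Hpos|Hneg].
    - set (s1 := s0 + 1). set (m := Rmin (sw (x s1)) om / 2).
      assert (Hw1 : 0 < sw (x s1)) by (apply Hw; unfold s1; lra).
      rminp (sw (x s1)) om.
      apply (Hnever s1 m); [unfold s1; lra|unfold m; lra|].
      intros s Hs. apply Rnot_lt_le. intros Hn.
      destruct (first_zero (fun s => m - sw (x s)) s1 s) as [t [Ht1 [Ht2 Ht3]]]; auto.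
      + intros u _. apply (continuous_minus (fun _ => m) (fun s => sw (x s))); [apply continuous_const|apply sol_cont; auto].
      + unfold m; lra.
      + lra.
      + assert (hd : 0 <= - Fw (x t)).
        { apply (first_hit_deriv (fun s => m - sw (x s)) s1 t); auto; [lra|].
          eapply is_derive_eq; [apply (is_derive_minus (fun _ => m) (fun s => sw (x s))); [apply is_derive_const|apply sol_dw; auto]|].
          unfold minus, plus, opp, zero; simpl; ring. }
        cbv beta in Ht2. assert (hs : Rabs (cos (sth (x t)) * Fw (x t) - q l) <= 2 * de).
        { apply Hsmall; unfold s1 in *; try lra. unfold m in *; lra. }
        apply Rabs_le_between in hs. assert (0 < t) as htp by (unfold s1 in *; lra). specialize (Hcos t htp).
        unfold de in *. rewrite (Rabs_pos_eq (q l)) in * by lra. nra.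
    -
      assert (Hex : exists s1, s0 + 1 <= s1 /\ sw (x s1) < om).
      { destruct (classic (exists s1, s0 + 1 <= s1 /\ sw (x s1) < om)) as [|Hn]; auto. exfalso.
        apply (Hnever (s0 + 1) om); auto; [lra|]. intros s Hs. destruct (Rle_dec om (sw (x s))); auto.
        exfalso. apply Hn. exists s. split; auto; lra. }
      destruct Hex as [s1 [Hs1 Hws1]].
      assert (Hdec : forall s, s1 <= s -> sw (x s) <= om -> Fw (x s) <= - de).
      { intros s Hs Hsw. assert (hs : Rabs (cos (sth (x s)) * Fw (x s) - q l) <= 2 * de) by (apply Hsmall; lra).
        apply Rabs_le_between in hs. assert (0 < s) as htp by lra. specialize (Hcos s htp).
        unfold de in *. rewrite (Rabs_left (q l)) in * by lra. nra. }
      assert (Hstay : forall s, s1 <= s -> sw (x s) < om).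
      { intros s Hs. apply Rnot_le_lt. intros Hn.
        destruct (first_zero (fun s => sw (x s) - om) s1 s) as [t [Ht1 [Ht2 Ht3]]]; auto.
        - intros u _. apply (continuous_minus (fun s => sw (x s)) (fun _ => om)); [apply sol_cont; auto|apply continuous_const].
        - lra.
        - lra.
        - assert (hd : 0 <= Fw (x t)).
          { apply (first_hit_deriv (fun s => sw (x s) - om) s1 t); auto; [lra|].
            eapply is_derive_eq; [apply (is_derive_minus (fun s => sw (x s)) (fun _ => om)); [apply sol_dw; auto|apply is_derive_const]|].
            unfold minus, plus, opp, zero; simpl; ring. }
          cbv beta in Ht2. assert (Fw (x t) <= - de) by (apply Hdec; lra). lra. }
      set (s2 := s1 + om / de).
      assert (0 < om / de) by pos.
      assert (hlin : sw (x s2) + de * s2 <= sw (x s1) + de * s1).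
      { apply (nonincr (fun s => sw (x s) + de * s) (fun s => Fw (x s) + de)); [unfold s2; lra| |].
        - intros s _. apply (is_derive_plus (fun s => sw (x s)) (fun s => de * s)); [apply sol_dw; auto|auto_derive; auto; ring].
        - intros s Hs. assert (Fw (x s) <= - de); [|lra]. apply Hdec; [lra|]. left; apply Hstay; lra. }
      assert (0 < sw (x s2)) by (apply Hw; unfold s2; lra).
      assert (de * s2 - de * s1 = om) by (unfold s2; field; lra). lra. }
  assert (Hl : - (PI / 2) < l < PI / 2).
  { split; [lra|]. destruct (Rle_lt_or_eq_dec l (PI / 2)) as [h|h]; auto; [lra|]. exfalso.
    rewrite h in Hq. pose proof (q_pos' (PI / 2)) as hp. destruct ths_int. lra. }
  assert (Hcl : 0 < cos l) by (apply cos_pos; auto).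
  exists l. split; [auto|]. split; auto. split; auto. split; auto.
  intros e He.
  destruct (continuous_eps cos l) with (e := cos l / 2) as [d [Hd Hcd]]; [apply continuous_cos|lra|].
  set (k := cos l / 2). assert (Hk : 0 < k) by (unfold k; lra).
  set (Bw := (Kq + K * wM) / k). assert (HBw : 0 < Bw) by (apply Rdiv_lt_0_compat; nra).
  (* [Bw] bounds [Fw] near [l], so a value [w >= e] would stay above [e / 2] for a time
     [e / (2 * Bw)], during which the angle would gain [gap], more than is left before [l]. *)
  set (gap := cm * (e / 2) * (e / (2 * Bw))).
  assert (Hg0 : 0 < e / (2 * Bw)) by pos.
  assert (Hgap : 0 < gap) by (unfold gap; pos).
  destruct (Hl2 (Rmin e (Rmin d gap))) as [s0 [Hs0 Hs0']]; [pos|].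
  assert (Hm : Rmin e (Rmin d gap) <= e /\ Rmin e (Rmin d gap) <= d /\ Rmin e (Rmin d gap) <= gap).
  { rmin e (Rmin d gap). rmin d gap. lra. }
  exists (s0 + 1). split; [lra|]. intros s Hs.
  split; [assert (h : s0 <= s) by lra; specialize (Hs0' s h); lra|].
  apply Rnot_le_lt. intros Hn.
  assert (HFw : forall u, s <= u -> Rabs (Fw (x u)) <= Bw).
  { intros u Hu. destruct (HF (x u) (sol_P1 x u Hx)) as [h1 h2].
    assert (h3 : s0 <= u) by lra. specialize (Hs0' u h3). assert (0 <= u) as h4 by lra. specialize (Hl1 u h4).
    assert (h5 : Rabs (sth (x u) - l) < d) by (apply Rabs_def1; lra). specialize (Hcd _ h5). apply Rabs_def2 in Hcd.
    assert (h6 : k < cos (sth (x u))) by (unfold k; lra).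
    assert (h7 : Rabs (cos (sth (x u)) * Fw (x u)) <= Kq + K * wM).
    { replace (cos (sth (x u)) * Fw (x u)) with ((cos (sth (x u)) * Fw (x u) - q (sth (x u))) + q (sth (x u))) by ring.
      eapply Rle_trans; [apply Rabs_triang|]. specialize (Hqb (sth (x u))). nra. }
    rewrite Rabs_mult, Rabs_pos_eq in h7 by lra. pose proof (Rabs_pos (Fw (x u))).
    apply Rmult_le_reg_l with k; auto. replace (k * Bw) with (Kq + K * wM) by (unfold Bw; field; lra). nra. }
  assert (Hlow : forall u, s <= u <= s + e / (2 * Bw) -> e / 2 <= sw (x u)).
  { intros u Hu.
    assert (h : sw (x s) + Bw * s <= sw (x u) + Bw * u).
    { apply (nondecr (fun s => sw (x s) + Bw * s) (fun s => Fw (x s) + Bw)); [lra| |].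
      - intros z _. apply (is_derive_plus (fun s => sw (x s)) (fun s => Bw * s)); [apply sol_dw; auto|auto_derive; auto; ring].
      - intros z Hz. assert (h8 : s <= z) by lra. specialize (HFw z h8). apply Rabs_le_between in HFw. lra. }
    assert (Bw * (u - s) <= e / 2); [|lra].
    replace (e / 2) with (Bw * (e / (2 * Bw))) by (field; lra). apply Rmult_le_compat_l; lra. }
  pose proof (th_lower_speed x s (s + e / (2 * Bw)) (e / 2) cm Hx) as h.
  assert (h9 : sth (x s) + e / 2 * cm * (s + e / (2 * Bw) - s) <= sth (x (s + e / (2 * Bw)))).
  { apply h; auto; try lra. apply Hcb. }
  replace (e / 2 * cm * (s + e / (2 * Bw) - s)) with gap in h9 by (unfold gap; ring).
  assert (h10 : s0 <= s) by lra. specialize (Hs0' s h10).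
  assert (h11 : 0 <= s + e / (2 * Bw)) by lra. specialize (Hl1 _ h11). lra.
Qed.

End Basic.

#[export] Hint Resolve sol_cv sol_cr sol_cth sol_cw : continuity.

Lemma continuous_min_pos (f : R -> R) (a b : R) : a <= b -> (forall s, a <= s <= b -> continuous f s) ->
  (forall s, a <= s <= b -> 0 < f s) -> exists m, 0 < m /\ forall s, a <= s <= b -> m <= f s.
Proof.
  intros Hab Hc Hp. destruct (continuity_ab_min f a b) as [m [Hm Hm2]]; auto.
  { intros x Hx. apply continuity_pt_filterlim. apply Hc; auto. }
  exists (f m). split; auto.
Qed.

Lemma deriv_neg_right (f : R -> R) (t l : R) : f t = 0 -> is_derive f t l -> l < 0 ->
  exists d, 0 < d /\ forall s, t < s < t + d -> f s < 0.
Proof.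
  intros H0 Hd Hl. apply is_derive_Reals in Hd. destruct (Hd (- l / 2)) as [d Hdd]; [lra|].
  exists d. split; [apply cond_pos|]. intros s Hs.
  assert (h : s - t <> 0) by lra. specialize (Hdd (s - t) h).
  rewrite H0, Rminus_0_r in Hdd. replace (t + (s - t)) with s in Hdd by ring.
  assert (h2 : Rabs (s - t) < d) by (rewrite Rabs_pos_eq; lra). specialize (Hdd h2). apply Rabs_def2 in Hdd.
  assert (h3 : f s / (s - t) < 0) by lra.
  assert (f s = f s / (s - t) * (s - t)) by (field; auto). nra.
Qed.

Section Moves.
Context {S : system}.

Lemma sol_local_near x t e : sol x -> 0 < e -> exists d, 0 < d /\ forall s, Rabs (s - t) < d -> near e (x t) (x s).
Proof.
  intros Hx He. destruct (sol_cont x t Hx) as (a & b & k & f).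
  destruct (continuous_eps _ _ a e He) as [d1 [h1 H1]]. destruct (continuous_eps _ _ b e He) as [d2 [h2 H2]].
  destruct (continuous_eps _ _ k e He) as [d3 [h3 H3]]. destruct (continuous_eps _ _ f e He) as [d4 [h4 H4]].
  exists (Rmin (Rmin d1 d2) (Rmin d3 d4)). split; [pos|].
  intros s Hs. rmin (Rmin d1 d2) (Rmin d3 d4).
  rmin d1 d2. rmin d3 d4.
  apply near_sym. split; [|split; [|split]]; [apply H1|apply H2|apply H3|apply H4]; lra.
Qed.

Lemma r_linear x s : sol x -> is_derive (fun s => sr (x s)) s (sv (x s) * cos (sth (x s)) ^ 2 * sr (x s)).
Proof. intros Hx. eapply is_derive_eq; [apply sol_dr; auto|]. unfold Fr. ring. Qed.

Lemma r_zero x t0 : sol x -> sr (x t0) = 0 -> forall s, sr (x s) = 0.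
Proof.
  intros Hx H0 s.
  set (p := Rmin s t0). set (p2 := Rmax s t0).
  assert (p <= s <= p2 /\ p <= t0 <= p2).
  { unfold p, p2. rmin s t0. pose proof (Rmax_l s t0). pose proof (Rmax_r s t0). lra. }
  destruct (continuous_bounded (fun s => sv (x s) * cos (sth (x s)) ^ 2) p p2) as [K HK]; [lra| |].
  { intros u _. apply (continuous_mult (fun s => sv (x s)) (fun s => cos (sth (x s)) ^ 2)); [apply sol_cv; auto|].
    apply (continuous_comp (fun s => sth (x s)) (fun t => cos t ^ 2)); [apply sol_cth; auto|].
    apply (is_derive_continuous (fun t => cos t ^ 2) _ (2 * cos (sth (x u)) * - sin (sth (x u)))).
    eapply is_derive_eq; [apply (is_derive_pow cos 2); apply is_derive_cos|]. simpl; ring. }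
  apply (linear_zero (fun s => sr (x s)) (fun s => sv (x s) * cos (sth (x s)) ^ 2) K p p2 t0); auto; try lra.
  intros u _. apply r_linear; auto.
Qed.

Lemma r_pos x t0 : sol x -> 0 < sr (x t0) -> forall s, 0 < sr (x s).
Proof.
  intros Hx H0 s. destruct (sol_P1 x s Hx) as [[h|h] _]; auto.
  rewrite (r_zero x s Hx (eq_sym h) t0) in H0. lra.
Qed.

Lemma r_nonincr x a b : sol x -> a <= b -> (forall s, a < s < b -> sv (x s) <= 0) -> sr (x b) <= sr (x a).
Proof.
  intros Hx Hab Hv. apply (nonincr (fun s => sr (x s)) (fun s => Fr (x s))); auto.
  - intros s _. apply sol_dr; auto.
  - intros s Hs. unfold Fr. specialize (Hv s Hs). destruct (sol_P1 x s Hx) as [h _].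
    pose proof (pow2_ge_0 (cos (sth (x s)))). assert (0 <= sr (x s) * - sv (x s)) by pos. nra.
Qed.

Lemma tends_cos x l : sol x -> 0 < cos l -> tends x l ->
  exists s0, 0 <= s0 /\ forall s, s0 <= s -> cos l / 2 < cos (sth (x s)).
Proof.
  intros Hx Hl [H1 H2].
  destruct (continuous_eps cos l) with (e := cos l / 2) as [d [Hd Hcd]]; [apply continuous_cos|lra|].
  destruct (H2 d Hd) as [s0 [Hs0 H]]. exists s0. split; auto. intros s Hs. specialize (H s Hs).
  assert (h : 0 <= s) by lra. specialize (H1 s h).
  assert (h5 : Rabs (sth (x s) - l) < d) by (apply Rabs_def1; lra). specialize (Hcd _ h5). apply Rabs_def2 in Hcd. lra.
Qed.

Lemma tends_En x l e : sol x -> (forall s, 0 < s -> 0 < sw (x s)) -> 0 < cos l -> tends x l -> 0 < e ->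
  exists s0, 0 <= s0 /\ forall s, s0 <= s -> Rabs (En (x s) - V l) < e.
Proof.
  intros Hx Hw Hl Ht He.
  destruct (tends_cos x l Hx Hl Ht) as [s1 [Hs1 Hcos]].
  destruct Ht as [H1 H2]. destruct c_bounds as (cm & cM & Hcm & HcM & Hcb).
  destruct (continuous_eps V l) with (e := e / 2) as [d [Hd HV]]; [apply V_cont; lra|lra|].
  set (k := cos l / 2) in *. assert (hk : 0 < k) by (unfold k; lra).
  set (A := / 2 * cM / k ^ 2). assert (HA : 0 < A).
  { unfold A. apply Rdiv_lt_0_compat; [lra|apply pow_lt; auto]. }
  set (m := Rmin 1 (e / (2 * A))).
  assert (Hm : 0 < m) by pos.
  assert (Hm1 : m <= 1) by apply Rmin_l. assert (Hm2 : m <= e / (2 * A)) by apply Rmin_r.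
  destruct (H2 (Rmin d m)) as [s2 [Hs2 H]]; [pos|].
  rmin d m.
  exists (s1 + s2 + 1). split; [lra|]. intros s Hs.
  assert (h2 : s2 <= s) by lra. specialize (H s h2). assert (h1 : s1 <= s) by lra. specialize (Hcos s h1).
  assert (h0 : 0 <= s) by lra. specialize (H1 s h0). assert (h3 : 0 < s) by lra. specialize (Hw s h3).
  assert (h4 : Rabs (sth (x s) - l) < d) by (apply Rabs_def1; lra). specialize (HV _ h4). apply Rabs_def2 in HV.
  assert (hE := En_V (x s) (sol_P1 x s Hx)). assert (hc : cos (sth (x s)) <> 0) by lra. specialize (hE hc).
  specialize (Hcb (sth (x s))).
  assert (hw2 : (sw (x s)) ^ 2 <= m).
  { assert (sw (x s) < m) by lra. nra. }
  assert (hb : 0 <= V (sth (x s)) - En (x s) <= e / 2).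
  { split; [pose proof (En_le_V (x s) (sol_P1 x s Hx) hc); lra|].
    assert (hk2 : k ^ 2 <= cos (sth (x s)) ^ 2) by (apply pow_incr; lra).
    assert (hk3 : 0 < k ^ 2) by (apply pow_lt; auto).
    assert (hle : (V (sth (x s)) - En (x s)) * k ^ 2 <= / 2 * m * cM).
    { apply Rle_trans with ((V (sth (x s)) - En (x s)) * cos (sth (x s)) ^ 2).
      - apply Rmult_le_compat_l; auto. pose proof (En_le_V (x s) (sol_P1 x s Hx) hc). lra.
      - rewrite <- hE. pose proof (pow2_ge_0 (sw (x s))). apply Rmult_le_compat; lra. }
    apply Rmult_le_reg_r with (k ^ 2); auto. eapply Rle_trans; [exact hle|].
    replace (/ 2 * m * cM) with (m * A * k ^ 2) by (unfold A; field; lra).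
    apply Rmult_le_compat_r; [lra|]. replace (e / 2) with (e / (2 * A) * A) by (field; lra).
    apply Rmult_le_compat_r; lra. }
  apply Rabs_def1; lra.
Qed.

(** As [w] fades, the derivative of [v] is close to [- r * cos ^ 2], so an [r] bounded below would
    send [v] to minus infinity, against the convergence of [En]. Were [v] never negative, [r] would
    not decrease and that case would occur; once negative, [v] stays so, because at [v = 0] the term
    [- W] prevails. Hence [r] decreases to zero and [En] determines the limit of [v]. *)
Lemma homothetic_limit x l : sol x -> (forall s, 0 < s -> 0 < sw (x s)) -> 0 < cos l -> tends x l -> 0 < sr (x 0) ->
  forall e, 0 < e -> exists s0, 0 <= s0 /\ forall s, s0 <= s ->
    sv (x s) < 0 /\ near e (x s) (St 0 (- sqrt (2 * V l)) l 0).
Proof.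
  intros Hx Hw Hl Ht Hr0.
  destruct (tends_cos x l Hx Hl Ht) as [sc [Hsc Hcos]].
  destruct c_bounds as (cm & cM & Hcm & HcM & Hcb). destruct W_bounds as (Wm & WM & HWm & HWM & HWb).
  set (k := cos l / 2) in *. assert (hk : 0 < k) by (unfold k; lra).
  assert (HVl : 0 < V l) by (apply Rdiv_lt_0_compat; [apply W_pos|apply pow_lt; auto]).
  assert (Hwsmall : forall e, 0 < e -> exists s0, 0 <= s0 /\ forall s, s0 <= s -> c (sth (x s)) * (sw (x s)) ^ 2 < e).
  { intros e He. destruct Ht as [_ H2].
    set (m := Rmin 1 (e / cM)). assert (Hm : 0 < m) by pos.
    assert (Hm1 : m <= 1) by apply Rmin_l. assert (Hm2 : m <= e / cM) by apply Rmin_r.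
    destruct (H2 m Hm) as [s0 [Hs0 H]]. exists (s0 + 1). split; [lra|]. intros s Hs.
    assert (h : s0 <= s) by lra. specialize (H s h). assert (h' : 0 < s) by lra. specialize (Hw s h').
    specialize (Hcb (sth (x s))).
    assert ((sw (x s)) ^ 2 < m) by nra. assert (0 <= sw (x s) ^ 2) by apply pow2_ge_0.
    assert (c (sth (x s)) * sw (x s) ^ 2 <= cM * sw (x s) ^ 2) by (apply Rmult_le_compat_r; lra).
    assert (cM * sw (x s) ^ 2 < cM * (e / cM)) by (apply Rmult_lt_compat_l; lra).
    replace (cM * (e / cM)) with e in H4 by (field; lra). lra. }
  assert (Hdec : forall e s0, 0 < e -> sc <= s0 -> (forall s, s0 <= s -> c (sth (x s)) * sw (x s) ^ 2 < e * k ^ 2) ->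
    (forall s, s0 <= s -> e <= sr (x s)) -> forall s, s0 <= s -> sv (x s) <= sv (x s0) - / 2 * e * k ^ 2 * (s - s0)).
  { intros e s0 He Hs0 Hcw Hr s Hs.
    assert (sv (x s) + / 2 * e * k ^ 2 * s <= sv (x s0) + / 2 * e * k ^ 2 * s0); [|lra].
    apply (nonincr (fun s => sv (x s) + / 2 * e * k ^ 2 * s) (fun s => Fv (x s) + / 2 * e * k ^ 2)); auto.
    - intros u _. apply (is_derive_plus (fun s => sv (x s)) (fun s => / 2 * e * k ^ 2 * s)); [apply sol_dv; auto|auto_derive; auto; ring].
    - intros u Hu. rewrite (Fv_eq _ (sol_P1 x u Hx)). assert (h : s0 <= u) by lra. specialize (Hcw u h). specialize (Hr u h).
      assert (h1 : sc <= u) by lra. specialize (Hcos u h1).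
      assert (hk2 : k ^ 2 <= cos (sth (x u)) ^ 2) by (apply pow_incr; lra).
      assert (0 < k ^ 2) by (apply pow_lt; auto).
      assert (e * k ^ 2 <= sr (x u) * cos (sth (x u)) ^ 2) by (apply Rmult_le_compat; lra). lra. }
  destruct (tends_En x l 1 Hx Hw Hl Ht Rlt_0_1) as [sE [HsE HE]].
  assert (Hnoinf : forall e s0, 0 < e -> sc <= s0 -> sE <= s0 -> (forall s, s0 <= s -> c (sth (x s)) * sw (x s) ^ 2 < e * k ^ 2) ->
    (forall s, s0 <= s -> e <= sr (x s)) -> False).
  { intros e s0 He Hs0 HsE0 Hcw Hr. pose proof (Hdec e s0 He Hs0 Hcw Hr) as h.
    assert (hk2 : 0 < k ^ 2) by (apply pow_lt; auto).
    set (A := / 2 * e * k ^ 2) in *. assert (HA : 0 < A) by (unfold A; nra).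
    set (N := Rabs (sv (x s0)) + 2 * (V l + 1) + 2). assert (0 < N) by (unfold N; pose proof (Rabs_pos (sv (x s0))); lra).
    assert (0 < N / A) by pos.
    assert (h1 : s0 <= s0 + N / A) by lra. specialize (h _ h1).
    replace (A * (s0 + N / A - s0)) with N in h by (field; lra).
    assert (h2 : sE <= s0 + N / A) by lra. specialize (HE _ h2). apply Rabs_def2 in HE.
    unfold En in HE. destruct (sol_P1 x (s0 + N / A) Hx) as [h3 _].
    pose proof (Rle_abs (sv (x s0))). unfold N in *. nra. }
  assert (Hneg : exists s1, sc <= s1 /\ sE <= s1 /\ 0 < s1 /\ forall s, s1 <= s -> sv (x s) < 0).
  { destruct (Hwsmall Wm HWm) as [sa [Hsa Ha]].
    set (s0 := sa + sc + sE + 1).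
    destruct (classic (exists s1, s0 <= s1 /\ sv (x s1) < 0)) as [[s1 [Hs1 Hv1]]|Hn].
    - exists s1. unfold s0 in Hs1. split; [lra|]. split; [lra|]. split; [lra|]. intros s Hs.
      apply Rnot_le_lt. intros Hnn.
      destruct (first_zero (fun s => sv (x s)) s1 s) as [t [Ht1 [Ht2 Ht3]]]; [lra|intros; apply sol_cv; auto|auto|lra|].
      cbv beta in Ht2.
      assert (hd : 0 <= Fv (x t)) by (apply (first_hit_deriv (fun s => sv (x s)) s1 t); auto; [lra|apply sol_dv; auto]).
      unfold Fv in hd. rewrite Ht2 in hd. assert (ht : sa <= t) by lra. specialize (Ha t ht). specialize (HWb (sth (x t))). lra.
    - exfalso. assert (hpos : forall s, s0 <= s -> 0 <= sv (x s)).
      { intros s Hs. apply Rnot_lt_le. intros hn. apply Hn. exists s. split; auto; lra. }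
      set (r0 := sr (x s0)). assert (hr0 : 0 < r0) by (apply (r_pos x 0); auto).
      assert (hk2 : 0 < k ^ 2) by (apply pow_lt; auto).
      destruct (Hwsmall (r0 * k ^ 2)) as [sb [Hsb Hb]]; [nra|].
      apply (Hnoinf r0 (s0 + sb)); auto; try (unfold s0; lra).
      + intros s Hs. apply Hb. unfold s0 in *; lra.
      + intros s Hs. apply (nondecr (fun s => sr (x s)) (fun s => Fr (x s))); [lra|intros; apply sol_dr; auto|].
        intros u Hu. unfold Fr. assert (h : s0 <= u) by lra. specialize (hpos u h). destruct (sol_P1 x u Hx) as [h3 _].
        pose proof (pow2_ge_0 (cos (sth (x u)))). apply Rmult_le_pos; [pos|auto]. }
  destruct Hneg as (s1 & Hs1c & Hs1E & Hs1p & Hneg).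
  assert (Hrsmall : forall e, 0 < e -> exists s2, s1 <= s2 /\ forall s, s2 <= s -> sr (x s) < e).
  { intros e He. assert (hk2 : 0 < k ^ 2) by (apply pow_lt; auto).
    destruct (Hwsmall (e * k ^ 2)) as [sb [Hsb Hb]]; [nra|].
    destruct (classic (exists s2, s1 + sb <= s2 /\ sr (x s2) < e)) as [[s2 [h1 h2]]|Hn].
    - exists s2. split; [lra|]. intros s Hs. eapply Rle_lt_trans; [apply (r_nonincr x s2 s); auto|auto].
      intros u Hu. left. apply Hneg. lra.
    - exfalso. apply (Hnoinf e (s1 + sb)); auto; try lra.
      + intros s Hs. apply Hb. lra.
      + intros s Hs. apply Rnot_lt_le. intros hn. apply Hn. exists s. split; auto; lra. }
  intros e He.
  set (v0 := sqrt (2 * V l)). assert (Hv0 : 0 < v0) by (apply sqrt_lt_R0; lra).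
  assert (Hv0sq : v0 * v0 = 2 * V l) by (apply sqrt_sqrt; lra).
  set (e2 := Rmin e (e * v0 / 4)). assert (He2 : 0 < e2) by pos.
  assert (He2a : e2 <= e) by apply Rmin_l. assert (He2b : e2 <= e * v0 / 4) by apply Rmin_r.
  destruct (Hrsmall e2 He2) as [s2 [Hs2 Hr2]].
  destruct (tends_En x l e2 Hx Hw Hl Ht He2) as [s3 [Hs3 HE3]].
  destruct Ht as [Ht1 Ht2]. destruct (Ht2 e He) as [s4 [Hs4 H4]].
  exists (s2 + s3 + s4 + 1). split; [lra|]. intros s Hs.
  assert (hv : sv (x s) < 0) by (apply Hneg; lra). split; auto.
  assert (hr : sr (x s) < e2) by (apply Hr2; lra). destruct (sol_P1 x s Hx) as [hr0 _].
  assert (hE : Rabs (En (x s) - V l) < e2) by (apply HE3; lra). apply Rabs_def2 in hE. unfold En in hE.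
  assert (h4 : s4 <= s) by lra. specialize (H4 s h4). assert (h5 : 0 <= s) by lra. specialize (Ht1 s h5).
  assert (h6 : 0 < s) by lra. specialize (Hw s h6).
  apply near_intro; simpl; try lra.
  fold v0. assert (hd : Rabs ((sv (x s) - v0) * (sv (x s) + v0)) < e * v0).
  { replace ((sv (x s) - v0) * (sv (x s) + v0)) with (sv (x s) ^ 2 - v0 * v0) by ring. rewrite Hv0sq.
    apply Rabs_def1; lra. }
  apply Rabs_def2 in hd. split; nra.
Qed.

(** * Orbits moving to the right *)

(** From time [0] on, [x] moves to the right; it reaches the angle [b] at time [t] ([whit]), or stops before it at time [t] ([turn]). *)
Definition whit (x : R -> state) (b t : R) : Prop :=
  0 < t /\ sth (x t) = b /\ forall s, 0 < s <= t -> 0 < sw (x s).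

Definition turn (x : R -> state) (b t : R) : Prop :=
  0 < t /\ sw (x t) = 0 /\ sth (x 0) < sth (x t) < b /\ forall s, 0 < s < t -> 0 < sw (x s).

Lemma w_nonzero_collinear x : P1 x -> cos (sth x) = 0 -> sw x <> 0.
Proof.
  intros H h h0. pose proof (En_eq x H) as e. rewrite h, h0 in e. pose proof (W_pos (sth x)). lra.
Qed.

(** The condition on [b] rules out a stop exactly at [b]: on a collinear line energy forbids
    [w = 0], and at a zero of [q] [no_stop] does. *)
Lemma advance x b eta : sol x -> - (PI / 2) <= sth (x 0) < b -> b <= PI / 2 -> 0 < eta ->
  (forall s, 0 < s <= eta -> 0 < sw (x s)) -> (cos b = 0 \/ q b = 0) ->
  (exists t, whit x b t) \/ (exists t, turn x b t) \/
  ((forall s, 0 < s -> 0 < sw (x s)) /\ exists l, sth (x 0) < l <= b /\ q l = 0 /\ 0 < cos l /\ tends x l).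
Proof.
  intros Hx H0 Hb2 Heta Hstart Hb.
  destruct (classic (exists s, 0 < s /\ sw (x s) <= 0)) as [[s [Hs Hws]]|Hn].
  - destruct (w_stop x eta s) as [t [Ht1 [Hwt Ht3]]]; auto.
    { destruct (Rle_dec eta s); auto. assert (0 < sw (x s)) by (apply Hstart; lra). lra. }
    { apply Hstart; lra. }
    assert (Hpos : forall u, 0 < u < t -> 0 < sw (x u)).
    { intros u Hu. destruct (Rle_dec u eta); [apply Hstart|apply Ht3]; lra. }
    assert (Hth : sth (x 0) < sth (x t)) by (apply th_incr; auto; lra).
    destruct (Rtotal_order (sth (x t)) b) as [h|[h|h]].
    + right; left. exists t. split; [lra|]. split; auto.
    + exfalso. destruct Hb as [Hb|Hb].
      * rewrite <- h in Hb. apply (w_nonzero_collinear (x t) (sol_P1 x t Hx) Hb). auto.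
      * destruct (Req_dec (cos b) 0) as [hc|hc].
        { rewrite <- h in hc. apply (w_nonzero_collinear (x t) (sol_P1 x t Hx) hc). auto. }
        destruct (no_stop x t b Hx Hb hc h Hwt) as [e [He H]].
        set (u := Rmax (t - e) (t / 2)). assert (t - e <= u) by apply Rmax_l. assert (t / 2 <= u) by apply Rmax_r.
        assert (u < t) by (apply Rmax_lub_lt; lra).
        assert (sw (x u) = 0) by (apply H; lra). assert (0 < sw (x u)) by (apply Hpos; lra). lra.
    + left. destruct (th_ivt x 0 t b) as [u [Hu1 [Hu2 Hu3]]]; auto; try lra.
      exists u. split; [lra|]. split; auto. intros z Hz. apply Hpos.
      destruct Hu1 as [_ [Hu1|Hu1]]; [lra|]. subst. lra.
  - assert (Hpos : forall s, 0 < s -> 0 < sw (x s)).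
    { intros s Hs. apply Rnot_le_lt. intros hn. apply Hn. exists s. split; auto; lra. }
    destruct (classic (exists t, 0 <= t /\ b <= sth (x t))) as [[t [Ht Hbt]]|Hn2].
    + left. destruct (th_ivt x 0 t b) as [u [Hu1 [Hu2 Hu3]]]; auto; try lra.
      exists u. split; [lra|]. split; auto. intros z Hz. apply Hpos. lra.
    + right; right. split; auto. apply (stuck x b); auto; try lra.
      intros s Hs. apply Rnot_le_lt. intros hn. apply Hn2. exists s. split; auto; lra.
Qed.

Lemma start_positive x : sol x -> 0 < sw (x 0) -> exists eta, 0 < eta /\ forall s, 0 <= s <= eta -> 0 < sw (x s).
Proof.
  intros Hx H. destruct (sign_near (fun s => sw (x s)) 0) as [d [Hd H1]]; [apply sol_cw; auto|auto|].
  exists (d / 2). split; [lra|]. intros s Hs. apply H1. apply Rabs_def1; lra.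
Qed.

Lemma start_rest x : sol x -> sw (x 0) = 0 -> 0 < cos (sth (x 0)) -> 0 < q (sth (x 0)) ->
  exists eta, 0 < eta /\ forall s, 0 < s <= eta -> 0 < sw (x s).
Proof.
  intros Hx H Hc Hq.
  assert (HF : 0 < Fw (x 0)).
  { pose proof (Fw_eq (x 0) (sol_P1 x 0 Hx)) as e. rewrite H in e. nra. }
  destruct (deriv_neg_right (fun s => - sw (x s)) 0 (- Fw (x 0))) as [d [Hd h]]; [lra| |lra|].
  { apply (is_derive_opp (fun s => sw (x s))). apply sol_dw; auto. }
  exists (d / 2). split; [lra|]. intros s Hs. assert (- sw (x s) < 0) by (apply h; lra). lra.
Qed.

(** At rest [cos * Fw = q], and [w] cannot be increasing when it first reaches zero from above. *)
Lemma turn_sign x b t : sol x -> turn x b t -> - (PI / 2) <= sth (x 0) -> b <= PI / 2 -> q (sth (x t)) <= 0.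
Proof.
  intros Hx (Ht & Hw & Hth & Hpos) H0 Hb.
  assert (hc : 0 < cos (sth (x t))) by (apply cos_pos; lra).
  pose proof (Fw_eq (x t) (sol_P1 x t Hx)) as e. rewrite Hw in e.
  assert (hd : 0 <= - Fw (x t)).
  { apply (first_hit_deriv (fun s => - sw (x s)) (t / 2) t); [lra| |lra|].
    - intros s Hs. assert (0 < sw (x s)) by (apply Hpos; lra). lra.
    - apply (is_derive_opp (fun s => sw (x s))). apply sol_dw; auto. }
  nra.
Qed.

Lemma push x b eta : sol x -> - (PI / 2) <= sth (x 0) < b -> b <= PI / 2 -> 0 < eta ->
  (forall s, 0 < s <= eta -> 0 < sw (x s)) -> (cos b = 0 \/ q b = 0) -> (forall t, sth (x 0) < t < b -> 0 < q t) ->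
  (exists t, whit x b t) \/ ((forall s, 0 < s -> 0 < sw (x s)) /\ q b = 0 /\ 0 < cos b /\ tends x b).
Proof.
  intros Hx H0 Hb2 Heta Hst Hb Hq.
  destruct (advance x b eta) as [h|[[t h]|[h [l (h1 & h2 & h3 & h4)]]]]; auto.
  - exfalso. pose proof (turn_sign x b t Hx h) as hs. destruct h as (_ & _ & hth & _).
    assert (0 < q (sth (x t))) by (apply Hq; auto). lra.
  - right. assert (l = b).
    { destruct h1 as [h1 [h5|h5]]; auto. assert (0 < q l) by (apply Hq; lra). lra. }
    subst. auto.
Qed.

Lemma fall x b eta : sol x -> - (PI / 2) <= sth (x 0) < b -> b <= PI / 2 -> 0 < eta ->
  (forall s, 0 < s <= eta -> 0 < sw (x s)) -> q b = 0 -> (forall t, sth (x 0) < t < b -> q t < 0) ->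
  (exists t, whit x b t) \/ (exists t, turn x b t) \/ ((forall s, 0 < s -> 0 < sw (x s)) /\ 0 < cos b /\ tends x b).
Proof.
  intros Hx H0 Hb2 Heta Hst Hb Hq.
  destruct (advance x b eta) as [h|[h|[h [l (h1 & h2 & h3 & h4)]]]]; auto.
  right; right. assert (l = b).
  { destruct h1 as [h1 [h5|h5]]; auto. assert (q l < 0) by (apply Hq; lra). lra. }
  subst. auto.
Qed.

Lemma push_collinear x eta : sol x -> ths <= sth (x 0) < PI / 2 -> 0 < eta ->
  (forall s, 0 < s <= eta -> 0 < sw (x s)) -> exists t, whit x (PI / 2) t.
Proof.
  intros Hx H0 Heta Hst. destruct ths_int as [h1 h2].
  destruct (push x (PI / 2) eta) as [h|(_ & _ & h & _)]; auto; try lra.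
  - left; apply cos_PI2.
  - intros t Ht. apply q_pos'; lra.
  - rewrite cos_PI2 in h. lra.
Qed.

(** [push] leaves convergence to the Euler angle as the alternative. With [r > 0] the limit is the
    lower equilibrium, where [v] is near [- v0], so [- / 2 * v * cos ^ 3 * w] is positive and of
    first order in [w]; it beats the quadratic terms, and [w] grows instead of fading. Collision
    orbits may approach the upper equilibrium, where this sign is reversed; hence the degenerate
    case treated later. *)
Lemma push_Euler x eta : sol x -> - ths <= sth (x 0) < 0 -> 0 < eta -> 0 < sr (x 0) ->
  (forall s, 0 < s <= eta -> 0 < sw (x s)) -> exists t, whit x 0 t.
Proof.
  intros Hx H0 Heta Hr Hst. destruct ths_int as [h1 h2].
  destruct (push x 0 eta) as [h|(Hpos & _ & _ & Ht)]; auto; try lra.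
  - right; apply q_zero.
  - intros t Ht. apply q_pos; lra.
  - exfalso. assert (hc0 : 0 < cos 0) by (rewrite cos_0; lra).
    destruct (periodic_bounded c1) as [B1 [HB1 hc1]]; [apply c1_cont|apply c1_per|].
    destruct c_bounds as (cm & cM & Hcm & HcM & Hcb).
    set (v0 := sqrt (2 * V 0)).
    assert (Hv0 : 0 < v0). { apply sqrt_lt_R0. assert (0 < V 0); [|lra]. apply Rdiv_lt_0_compat; [apply W_pos|apply pow_lt; auto]. }
    destruct (tends_cos x 0 Hx hc0 Ht) as [sc [Hsc Hcos]]. rewrite cos_0 in Hcos.
    set (A := cM + B1). assert (HA : 0 < A) by (unfold A; lra).
    (* For [w < e] the quadratic terms are at most [w * v0 / 64], while [v < - v0 / 2] and
       [cos > / 2] make the term in [v] at least [w * v0 / 32]. *)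
    set (e := Rmin (v0 / 2) (v0 / (64 * A))).
    assert (He : 0 < e) by pos.
    assert (He1 : e <= v0 / 2) by apply Rmin_l. assert (He2 : e <= v0 / (64 * A)) by apply Rmin_r.
    assert (He3 : e * A <= v0 / 64).
    { replace (v0 / 64) with (v0 / (64 * A) * A) by (field; lra). apply Rmult_le_compat_r; lra. }
    destruct (homothetic_limit x 0 Hx Hpos hc0 Ht Hr e He) as [s0 [Hs0 Hlim]].
    fold v0 in Hlim. destruct Ht as [Ht1 Ht2].
    set (s1 := s0 + sc + 1).
    assert (Hup : forall s, s1 <= s -> 0 < Fw (x s)).
    { intros s Hs. unfold s1 in Hs. assert (k1 : s0 <= s) by lra. destruct (Hlim s k1) as [_ hn].
      apply near_elim in hn. simpl in hn. destruct hn as (n1 & n2 & n3 & n4).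
      assert (k2 : sc <= s) by lra. specialize (Hcos s k2). assert (k3 : 0 < s) by lra. pose proof (Hpos s k3) as hw.
      assert (k4 : 0 <= s) by lra. specialize (Ht1 s k4).
      assert (hth : sth (x 0) < sth (x s)) by (apply th_incr; auto; intros; apply Hpos; lra).
      assert (hq : 0 < q (sth (x s))) by (apply q_pos; lra).
      pose proof (Fw_eq (x s) (sol_P1 x s Hx)) as eF.
      specialize (hc1 (sth (x s))). specialize (Hcb (sth (x s))).
      set (k := cos (sth (x s))) in *. set (z := sin (sth (x s))) in *.
      assert (hk1 : k <= 1) by apply COS_bound. assert (hz : -1 <= z <= 1) by apply SIN_bound.
      apply Rabs_le_between in hc1.
      assert (hR : c (sth (x s)) * z + / 2 * c1 (sth (x s)) * k <= A) by (unfold A; nra).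
      assert (hw2 : sw (x s) ^ 2 * (c (sth (x s)) * z + / 2 * c1 (sth (x s)) * k) <= sw (x s) * (v0 / 64)).
      { replace (sw (x s) ^ 2) with (sw (x s) * sw (x s)) by ring. rewrite Rmult_assoc. apply Rmult_le_compat_l; [lra|].
        apply Rle_trans with (sw (x s) * A); [apply Rmult_le_compat_l; lra|].
        apply Rle_trans with (e * A); [apply Rmult_le_compat_r; lra|auto]. }
      assert (hk3 : / 8 <= k ^ 3). { replace (/ 8) with ((/ 2) ^ 3) by (simpl; field). apply pow_incr; lra. }
      assert (hv : sw (x s) * (v0 / 32) <= - (/ 2 * sv (x s) * k ^ 3 * sw (x s))).
      { replace (- (/ 2 * sv (x s) * k ^ 3 * sw (x s))) with (sw (x s) * (/ 2 * (- sv (x s)) * k ^ 3)) by ring.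
        apply Rmult_le_compat_l; [lra|]. replace (v0 / 32) with (/ 2 * (v0 / 2) * / 8) by field.
        apply Rmult_le_compat; lra. }
      assert (0 < k * Fw (x s)); [|nra]. rewrite eF.
      assert (0 < sw (x s) * (v0 / 64)) by pos. lra. }
    assert (Hws1 : 0 < sw (x s1)) by (apply Hpos; unfold s1; lra).
    destruct (Ht2 (sw (x s1)) Hws1) as [s2 [Hs2 Hsmall]].
    set (s3 := s1 + s2 + 1).
    assert (h3 : s2 <= s3) by (unfold s3, s1; lra). destruct (Hsmall s3 h3) as [_ h4].
    assert (sw (x s1) <= sw (x s3)); [|lra].
    apply (nondecr (fun s => sw (x s)) (fun s => Fw (x s))); [unfold s3; lra|intros; apply sol_dw; auto|].
    intros u Hu. left. apply Hup. lra.
Qed.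

(** Two separate claims, because a neighbour of an orbit starting at rest may start leftwards:
    closeness of any hit that occurs, and existence of a hit when [w > 0] initially. The first alone
    serves after a turn, where the mirrored orbit starts with [w = 0]. *)
Lemma whit_near x b t e : sol x -> whit x b t -> 0 < e ->
  exists d, 0 < d /\ forall y, sol y -> near d (x 0) (y 0) ->
    (forall ty, whit y b ty -> near e (x t) (y ty) /\ Rabs (ty - t) < e) /\ (0 < sw (x 0) -> exists ty, whit y b ty).
Proof.
  intros Hx (Ht & Hb & Hpos) He.
  destruct (sol_local_near x t (e / 2) Hx) as [d1 [Hd1 H1]]; [lra|].
  destruct (sign_near (fun s => sw (x s)) t) as [d2 [Hd2 H2]]; [apply sol_cw; auto|apply Hpos; lra|].
  set (eta := Rmin (Rmin (d1 / 2) (d2 / 2)) (Rmin (t / 2) (e / 2))).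
  assert (Heta : 0 < eta) by pos.
  assert (Heta' : eta <= d1 / 2 /\ eta <= d2 / 2 /\ eta <= t / 2 /\ eta <= e / 2).
  { unfold eta. rmin (Rmin (d1 / 2) (d2 / 2)) (Rmin (t / 2) (e / 2)).
    rmin (d1 / 2) (d2 / 2). rmin (t / 2) (e / 2). lra. }
  clearbody eta.
  assert (Hpos2 : forall s, 0 < s <= t + eta -> 0 < sw (x s)).
  { intros s Hs. destruct (Rle_dec s t); [apply Hpos; lra|]. apply H2. apply Rabs_def1; lra. }
  assert (Hlo : sth (x (t - eta)) < b) by (rewrite <- Hb; apply th_incr; auto; [lra|intros; apply Hpos2; lra]).
  assert (Hhi : b < sth (x (t + eta))) by (rewrite <- Hb; apply th_incr; auto; [lra|intros; apply Hpos2; lra]).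
  assert (Hm : exists m, 0 < m /\ (0 < sw (x 0) -> forall s, 0 <= s <= t + eta -> m <= sw (x s))).
  { destruct (Rlt_dec 0 (sw (x 0))) as [h|h]; [|exists 1; split; [lra|tauto]].
    destruct (continuous_min_pos (fun s => sw (x s)) 0 (t + eta)) as [m [Hm1 Hm2]]; [lra| | |].
    - intros; apply sol_cw; auto.
    - intros s Hs. destruct (Rle_lt_or_eq_dec 0 s) as [k|k]; [lra| |rewrite <- k; auto]. apply Hpos2. lra.
    - exists m. auto. }
  destruct Hm as [m [Hm Hmw]].
  set (tol := Rmin (Rmin (e / 2) m) (Rmin (b - sth (x (t - eta))) (sth (x (t + eta)) - b))).
  assert (Htol : 0 < tol) by pos.
  assert (Htol' : tol <= e / 2 /\ tol <= m /\ tol <= b - sth (x (t - eta)) /\ tol <= sth (x (t + eta)) - b).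
  { unfold tol. set (u1 := b - sth (x (t - eta))). set (u2 := sth (x (t + eta)) - b).
    rmin (Rmin (e / 2) m) (Rmin u1 u2).
    rmin (e / 2) m. rmin u1 u2. lra. }
  clearbody tol.
  destruct (continuous_dependence x (t + eta) tol Hx) as [d [Hd Hdep]]; [lra|auto|].
  exists d. split; auto. intros y Hy Hn.
  assert (Hnear : forall s, 0 <= s <= t + eta -> near tol (x s) (y s)).
  { intros s Hs. apply Hdep; auto. rewrite Rabs_pos_eq; lra. }
  assert (Hyhi : b < sth (y (t + eta))).
  { destruct (near_elim _ _ _ (Hnear (t + eta) ltac:(lra))) as (_ & _ & n & _). lra. }
  split.
  - intros ty (Hty & Hyb & Hyw).
    assert (k1 : ty <= t + eta).
    { destruct (Rle_dec ty (t + eta)); auto. exfalso. assert (sth (y (t + eta)) < sth (y ty)); [|lra].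
      apply th_incr; auto; [lra|]. intros; apply Hyw; lra. }
    assert (k2 : t - eta <= ty).
    { destruct (Rle_dec (t - eta) ty); auto. exfalso.
      destruct (near_elim _ _ _ (Hnear ty ltac:(lra))) as (_ & _ & k & _).
      assert (sth (x ty) < sth (x (t - eta))); [|lra]. apply th_incr; auto; [lra|]. intros; apply Hpos2; lra. }
    split; [|apply Rabs_def1; lra].
    apply near_weaken with (e / 2 + tol); [lra|]. apply near_trans with (x ty).
    + apply H1. apply Rabs_def1; lra.
    + apply Hnear. lra.
  - intros Hw0. specialize (Hmw Hw0).
    assert (Hy0 : sth (y 0) < b).
    { destruct (near_elim _ _ _ (Hnear 0 ltac:(lra))) as (_ & _ & k & _).
      assert (sth (x 0) < sth (x (t - eta))); [|lra]. apply th_incr; auto; [lra|]. intros; apply Hpos2; lra. }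
    destruct (th_ivt y 0 (t + eta) b) as [u [Hu1 [Hu2 Hu3]]]; auto; try lra.
    exists u. split; [lra|]. split; auto. intros s Hs.
    assert (hs : 0 <= s <= t + eta) by lra.
    destruct (near_elim _ _ _ (Hnear s hs)) as (_ & _ & _ & k). specialize (Hmw s hs). lra.
Qed.

(** [q < 0] makes the stop transversal: [Fw < 0] there, so [w] is negative just after, and
    neighbours must stop too. *)
Lemma turn_near x b t e : sol x -> 0 < sw (x 0) -> turn x b t -> - (PI / 2) <= sth (x 0) -> b <= PI / 2 ->
  q (sth (x t)) < 0 -> 0 < e ->
  exists d, 0 < d /\ forall y, sol y -> near d (x 0) (y 0) -> exists ty, turn y b ty /\ near e (x t) (y ty) /\ Rabs (ty - t) < e.
Proof.
  intros Hx Hw0 (Ht & Hwt & Hth & Hpos) H0 Hb Hq He0.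
  assert (hc : 0 < cos (sth (x t))) by (apply cos_pos; lra).
  assert (hF : Fw (x t) < 0) by (pose proof (Fw_eq (x t) (sol_P1 x t Hx)) as eF; rewrite Hwt in eF; nra).
  set (e' := Rmin e (b - sth (x t))). assert (He : 0 < e') by pos.
  assert (He1 : e' <= e) by apply Rmin_l. assert (He2 : e' <= b - sth (x t)) by apply Rmin_r.
  destruct (sol_local_near x t (e' / 2) Hx) as [d1 [Hd1 H1]]; [lra|].
  destruct (deriv_neg_right (fun s => sw (x s)) t (Fw (x t)) Hwt (sol_dw x t Hx) hF) as [d2 [Hd2 H2]].
  set (eta := Rmin (Rmin (d1 / 2) (d2 / 2)) (Rmin (t / 2) (e / 2))).
  assert (Heta : 0 < eta) by pos.
  assert (Heta' : eta <= d1 / 2 /\ eta <= d2 / 2 /\ eta <= t / 2 /\ eta <= e / 2).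
  { unfold eta. rmin (Rmin (d1 / 2) (d2 / 2)) (Rmin (t / 2) (e / 2)).
    rmin (d1 / 2) (d2 / 2). rmin (t / 2) (e / 2). lra. }
  clearbody eta.
  assert (Hwneg : sw (x (t + eta)) < 0) by (apply H2; lra).
  destruct (continuous_min_pos (fun s => sw (x s)) 0 (t - eta)) as [m [Hm Hmw]]; [lra| | |].
  { intros; apply sol_cw; auto. }
  { intros s Hs. destruct (Rle_lt_or_eq_dec 0 s) as [k|k]; [lra| |rewrite <- k; auto]. apply Hpos. lra. }
  set (tol := Rmin (Rmin (e' / 2) m) (- sw (x (t + eta)))).
  assert (Htol : 0 < tol) by pos.
  assert (Htol' : tol <= e' / 2 /\ tol <= m /\ tol <= - sw (x (t + eta))).
  { unfold tol. pose proof (Rmin_l (Rmin (e' / 2) m) (- sw (x (t + eta)))). pose proof (Rmin_r (Rmin (e' / 2) m) (- sw (x (t + eta)))).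
    rmin (e' / 2) m. lra. }
  clearbody tol.
  destruct (continuous_dependence x (t + eta) tol Hx) as [d [Hd Hdep]]; [lra|auto|].
  exists d. split; auto. intros y Hy Hn.
  assert (Hnear : forall s, 0 <= s <= t + eta -> near tol (x s) (y s)).
  { intros s Hs. apply Hdep; auto. rewrite Rabs_pos_eq; lra. }
  assert (Hypos : forall s, 0 <= s <= t - eta -> 0 < sw (y s)).
  { intros s Hs. destruct (near_elim _ _ _ (Hnear s ltac:(lra))) as (_ & _ & _ & k). specialize (Hmw s Hs). lra. }
  destruct (w_stop y (t - eta) (t + eta)) as [u [Hu1 [Hu2 Hu3]]]; auto; [lra|apply Hypos; lra| |].
  { destruct (near_elim _ _ _ (Hnear (t + eta) ltac:(lra))) as (_ & _ & _ & k). lra. }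
  assert (Hypos2 : forall s, 0 <= s < u -> 0 < sw (y s)).
  { intros s Hs. destruct (Rle_dec s (t - eta)); [apply Hypos; lra|apply Hu3; lra]. }
  assert (Hclose : near e' (x t) (y u)).
  { apply near_weaken with (e' / 2 + tol); [lra|]. apply near_trans with (x u); [apply H1; apply Rabs_def1; lra|apply Hnear; lra]. }
  exists u. split; [|split; [apply near_weaken with e'; auto|apply Rabs_def1; lra]].
  split; [lra|]. split; [lra|]. split.
  - split.
    + apply th_incr; auto; [lra|]. intros; apply Hypos2; lra.
    + destruct (near_elim _ _ _ Hclose) as (_ & _ & k & _). lra.
  - intros; apply Hypos2; lra.
Qed.

Lemma whit_unique x b t t' : sol x -> whit x b t -> whit x b t' -> t = t'.
Proof.
  intros Hx (h1 & h2 & h3) (k1 & k2 & k3).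
  destruct (Rtotal_order t t') as [h|[h|h]]; auto; exfalso.
  - assert (sth (x t) < sth (x t')); [|lra]. apply th_incr; auto. intros; apply k3; lra.
  - assert (sth (x t') < sth (x t)); [|lra]. apply th_incr; auto. intros; apply h3; lra.
Qed.

Lemma turn_not_whit x b t t' : turn x b t -> whit x b t' -> sol x -> False.
Proof.
  intros (h1 & h2 & h3 & h4) (k1 & k2 & k3) Hx.
  destruct (Rle_dec t t') as [h|h].
  - assert (0 < sw (x t)) by (apply k3; lra). lra.
  - assert (sth (x t') < sth (x t)); [|lra]. apply th_incr; auto; [lra|]. intros; apply h4; lra.
Qed.

End Moves.

(** * Comparison of orbits at equal angles *)

Lemma cos_between a t b : - (PI / 2) <= a -> a <= t <= b -> b <= PI / 2 -> Rmin (cos a) (cos b) <= cos t.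
Proof.
  intros Ha Ht Hb. assert (HPI := PI_RGT_0). destruct (Rle_dec 0 t).
  - eapply Rle_trans; [apply Rmin_r|]. apply cos_decr_1; lra.
  - eapply Rle_trans; [apply Rmin_l|]. rewrite <- (cos_neg a), <- (cos_neg t). apply cos_decr_1; lra.
Qed.

Lemma drift_bound a A z b B k : 0 < a <= A -> - 1 <= z <= 1 -> - B <= b <= B -> - 1 <= k <= 1 ->
  - (A + B) <= a * z + / 2 * b * k <= A + B.
Proof.
  intros Ha Hz Hb Hk.
  assert (- A <= a * z <= A) by (split; nra).
  assert (- B <= b * k <= B).
  { apply Rabs_le_between. rewrite Rabs_mult. assert (Rabs b <= B) by (apply Rabs_le; lra). assert (Rabs k <= 1) by (apply Rabs_le; lra).
    pose proof (Rabs_pos b). pose proof (Rabs_pos k). nra. }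
  lra.
Qed.

Section Coupling.
Context {S : system}.

Definition coll (x : R -> state) : Prop := sol x /\ sr (x 0) = 0.

Lemma coll_sol x : coll x -> sol x.
Proof. intros [H _]; auto. Qed.

Lemma coll_r x s : coll x -> sr (x s) = 0.
Proof. intros [H h]. apply (r_zero x 0); auto. Qed.

Lemma coll_v_nondecr x a b : coll x -> a <= b -> sv (x a) <= sv (x b).
Proof.
  intros Hx Hab. apply (nondecr (fun s => sv (x s)) (fun s => Fv (x s))); auto.
  - intros s _. apply sol_dv, Hx.
  - intros s _. rewrite (Fv_eq _ (sol_P1 x s (coll_sol x Hx))), coll_r by auto.
    pose proof (pow2_ge_0 (sw (x s))). pose proof (c_pos (sth (x s))). nra.
Qed.

Lemma coll_energy x s : coll x -> c (sth (x s)) * sw (x s) ^ 2 = 2 * W (sth (x s)) - sv (x s) ^ 2 * cos (sth (x s)) ^ 2.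
Proof.
  intros Hx. pose proof (En_eq (x s) (sol_P1 x s (coll_sol x Hx))) as e. unfold En in e. rewrite coll_r in e by auto. lra.
Qed.

(** [g s] is the time at which [b] has the angle that [a] has at time [s]; in its rate the factors
    [c] cancel. *)
Lemma coupling (a b : R -> state) p p' : sol a -> sol b -> p < p' -> (forall s, p <= s <= p' -> 0 < sw (b s)) ->
  exists g : R -> R, forall s, sth (b p) < sth (a s) < sth (b p') ->
    p < g s < p' /\ sth (b (g s)) = sth (a s) /\ is_derive g s (sw (a s) / sw (b (g s))).
Proof.
  intros Ha Hb Hp Hw.
  destruct (incr_continuous_inverse (fun s => sth (b s)) (fun s => Fth (b s)) p p') as [g Hg]; auto.
  - intros s _. apply sol_dth; auto.
  - intros s Hs. unfold Fth. apply Rmult_lt_0_compat; [auto|apply c_pos].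
  - exists (fun s => g (sth (a s))). intros s Hs. destruct (Hg _ Hs) as (h1 & h2 & h3). split; auto. split; auto.
    eapply is_derive_eq.
    { apply (is_derive_comp g (fun s => sth (a s))); [exact h3|apply sol_dth; auto]. }
    unfold scal; simpl; unfold mult; simpl. unfold Fth. rewrite h2.
    assert (0 < sw (b (g (sth (a s))))) by (apply Hw; lra). pose proof (c_pos (sth (a s))). field. lra.
Qed.

Lemma extend_positive b p p' : sol b -> p <= p' -> (forall s, p <= s <= p' -> 0 < sw (b s)) ->
  exists e, 0 < e /\ forall s, p - e <= s <= p' + e -> 0 < sw (b s).
Proof.
  intros Hb Hp Hw.
  destruct (sign_near (fun s => sw (b s)) p) as [d1 [h1 H1]]; [apply sol_cw; auto|apply Hw; lra|].
  destruct (sign_near (fun s => sw (b s)) p') as [d2 [h2 H2]]; [apply sol_cw; auto|apply Hw; lra|].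
  exists (Rmin (d1 / 2) (d2 / 2)). split; [pos|].
  rmin (d1 / 2) (d2 / 2).
  intros s Hs. destruct (Rlt_dec s p); [apply H1; apply Rabs_def1; lra|].
  destruct (Rlt_dec p' s); [apply H2; apply Rabs_def1; lra|apply Hw; lra].
Qed.

(** At equal angles, a positive [r] only makes [v] decrease relative to a collision orbit. *)
Lemma barrier a b s0 s1 p p' : sol a -> coll b -> s0 <= s1 -> p <= p' ->
  (forall s, s0 <= s <= s1 -> 0 <= sw (a s)) -> (forall s, p <= s <= p' -> 0 < sw (b s)) ->
  sth (a s0) = sth (b p) -> sth (a s1) = sth (b p') -> sv (a s0) < sv (b p) -> sv (a s1) < sv (b p').
Proof.
  intros Ha Hb Hs Hp Hwa Hwb Hth0 Hth1 Hv0.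
  assert (Hbs := coll_sol b Hb).
  destruct (extend_positive b p p' Hbs Hp Hwb) as [e [He Hwb']].
  destruct (coupling a b (p - e) (p' + e) Ha Hbs) as [g Hg]; [lra|auto|].
  assert (Hrange : forall s, s0 <= s <= s1 -> sth (b (p - e)) < sth (a s) < sth (b (p' + e))).
  { intros s h.
    assert (sth (b (p - e)) < sth (b p)) by (apply th_incr; auto; [lra|intros; apply Hwb'; lra]).
    assert (sth (b p') < sth (b (p' + e))) by (apply th_incr; auto; [lra|intros; apply Hwb'; lra]).
    assert (hm : forall u v, s0 <= u -> u <= v -> v <= s1 -> sth (a u) <= sth (a v)).
    { intros u v h1 h2 h3. apply (nondecr (fun s => sth (a s)) (fun s => Fth (a s))); auto.
      - intros z _. apply sol_dth; auto.
      - intros z hz. unfold Fth. apply Rmult_le_pos; [apply Hwa; lra|left; apply c_pos]. }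
    pose proof (hm s0 s). pose proof (hm s s1). lra. }
  assert (Hinj : forall u, p - e < u < p' + e -> forall v, p <= v <= p' -> sth (b u) = sth (b v) -> u = v).
  { intros u h1 v h2. apply (th_injective b (p - e) (p' + e)); auto; lra. }
  assert (Hg0 : g s0 = p). { destruct (Hg s0) as (h1 & h2 & _); [apply Hrange; lra|]. apply Hinj; lra. }
  assert (Hg1 : g s1 = p'). { destruct (Hg s1) as (h1 & h2 & _); [apply Hrange; lra|]. apply Hinj; lra. }
  set (dd := fun s => sv (b (g s)) - sv (a s)).
  assert (Hd : forall s, s0 <= s <= s1 -> is_derive dd s (/ 2 * c (sth (a s)) * sw (a s) * (sw (b (g s)) - sw (a s)) + sr (a s) * cos (sth (a s)) ^ 2)).
  { intros s h. destruct (Hg s (Hrange s h)) as (h1 & h2 & h3).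
    eapply is_derive_eq.
    { apply (is_derive_minus (fun s => sv (b (g s))) (fun s => sv (a s))); [|apply sol_dv; auto].
      apply (is_derive_comp (fun u => sv (b u)) g); [apply sol_dv; auto|exact h3]. }
    unfold minus, plus, opp, scal; simpl; unfold mult; simpl.
    rewrite (Fv_eq (b (g s)) (sol_P1 b _ Hbs)), (Fv_eq (a s) (sol_P1 a _ Ha)), (coll_r b _ Hb), h2.
    assert (0 < sw (b (g s))) by (apply Hwb'; lra). field. lra. }
  destruct (continuous_bounded (fun s => sv (a s)) s0 s1 Hs) as [B1 HB1]; [intros; apply sol_cv; auto|].
  destruct (continuous_bounded (fun s => sv (b s)) (p - e) (p' + e)) as [B2 HB2]; [lra|intros; apply sol_cv; auto|].
  assert (Hlow : forall s, s0 <= s <= s1 -> 0 <= dd s ->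
    - (B1 + B2) * dd s <= / 2 * c (sth (a s)) * sw (a s) * (sw (b (g s)) - sw (a s)) + sr (a s) * cos (sth (a s)) ^ 2).
  { intros s h hd. destruct (Hg s (Hrange s h)) as (h1 & h2 & h3).
    assert (hwb : 0 < sw (b (g s))) by (apply Hwb'; lra). specialize (Hwa s h).
    assert (eb := En_eq (b (g s)) (sol_P1 b _ Hbs)). assert (ea := En_eq (a s) (sol_P1 a _ Ha)). unfold En in ea, eb.
    rewrite (coll_r b _ Hb), h2 in eb. assert (hg : p - e <= g s <= p' + e) by lra. specialize (HB1 s h). specialize (HB2 _ hg).
    apply Rabs_le_between in HB1. apply Rabs_le_between in HB2.
    destruct (sol_P1 a s Ha) as [hr _]. unfold dd in *.
    set (wa := sw (a s)) in *. set (wb := sw (b (g s))) in *. set (va := sv (a s)) in *. set (vb := sv (b (g s))) in *.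
    set (k := cos (sth (a s))) in *. set (cc := c (sth (a s))) in *.
    assert (hk : 0 <= k ^ 2 <= 1). { split; [apply pow2_ge_0|]. unfold k. pose proof (COS_bound (sth (a s))). nra. }
    (* [wb - wa] is the difference of squares over [wa + wb], and energy turns squares of [w] into
       squares of [v]. So the derivative of [dd] is a bounded multiple of [dd] plus a nonnegative
       multiple of [r]; by Gronwall [dd] cannot come down to zero. *)
    set (lam := wa / (wa + wb)).
    assert (hlam : 0 <= lam <= 1).
    { unfold lam. split; [pos|]. apply Rmult_le_reg_r with (wa + wb); [lra|].
      unfold Rdiv. rewrite Rmult_assoc, Rinv_l; lra. }
    replace (/ 2 * cc * wa * (wb - wa)) with (lam * (/ 2 * wb ^ 2 * cc - / 2 * wa ^ 2 * cc)) by (unfold lam; field; lra).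
    rewrite ea, eb.
    replace (lam * (W (sth (a s)) - (0 + / 2 * vb ^ 2) * k ^ 2 - (W (sth (a s)) - (sr (a s) + / 2 * va ^ 2) * k ^ 2)) + sr (a s) * k ^ 2)
      with (lam * k ^ 2 * (- / 2 * (va + vb) * (vb - va)) + (1 + lam) * (sr (a s) * k ^ 2)) by ring.
    assert (0 <= (1 + lam) * (sr (a s) * k ^ 2)) by pos.
    assert (hlk : 0 <= lam * k ^ 2 <= 1) by (split; [pos|nra]).
    assert (- (B1 + B2) * (vb - va) <= - / 2 * (va + vb) * (vb - va)) by (apply Rmult_le_compat_r; lra).
    assert (0 <= (B1 + B2) * (vb - va)) by pos.
    set (z := - / 2 * (va + vb) * (vb - va)) in *. set (y := (B1 + B2) * (vb - va)) in *.
    assert (- y <= lam * k ^ 2 * z); [|unfold y in *; lra].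
    unfold y in *. destruct (Rle_dec 0 z).
    - assert (0 <= lam * k ^ 2 * z) by pos. lra.
    - assert (lam * k ^ 2 * (- z) <= 1 * (- z)) by (apply Rmult_le_compat_r; lra). lra. }
  assert (H0 : 0 < dd s0) by (unfold dd; rewrite Hg0; lra).
  apply Rnot_le_lt. intros Hn.
  destruct (first_zero (fun s => - dd s) s0 s1) as [t [Ht1 [Ht2 Ht3]]]; auto.
  - intros s h. apply (continuous_opp dd). eapply is_derive_continuous. apply Hd. auto.
  - lra.
  - unfold dd. rewrite Hg1. lra.
  - cbv beta in Ht2.
    assert (G := gronwall_back dd _ (B1 + B2) s0 t ltac:(lra) (fun s h => Hd s ltac:(lra))).
    cbv beta in G. replace (dd t) with 0 in G by lra. rewrite Rmult_0_l in G.
    assert (dd s0 <= 0); [|lra]. apply G. intros s h. apply Hlow; [lra|]. assert (- dd s < 0) by (apply Ht3; lra). lra.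
Qed.

(** Where [V] decreases, the difference of the velocities [w] at equal angles is bounded away from zero. *)
Lemma arrivals_coincide a b l s0 u0 : coll a -> coll b -> - (PI / 2) < l < PI / 2 -> - (PI / 2) < sth (a s0) ->
  (forall s, s0 <= s -> 0 < sw (a s)) -> (forall s, u0 <= s -> 0 < sw (b s)) ->
  sth (a s0) = sth (b u0) -> (forall t, sth (a s0) <= t < l -> q t <= 0) -> 0 <= s0 -> 0 <= u0 ->
  tends a l -> tends b l -> 0 < sv (a s0) + sv (b u0) -> sv (a s0) = sv (b u0).
Proof.
  intros Ha Hb Hl Has0 Hwa Hwb Hth Hq Hs0 Hu0 Hta Htb Hsum.
  destruct (Req_dec (sv (a s0)) (sv (b u0))) as [|Hne]; auto. exfalso.
  assert (Has := coll_sol a Ha). assert (Hbs := coll_sol b Hb).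
  destruct c_bounds as (cm & cM & Hcm & HcM & Hcb).
  destruct (periodic_bounded c1) as [B1 [HB1 hc1]]; [apply c1_cont|apply c1_per|].
  set (kap := Rmin (cos (sth (a s0))) (cos l)).
  assert (Hsl : sth (a s0) < l) by (apply Hta; lra).
  assert (Hkap : 0 < kap) by (apply Rmin_glb_lt; apply cos_pos; lra).
  (* The weight [exp (C * theta)] absorbs the metric terms, bounded by [cM + B1] and divided by
     [cos >= kap]. The weighted squared difference of [w] is then nondecreasing, whereas two
     arrivals make it tend to zero. *)
  set (C := 2 * (cM + B1) / (kap * cm)).
  assert (HC : 0 < C) by pos.
  destruct (extend_positive b u0 u0 Hbs ltac:(lra)) as [e [He Hwe]]; [intros; apply Hwb; lra|].
  assert (Hwb' : forall s, u0 - e <= s -> 0 < sw (b s)).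
  { intros s h. destruct (Rle_dec u0 s); [auto|apply Hwe; lra]. }
  set (D0 := sw (a s0) - sw (b u0)).
  assert (HD0 : D0 <> 0).
  { intros h. apply Hne. pose proof (coll_energy a s0 Ha) as ea. pose proof (coll_energy b u0 Hb) as eb.
    rewrite <- Hth in eb. replace (sw (b u0)) with (sw (a s0)) in eb by (unfold D0 in h; lra).
    assert (hc : 0 < cos (sth (a s0)) ^ 2) by (apply pow_lt; apply cos_pos; lra).
    assert (sv (a s0) ^ 2 = sv (b u0) ^ 2) by nra. nra. }
  assert (Hmain : forall s1, s0 < s1 -> exists u1, u0 <= u1 /\ sth (b u1) = sth (a s1) /\
     D0 ^ 2 * exp (- C * PI) <= (sw (a s1) - sw (b u1)) ^ 2).
  { intros s1 Hs1.
    assert (Has1 : sth (a s1) < l) by (apply Hta; lra).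
    destruct Htb as [Htb1 Htb2]. destruct (Htb2 (l - sth (a s1))) as [u2 [Hu2 Hu2']]; [lra|].
    set (p' := u0 + u2 + 1). assert (h1 : u2 <= p') by (unfold p'; lra). destruct (Hu2' p' h1) as [h2 _].
    destruct (coupling a b (u0 - e) p' Has Hbs) as [g Hg]; [unfold p'; lra|intros; apply Hwb'; lra|].
    assert (Hmono : forall u v, s0 <= u -> u < v -> sth (a u) < sth (a v)).
    { intros u v k1 k2. apply th_incr; auto. intros; apply Hwa; lra. }
    assert (Hbmono : forall u v, u0 - e <= u -> u < v -> sth (b u) < sth (b v)).
    { intros u v k1 k2. apply th_incr; auto. intros; apply Hwb'; lra. }
    assert (Hle : forall s, s0 <= s <= s1 -> sth (a s0) <= sth (a s) <= sth (a s1)).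
    { intros s h. split; apply th_mono; auto; try lra; intros; apply Hwa; lra. }
    assert (Hrange : forall s, s0 <= s <= s1 -> sth (b (u0 - e)) < sth (a s) < sth (b p')).
    { intros s h. specialize (Hle s h). split; [|lra]. rewrite Hth in Hle. pose proof (Hbmono (u0 - e) u0). lra. }
    assert (Hgb : forall s, s0 <= s <= s1 -> u0 <= g s).
    { intros s h. destruct (Hg s (Hrange s h)) as (k1 & k2 & _). apply Rnot_lt_le. intros hn.
      assert (sth (b (g s)) < sth (b u0)) by (apply Hbmono; lra). specialize (Hle s h). lra. }
    assert (Hg0 : g s0 = u0).
    { destruct (Hg s0 (Hrange s0 ltac:(lra))) as (k1 & k2 & _). pose proof (Hgb s0 ltac:(lra)) as k3.
      destruct k3 as [k3|k3]; auto. assert (sth (b u0) < sth (b (g s0))) by (apply Hbmono; lra). lra. }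
    exists (g s1). split; [apply Hgb; lra|]. split; [apply Hg, Hrange; lra|].
    assert (Hd : forall s, s0 <= s <= s1 -> is_derive (fun s => (sw (a s) - sw (b (g s))) ^ 2 * exp (C * sth (a s))) s
       (2 * (sw (a s) - sw (b (g s))) * (Fw (a s) - sw (a s) / sw (b (g s)) * Fw (b (g s))) * exp (C * sth (a s))
        + (sw (a s) - sw (b (g s))) ^ 2 * (C * Fth (a s) * exp (C * sth (a s))))).
    { intros s h. destruct (Hg s (Hrange s h)) as (k1 & k2 & k3).
      apply (is_derive_mult (fun s => (sw (a s) - sw (b (g s))) ^ 2) (fun s => exp (C * sth (a s)))); [| |apply Rmult_comm].
      - apply (derive_sq_diff (fun s => sw (a s)) (fun s => sw (b (g s)))); [apply sol_dw; auto|].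
        apply (is_derive_comp (fun u => sw (b u)) g); [apply sol_dw; auto|exact k3].
      - eapply is_derive_eq.
        { apply (is_derive_comp exp (fun s => C * sth (a s))); [apply is_derive_exp|].
          apply (is_derive_scal (fun s => sth (a s)) s C). apply sol_dth; auto. }
        unfold scal; simpl; unfold mult; simpl. ring. }
    assert (Hnd : D0 ^ 2 * exp (C * sth (a s0)) <= (sw (a s1) - sw (b (g s1))) ^ 2 * exp (C * sth (a s1))).
    { unfold D0. rewrite <- Hg0 at 1.
      apply (nondecr (fun s => (sw (a s) - sw (b (g s))) ^ 2 * exp (C * sth (a s))) _ s0 s1 ltac:(lra) Hd).
      intros s h. assert (h' : s0 <= s <= s1) by lra. destruct (Hg s (Hrange s h')) as (k1 & k2 & k3).
      pose proof (Hgb s h') as k4.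
      assert (hwa : 0 < sw (a s)) by (apply Hwa; lra). assert (hwb : 0 < sw (b (g s))) by (apply Hwb; lra).
      assert (hle := Hle s h').
      assert (hkk : kap <= cos (sth (a s))) by (apply cos_between; lra).
      assert (hq : q (sth (a s)) <= 0) by (apply Hq; lra).
      assert (hva : sv (a s0) <= sv (a s)) by (apply coll_v_nondecr; auto; lra).
      assert (hvb : sv (b u0) <= sv (b (g s))) by (apply coll_v_nondecr; auto).
      pose proof (Fw_eq (a s) (sol_P1 a s Has)) as fa. pose proof (Fw_eq (b (g s)) (sol_P1 b (g s) Hbs)) as fb.
      pose proof (coll_energy a s Ha) as ea. pose proof (coll_energy b (g s) Hb) as eb. rewrite k2 in fb, eb.
      specialize (Hcb (sth (a s))). specialize (hc1 (sth (a s))). apply Rabs_le_between in hc1.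
      assert (hz : -1 <= sin (sth (a s)) <= 1) by apply SIN_bound. assert (hk1 : cos (sth (a s)) <= 1) by apply COS_bound.
      unfold Fth.
      set (k := cos (sth (a s))) in *. set (z := sin (sth (a s))) in *. set (cc := c (sth (a s))) in *. set (cp := c1 (sth (a s))) in *.
      set (wa := sw (a s)) in *. set (wb := sw (b (g s))) in *. set (va := sv (a s)) in *. set (vb := sv (b (g s))) in *.
      set (fwa := Fw (a s)) in *. set (fwb := Fw (b (g s))) in *. set (qq := q (sth (a s))) in *.
      assert (hcd : k * ((wa - wb) * (fwa - wa / wb * fwb)) = - qq * (wa - wb) ^ 2 / wb + / 2 * k ^ 3 * wa * ((wa - wb) * (vb - va)) - (cc * z + / 2 * cp * k) * wa * (wa - wb) ^ 2).
      { replace (k * ((wa - wb) * (fwa - wa / wb * fwb))) with ((wa - wb) * (k * fwa - wa / wb * (k * fwb))) by ring.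
        rewrite fa, fb. field. lra. }
      (* At equal angles and zero radius, the orbit with the larger [v ^ 2] has the smaller [w ^ 2];
         as [va + vb > 0], the squares of [v] are ordered like the values. *)
      assert (hsgn : 0 <= (wa - wb) * (vb - va)).
      { assert (hh : cc * (wa - wb) * (wa + wb) = (vb - va) * (vb + va) * k ^ 2).
        { replace (cc * (wa - wb) * (wa + wb)) with (cc * wa ^ 2 - cc * wb ^ 2) by ring. rewrite ea, eb. ring. }
        assert (0 <= cc * (wa + wb) * ((wa - wb) * (vb - va))).
        { replace (cc * (wa + wb) * ((wa - wb) * (vb - va))) with ((cc * (wa - wb) * (wa + wb)) * (vb - va)) by ring. rewrite hh.
          replace ((vb - va) * (vb + va) * k ^ 2 * (vb - va)) with ((vb + va) * ((vb - va) ^ 2 * k ^ 2)) by ring.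
          apply Rmult_le_pos; [lra|apply Rmult_le_pos; apply pow2_ge_0]. }
        assert (0 < cc * (wa + wb)) by nra. nra. }
      assert (hR : cc * z + / 2 * cp * k <= cM + B1) by (apply drift_bound; lra).
      assert (hT : - (cM + B1) * wa * (wa - wb) ^ 2 <= k * ((wa - wb) * (fwa - wa / wb * fwb))).
      { rewrite hcd. assert (0 <= - qq * (wa - wb) ^ 2 / wb).
        { apply Rdiv_le_0_compat; [|lra]. apply Rmult_le_pos; [lra|apply pow2_ge_0]. }
        assert (0 <= / 2 * k ^ 3 * wa * ((wa - wb) * (vb - va))).
        { apply Rmult_le_pos; auto. apply Rmult_le_pos; [|lra]. apply Rmult_le_pos; [lra|apply pow_le; lra]. }
        assert ((cc * z + / 2 * cp * k) * (wa * (wa - wb) ^ 2) <= (cM + B1) * (wa * (wa - wb) ^ 2)).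
        { apply Rmult_le_compat_r; auto. apply Rmult_le_pos; [lra|apply pow2_ge_0]. }
        lra. }
      assert (hex : 0 < exp (C * sth (a s))) by apply exp_pos.
      assert (hfin : 0 <= 2 * ((wa - wb) * (fwa - wa / wb * fwb)) + (wa - wb) ^ 2 * (C * (wa * cc))).
      { set (Y := (wa - wb) * (fwa - wa / wb * fwb)) in *. set (Z := wa * (wa - wb) ^ 2).
        assert (hZ : 0 <= Z) by pos.
        replace ((wa - wb) ^ 2 * (C * (wa * cc))) with (C * cc * Z) by (unfold Z; ring).
        assert (hC2 : 2 * (cM + B1) * Z <= k * (C * cc * Z)).
        { apply Rle_trans with (kap * (C * cm * Z)).
          - right. unfold C. field. lra.
          - apply Rmult_le_compat; [lra| |auto|]. 
            + apply Rmult_le_pos; auto. apply Rmult_le_pos; lra.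
            + apply Rmult_le_compat_r; auto. apply Rmult_le_compat_l; lra. }
        apply Rmult_le_reg_l with k; [lra|rewrite Rmult_0_r].
        replace (- (cM + B1) * wa * (wa - wb) ^ 2) with (- (cM + B1) * Z) in hT by (unfold Z; ring). lra. }
      replace (2 * (wa - wb) * (fwa - wa / wb * fwb) * exp (C * sth (a s)) + (wa - wb) ^ 2 * (C * (wa * cc) * exp (C * sth (a s))))
        with ((2 * ((wa - wb) * (fwa - wa / wb * fwb)) + (wa - wb) ^ 2 * (C * (wa * cc))) * exp (C * sth (a s))) by ring.
      apply Rmult_le_pos; lra. }
    assert (hx1 : 0 < exp (C * sth (a s1))) by apply exp_pos.
    apply Rmult_le_reg_r with (exp (C * sth (a s1))); auto. eapply Rle_trans; [|exact Hnd].
    rewrite Rmult_assoc, <- exp_plus. apply Rmult_le_compat_l; [apply pow2_ge_0|].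
    assert (hh : - C * PI + C * sth (a s1) <= C * sth (a s0)) by nra.
    destruct hh as [hh|hh]; [left; apply exp_increasing; auto|right; now rewrite hh]. }
  assert (Heps : 0 < D0 ^ 2 * exp (- C * PI)).
  { apply Rmult_lt_0_compat; [apply pow2_gt_0; auto|apply exp_pos]. }
  set (eps := D0 ^ 2 * exp (- C * PI)) in *.
  set (eta := Rmin 1 eps). assert (Heta : 0 < eta) by pos.
  assert (He1 : eta <= 1) by apply Rmin_l. assert (He2 : eta <= eps) by apply Rmin_r.
  destruct Hta as [Hta1 Hta2]. destruct Htb as [Htb1 Htb2].
  destruct (Hta2 eta Heta) as [sa [Hsa Hsa']]. destruct (Htb2 eta Heta) as [sb [Hsb Hsb']].
  assert (Hlb : sth (b sb) < l) by (apply Htb1; auto).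
  destruct (Hta2 (l - sth (b sb))) as [sc [Hsc Hsc']]; [lra|].
  set (s1 := s0 + sa + sc + 1).
  destruct (Hmain s1) as [u1 (Hu1 & Hbu1 & Hfin)]; [unfold s1; lra|].
  assert (k1 : sa <= s1) by (unfold s1; lra). destruct (Hsa' s1 k1) as [_ ka].
  assert (k2 : sc <= s1) by (unfold s1; lra). destruct (Hsc' s1 k2) as [kc _].
  assert (k3 : sb <= u1).
  { destruct (Rle_dec sb u1); auto. exfalso. assert (sth (b u1) < sth (b sb)); [|lra].
    apply th_incr; auto; [lra|]. intros; apply Hwb; lra. }
  destruct (Hsb' u1 k3) as [_ kb].
  assert (0 < sw (a s1)) by (apply Hwa; unfold s1; lra). assert (0 < sw (b u1)) by (apply Hwb; auto).
  assert ((sw (a s1) - sw (b u1)) ^ 2 < eps); [|lra]. 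
  assert (-eta < sw (a s1) - sw (b u1) < eta) by lra. nra.
Qed.

End Coupling.

(** * Arrival at and departure from the Lagrange equilibria *)

Lemma sq_close x v e : 0 < v -> 0 <= e -> x <= 0 -> Rabs (x ^ 2 - v * v) < e * v -> Rabs (x + v) < e.
Proof.
  intros Hv He Hx H. apply Rabs_def2 in H. apply Rabs_def1; nra.
Qed.

Lemma sq_le_sq u d : - d <= u <= d -> u ^ 2 <= d ^ 2.
Proof. intros H. nra. Qed.

(** Growth rate of the squared distance, in energy and angular velocity, between two orbits at equal angles. *)
Lemma follow_rate k z cc cp wa wb va vb fwa fwb qq ra nu wM cM B1 Kc VB d0 :
  0 < k <= 1 -> - Kc * k <= cc * z -> 0 < cc <= cM -> - B1 <= cp <= B1 -> 0 < wa -> 0 < wb <= wM -> 0 < nu -> 0 < Kc -> 0 < B1 ->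
  va <= - nu -> vb <= - (2 * nu) -> - VB <= va -> 0 <= qq -> 0 <= ra <= d0 -> 0 < d0 ->
  k * fwa = qq - / 2 * va * k ^ 3 * wa - wa ^ 2 * (cc * z + / 2 * cp * k) ->
  k * fwb = qq - / 2 * vb * k ^ 3 * wb - wb ^ 2 * (cc * z + / 2 * cp * k) ->
  2 * (ra + / 2 * va ^ 2 - (0 + / 2 * vb ^ 2)) * (/ 2 * va * cc * wa ^ 2 - wa / wb * (/ 2 * vb * cc * wb ^ 2))
    + 2 * (wa - wb) * (fwa - wa / wb * fwb) <=
  (cM * (VB + 2 * wM / nu) + 4 / nu + 2 * (Kc + B1)) * wa * ((ra + / 2 * va ^ 2 - (0 + / 2 * vb ^ 2)) ^ 2 + (wa - wb) ^ 2 + d0 ^ 2).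
Proof.
  intros hk hz hcc hcp hwa hwb hnu hKc hB1 hva hvb hVB hqq hra hd0 fa fb.
  set (dE := ra + / 2 * va ^ 2 - (0 + / 2 * vb ^ 2)). set (D := wa - wb). set (K1 := Kc + B1).
  assert (hdv : Rabs (va - vb) <= (Rabs dE + d0) / nu).
  { apply Rmult_le_reg_r with nu; auto. replace ((Rabs dE + d0) / nu * nu) with (Rabs dE + d0) by (field; lra).
    assert (hh : (va - vb) * (va + vb) = 2 * dE - 2 * ra) by (unfold dE; field).
    assert (hh2 : Rabs (va - vb) * Rabs (va + vb) <= 2 * Rabs dE + 2 * d0).
    { rewrite <- Rabs_mult, hh. unfold Rminus. eapply Rle_trans; [apply Rabs_triang|].
      rewrite Rabs_Ropp, !Rabs_mult, (Rabs_pos_eq 2), (Rabs_pos_eq ra) by lra. lra. }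
    assert (h2nu : 2 * nu <= Rabs (va + vb)) by (rewrite Rabs_left; lra).
    assert (Rabs (va - vb) * (2 * nu) <= Rabs (va - vb) * Rabs (va + vb)) by (apply Rmult_le_compat_l; [apply Rabs_pos|auto]). lra. }
  assert (hva2 : Rabs va <= VB) by (rewrite Rabs_left; lra).
  assert (h1 : 2 * dE * (/ 2 * va * cc * wa ^ 2 - wa / wb * (/ 2 * vb * cc * wb ^ 2)) = cc * wa * (dE * (va * D + (va - vb) * wb))).
  { unfold D. field. lra. }
  assert (h2 : k * (D * (fwa - wa / wb * fwb)) = - qq * D ^ 2 / wb - / 2 * k ^ 3 * wa * (D * (va - vb)) - (cc * z + / 2 * cp * k) * wa * D ^ 2).
  { replace (k * (D * (fwa - wa / wb * fwb))) with (D * (k * fwa - wa / wb * (k * fwb))) by ring.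
    rewrite fa, fb. unfold D. field. lra. }
  clear fa fb.
  set (P := Rabs dE) in *. set (Q := Rabs D). set (Z := Rabs (va - vb)) in *.
  assert (hP : 0 <= P) by apply Rabs_pos. assert (hQ : 0 <= Q) by apply Rabs_pos. assert (hZ : 0 <= Z) by apply Rabs_pos.
  assert (b1 : dE * (va * D + (va - vb) * wb) <= P * (VB * Q + Z * wM)).
  { eapply Rle_trans; [apply Rle_abs|]. rewrite Rabs_mult. apply Rmult_le_compat_l; auto.
    eapply Rle_trans; [apply Rabs_triang|]. rewrite !Rabs_mult, (Rabs_pos_eq wb) by lra. fold Q Z.
    apply Rplus_le_compat; [apply Rmult_le_compat_r; auto|apply Rmult_le_compat_l; lra]. }
  assert (hD2 : D ^ 2 = Q ^ 2) by (unfold Q; symmetry; apply pow2_abs).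
  assert (hdE2 : dE ^ 2 = P ^ 2) by (unfold P; symmetry; apply pow2_abs).
  assert (hQZ : 0 <= Q * Z) by pos.
  assert (b2 : D * (fwa - wa / wb * fwb) <= wa * (Q * Z + K1 * Q ^ 2)).
  { apply Rmult_le_reg_l with k; [lra|]. rewrite h2.
    assert (e1 : 0 <= qq * D ^ 2 / wb) by (apply Rdiv_le_0_compat; [apply Rmult_le_pos; [auto|apply pow2_ge_0]|lra]).
    assert (e2 : - (D * (va - vb)) <= Q * Z) by (unfold Q, Z; rewrite <- Rabs_mult, <- Rabs_Ropp; apply Rle_abs).
    assert (hk2 : 0 <= k ^ 2 <= 1) by (split; [apply pow2_ge_0|clear - hk; nra]).
    assert (e3 : - (/ 2 * k ^ 3 * wa * (D * (va - vb))) <= k * (wa * (Q * Z))).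
    { replace (- (/ 2 * k ^ 3 * wa * (D * (va - vb)))) with (k * (wa * (/ 2 * k ^ 2 * (- (D * (va - vb)))))) by ring.
      apply Rmult_le_compat_l; [lra|]. apply Rmult_le_compat_l; [lra|].
      apply Rle_trans with (/ 2 * k ^ 2 * (Q * Z)); [apply Rmult_le_compat_l; lra|].
      assert (k ^ 2 * (Q * Z) <= 1 * (Q * Z)) by (apply Rmult_le_compat_r; lra). lra. }
    assert (e4 : - ((cc * z + / 2 * cp * k) * wa * D ^ 2) <= k * (wa * (K1 * Q ^ 2))).
    { rewrite hD2. replace (- ((cc * z + / 2 * cp * k) * wa * Q ^ 2)) with (- (cc * z + / 2 * cp * k) * (wa * Q ^ 2)) by ring.
      replace (k * (wa * (K1 * Q ^ 2))) with (K1 * k * (wa * Q ^ 2)) by ring.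
      apply Rmult_le_compat_r; [apply Rmult_le_pos; [lra|apply pow2_ge_0]|].
      unfold K1. assert (0 <= (B1 + cp) * k) by pos. assert (0 <= B1 * k) by pos. lra. }
    replace (- qq * D ^ 2 / wb) with (- (qq * D ^ 2 / wb)) by (field; lra). lra. }
  rewrite h1, hD2, hdE2.
  set (SS := P ^ 2 + Q ^ 2 + d0 ^ 2).
  assert (sPQ : P * Q <= SS /\ P * d0 <= SS /\ Q * d0 <= SS /\ P ^ 2 <= SS /\ Q ^ 2 <= SS /\ 0 <= SS).
  { unfold SS. clear - hP hQ hd0. pose proof (pow2_ge_0 (P - Q)). pose proof (pow2_ge_0 (P - d0)). pose proof (pow2_ge_0 (Q - d0)).
    pose proof (pow2_ge_0 P). pose proof (pow2_ge_0 Q). pose proof (pow2_ge_0 d0). repeat split; lra. }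
  destruct sPQ as (sPQ & sPd & sQd & sPP & sQQ & hSS).
  assert (in1 : 0 < / nu) by (apply Rinv_0_lt_compat; auto).
  assert (hwn : 0 < 2 * wM / nu) by pos.
  assert (f1 : P * (VB * Q + Z * wM) <= (VB + 2 * wM / nu) * SS).
  { assert (P * (VB * Q) <= VB * SS) by (replace (P * (VB * Q)) with (VB * (P * Q)) by ring; apply Rmult_le_compat_l; lra).
    assert (P * Z <= 2 / nu * SS).
    { apply Rle_trans with (P * ((P + d0) / nu)); [apply Rmult_le_compat_l; auto|].
      replace (P * ((P + d0) / nu)) with (/ nu * (P ^ 2 + P * d0)) by (field; lra).
      replace (2 / nu * SS) with (/ nu * (2 * SS)) by (field; lra). apply Rmult_le_compat_l; lra. }
    replace ((VB + 2 * wM / nu) * SS) with (VB * SS + wM * (2 / nu * SS)) by (field; lra).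
    assert (wM * (P * Z) <= wM * (2 / nu * SS)) by (apply Rmult_le_compat_l; lra). lra. }
  assert (f2 : Q * Z + K1 * Q ^ 2 <= (/ nu * 2 + K1) * SS).
  { assert (Q * Z <= / nu * (2 * SS)).
    { apply Rle_trans with (Q * ((P + d0) / nu)); [apply Rmult_le_compat_l; auto|].
      replace (Q * ((P + d0) / nu)) with (/ nu * (P * Q + Q * d0)) by (field; lra).
      apply Rmult_le_compat_l; lra. }
    assert (K1 * Q ^ 2 <= K1 * SS) by (apply Rmult_le_compat_l; unfold K1; lra). lra. }
  assert (g1 : cc * wa * (dE * (va * D + (va - vb) * wb)) <= cM * wa * ((VB + 2 * wM / nu) * SS)).
  { apply Rle_trans with (cc * wa * ((VB + 2 * wM / nu) * SS)).
    - apply Rmult_le_compat_l; [pos|lra].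
    - apply Rmult_le_compat_r; [|apply Rmult_le_compat_r; lra]. apply Rmult_le_pos; auto. lra. }
  assert (g2 : D * (fwa - wa / wb * fwb) <= wa * ((/ nu * 2 + K1) * SS)).
  { eapply Rle_trans; [exact b2|]. apply Rmult_le_compat_l; lra. }
  replace (2 * D * (fwa - wa / wb * fwb)) with (2 * (D * (fwa - wa / wb * fwb))) by ring.
  replace ((cM * (VB + 2 * wM / nu) + 4 / nu + 2 * K1) * wa * SS)
    with (cM * wa * ((VB + 2 * wM / nu) * SS) + 2 * (wa * ((/ nu * 2 + K1) * SS))) by (field; lra).
  lra.
Qed.

Section Follow.
Context {S : system}.

Lemma V_ths_cases l : l = ths \/ l = - ths -> V l = V ths /\ - (PI / 2) < l < PI / 2 /\ q l = 0 /\ 0 < cos l.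
Proof.
  intros Hl. destruct ths_int. assert (- (PI / 2) < l < PI / 2) by (destruct Hl; subst; lra).
  split; [destruct Hl; subst; [auto|apply V_even]|]. split; auto. split; [destruct Hl; subst; [apply q_ths'|apply q_ths]|].
  apply cos_pos; auto.
Qed.

(** The bound on [sv (G 0)] selects the upper equilibrium [(0, vs, l, 0)]. *)
Definition arrival (G : R -> state) (l : R) : Prop :=
  coll G /\ tends G l /\ (forall s, 0 <= s -> 0 < sw (G s)) /\ - vs < sv (G 0).

(** [v] is nondecreasing on the collision manifold and its square tends to [2 * V ths]; starting
    above [- vs], it can only tend to [vs]. *)
Lemma arrival_v G l : l = ths \/ l = - ths -> arrival G l ->
  (forall s, 0 <= s -> sv (G s) <= vs) /\ forall e, 0 < e -> exists s0, 0 <= s0 /\ forall s, s0 <= s -> vs - e < sv (G s).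
Proof.
  intros Hl (HG & Ht & Hw & Hv0). destruct (V_ths_cases l Hl) as (hV & hl & hq & hc).
  assert (Hvs := vs_pos). assert (Hsq := vs_sq).
  assert (HGs := coll_sol G HG).
  assert (HE : forall e, 0 < e -> exists s0, 0 <= s0 /\ forall s, s0 <= s -> Rabs (/ 2 * sv (G s) ^ 2 - V ths) < e).
  { intros e He. destruct (tends_En G l e HGs) as [s0 [h1 h2]]; auto; [intros; apply Hw; lra|].
    exists s0. split; auto. intros s Hs. specialize (h2 s Hs). unfold En in h2. rewrite coll_r, hV in h2 by auto.
    now rewrite Rplus_0_l in h2. }
  split.
  - intros s Hs. apply Rnot_lt_le. intros Hn.
    set (e := / 2 * (sv (G s) ^ 2 - vs * vs)). assert (He : 0 < e) by (unfold e; nra).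
    destruct (HE e He) as [s0 [h1 h2]]. assert (h3 : s0 <= s + s0) by lra. specialize (h2 _ h3).
    assert (h4 : sv (G s) <= sv (G (s + s0))) by (apply coll_v_nondecr; auto; lra).
    apply Rabs_def2 in h2. unfold e in h2. nra.
  - intros e He. set (d := Rmin e (vs + sv (G 0)) / 2). assert (Hd : 0 < Rmin e (vs + sv (G 0))) by pos.
    rmin e (vs + sv (G 0)).
    destruct (HE (/ 2 * (d * vs))) as [s0 [h1 h2]]; [unfold d; nra|].
    exists s0. split; auto. intros s Hs. specialize (h2 s Hs).
    assert (h4 : sv (G 0) <= sv (G s)) by (apply coll_v_nondecr; auto; lra).
    apply Rabs_def2 in h2. destruct (Rle_dec (sv (G s)) 0) as [hn|hp].
    + exfalso. assert (Rabs (sv (G s) + vs) < d).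
      { apply sq_close; auto; [unfold d; lra|]. apply Rabs_def1; nra. }
      apply Rabs_def2 in H1. unfold d in H1. lra.
    + unfold d in h2. nra.
Qed.

Section Arrival.
Variables (G : R -> state) (l : R).
Hypothesis Hl : l = ths \/ l = - ths.
Hypothesis HG : arrival G l.
Hypothesis HG0 : - (PI / 2) <= sth (G 0).
Hypothesis Hq : forall t, sth (G 0) < t < l -> q t < 0.
Variable a : R -> state.
Hypothesis Ha : coll a.
Hypothesis Ha0 : sth (a 0) = sth (G 0).
Hypothesis Hw0 : 0 < sw (a 0).
Hypothesis Hva0 : - vs < sv (a 0).

Lemma arrival_fall : (exists t, whit a l t) \/ (exists t, turn a l t) \/ ((forall s, 0 <= s -> 0 < sw (a s)) /\ tends a l).
Proof.
  destruct (V_ths_cases l Hl) as (hV & hl & hq & hc).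
  destruct (start_positive a (coll_sol a Ha) Hw0) as [eta [Heta Hst]].
  destruct HG as (HGc & [Ht1 Ht2] & HGw & HGv).
  destruct (fall a l eta) as [h|[h|(h1 & h2 & h3)]]; auto; try lra.
  - apply Ha.
  - rewrite Ha0. split; auto. apply Ht1; lra.
  - intros; apply Hst; lra.
  - intros t h. apply Hq. lra.
  - right; right. split; auto. intros s Hs. destruct (Rle_lt_or_eq_dec 0 s Hs) as [k|k]; auto. rewrite <- k; auto.
Qed.

Lemma arrival_same_angle (x y : R -> state) : coll x -> coll y -> tends x l -> tends y l -> sth (x 0) = sth (y 0) ->
  (forall s, 0 <= s -> 0 < sw (x s)) -> (forall s, 0 <= s -> 0 < sw (y s)) ->
  forall s, 0 <= s -> exists u, 0 <= u /\ sth (y u) = sth (x s).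
Proof.
  intros Hx Hy Htx Hty H0 Hwx Hwy s Hs.
  assert (Hxl : sth (x s) < l) by (apply Htx; auto). destruct Hty as [Hy1 Hy2].
  destruct (Hy2 (l - sth (x s))) as [s0 [h1 h2]]; [lra|]. destruct (h2 s0 ltac:(lra)) as [h3 _].
  destruct Hs as [Hs|<-]; [|exists 0; split; [lra|auto]].
  assert (sth (x 0) < sth (x s)) by (apply th_incr; [apply Hx|lra|intros; apply Hwx; lra]).
  destruct (th_ivt y 0 s0 (sth (x s))) as [u [Hu1 [Hu2 Hu3]]]; try lra; [apply Hy|].
  exists u. split; [lra|auto].
Qed.

(** [barrier] keeps the two values of [v] strictly ordered, while [arrivals_coincide] makes them
    equal once their sum is positive, which happens eventually since [x] tends to [v = vs]. *)
Lemma arrival_no_tie (x y : R -> state) : coll x -> coll y -> tends x l -> tends y l -> sth (x 0) = sth (y 0) ->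
  (forall s, 0 <= s -> 0 < sw (x s)) -> (forall s, 0 <= s -> 0 < sw (y s)) -> sth (x 0) = sth (G 0) ->
  - vs < sv (x 0) -> sv (x 0) < sv (y 0) -> False.
Proof.
  intros Hx Hy Htx Hty H0 Hwx Hwy HxG Hvx Hxy.
  destruct (V_ths_cases l Hl) as (hV & hl & hq & hc).
  assert (Hax : arrival x l) by (split; [|split; [|split]]; auto).
  destruct (arrival_v x l Hl Hax) as [_ hv]. assert (Hvs := vs_pos).
  destruct (hv vs Hvs) as [s0 [h1 h2]]. set (s1 := s0 + 1).
  assert (hp : 0 < sv (x s1)) by (specialize (h2 s1); unfold s1 in *; lra).
  destruct (arrival_same_angle x y Hx Hy Htx Hty H0 Hwx Hwy s1) as [u (Hu & Huth)]; [unfold s1; lra|].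
  assert (hlt : sv (x s1) < sv (y u)).
  { apply (barrier x y 0 s1 0 u); auto; [apply Hx|unfold s1; lra| |].
    - intros; left; apply Hwx; lra.
    - intros; apply Hwy; lra. }
  assert (hgt : sth (x 0) < sth (x s1)) by (apply th_incr; [apply Hx|unfold s1; lra|intros; apply Hwx; lra]).
  assert (sv (x s1) = sv (y u)); [|lra].
  apply (arrivals_coincide x y l s1 u); auto; try lra.
  - intros; apply Hwx; unfold s1 in *; lra.
  - intros; apply Hwy; lra.
  - intros t h. left. apply Hq. lra.
  - unfold s1; lra.
Qed.

(** A turn requires [v ^ 2 / 2 = V > V ths], hence [v > vs]; but [barrier] keeps [v] below that of
    [G], which never exceeds [vs]. *)
Lemma pass_below : sv (a 0) < sv (G 0) -> exists t, whit a l t.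
Proof.
  intros Hlt. destruct (V_ths_cases l Hl) as (hV & hl & hq & hc).
  destruct arrival_fall as [h|[[t h]|[h1 h2]]]; auto; exfalso.
  - destruct HG as (HGc & [Ht1 Ht2] & HGw & HGv). destruct h as (k1 & k2 & k3 & k4).
    assert (Hsol := coll_sol a Ha).
    assert (hct : cos (sth (a t)) <> 0) by (apply Rgt_not_eq, cos_pos; lra).
    assert (hE := En_turn (a t) (sol_P1 a t Hsol) hct k2). unfold En in hE. rewrite coll_r in hE by auto.
    assert (hVm : V ths <= V (sth (a t))) by (apply V_min_le; lra).
    assert (hVs : V ths < V (sth (a t))).
    { destruct hVm as [|hVm]; auto. exfalso.
      assert (hqt : q (sth (a t)) < 0) by (apply Hq; lra).
      destruct (Req_dec (sth (a t)) ths) as [e1|e1]; [rewrite e1, q_ths' in hqt; lra|].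
      destruct (Req_dec (sth (a t)) (- ths)) as [e2|e2]; [rewrite e2, q_ths in hqt; lra|].
      assert (V ths < V (sth (a t))) by (apply V_min; auto; lra). lra. }
    assert (hm : sv (a 0) <= sv (a t)) by (apply coll_v_nondecr; auto; lra).
    pose proof vs_sq. pose proof vs_pos.
    assert (hbig : vs < sv (a t)) by nra.
    assert (Hex : exists u, 0 <= u /\ sth (G u) = sth (a t)).
    { destruct (Ht2 (l - sth (a t))) as [s0 [h1 h2]]; [lra|]. destruct (h2 s0 ltac:(lra)) as [h3 _].
      destruct (ivt (fun s => sth (G s)) 0 s0 (sth (a t))) as [u [Hu1 [Hu2 Hu3]]]; try lra.
      { intros; apply sol_cth; apply HGc. }
      exists u. split; auto; lra. }
    destruct Hex as [u [Hu Hut]].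
    assert (sv (a t) < sv (G u)).
    { apply (barrier a G 0 t 0 u); auto; try lra.
      - intros s Hs. destruct (Req_dec s 0) as [->|]; [lra|]. destruct (Req_dec s t) as [->|]; [lra|]. left; apply k4; lra.
      - intros; apply HGw; lra. }
    destruct (arrival_v G l Hl HG) as [hv _]. specialize (hv u Hu). lra.
  - destruct HG as (HGc & HGt & HGw & HGv).
    apply (arrival_no_tie a G); auto.
Qed.

(** At the angle [l], energy and [w > 0] force [v < vs]; but [barrier] keeps [v] above that of [G],
    which tends to [vs]. *)
Lemma turn_above : sv (G 0) < sv (a 0) -> exists t, turn a l t.
Proof.
  intros Hlt. destruct (V_ths_cases l Hl) as (hV & hl & hq & hc).
  assert (Hsol := coll_sol a Ha).
  destruct arrival_fall as [[t h]|[h|[h1 h2]]]; auto; exfalso.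
  - destruct h as (k1 & k2 & k3). destruct (arrival_v G l Hl HG) as [_ hv].
    destruct HG as (HGc & HGt & HGw & HGv).
    assert (hE := coll_energy a t Ha). rewrite k2 in hE.
    assert (hwt : 0 < sw (a t)) by (apply k3; lra).
    assert (hWV : W l = V l * cos l ^ 2) by (apply W_V; lra).
    assert (hc2 : 0 < cos l ^ 2) by (apply pow_lt; auto).
    pose proof (c_pos l). pose proof vs_sq. pose proof vs_pos.
    assert (hlt : sv (a t) ^ 2 < vs * vs).
    { rewrite hWV, hV in hE. assert (0 < c l * sw (a t) ^ 2) by pos. nra. }
    assert (hva : sv (a t) < vs) by nra.
    destruct (hv (vs - sv (a t))) as [s0 [h1 h2]]; [lra|].
    set (u := s0 + 1). assert (hu : vs - (vs - sv (a t)) < sv (G u)) by (apply h2; unfold u; lra).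
    assert (hG1 : sth (G 0) < sth (G u)) by (apply th_incr; [apply HGc|unfold u; lra|intros; apply HGw; lra]).
    assert (hG2 : sth (G u) < l) by (apply HGt; unfold u; lra).
    destruct (th_ivt a 0 t (sth (G u))) as [z [Hz1 [Hz2 Hz3]]]; auto; try lra.
    assert (sv (G u) < sv (a z)).
    { apply (barrier G a 0 u 0 z); auto; try lra.
      - apply HGc.
      - unfold u; lra.
      - intros; left; apply HGw; lra.
      - intros s Hs. destruct (Req_dec s 0) as [->|]; [lra|]. apply k3; lra. }
    assert (sv (a z) <= sv (a t)) by (apply coll_v_nondecr; auto; lra). lra.
  - destruct HG as (HGc & HGt & HGw & HGv).
    apply (arrival_no_tie G a); auto; try lra.
Qed.
End Arrival.

(** The unstable branch of the lower equilibrium [(0, - vs, l, 0)], followed until time [0]. *)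
Definition departure (b : R -> state) (l : R) : Prop :=
  coll b /\ (forall s, s <= 0 -> 0 < sw (b s)) /\ (forall s, s <= 0 -> l < sth (b s)) /\
  forall e, 0 < e -> exists s0, s0 <= 0 /\ forall s, s <= s0 -> near e (b s) (St 0 (- vs) l 0).

(** The passage near the equilibrium takes an unbounded time, but the angle varies by at most [PI].
    Measured against the angle, the squared distance in [(En, w)] grows at most by the factor
    [exp (C * PI)], uniformly in how close the passage is. The estimate needs [v <= - nu], which a
    continuation argument maintains; a negative [v] also makes [r] and [En] nonincreasing. *)
Lemma follow b l : l = ths \/ l = - ths -> departure b l -> sv (b 0) < 0 -> sth (b 0) <= PI / 2 ->
  (forall t, l < t < sth (b 0) -> 0 <= q t) ->
  forall e, 0 < e -> exists d, 0 < d /\ forall a t, sol a -> 0 < t -> l < sth (a 0) < l + d -> near d (a 0) (St 0 (- vs) l 0) ->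
    (forall s, 0 < s <= t -> 0 < sw (a s)) -> 0 <= sw (a 0) -> sth (a t) = sth (b 0) ->
    Rabs (sv (a t) - sv (b 0)) < e /\ sr (a t) < e.
Proof.
  intros Hl (Hb & Hwb & Hthb & Hlim) Hvb HthR Hq e He.
  destruct (V_ths_cases l Hl) as (hV & hl & hql & hcl). destruct ths_int as [hth1 hth2].
  assert (Hbs := coll_sol b Hb). assert (Hvs := vs_pos). assert (Hsq := vs_sq). assert (HVp := V_ths_pos).
  destruct c_bounds as (cm & cM & Hcm & HcM & Hcb).
  destruct (periodic_bounded c1) as [B1 [HB1 hc1]]; [apply c1_cont|apply c1_per|].
  destruct Fw_est as (KF & wM & HKF & HwM & HF).
  assert (Hct : 0 < cos ths) by (apply cos_pos; lra).
  set (nu := - sv (b 0) / 2). assert (Hnu : 0 < nu) by (unfold nu; lra).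
  set (K1 := cM / cos ths + B1). assert (HK1 : 0 < K1) by (unfold K1; assert (0 < cM / cos ths) by pos; lra).
  set (VB := 2 * (V ths + 2) + 1). assert (HVB : 0 < VB) by (unfold VB; lra).
  set (C0 := cM * (VB + 2 * wM / nu) + 4 / nu + 2 * K1). assert (HC0 : 0 < C0).
  { unfold C0. assert (0 < 2 * wM / nu) by pos. assert (0 < 4 / nu) by pos.
    assert (0 < cM * (VB + 2 * wM / nu)) by pos. lra. }
  (* [C0] is the constant of [follow_rate], a growth rate per unit of [w]; the angle advances by at
     least [cm] per unit of [w]. *)
  set (C := C0 / cm). assert (HC : 0 < C) by pos.
  set (X := exp (C * PI)). assert (HX : 0 < X) by apply exp_pos.
  assert (HXge : 1 <= X).
  { unfold X. rewrite <- exp_0. left. apply exp_increasing. pose proof PI_RGT_0. nra. }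
  (* [Y] is the error allowed on [v]: being at most [nu / 2], it turns [v <= - 2 * nu] on [b] into
     [v < - nu] on [a], which closes the continuation. An error [T] on [En] costs less than [Y] on
     [v], because the sum of the two values of [v] is at most [- 2 * nu]. *)
  set (Y := Rmin (e / 2) (nu / 2)). assert (HY : 0 < Y) by pos.
  assert (HY1 : Y <= e / 2) by apply Rmin_l. assert (HY2 : Y <= nu / 2) by apply Rmin_r.
  set (T := nu * Y / 4). assert (HT : 0 < T) by (unfold T; nra).
  set (d0 := Rmin (Rmin 1 (e / 2)) (T / (3 * X))). assert (HTX : 0 < T / (3 * X)) by pos.
  assert (Hd0 : 0 < d0) by (unfold d0; pos).
  assert (Hd0' : d0 <= 1 /\ d0 <= e / 2 /\ d0 <= T / (3 * X)).
  { unfold d0. rmin (Rmin 1 (e / 2)) (T / (3 * X)).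
    rmin 1 (e / 2). lra. }
  assert (HdT : 3 * d0 ^ 2 * X <= T ^ 2).
  { assert (h : 3 * X * d0 <= T). { replace T with (3 * X * (T / (3 * X))) by (field; lra). apply Rmult_le_compat_l; lra. }
    assert (3 * d0 ^ 2 * X <= (3 * X * d0) ^ 2).
    { replace ((3 * X * d0) ^ 2) with (3 * d0 ^ 2 * X * (3 * X)) by ring.
      assert (0 <= 3 * d0 ^ 2 * X) by (apply Rmult_le_pos; [apply Rmult_le_pos; [lra|apply pow_le; lra]|lra]). nra. }
    assert ((3 * X * d0) ^ 2 <= T ^ 2) by (apply pow_incr; split; [nra|auto]). lra. }
  set (d1 := Rmin (Rmin 1 nu) (d0 / (4 * (1 + vs)))). assert (Hd1p : 0 < d0 / (4 * (1 + vs))) by pos.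
  assert (Hd1 : 0 < d1) by pos.
  assert (Hd1a : d1 <= 1) by (eapply Rle_trans; [apply Rmin_l|apply Rmin_l]).
  assert (Hd1n : d1 <= nu) by (eapply Rle_trans; [apply Rmin_l|apply Rmin_r]). assert (Hd1b : d1 <= d0 / (4 * (1 + vs))) by apply Rmin_r.
  assert (Hd1c : d1 * (4 * (1 + vs)) <= d0).
  { replace d0 with (d0 / (4 * (1 + vs)) * (4 * (1 + vs))) by (field; lra). apply Rmult_le_compat_r; lra. }
  assert (Hd1d : 4 * d1 <= d0) by (assert (0 <= d1 * vs) by pos; lra).
  assert (HE : forall x, P1 x -> near d1 x (St 0 (- vs) l 0) -> Rabs (En x - V ths) < d0 / 2 /\ Rabs (sw x) < d0 / 2 /\ 0 <= sr x < d0 /\ sv x < - vs + d1).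
  { intros x HP Hn. apply near_elim in Hn. simpl in Hn. destruct Hn as (n1 & n2 & n3 & n4). destruct HP as [hr _].
    split; [|split; [apply Rabs_def1; lra|lra]].
    unfold En. replace (V ths) with (/ 2 * (vs * vs)) by lra.
    replace (sr x + / 2 * sv x ^ 2 - / 2 * (vs * vs)) with (sr x + / 2 * ((sv x + vs) * (sv x - vs))) by ring.
    assert (hp : Rabs ((sv x + vs) * (sv x - vs)) <= d1 * (2 * vs + 1)).
    { rewrite Rabs_mult. apply Rmult_le_compat; try apply Rabs_pos; apply Rabs_le; lra. }
    apply Rabs_le_between in hp. apply Rabs_def1; lra. }
  destruct (Hlim d1 Hd1) as [sb [Hsb Hsbn]].
  set (d := Rmin d1 (sth (b sb) - l)). assert (Hdb : l < sth (b sb)) by (apply Hthb; auto).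
  assert (Hd : 0 < d) by pos.
  assert (Hda : d <= d1) by apply Rmin_l. assert (Hdbb : d <= sth (b sb) - l) by apply Rmin_r.
  exists d. split; auto. intros a t Ha Ht Hth0 Hn Hwa Hw0 Htht.
  assert (Hn1 : near d1 (a 0) (St 0 (- vs) l 0)) by (apply near_weaken with d; auto).
  destruct (HE (a 0) (sol_P1 a 0 Ha) Hn1) as (hE0 & hw0 & hr0 & hv0).
  destruct (Hlim (sth (a 0) - l)) as [sp [Hsp Hspn]]; [lra|].
  set (p := Rmin sp sb - 1).
  assert (hp1 : p <= sp) by (unfold p; pose proof (Rmin_l sp sb); lra). assert (hp2 : p <= sb) by (unfold p; pose proof (Rmin_r sp sb); lra).
  assert (hpth : sth (b p) < sth (a 0)). { specialize (Hspn p hp1). apply near_elim in Hspn. simpl in Hspn. lra. }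
  assert (hp0 : p < 0) by (unfold p; pose proof (Rmin_r sp sb); lra).
  destruct (extend_positive b p 0 Hbs ltac:(lra)) as [ee [Hee Hwbe]]; [intros; apply Hwb; lra|].
  destruct (coupling a b p ee Ha Hbs) as [g Hg]; [lra|intros; apply Hwbe; lra|].
  assert (Hbmono : forall u v, p <= u -> u < v -> v <= ee -> sth (b u) < sth (b v)).
  { intros u v k1 k2 k3. apply th_incr; auto. intros; apply Hwbe; lra. }
  assert (Hamono : forall u v, 0 <= u -> u < v -> v <= t -> sth (a u) < sth (a v)).
  { intros u v k1 k2 k3. apply th_incr; auto. intros; apply Hwa; lra. }
  assert (Hale : forall s, 0 <= s <= t -> sth (a 0) <= sth (a s) <= sth (b 0)).
  { intros s h. rewrite <- Htht. split.
    - destruct (proj1 h) as [k|k]; [left; apply Hamono; lra|right; now rewrite k].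
    - destruct (proj2 h) as [k|k]; [left; apply Hamono; lra|right; now rewrite k]. }
  assert (Hrange : forall s, 0 <= s <= t -> sth (b p) < sth (a s) < sth (b ee)).
  { intros s h. specialize (Hale s h). pose proof (Hbmono 0 ee). lra. }
  assert (Hg0 : forall s, 0 <= s <= t -> g s <= 0).
  { intros s h. destruct (Hg s (Hrange s h)) as (k1 & k2 & _). apply Rnot_lt_le. intros hn.
    assert (sth (b 0) < sth (b (g s))) by (apply Hbmono; lra). specialize (Hale s h). lra. }
  assert (Hg00 : g 0 <= sb).
  { destruct (Hg 0 (Hrange 0 ltac:(lra))) as (k1 & k2 & _). apply Rnot_lt_le. intros hn.
    assert (sth (b sb) < sth (b (g 0))) by (apply Hbmono; lra). lra. }
  assert (Hgt : g t = 0).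
  { destruct (Hg t (Hrange t ltac:(lra))) as (k1 & k2 & _). pose proof (Hg0 t ltac:(lra)) as k3. destruct k3 as [k3|k3]; auto.
    assert (sth (b (g t)) < sth (b 0)) by (apply Hbmono; lra). lra. }
  destruct (HE (b (g 0)) (sol_P1 b _ Hbs) (Hsbn _ Hg00)) as (hEb0 & hwb0 & _ & _).
  assert (Hvb2 : forall s, 0 <= s <= t -> - vs <= sv (b (g s)) <= - (2 * nu)).
  { intros s h. split.
    - apply Rnot_lt_le. intros Hn'.
      destruct (Hlim (- vs - sv (b (g s)))) as [s0 [_ h0]]; [lra|].
      assert (k : Rmin s0 (g s) <= s0) by apply Rmin_l. specialize (h0 _ k). apply near_elim in h0. simpl in h0.
      assert (sv (b (Rmin s0 (g s))) <= sv (b (g s))) by (apply coll_v_nondecr; auto; apply Rmin_r). lra.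
    - unfold nu. assert (sv (b (g s)) <= sv (b 0)) by (apply coll_v_nondecr; auto). lra. }
  set (ye := fun s => (En (a s) - En (b (g s))) ^ 2 + (sw (a s) - sw (b (g s))) ^ 2).
  assert (Hy0 : ye 0 <= 2 * d0 ^ 2).
  { unfold ye. apply Rabs_def2 in hE0, hw0, hEb0, hwb0.
    assert (- d0 < En (a 0) - En (b (g 0)) < d0) by lra. assert (- d0 < sw (a 0) - sw (b (g 0)) < d0) by lra.
    pose proof (sq_le_sq (En (a 0) - En (b (g 0))) d0). pose proof (sq_le_sq (sw (a 0) - sw (b (g 0))) d0). lra. }
  set (y' := fun s => 2 * (En (a s) - En (b (g s))) * (/ 2 * sv (a s) * c (sth (a s)) * sw (a s) ^ 2 - sw (a s) / sw (b (g s)) * (/ 2 * sv (b (g s)) * c (sth (b (g s))) * sw (b (g s)) ^ 2))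
      + 2 * (sw (a s) - sw (b (g s))) * (Fw (a s) - sw (a s) / sw (b (g s)) * Fw (b (g s)))).
  assert (Hdy : forall s, 0 <= s <= t -> is_derive ye s (y' s)).
  { intros s h. destruct (Hg s (Hrange s h)) as (k1 & k2 & k3).
    apply (is_derive_plus (fun s => (En (a s) - En (b (g s))) ^ 2) (fun s => (sw (a s) - sw (b (g s))) ^ 2)).
    - apply (derive_sq_diff (fun s => En (a s)) (fun s => En (b (g s)))); [apply En_derive; auto|].
      apply (is_derive_comp (fun u => En (b u)) g); [apply En_derive; auto|exact k3].
    - apply (derive_sq_diff (fun s => sw (a s)) (fun s => sw (b (g s)))); [apply sol_dw; auto|].
      apply (is_derive_comp (fun u => sw (b u)) g); [apply sol_dw; auto|exact k3]. }
  assert (Hest : forall s1, 0 <= s1 <= t -> (forall s, 0 <= s < s1 -> sv (a s) <= - nu) ->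
     ye s1 <= T ^ 2 /\ sr (a s1) <= sr (a 0)).
  { intros s1 Hs1 Hv.
    assert (Hr : forall s, 0 <= s <= s1 -> sr (a s) <= sr (a 0)).
    { intros s h. apply r_nonincr; auto; [lra|]. intros u hu. assert (hh : 0 <= u < s1) by lra. specialize (Hv u hh). lra. }
    split; [|apply Hr; lra].
    assert (HEa : forall s, 0 <= s <= s1 -> En (a s) <= V ths + 1).
    { intros s h. assert (En (a s) <= En (a 0)).
      { apply En_nonincr; auto; [lra|]. intros u hu. assert (hh : 0 <= u < s1) by lra. specialize (Hv u hh). lra. }
      apply Rabs_def2 in hE0. lra. }
    (* The added [d0 ^ 2] absorbs the radius of [a], which enters when a difference of [En] is
       converted into one of [v]. *)
    assert (Hgr : (ye s1 + d0 ^ 2) * exp (- C * sth (a s1)) <= (ye 0 + d0 ^ 2) * exp (- C * sth (a 0))).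
    { assert (hdd : forall s, 0 <= s <= s1 -> is_derive (fun s => (ye s + d0 ^ 2) * exp (- C * sth (a s))) s
         ((y' s - C * Fth (a s) * (ye s + d0 ^ 2)) * exp (- C * sth (a s)))).
      { intros s h. eapply is_derive_eq.
        { apply (is_derive_mult (fun s => ye s + d0 ^ 2) (fun s => exp (- C * sth (a s)))); [| |apply Rmult_comm].
          - apply (is_derive_plus ye (fun _ => d0 ^ 2)); [apply Hdy; lra|apply is_derive_const].
          - apply (is_derive_comp exp (fun s => - C * sth (a s))); [apply is_derive_exp|].
            apply (is_derive_scal (fun s => sth (a s)) s (- C)). apply sol_dth; auto. }
        unfold plus, zero, scal; simpl; unfold mult; simpl. ring. }
      apply (nonincr _ _ 0 s1 ltac:(lra) hdd). intros s h.
      assert (hst : 0 <= s <= t) by lra. destruct (Hg s (Hrange s hst)) as (k1 & k2 & k3).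
      assert (Hex : 0 < exp (- C * sth (a s))) by apply exp_pos.
      assert (Hgoal : y' s <= C * Fth (a s) * (ye s + d0 ^ 2)).
      2: { rewrite <- (Rmult_0_l (exp (- C * sth (a s)))). apply Rmult_le_compat_r; lra. }
      assert (hva : sv (a s) <= - nu) by (apply Hv; lra).
      assert (hwa : 0 < sw (a s)) by (apply Hwa; lra). assert (hwb : 0 < sw (b (g s))) by (apply Hwb; apply Hg0; lra).
      assert (hle := Hale s hst). assert (hlt : sth (a s) < sth (b 0)) by (rewrite <- Htht; apply Hamono; lra).
      assert (hk : 0 < cos (sth (a s))) by (apply cos_pos; lra).
      assert (hqs : 0 <= q (sth (a s))) by (apply Hq; lra).
      assert (hvbs := Hvb2 s hst). specialize (Hr s ltac:(lra)). specialize (HEa s ltac:(lra)).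
      pose proof (Fw_eq (a s) (sol_P1 a s Ha)) as fa. pose proof (Fw_eq (b (g s)) (sol_P1 b (g s) Hbs)) as fb.
      destruct (HF (b (g s)) (sol_P1 b (g s) Hbs)) as [_ hwbM].
      destruct (sol_P1 a s Ha) as [hra _].
      assert (hrb := coll_r b (g s) Hb).
      unfold y', Fth, ye. unfold En in *. rewrite k2 in *. rewrite hrb.
      (* [follow_rate] divides by [cos], which may tend to zero at the end of the range. For
         nonnegative angles [sin] has the favourable sign; for negative ones [cos] is at least
         [cos ths]. *)
      assert (hz : - (cM / cos ths) * cos (sth (a s)) <= c (sth (a s)) * sin (sth (a s))).
      { specialize (Hcb (sth (a s))). assert (h0 : 0 < cM / cos ths) by pos.
        destruct (Rle_dec 0 (sth (a s))) as [hs0|hs0].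
        - assert (0 <= sin (sth (a s))) by (apply sin_ge_0; lra).
          assert (0 <= c (sth (a s)) * sin (sth (a s))) by pos.
          assert (0 <= cM / cos ths * cos (sth (a s))) by pos. lra.
        - assert (hcc : cos ths <= cos (sth (a s))).
          { rewrite <- (cos_neg (sth (a s))). apply cos_decr_1; destruct Hl; subst l; lra. }
          assert (-1 <= sin (sth (a s))) by apply SIN_bound.
          assert (cM <= cM / cos ths * cos (sth (a s))).
          { replace cM with (cM / cos ths * cos ths) at 1 by (field; lra). apply Rmult_le_compat_l; lra. }
          assert (0 <= c (sth (a s)) * (sin (sth (a s)) + 1)) by pos. lra. }
      specialize (Hcb (sth (a s))). specialize (hc1 (sth (a s))). apply Rabs_le_between in hc1.
      assert (hk1 : cos (sth (a s)) <= 1) by apply COS_bound.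
      rewrite (Rabs_pos_eq _ (Rlt_le _ _ hwb)) in hwbM.
      set (k := cos (sth (a s))) in *. set (z := sin (sth (a s))) in *. set (cc := c (sth (a s))) in *. set (cp := c1 (sth (a s))) in *.
      set (wa := sw (a s)) in *. set (wb := sw (b (g s))) in *. set (va := sv (a s)) in *. set (vb := sv (b (g s))) in *.
      set (fwa := Fw (a s)) in *. set (fwb := Fw (b (g s))) in *. set (qq := q (sth (a s))) in *. set (ra := sr (a s)) in *.
      assert (hVBa : - VB <= va) by (unfold VB; clear - HEa hra HVp; nra).
      pose proof (follow_rate k z cc cp wa wb va vb fwa fwb qq ra nu wM cM B1 (cM / cos ths) VB d0) as hrate.
      fold K1 in hrate. fold C0 in hrate.
      assert (hKc : 0 < cM / cos ths) by pos.
      eapply Rle_trans; [apply hrate; try lra; auto|].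
      set (SS := (ra + / 2 * va ^ 2 - (0 + / 2 * vb ^ 2)) ^ 2 + (wa - wb) ^ 2 + d0 ^ 2).
      assert (hSS : 0 <= SS) by (unfold SS; repeat apply Rplus_le_le_0_compat; apply pow2_ge_0).
      replace (C * (wa * cc) * SS) with (C * cc * wa * SS) by ring.
      apply Rmult_le_compat_r; auto. apply Rmult_le_compat_r; [lra|].
      replace C0 with (C * cm) by (unfold C; field; lra). apply Rmult_le_compat_l; lra. }
    assert (hX2 : exp (- C * sth (a 0)) <= X * exp (- C * sth (a s1))).
    { unfold X. rewrite <- exp_plus. assert (hh : - C * sth (a 0) <= C * PI + - C * sth (a s1)).
      { assert (hdiff : sth (a s1) - sth (a 0) <= PI) by (pose proof (Hale s1 Hs1); lra).
        assert (C * (sth (a s1) - sth (a 0)) <= C * PI) by (apply Rmult_le_compat_l; lra). lra. }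
      destruct hh as [hh|hh]; [left; apply exp_increasing; auto|right; now rewrite hh]. }
    assert (hye1 : ye s1 + d0 ^ 2 <= (ye 0 + d0 ^ 2) * X).
    { apply Rmult_le_reg_r with (exp (- C * sth (a s1))); [apply exp_pos|]. eapply Rle_trans; [exact Hgr|].
      rewrite Rmult_assoc. apply Rmult_le_compat_l; auto.
      unfold ye. repeat apply Rplus_le_le_0_compat; apply pow2_ge_0. }
    assert ((ye 0 + d0 ^ 2) * X <= 3 * d0 ^ 2 * X) by (apply Rmult_le_compat_r; lra).
    pose proof (pow2_ge_0 d0). lra. }
  assert (Hclose : forall s1, 0 <= s1 <= t -> (forall s, 0 <= s < s1 -> sv (a s) <= - nu) -> sv (a s1) <= 0 ->
     Rabs (sv (a s1) - sv (b (g s1))) < Y).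
  { intros s1 Hs1 Hv Hv1. destruct (Hest s1 Hs1 Hv) as [h1 h2]. pose proof (Hvb2 s1 Hs1) as h3.
    assert (h4 : (En (a s1) - En (b (g s1))) ^ 2 <= T ^ 2) by (unfold ye in h1; pose proof (pow2_ge_0 (sw (a s1) - sw (b (g s1)))); lra).
    assert (h5 : Rabs (En (a s1) - En (b (g s1))) <= T).
    { apply Rabs_le. clear - h4 HT. split; nra. }
    apply Rabs_le_between in h5. destruct (sol_P1 a s1 Ha) as [hr _]. unfold En in h5. rewrite (coll_r b _ Hb) in h5.
    assert (hT2 : d0 <= T). { assert (T / (3 * X) <= T); [|lra]. apply Rmult_le_reg_r with (3 * X); [lra|]. unfold Rdiv. rewrite Rmult_assoc, Rinv_l by lra. assert (T * 1 <= T * (3 * X)) by (apply Rmult_le_compat_l; lra). lra. }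
    set (va := sv (a s1)) in *. set (vb := sv (b (g s1))) in *.
    assert (h6 : Rabs ((va - vb) * (va + vb)) <= 4 * T).
    { replace ((va - vb) * (va + vb)) with (va ^ 2 - vb ^ 2) by ring. apply Rabs_le. lra. }
    rewrite Rabs_mult in h6.
    assert (h7 : 2 * nu <= Rabs (va + vb)) by (rewrite Rabs_left; lra).
    assert (h8 : Rabs (va - vb) * (2 * nu) <= Rabs (va - vb) * Rabs (va + vb)) by (apply Rmult_le_compat_l; [apply Rabs_pos|auto]).
    apply Rmult_lt_reg_r with (2 * nu); [lra|]. unfold T in h6. assert (0 < nu * Y) by pos. lra. }
  assert (Hall : forall s, 0 <= s <= t -> sv (a s) < - nu).
  { intros s Hs. apply Rnot_le_lt. intros Hn'.
    assert (Hini : sv (a 0) < - nu).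
    { pose proof (Hvb2 0 ltac:(lra)). lra. }
    destruct (first_zero (fun s => sv (a s) + nu) 0 s) as [u [Hu1 [Hu2 Hu3]]]; try lra.
    { intros z _. apply (continuous_plus (fun s => sv (a s)) (fun _ => nu)); [apply sol_cv; auto|apply continuous_const]. }
    cbv beta in Hu2.
    assert (hc : Rabs (sv (a u) - sv (b (g u))) < Y).
    { apply Hclose; [lra| |lra]. intros z hz. specialize (Hu3 z hz). cbv beta in Hu3. lra. }
    pose proof (Hvb2 u ltac:(lra)). apply Rabs_def2 in hc. lra. }
  split.
  - assert (hc : Rabs (sv (a t) - sv (b (g t))) < Y).
    { apply Hclose; [lra| |]. intros z hz. left. apply Hall. lra. pose proof (Hall t ltac:(lra)). lra. }
    rewrite Hgt in hc. lra.
  - destruct (Hest t ltac:(lra)) as [_ hr]. { intros z hz. left. apply Hall. lra. }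
    lra.
Qed.
End Follow.

Section Sections.
Context {S : system}.

Lemma whit_ext (x y : R -> state) b t : (forall s, x s = y s) -> whit x b t -> whit y b t.
Proof. intros H (h1 & h2 & h3). split; auto. split; [now rewrite <- H|]. intros s hs. rewrite <- H; auto. Qed.

Lemma whit_trans x b b' t t' : whit x b t -> whit (fun s => x (s + t)) b' t' -> whit x b' (t' + t).
Proof.
  intros (h1 & h2 & h3) (k1 & k2 & k3). split; [lra|]. split; auto.
  intros s hs. destruct (Rle_dec s t); [apply h3; lra|]. replace s with ((s - t) + t) by ring. apply k3. lra.
Qed.

(** While [v <= 0], the energy decreases, by at most a constant times the increase of the angle. *)
Lemma approach_stays l : l = ths \/ l = - ths -> forall e, 0 < e -> exists d, 0 < d /\ forall a t, sol a -> 0 <= t ->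
  near d (a 0) (St 0 (- vs) l 0) -> (forall s, 0 <= s < t -> 0 < sw (a s)) -> 0 <= sw (a t) -> sth (a t) <= l ->
  (sth (a t) = l \/ sw (a t) = 0) -> near e (a t) (St 0 (- vs) l 0).
Proof.
  intros Hl e He. destruct (V_ths_cases l Hl) as (hV & hl & hq & hc).
  assert (Hvs := vs_pos). assert (Hsq := vs_sq). assert (HVp := V_ths_pos).
  destruct c_bounds as (cm & cM & Hcm & HcM & Hcb). destruct Fw_est as (KF & wM & HKF & HwM & HF).
  set (VB := 2 * (V ths + 2) + 1). assert (HVB : 0 < VB) by (unfold VB; lra).
  set (C := / 2 * VB * wM). assert (HC : 0 < C) by (unfold C; nra).
  set (T := Rmin (Rmin 1 (vs * vs / 16)) (Rmin (vs * e / 8) (cm * e * e / 8))).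
  assert (HT : 0 < T).
  { assert (0 < vs * vs) by pos. assert (0 < vs * e) by pos.
    assert (0 < cm * e * e) by pos.
    unfold T. pos. }
  assert (HT' : T <= 1 /\ T <= vs * vs / 16 /\ T <= vs * e / 8 /\ T <= cm * e * e / 8).
  { unfold T. set (u1 := vs * vs / 16). set (u2 := vs * e / 8). set (u3 := cm * e * e / 8).
    rmin (Rmin 1 u1) (Rmin u2 u3).
    rmin 1 u1. rmin u2 u3. lra. }
  set (K := 1 + (2 * vs + 1) + C). assert (HK : 0 < K) by (unfold K; lra).
  set (d := Rmin (Rmin 1 (vs / 4)) (Rmin (e / 2) (T / (2 * K)))).
  assert (HTK : 0 < T / (2 * K)) by pos.
  assert (Hd : 0 < d) by (unfold d; pos).
  assert (Hd' : d <= 1 /\ d <= vs / 4 /\ d <= e / 2 /\ d <= T / (2 * K)).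
  { unfold d. set (u := T / (2 * K)) in *. rmin (Rmin 1 (vs / 4)) (Rmin (e / 2) u).
    rmin 1 (vs / 4). rmin (e / 2) u. lra. }
  assert (HdK : d * K <= T / 2).
  { replace (T / 2) with (T / (2 * K) * K) by (field; lra). apply Rmult_le_compat_r; lra. }
  clearbody d T. clear HTK.
  exists d. split; auto. intros a t Ha Ht Hn Hw Hwt Htl Hend.
  apply near_elim in Hn. simpl in Hn. destruct Hn as (n1 & n2 & n3 & n4).
  destruct (sol_P1 a 0 Ha) as [hr0 _].
  assert (HE0 : Rabs (En (a 0) - V ths) <= d * (1 + (2 * vs + 1))).
  { unfold En. replace (V ths) with (/ 2 * (vs * vs)) by lra.
    replace (sr (a 0) + / 2 * sv (a 0) ^ 2 - / 2 * (vs * vs)) with (sr (a 0) + / 2 * ((sv (a 0) + vs) * (sv (a 0) - vs))) by ring.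
    assert (hp : Rabs ((sv (a 0) + vs) * (sv (a 0) - vs)) <= d * (2 * vs + 1)).
    { rewrite Rabs_mult. apply Rmult_le_compat; try apply Rabs_pos; apply Rabs_le; lra. }
    apply Rabs_le_between in hp. assert (0 <= d * (2 * vs + 1)) by pos. apply Rabs_le. lra. }
  apply Rabs_le_between in HE0.
  assert (Hmono : forall s, 0 <= s <= t -> sth (a 0) <= sth (a s) <= l).
  { intros s Hs. split.
    - apply th_mono; auto; [lra|intros; apply Hw; lra].
    - apply Rle_trans with (sth (a t)); auto.
      apply th_mono; auto; [lra|intros; apply Hw; lra]. }
  assert (Hest : forall s1, 0 <= s1 <= t -> (forall s, 0 <= s < s1 -> sv (a s) <= 0) ->
     Rabs (En (a s1) - V ths) <= T / 2 /\ sr (a s1) <= d).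
  { intros s1 Hs1 Hv. split; [|assert (sr (a s1) <= sr (a 0)); [|lra]; apply r_nonincr; auto; [lra|intros; apply Hv; lra]].
    assert (hdec : forall s, 0 <= s <= s1 -> En (a s) <= En (a 0)).
    { intros s h. apply En_nonincr; auto; [lra|]. intros; apply Hv; lra. }
    assert (hinc : En (a 0) + C * sth (a 0) <= En (a s1) + C * sth (a s1)).
    { apply (nondecr (fun s => En (a s) + C * sth (a s)) (fun s => / 2 * sv (a s) * c (sth (a s)) * (sw (a s)) ^ 2 + C * Fth (a s)) 0 s1 ltac:(lra)).
      - intros s _. apply (is_derive_plus (fun s => En (a s)) (fun s => C * sth (a s))); [apply En_derive; auto|].
        apply (is_derive_scal (fun s => sth (a s)) s C). apply sol_dth; auto.
      - intros s h. assert (hv : sv (a s) <= 0) by (apply Hv; lra). specialize (hdec s ltac:(lra)).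
        destruct (sol_P1 a s Ha) as [hr _].
        assert (hVB : - VB <= sv (a s)).
        { unfold En in hdec, HE0. unfold VB. assert (sv (a s) ^ 2 <= 2 * (V ths + 2)).
          { unfold K in HdK. assert (0 <= d * C) by pos. lra. }
          clear - H HVp. nra. }
        destruct (HF (a s) (sol_P1 a s Ha)) as [_ hwM]. assert (hw : 0 < sw (a s)) by (apply Hw; lra).
        rewrite Rabs_pos_eq in hwM by lra. unfold Fth. pose proof (c_pos (sth (a s))).
        replace (/ 2 * sv (a s) * c (sth (a s)) * sw (a s) ^ 2 + C * (sw (a s) * c (sth (a s))))
          with ((sw (a s) * c (sth (a s))) * (C - / 2 * (- sv (a s)) * sw (a s))) by ring.
        apply Rmult_le_pos; [pos|]. unfold C.
        assert (- sv (a s) * sw (a s) <= VB * wM) by (apply Rmult_le_compat; lra). lra. }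
    pose proof (hdec s1 ltac:(lra)). pose proof (Hmono s1 Hs1).
    assert (C * (sth (a s1) - sth (a 0)) <= C * d) by (apply Rmult_le_compat_l; lra).
    unfold K in HdK. apply Rabs_le. assert (0 <= d * C) by pos. lra. }
  assert (Hcl : forall s1, 0 <= s1 <= t -> (forall s, 0 <= s < s1 -> sv (a s) <= 0) -> sv (a s1) <= 0 ->
     Rabs (sv (a s1) + vs) < e /\ sv (a s1) < 0 /\ Rabs (En (a s1) - V ths) <= T / 2 /\ sr (a s1) <= d).
  { intros s1 Hs1 Hv Hv1. destruct (Hest s1 Hs1 Hv) as [h1 h2]. split; [|split; auto].
    - apply sq_close; auto; [lra|]. apply Rabs_le_between in h1. unfold En in h1. destruct (sol_P1 a s1 Ha) as [hr _].
      assert (hdT : d <= T / 2). { unfold K in HdK. assert (0 <= d * (2 * vs + 1)) by pos. assert (0 <= d * C) by pos. lra. }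
      apply Rabs_def1; lra.
    - apply Rabs_le_between in h1. unfold En in h1. destruct (sol_P1 a s1 Ha) as [hr _].
      assert (hdT : d <= T / 2). { unfold K in HdK. assert (0 <= d * (2 * vs + 1)) by pos. assert (0 <= d * C) by pos. lra. }
      destruct Hv1 as [|Hv1]; auto. exfalso. rewrite Hv1 in h1. assert (0 < vs * vs) by pos. lra. }
  assert (Hall : forall s, 0 <= s <= t -> sv (a s) < 0).
  { intros s Hs. apply Rnot_le_lt. intros Hn'.
    destruct (first_zero (fun s => sv (a s)) 0 s) as [u [Hu1 [Hu2 Hu3]]]; try lra.
    { intros z _. apply sol_cv; auto. }
    cbv beta in Hu2. destruct (Hcl u) as (_ & h & _); try lra. intros z hz. left. apply (Hu3 z hz). }
  destruct (Hcl t) as (h1 & h2 & h3 & h4); [lra|intros; left; apply Hall; lra|left; apply Hall; lra|].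
  destruct (sol_P1 a t Ha) as [hr _]. apply Rabs_def2 in h1.
  pose proof (Hmono t ltac:(lra)).
  apply near_intro; simpl; try lra.
  (* Only [w] is left to bound: it is zero at a stop, and at the angle [l] energy expresses it
     through [V ths - En]. *)
  destruct Hend as [Hend|Hend]; [|lra].
  pose proof (En_V (a t) (sol_P1 a t Ha)) as hE. rewrite Hend in hE. specialize (hE ltac:(lra)). rewrite hV in hE.
  apply Rabs_le_between in h3. specialize (Hcb l).
  assert (hk : cos l ^ 2 <= 1) by (pose proof (COS_bound l); clear - H0 hc; nra).
  assert (hk0 : 0 <= cos l ^ 2) by apply pow2_ge_0.
  assert (hw2 : / 2 * sw (a t) ^ 2 * c l <= T / 2).
  { rewrite hE. destruct (Rle_dec 0 (V ths - En (a t))).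
    - assert ((V ths - En (a t)) * cos l ^ 2 <= (V ths - En (a t)) * 1) by (apply Rmult_le_compat_l; lra). lra.
    - assert ((En (a t) - V ths) * cos l ^ 2 >= 0) by (apply Rle_ge, Rmult_le_pos; lra). lra. }
  assert (hw3 : sw (a t) ^ 2 * cm <= sw (a t) ^ 2 * c l) by (apply Rmult_le_compat_l; [apply pow2_ge_0|lra]).
  assert (hw4 : sw (a t) ^ 2 < e ^ 2).
  { apply Rmult_lt_reg_r with cm; auto. replace (e ^ 2 * cm) with (cm * e * e) by ring. lra. }
  clear - hw4 Hwt He. split; nra.
Qed.

(** * The section [theta = - PI / 2], [w > 0] *)

Definition sec (p : state) : Prop := P1 p /\ sth p = - (PI / 2) /\ 0 < sw p.
(** On the collinear line the energy relation reduces to [c * w ^ 2 = 2 * W], so [(r, v)] are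
    coordinates on the section. *)
Definition w0 : R := sqrt (2 * W (- (PI / 2)) / c (- (PI / 2))).
Definition sig (r v : R) : state := St r v (- (PI / 2)) w0.

Lemma cos_mPI2 : cos (- (PI / 2)) = 0.
Proof. rewrite cos_neg. apply cos_PI2. Qed.

Lemma w0_sq : w0 * w0 * c (- (PI / 2)) = 2 * W (- (PI / 2)).
Proof.
  pose proof (c_pos (- (PI / 2))). pose proof (W_pos (- (PI / 2))). unfold w0. rewrite sqrt_sqrt; [field; lra|].
  left. pos.
Qed.

Lemma w0_pos : 0 < w0.
Proof. apply sqrt_lt_R0. apply Rdiv_lt_0_compat; [pose proof (W_pos (- (PI / 2))); lra|apply c_pos]. Qed.

Lemma sec_sig r v : 0 <= r -> sec (sig r v).
Proof.
  intros Hr. split; [|split; [reflexivity|apply w0_pos]]. split; auto. unfold energy; simpl. rewrite cos_mPI2.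
  pose proof w0_sq. lra.
Qed.

Lemma sec_w p : sec p -> sw p = w0.
Proof.
  intros ([H1 H2] & H3 & H4). unfold energy in H2. rewrite H3, cos_mPI2 in H2. pose proof w0_sq. pose proof w0_pos.
  pose proof (c_pos (- (PI / 2))).
  assert (h : (sw p * sw p - w0 * w0) * c (- (PI / 2)) = 0) by lra.
  apply Rmult_integral in h. destruct h as [h|h]; [|lra]. nra.
Qed.

Lemma sec_near p p' e : sec p -> sec p' -> 0 < e -> Rabs (sr p - sr p') < e -> Rabs (sv p - sv p') < e -> near e p p'.
Proof.
  intros H H' He h1 h2. split; [auto|split; [auto|]]. rewrite (sec_w p H), (sec_w p' H'), (proj1 (proj2 H)), (proj1 (proj2 H')).
  rewrite !Rminus_diag, Rabs_R0. auto.
Qed.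

Lemma orb_sol p : sec p -> sol (flow p).
Proof. intros H. apply flow_spec, H. Qed.
Lemma orb_0 p : sec p -> flow p 0 = p.
Proof. intros H. apply flow_spec, H. Qed.

Definition turns (p : state) : Prop := exists t, turn (flow p) (- ths) t.
Definition hits (p : state) : Prop := exists t, whit (flow p) 0 t.
Definition asym (p : state) : Prop := (forall s, 0 <= s -> 0 < sw (flow p s)) /\ tends (flow p) (- ths).
Definition hitsP (Q : R -> Prop) (p : state) : Prop := exists t, whit (flow p) 0 t /\ Q (sv (flow p t)).

(** The orbit of [p] turns back before [- ths] and returns to the line [- PI / 2]; [p'] is the mirror image of the return point. *)
Definition ret (p p' : state) : Prop := exists t1 t2, turn (flow p) (- ths) t1 /\
  whit (fun s => mir (flow p (s + t1))) (PI / 2) t2 /\ shift p' = mir (flow p (t2 + t1)).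

Definition unshift (x : state) := St (sr x) (sv x) (sth x - PI) (sw x).
Lemma shift_unshift x : shift (unshift x) = x.
Proof. apply state_eq; simpl; auto. ring. Qed.
Lemma unshift_shift x : unshift (shift x) = x.
Proof. apply state_eq; simpl; auto. ring. Qed.

Lemma P1_unshift x : P1 x -> P1 (unshift x).
Proof.
  intros [H1 H2]. split; auto. unfold energy in *; simpl.
  assert (hc := neg_cos (sth x - PI)).
  rewrite <- (c_per (sth x - PI)), <- (W_per (sth x - PI)). replace (sth x - PI + PI) with (sth x) in * by ring.
  rewrite hc in H2. lra.
Qed.

Lemma turn_q p t : sec p -> turn (flow p) (- ths) t -> q (sth (flow p t)) < 0 /\ ths < - sth (flow p t) < PI / 2.
Proof.
  intros Hp (h1 & h2 & h3 & h4). rewrite (orb_0 p Hp), (proj1 (proj2 Hp)) in h3. destruct ths_int.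
  split; [apply q_neg|]; lra.
Qed.

(** The mirror image of the stop lies between [ths] and [PI / 2], where [q > 0] starts it to the
    right. *)
Lemma turn_mirror p t : sec p -> turn (flow p) (- ths) t ->
  sol (fun s => mir (flow p (s + t))) /\ exists eta, 0 < eta /\ forall s, 0 < s <= eta -> 0 < sw (mir (flow p (s + t))).
Proof.
  intros Hp Ht. assert (Hy : sol (fun s => mir (flow p (s + t)))) by (apply sol_mir, sol_translate, orb_sol; auto).
  split; auto. destruct (turn_q p t Hp Ht) as [hq hth]. destruct ths_int.
  apply (start_rest (fun s => mir (flow p (s + t)))); auto; simpl; rewrite Rplus_0_l.
  - destruct Ht as (_ & h & _). lra.
  - rewrite cos_neg. apply cos_pos; lra.
  - rewrite q_odd. lra.
Qed.

Lemma turn_ret p : sec p -> turns p -> exists p', ret p p'.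
Proof.
  intros Hp [t Ht]. destruct (turn_mirror p t Hp Ht) as [Hy [eta [Heta H]]].
  destruct (turn_q p t Hp Ht) as [hq hth].
  destruct (push_collinear _ eta Hy) as [t2 H2]; auto.
  { simpl. rewrite Rplus_0_l. lra. }
  exists (unshift (mir (flow p (t2 + t)))), t, t2. split; auto. split; auto. apply shift_unshift.
Qed.

Lemma ret_turns p p' : ret p p' -> turns p.
Proof. intros (t1 & t2 & h & _). exists t1; auto. Qed.

Lemma ret_sec p p' : sec p -> ret p p' -> sec p'.
Proof.
  intros Hp (t1 & t2 & h1 & h2 & h3). assert (Hp' : p' = unshift (mir (flow p (t2 + t1)))) by (rewrite <- h3; symmetry; apply unshift_shift).
  rewrite Hp'. split; [apply P1_unshift, P1_mir, sol_P1, orb_sol; auto|].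
  destruct h2 as (k1 & k2 & k3). split; [simpl in *; lra|]. apply (k3 t2). lra.
Qed.

Lemma ret_r p p' : sec p -> ret p p' -> 0 < sr p -> 0 < sr p'.
Proof.
  intros Hp (t1 & t2 & h1 & h2 & h3) Hr. replace (sr p') with (sr (shift p')) by reflexivity. rewrite h3. simpl.
  apply (r_pos _ 0); [apply orb_sol; auto|now rewrite orb_0].
Qed.

Lemma turn_unique x b t t' : turn x b t -> turn x b t' -> t = t'.
Proof.
  intros (h1 & h2 & h3 & h4) (k1 & k2 & k3 & k4). destruct (Rtotal_order t t') as [h|[h|h]]; auto; exfalso.
  - specialize (k4 t). lra.
  - specialize (h4 t'). lra.
Qed.

Lemma ret_unique p p' p'' : sec p -> ret p p' -> ret p p'' -> p' = p''.
Proof.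
  intros Hp (t1 & t2 & h1 & h2 & h3) (u1 & u2 & k1 & k2 & k3).
  rewrite <- (turn_unique _ _ _ _ h1 k1) in *.
  rewrite <- (whit_unique _ _ _ _ (proj1 (turn_mirror p t1 Hp h1)) h2 k2) in *.
  rewrite <- (unshift_shift p'), <- (unshift_shift p''), h3, k3. auto.
Qed.

(** Before [- ths] the force is negative, so the orbit passes, turns, or converges to [- ths]; once
    past, [push_Euler] carries it to the Euler line because [r > 0]. *)
Lemma trichotomy p : sec p -> 0 < sr p -> hits p \/ turns p \/ asym p.
Proof.
  intros Hp Hr. assert (Hx := orb_sol p Hp). assert (H0 := orb_0 p Hp). destruct ths_int as [ht1 ht2].
  assert (Hth0 : sth (flow p 0) = - (PI / 2)) by (rewrite H0; apply Hp).
  destruct (start_positive (flow p) Hx) as [eta [Heta Hst]]; [rewrite H0; apply Hp|].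
  destruct (fall (flow p) (- ths) eta) as [[t h]|[h|(h1 & h2 & h3)]]; auto; try lra.
  - intros; apply Hst; lra.
  - apply q_ths.
  - rewrite Hth0. intros t h. apply q_neg; lra.
  - left. assert (Hxt : sol (fun s => flow p (s + t))) by (apply sol_translate; auto).
    destruct (start_positive _ Hxt) as [e2 [He2 Hst2]]; [rewrite Rplus_0_l; destruct h as (k1 & _ & k3); apply k3; lra|].
    destruct (push_Euler _ e2 Hxt) as [t' h']; auto.
    + rewrite Rplus_0_l. destruct h as (_ & h & _). lra.
    + apply (r_pos (flow p) 0); auto. now rewrite H0.
    + intros; apply Hst2; lra.
    + exists (t' + t). eapply whit_trans; eauto.
  - right; right. split; auto. intros s Hs. destruct Hs as [Hs|<-]; auto. apply Hst; lra.
Qed.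
End Sections.

(** * Openness of outcomes, and neighbours of asymptotic orbits *)

Section Openness.
Context {S : system}.

Definition open_at (p : state) (A : state -> Prop) : Prop :=
  exists d, 0 < d /\ forall q, sec q -> near d p q -> A q.

Lemma sec_whit_near p b t e : sec p -> whit (flow p) b t -> 0 < e ->
  open_at p (fun q => exists t', whit (flow q) b t' /\ near e (flow p t) (flow q t')).
Proof.
  intros Hp Ht He. destruct (whit_near (flow p) b t e (orb_sol p Hp) Ht He) as [d [Hd H]].
  exists d. split; auto. intros q Hq Hn.
  rewrite (orb_0 p Hp) in H. destruct (H (flow q) (orb_sol q Hq)) as [h1 h2]; [now rewrite orb_0|].
  destruct h2 as [t' h2]; [apply Hp|]. exists t'. split; auto. apply h1; auto.
Qed.

Lemma hits_open p : sec p -> hits p -> open_at p hits.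
Proof.
  intros Hp [t Ht]. destruct (sec_whit_near p 0 t 1 Hp Ht Rlt_0_1) as [d [Hd H]]. exists d. split; auto.
  intros q Hq Hn. destruct (H q Hq Hn) as [t' [h _]]. exists t'; auto.
Qed.

Lemma hits_pos_open p : sec p -> hitsP (fun v => 0 < v) p -> open_at p (hitsP (fun v => 0 < v)).
Proof.
  intros Hp [t [Ht Hv]]. cbv beta in Hv. destruct (sec_whit_near p 0 t _ Hp Ht Hv) as [d [Hd H]]. exists d. split; auto.
  intros q Hq Hn. destruct (H q Hq Hn) as [t' [h h2]]. exists t'. split; auto. cbv beta in *. apply near_elim in h2. lra.
Qed.

Lemma hits_neg_open p : sec p -> hitsP (fun v => v < 0) p -> open_at p (hitsP (fun v => v < 0)).
Proof.
  intros Hp [t [Ht Hv]]. cbv beta in Hv. assert (Hv' : 0 < - sv (flow p t)) by lra.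
  destruct (sec_whit_near p 0 t _ Hp Ht Hv') as [d [Hd H]]. exists d. split; auto.
  intros q Hq Hn. destruct (H q Hq Hn) as [t' [h h2]]. exists t'. split; auto. cbv beta in *. apply near_elim in h2. lra.
Qed.

Lemma hits_unique p Q Q' : sec p -> hitsP Q p -> hitsP Q' p -> exists v, Q v /\ Q' v.
Proof.
  intros Hp [t [h1 h2]] [t' [k1 k2]]. rewrite <- (whit_unique _ _ _ _ (orb_sol p Hp) h1 k1) in k2. eauto.
Qed.

Lemma hits_whit_ths p t : sec p -> whit (flow p) 0 t -> exists t', whit (flow p) (- ths) t' /\ t' < t.
Proof.
  intros Hp (h1 & h2 & h3). destruct ths_int.
  destruct (ivt (fun s => sth (flow p s)) 0 t (- ths)) as [u [Hu1 [Hu2 Hu3]]]; try lra.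
  - intros; apply sol_cth, orb_sol; auto.
  - rewrite orb_0 by auto. rewrite (proj1 (proj2 Hp)). lra.
  - exists u. split.
    + split; [lra|]. split; auto. intros; apply h3; lra.
    + destruct Hu1 as [_ [k|k]]; auto. subst. lra.
Qed.

Lemma hits_not_turns p : sec p -> hits p -> turns p -> False.
Proof.
  intros Hp [t Ht] [t' Ht']. destruct (hits_whit_ths p t Hp Ht) as [u [Hu _]].
  apply (turn_not_whit _ _ _ _ Ht' Hu). apply orb_sol; auto.
Qed.

Lemma asym_not_hits p : sec p -> asym p -> hits p -> False.
Proof.
  intros Hp [_ [H _]] [t Ht]. destruct (hits_whit_ths p t Hp Ht) as [u [(h1 & h2 & _) _]]. specialize (H u). lra.
Qed.

Lemma turns_open p : sec p -> turns p -> open_at p turns.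
Proof.
  intros Hp [t Ht]. destruct (turn_q p t Hp Ht) as [hq _]. destruct ths_int.
  destruct (turn_near (flow p) (- ths) t 1 (orb_sol p Hp)) as [d [Hd H1]]; auto; try lra.
  - rewrite orb_0 by auto. apply Hp.
  - rewrite orb_0 by auto. rewrite (proj1 (proj2 Hp)). lra.
  - exists d. split; auto. intros q Hq Hn. destruct (H1 (flow q) (orb_sol q Hq)) as [t' [h _]].
    + rewrite !orb_0; auto.
    + exists t'; auto.
Qed.

Lemma near_mir e x y : near e x y -> near e (mir x) (mir y).
Proof. intros h. apply near_elim in h. apply near_intro; simpl; lra. Qed.

Lemma near_shift e x y : near e (shift x) (shift y) -> near e x y.
Proof. intros h. apply near_elim in h. simpl in h. apply near_intro; lra. Qed.

(** The turn is transversal, and the mirrored orbits reach [PI / 2] at nearby points by the first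
    claim of [whit_near]; that they reach it at all comes from [turn_ret]. *)
Lemma ret_cont p p' e : sec p -> ret p p' -> 0 < e -> open_at p (fun q => exists q', ret q q' /\ near e p' q').
Proof.
  intros Hp (t1 & t2 & h1 & h2 & h3) He.
  destruct (turn_mirror p t1 Hp h1) as [Hy _].
  destruct (whit_near _ _ _ e Hy h2 He) as [d1 [Hd1 H1]].
  destruct (turn_q p t1 Hp h1) as [hq _]. destruct ths_int.
  destruct (turn_near (flow p) (- ths) t1 d1 (orb_sol p Hp)) as [d [Hd H2]]; auto; try lra.
  - rewrite orb_0 by auto. apply Hp.
  - rewrite orb_0 by auto. rewrite (proj1 (proj2 Hp)). lra.
  - exists d. split; auto. intros q Hq Hn.
    destruct (H2 (flow q) (orb_sol q Hq)) as [u1 [k1 [k2 _]]]; [rewrite !orb_0; auto|].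
    destruct (turn_ret q Hq (ex_intro _ u1 k1)) as [q' Hq'].
    exists q'. split; auto. apply near_shift. rewrite h3.
    destruct Hq' as (v1 & v2 & l1 & l2 & l3). rewrite l3. rewrite <- (turn_unique _ _ _ _ k1 l1) in *.
    destruct (turn_mirror q u1 Hq k1) as [Hyq _].
    destruct (H1 _ Hyq) as [H3 _].
    + rewrite !Rplus_0_l. apply near_mir. auto.
    + apply (H3 v2 l2).
Qed.

(** Energy fixes [w] up to sign, hence closeness at equal angles is closeness of [(r, v)]. *)
Lemma near_at_angle x0 e : P1 x0 -> 0 < sw x0 -> 0 < e -> exists d, 0 < d /\ forall x, P1 x -> sth x = sth x0 -> 0 < sw x ->
  Rabs (sr x - sr x0) < d -> Rabs (sv x - sv x0) < d -> near e x0 x.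
Proof.
  intros H0 Hw He.
  set (K := c (sth x0) * sw x0). assert (HK : 0 < K) by (apply Rmult_lt_0_compat; [apply c_pos|auto]).
  set (M := 2 + (2 * Rabs (sv x0) + 1)). assert (HM : 0 < M) by (unfold M; pose proof (Rabs_pos (sv x0)); lra).
  set (d := Rmin (Rmin 1 e) (e * K / M)).
  assert (Hd1 : 0 < e * K / M) by pos.
  assert (Hd : 0 < d) by (unfold d; pos).
  assert (Hd' : d <= 1 /\ d <= e /\ d <= e * K / M).
  { unfold d. set (u := e * K / M). rmin (Rmin 1 e) u. rmin 1 e. lra. }
  assert (HdM : d * M <= e * K). { replace (e * K) with (e * K / M * M) by (field; lra). apply Rmult_le_compat_r; lra. }
  exists d. split; auto. intros x Hx Hth Hwx hr hv.
  apply near_sym. split; [lra|split; [lra|split]].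
  { rewrite Hth, Rminus_diag, Rabs_R0. auto. }
  pose proof (En_eq x Hx) as e1. pose proof (En_eq x0 H0) as e2. rewrite Hth in e1. unfold En in *.
  set (k := cos (sth x0)) in *.
  assert (hk : 0 <= k ^ 2 <= 1). { split; [apply pow2_ge_0|]. pose proof (COS_bound (sth x0)). fold k in H. clear - H. nra. }
  assert (hdiff : (sw x - sw x0) * ((sw x + sw x0) * c (sth x0)) = - (2 * (sr x - sr x0) + (sv x - sv x0) * (sv x + sv x0)) * k ^ 2) by lra.
  assert (hb : Rabs (- (2 * (sr x - sr x0) + (sv x - sv x0) * (sv x + sv x0)) * k ^ 2) < d * M).
  { rewrite Rabs_mult, Rabs_Ropp, (Rabs_pos_eq (k ^ 2)) by lra.
    assert (hs : Rabs (sv x + sv x0) <= 2 * Rabs (sv x0) + 1).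
    { replace (sv x + sv x0) with ((sv x - sv x0) + 2 * sv x0) by ring. eapply Rle_trans; [apply Rabs_triang|].
      rewrite Rabs_mult, (Rabs_pos_eq 2); lra. }
    assert (h : Rabs (2 * (sr x - sr x0) + (sv x - sv x0) * (sv x + sv x0)) < d * M).
    { eapply Rle_lt_trans; [apply Rabs_triang|]. rewrite !Rabs_mult, (Rabs_pos_eq 2) by lra. unfold M.
      assert (Rabs (sv x - sv x0) * Rabs (sv x + sv x0) <= d * (2 * Rabs (sv x0) + 1)) by (apply Rmult_le_compat; try apply Rabs_pos; lra). lra. }
    pose proof (Rabs_pos (2 * (sr x - sr x0) + (sv x - sv x0) * (sv x + sv x0))).
    set (z := Rabs (2 * (sr x - sr x0) + (sv x - sv x0) * (sv x + sv x0))) in *.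
    assert (z * k ^ 2 <= z * 1) by (apply Rmult_le_compat_l; lra). lra. }
  rewrite <- hdiff, Rabs_mult, (Rabs_pos_eq ((sw x + sw x0) * c (sth x0))) in hb.
  2: { left. apply Rmult_lt_0_compat; [lra|apply c_pos]. }
  assert (hK : K <= (sw x + sw x0) * c (sth x0)).
  { unfold K. rewrite Rmult_comm. apply Rmult_le_compat_r; [left; apply c_pos|lra]. }
  apply Rmult_lt_reg_r with K; auto.
  apply Rle_lt_trans with (Rabs (sw x - sw x0) * ((sw x + sw x0) * c (sth x0))); [|lra].
  apply Rmult_le_compat_l; auto. apply Rabs_pos.
Qed.

(** By [homothetic_limit] the orbit [x] comes close to the lower equilibrium, where [follow] takes over for its neighbours. *)
Lemma exit_follow x l b : sol x -> (forall s, 0 < s -> 0 < sw (x s)) -> tends x l -> 0 < sr (x 0) -> l = ths \/ l = - ths ->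
  departure b l -> sv (b 0) < 0 -> sth (b 0) <= PI / 2 -> (forall t, l < t < sth (b 0) -> 0 <= q t) ->
  forall e, 0 < e -> exists d, 0 < d /\ forall y, sol y -> near d (x 0) (y 0) ->
    forall t, whit y (sth (b 0)) t -> Rabs (sv (y t) - sv (b 0)) < e /\ sr (y t) < e.
Proof.
  intros Hx Hw Ht Hr Hl Hb Hvb Hthb Hq e He.
  destruct (V_ths_cases l Hl) as (hV & hl & hq & hc).
  destruct (follow b l Hl Hb Hvb Hthb Hq e He) as [d1 [Hd1 Hfol]].
  destruct (approach_stays l Hl (d1 / 2) ltac:(lra)) as [d2 [Hd2 Happ]].
  destruct (homothetic_limit x l Hx Hw hc Ht Hr (d2 / 2) ltac:(lra)) as [s00 [Hs00 Hlim]].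
  set (s0 := s00 + 1). assert (Hs0 : 0 < s0) by (unfold s0; lra).
  destruct (Hlim s0 ltac:(unfold s0; lra)) as [_ Hn0]. clearbody s0.
  assert (Hxl : sth (x s0) < l) by (apply Ht; lra).
  assert (hb0 : l < sth (b 0)) by (apply Hb; lra).
  replace (sqrt (2 * V l)) with vs in Hn0 by (unfold vs; now rewrite hV).
  set (e2 := Rmin (d2 / 2) (l - sth (x s0))). assert (He2 : 0 < e2) by pos.
  assert (He2a : e2 <= d2 / 2) by apply Rmin_l. assert (He2b : e2 <= l - sth (x s0)) by apply Rmin_r.
  destruct (continuous_dependence x s0 e2 Hx (Rlt_le _ _ Hs0) He2) as [d [Hd Hdep]].
  exists d. split; auto. intros y Hy Hn t (h1 & h2 & h3).
  assert (Hns : near e2 (x s0) (y s0)) by (apply Hdep; auto; rewrite Rabs_pos_eq; lra).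
  assert (Hyl : sth (y s0) < l) by (apply near_elim in Hns; lra).
  assert (HnL : near d2 (y s0) (St 0 (- vs) l 0)).
  { apply near_weaken with (e2 + d2 / 2); [lra|]. eapply near_trans; [apply near_sym; eauto|auto]. }
  assert (Hst : s0 < t).
  { destruct (Rlt_dec s0 t); auto. exfalso.
    destruct (Rle_lt_or_eq_dec t s0 ltac:(lra)) as [k|k]; [|subst; lra].
    destruct (near_elim _ _ _ (Hdep y Hy Hn t ltac:(rewrite Rabs_pos_eq; lra))) as (_ & _ & k2 & _).
    assert (sth (x t) < sth (x s0)); [|lra]. apply th_incr; auto. intros; apply Hw; lra. }
  destruct (th_ivt y s0 t l) as [u [Hu1 [Hu2 Hu3]]]; auto; try lra.
  assert (Hut : u < t) by (destruct Hu1 as [_ [k|k]]; auto; subst; lra).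
  assert (HnU : near (d1 / 2) (y u) (St 0 (- vs) l 0)).
  { assert (hh := Happ (fun s => y (s + s0)) (u - s0) (sol_translate y s0 Hy)). cbv beta in hh.
    rewrite Rplus_0_l in hh. replace (u - s0 + s0) with u in hh by ring. apply hh; auto; try lra.
    - intros s hs. apply h3; lra.
    - left. apply h3. lra. }
  destruct (sol_local_near y u (d1 / 2) Hy ltac:(lra)) as [d3 [Hd3 H3]].
  set (u' := u + Rmin (d3 / 2) ((t - u) / 2)).
  rminp (d3 / 2) ((t - u) / 2).
  assert (Hu' : u < u' < t) by (unfold u'; lra).
  assert (HnU' : near d1 (y u') (St 0 (- vs) l 0)).
  { apply near_weaken with (d1 / 2 + d1 / 2); [lra|]. apply near_trans with (y u); auto. apply near_sym, H3. apply Rabs_def1; unfold u'; lra. }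
  assert (Hthu' : l < sth (y u')) by (rewrite <- Hu2; apply th_incr; auto; [lra|intros; apply h3; lra]).
  destruct (Hfol (fun s => y (s + u')) (t - u')) as [r1 r2].
  - apply sol_translate; auto.
  - lra.
  - rewrite Rplus_0_l. apply near_elim in HnU'. simpl in HnU'. lra.
  - rewrite Rplus_0_l. auto.
  - intros s hs. apply h3. lra.
  - rewrite Rplus_0_l. left. apply h3. lra.
  - replace (t - u' + u') with t by ring. auto.
  - replace (t - u' + u') with t in * by ring. auto.
Qed.

(** By [approach_stays] a turning neighbour stops close to the lower equilibrium at [- ths]. Its
    mirror image then starts close to the lower equilibrium at [ths], and [follow] takes it along
    [b]. *)
Lemma turn_follow p b : sec p -> 0 < sr p -> asym p -> departure b ths -> sv (b 0) < 0 -> sth (b 0) = PI / 2 ->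
  forall e, 0 < e -> open_at p (fun q => forall q', ret q q' -> Rabs (sv q' - sv (b 0)) < e /\ sr q' < e).
Proof.
  intros Hp Hr [Hw Ht] Hb Hvb Hthb e He.
  assert (Hl : - ths = ths \/ - ths = - ths) by auto. destruct (V_ths_cases (- ths) Hl) as (hV & hl & hq & hc).
  destruct ths_int as [ht1 ht2].
  assert (Hx := orb_sol p Hp).
  destruct (follow b ths ltac:(auto) Hb Hvb ltac:(lra)) with (e := e) as [d1 [Hd1 Hfol]]; auto.
  { intros t h. left. apply q_pos'. lra. }
  destruct (approach_stays (- ths) Hl (d1 / 2) ltac:(lra)) as [d2 [Hd2 Happ]].
  destruct (homothetic_limit (flow p) (- ths) Hx) with (e := d2 / 2) as [s00 [Hs00 Hlim]]; auto; try lra.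
  { intros; apply Hw; lra. }
  { now rewrite orb_0. }
  set (s0 := s00 + 1). assert (Hs0' : 0 < s0) by (unfold s0; lra). assert (Hs0 : 0 <= s0) by lra.
  destruct (Hlim s0 ltac:(unfold s0; lra)) as [_ Hn0]. clearbody s0.
  assert (Hxl : sth (flow p s0) < - ths) by (apply Ht; auto).
  replace (sqrt (2 * V (- ths))) with vs in Hn0 by (unfold vs; now rewrite hV).
  destruct (continuous_min_pos (fun s => sw (flow p s)) 0 s0 Hs0) as [m [Hm Hmw]].
  { intros; apply sol_cw; auto. }
  { intros; apply Hw; lra. }
  set (e2 := Rmin (d2 / 2) m). assert (He2 : 0 < e2) by pos.
  assert (He2a : e2 <= d2 / 2) by apply Rmin_l. assert (He2b : e2 <= m) by apply Rmin_r.
  destruct (continuous_dependence (flow p) s0 e2 Hx Hs0 He2) as [d [Hd Hdep]].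
  exists d. split; auto. intros q Hq Hn q' (t1 & t2 & h1 & h2 & h3).
  assert (Hy := orb_sol q Hq).
  assert (Hdep' : forall s, 0 <= s <= s0 -> near e2 (flow p s) (flow q s)).
  { intros s hs. apply Hdep; auto; [now rewrite !orb_0|rewrite Rabs_pos_eq; lra]. }
  assert (HnL : near d2 (flow q s0) (St 0 (- vs) (- ths) 0)).
  { apply near_weaken with (e2 + d2 / 2); [lra|]. eapply near_trans; [apply near_sym; apply Hdep'; lra|auto]. }
  destruct h1 as (k1 & k2 & k3 & k4).
  assert (Hst : s0 < t1).
  { apply Rnot_le_lt. intros hn. pose proof (near_elim _ _ _ (Hdep' t1 ltac:(lra))) as k.
    specialize (Hmw t1 ltac:(lra)). lra. }
  assert (Hn1 : near (d1 / 2) (flow q t1) (St 0 (- vs) (- ths) 0)).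
  { assert (hh := Happ (fun s => flow q (s + s0)) (t1 - s0) (sol_translate _ s0 Hy)). cbv beta in hh.
    rewrite Rplus_0_l in hh. replace (t1 - s0 + s0) with t1 in hh by ring. apply hh; auto; try lra.
    intros s hs. apply k4; lra. }
  destruct (turn_mirror q t1 Hq ltac:(split; auto)) as [Hz _].
  destruct (turn_q q t1 Hq ltac:(split; auto)) as [_ hth].
  apply near_elim in Hn1. simpl in Hn1. destruct h2 as (l1 & l2 & l3).
  destruct (Hfol (fun s => mir (flow q (s + t1))) t2) as [r1 r2]; auto.
  - simpl. rewrite Rplus_0_l. lra.
  - rewrite Rplus_0_l. apply near_intro; simpl; lra.
  - simpl. rewrite Rplus_0_l. lra.
  - rewrite Hthb. auto.
  - replace (sv q') with (sv (shift q')) by reflexivity. replace (sr q') with (sr (shift q')) by reflexivity.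
    rewrite h3. auto.
Qed.

Lemma departure_sol b l : departure b l -> sol b.
Proof. intros [[H _] _]. auto. Qed.

(** The reversor [theta -> - theta], [v -> - v] exchanges departures and arrivals. *)
Definition flip (b : R -> state) (s : R) : state := rev (mir (b (0 - s))).

Lemma flip_coll b : coll b -> coll (flip b).
Proof.
  intros [H h]. split.
  - unfold flip. apply (sol_rev (fun s => mir (b s)) 0). apply sol_mir. auto.
  - unfold flip; simpl. now rewrite Rminus_0_r.
Qed.

Lemma departure_arrival b l : departure b l -> sv (b 0) < vs -> arrival (flip b) (- l).
Proof.
  intros (Hb & Hw & Hth & Hlim) Hv. split; [apply flip_coll; auto|split; [split|split]].
  - intros s Hs. simpl. specialize (Hth (0 - s) ltac:(lra)). lra.
  - intros e He. destruct (Hlim e He) as [s0 [h1 h2]]. exists (- s0). split; [lra|]. intros s Hs.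
    specialize (h2 (0 - s) ltac:(lra)). apply near_elim in h2. simpl in *. lra.
  - intros s Hs. simpl. specialize (Hw (0 - s) ltac:(lra)). lra.
  - simpl. rewrite Rminus_0_r. lra.
Qed.

Lemma departure_v b l : departure b l -> - vs < sv (b 0) /\ forall s, s <= 0 -> - vs <= sv (b s).
Proof.
  intros (Hb & Hw & Hth & Hlim).
  assert (hm : forall s, s <= 0 -> - vs <= sv (b s)).
  { intros s Hs. destruct (Rle_dec (- vs) (sv (b s))) as [|hn]; auto. exfalso.
    assert (hpos : 0 < - vs - sv (b s)) by lra. destruct (Hlim _ hpos) as [s0 [h1 h2]].
    specialize (h2 (Rmin s0 s) (Rmin_l _ _)). apply near_elim in h2. change (sv (St 0 (- vs) l 0)) with (- vs) in h2.
    assert (sv (b (Rmin s0 s)) <= sv (b s)) by (apply coll_v_nondecr; auto; apply Rmin_r). lra. }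
  split; auto. apply Rle_lt_trans with (sv (b (-1))); [apply hm; lra|].
  apply (incr (fun s => sv (b s)) (fun s => Fv (b s))); [lra|intros; apply sol_dv, Hb|].
  intros s hs. rewrite (Fv_eq _ (sol_P1 b s (coll_sol b Hb))), coll_r by auto.
  assert (0 < sw (b s)) by (apply (Hw s); lra). assert (0 < sw (b s) ^ 2) by (apply pow_lt; auto). pose proof (c_pos (sth (b s))).
  assert (0 < c (sth (b s)) * sw (b s) ^ 2) by pos. lra.
Qed.

End Openness.

(** The branches of the theorem, with time [0] moved to the crossing of [- PI / 2] ([gam]) and of
    [0] ([gam']). The shift by [PI] moves the equilibrium at [ths - PI] to [ths], so that both fit
    [departure]. *)
Class branches {S : system} := {
  gam : R -> state;
  gam' : R -> state;
  gam_dep : departure (fun s => shift (gam s)) ths;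
  gam_sol : sol gam;
  gam_th : sth (gam 0) = - (PI / 2);
  gam_v : sv (gam 0) < 0;
  gam_hit : exists t, whit gam 0 t /\ 0 < sv (gam t);
  gam'_dep : departure gam' (- ths);
  gam'_th : sth (gam' 0) = 0;
  gam'_v : sv (gam' 0) < 0
}.

(** * Consequences of the signs of [v] along the two branches *)

Section Branches.
Context {S : system} {B : branches}.

Lemma gam_sec : sec (gam 0).
Proof.
  split; [apply sol_P1, gam_sol|split; [apply gam_th|]].
  destruct gam_dep as (_ & h & _). specialize (h 0 ltac:(lra)). simpl in h. auto.
Qed.

Lemma gam_r : sr (gam 0) = 0.
Proof. destruct gam_dep as ([_ h] & _). exact h. Qed.

Lemma gam_flow s : flow (gam 0) s = gam s.
Proof. rewrite (sol_flow gam 0 s gam_sol). f_equal. ring. Qed.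

Lemma gam_pos : hitsP (fun v => 0 < v) (gam 0).
Proof.
  destruct gam_hit as [t [h1 h2]]. exists t. rewrite gam_flow. split; auto.
  apply (whit_ext gam); auto. intros; symmetry; apply gam_flow.
Qed.

Lemma asym_hits p e : sec p -> 0 < sr p -> asym p -> 0 < e ->
  open_at p (fun q => forall t, whit (flow q) 0 t -> near e (gam' 0) (flow q t)).
Proof.
  intros Hp Hr Ha He. destruct ths_int as [ht1 ht2].
  assert (Hg' : sol gam') by (eapply departure_sol, gam'_dep).
  destruct (near_at_angle (gam' 0) e) as [d1 [Hd1 H1]]; auto.
  { apply sol_P1; auto. }
  { apply gam'_dep. lra. }
  destruct (exit_follow (flow p) (- ths) gam' (orb_sol p Hp)) with (e := d1) as [d [Hd H]]; auto.
  - intros; apply Ha; lra.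
  - apply Ha.
  - now rewrite orb_0.
  - apply gam'_dep.
  - apply gam'_v.
  - rewrite gam'_th. lra.
  - rewrite gam'_th. intros t h. left. apply q_pos. lra.
  - exists d. split; auto. intros q Hq Hn t Ht.
    destruct (H (flow q) (orb_sol q Hq)) with (t := t) as [h1 h2]; [now rewrite !orb_0|now rewrite gam'_th|].
    assert (hr' : sr (gam' 0) = 0) by apply gam'_dep.
    destruct (sol_P1 (flow q) t (orb_sol q Hq)) as [hr _].
    apply H1; auto.
    + apply sol_P1, orb_sol; auto.
    + rewrite gam'_th. apply Ht.
    + destruct Ht as (k1 & k2 & k3). apply k3. lra.
    + rewrite hr'. apply Rabs_def1; lra.
Qed.

Lemma asym_ret p e : sec p -> 0 < sr p -> asym p -> 0 < e ->
  open_at p (fun q => forall q', ret q q' -> near e (gam 0) q').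
Proof.
  intros Hp Hr Ha He.
  destruct (turn_follow p (fun s => shift (gam s)) Hp Hr Ha gam_dep) with (e := e) as [d [Hd H]]; auto.
  - apply gam_v.
  - simpl. rewrite gam_th. lra.
  - exists d. split; auto. intros q Hq Hn q' Hq'. destruct (H q Hq Hn q' Hq') as [h1 h2]. simpl in h1.
    assert (hs := ret_sec q q' Hq Hq'). apply near_sym. apply sec_near; auto; [apply gam_sec|].
    rewrite gam_r. destruct hs as [[hr _] _]. apply Rabs_def1; lra.
Qed.

Lemma asym_no_pos p : sec p -> 0 < sr p -> asym p -> open_at p (fun q => hits q -> hitsP (fun v => v < 0) q).
Proof.
  intros Hp Hr Ha. assert (hv : 0 < - sv (gam' 0)) by (pose proof gam'_v; lra). destruct (asym_hits p _ Hp Hr Ha hv) as [d [Hd H]].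
  exists d. split; auto. intros q Hq Hn [t Ht]. exists t. split; auto. specialize (H q Hq Hn t Ht). apply near_elim in H. lra.
Qed.

Lemma asym_ret_pos p : sec p -> 0 < sr p -> asym p -> open_at p (fun q => forall q', ret q q' -> hitsP (fun v => 0 < v) q').
Proof.
  intros Hp Hr Ha. destruct (hits_pos_open (gam 0) gam_sec gam_pos) as [e [He H]].
  destruct (asym_ret p e Hp Hr Ha He) as [d [Hd H1]]. exists d. split; auto. intros q Hq Hn q' Hq'.
  apply H; [eapply ret_sec; eauto|eapply H1; eauto].
Qed.

(** This reversed mirror image of [gam] arrives at the upper equilibrium at [- ths]. Its value of
    [v] on the section, [- sv (gam 0)], separates the collision orbits that pass [- ths] from those
    that turn before it. *)
Definition Gam1 := flip (fun s => shift (gam s)).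

Lemma Gam1_arrival : arrival Gam1 (- ths).
Proof. apply departure_arrival; [apply gam_dep|]. pose proof gam_v. pose proof vs_pos. simpl. lra. Qed.

Lemma Gam1_0 : sth (Gam1 0) = - (PI / 2) /\ sv (Gam1 0) = - sv (gam 0).
Proof. unfold Gam1, flip; simpl. rewrite Rminus_0_r, gam_th. split; lra. Qed.

Lemma sec_coll p : sec p -> sr p = 0 -> coll (flow p).
Proof. intros Hp Hr. split; [apply orb_sol; auto|now rewrite orb_0]. Qed.

Lemma coll_pass p : sec p -> sr p = 0 -> - vs < sv p < - sv (gam 0) -> exists t, whit (flow p) (- ths) t.
Proof.
  intros Hp Hr Hv. destruct Gam1_0 as [h1 h2]. destruct ths_int.
  apply (pass_below Gam1 (- ths)); auto using Gam1_arrival, sec_coll; try rewrite !orb_0; auto; try lra.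
  - intros t h. apply q_neg. lra.
  - rewrite h1. apply Hp.
  - apply Hp.
Qed.

Lemma coll_turn p : sec p -> sr p = 0 -> - sv (gam 0) < sv p -> turns p.
Proof.
  intros Hp Hr Hv. destruct Gam1_0 as [h1 h2]. destruct ths_int. pose proof gam_v. pose proof vs_pos.
  apply (turn_above Gam1 (- ths)); auto using Gam1_arrival, sec_coll; try rewrite !orb_0; auto; try lra.
  - intros t h. apply q_neg. lra.
  - rewrite h1. apply Hp.
  - apply Hp.
Qed.

(** For [r = v = 0] the start is below the threshold [- sv (gam 0) > 0], so [- ths] is passed. This
    persists for small [r], and [r > 0] then brings the orbit to the Euler line. *)
Lemma small_hits : exists d, 0 < d /\ forall r, 0 < r < d -> hits (sig r 0).
Proof.
  assert (Hs : sec (sig 0 0)) by (apply sec_sig; lra). destruct ths_int as [ht1 ht2].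
  destruct (coll_pass (sig 0 0)) as [t Ht]; auto; [simpl; pose proof gam_v; pose proof vs_pos; lra|].
  destruct (sec_whit_near (sig 0 0) (- ths) t 1 Hs Ht Rlt_0_1) as [d [Hd H]].
  exists d. split; auto. intros r Hr. assert (Hsr : sec (sig r 0)) by (apply sec_sig; lra).
  destruct (H (sig r 0) Hsr) as [t' [Ht' _]].
  { apply sec_near; auto; simpl; apply Rabs_def1; lra. }
  destruct (trichotomy (sig r 0) Hsr) as [h|[[u h]|h]]; auto; [simpl; lra| |]; exfalso.
  - apply (turn_not_whit _ _ _ _ h Ht'). apply orb_sol; auto.
  - destruct h as [_ [h _]]. destruct Ht' as (k1 & k2 & _). specialize (h t'). lra.
Qed.

End Branches.

(** * Changes of outcome along a parameter; orbits of large radius *)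

Lemma first_change (A B : R) (P : R -> Prop) : A < B -> (exists e, 0 < e /\ forall r, A < r < A + e -> P r) -> ~ P B ->
  (forall r, A < r < B -> P r -> exists d, 0 < d /\ forall r', Rabs (r' - r) < d -> P r') ->
  exists s, A < s <= B /\ ~ P s /\ forall r, A < r < s -> P r.
Proof.
  intros HAB [e [He HP]] HB Hop.
  set (E := fun s => A < s <= B /\ forall r, A < r < s -> P r).
  assert (HE : E (A + Rmin e (B - A))).
  { rminp e (B - A).
    split; [lra|]. intros r Hr. apply HP. lra. }
  destruct (completeness E) as [s [Hs1 Hs2]].
  { exists B. intros x [hx _]. lra. }
  { eexists; apply HE. }
  assert (HAs : A < s). { specialize (Hs1 _ HE). assert (0 < Rmin e (B - A)) by pos. lra. }
  assert (HsB : s <= B) by (apply Hs2; intros x [hx _]; lra).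
  assert (Hbel : forall r, A < r < s -> P r).
  { intros r Hr. destruct (classic (P r)) as [|hn]; auto. exfalso.
    assert (s <= r); [|lra]. apply Hs2. intros x [hx h]. destruct (Rle_dec x r); auto. exfalso. apply hn, h. lra. }
  exists s. split; auto. split; auto. intros hPs.
  assert (hlt : s < B) by (destruct HsB as [|h]; auto; subst; tauto).
  destruct (Hop s) as [d [Hd H]]; auto.
  set (s' := Rmin B (s + d / 2)).
  assert (s < s' <= B) by (unfold s'; split; [pos|apply Rmin_l]).
  assert (s' <= s + d / 2) by apply Rmin_r.
  assert (E s').
  { split; [lra|]. intros r Hr. destruct (Rlt_dec r s); [apply Hbel; lra|]. apply H. rewrite Rabs_pos_eq; lra. }
  specialize (Hs1 _ H2). lra.
Qed.

Lemma last_change (A B : R) (P : R -> Prop) : A < B -> ~ P A -> P B ->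
  (forall r, A < r <= B -> P r -> exists d, 0 < d /\ forall r', Rabs (r' - r) < d -> P r') ->
  exists s, A <= s < B /\ ~ P s /\ forall r, s < r <= B -> P r.
Proof.
  intros HAB HA HB Hop.
  set (E := fun s => A <= s <= B /\ ~ P s).
  assert (HE : E A) by (split; auto; lra).
  destruct (completeness E) as [s [Hs1 Hs2]].
  { exists B. intros x [hx _]. lra. }
  { now exists A. }
  assert (HAs : A <= s) by now apply Hs1.
  assert (HsB : s <= B) by (apply Hs2; intros x [hx _]; lra).
  assert (Hab : forall r, s < r <= B -> P r).
  { intros r Hr. destruct (classic (P r)) as [|hn]; auto. exfalso.
    assert (r <= s); [|lra]. apply Hs1. split; auto. lra. }
  assert (hnP : ~ P s).
  { intros hPs. destruct HAs as [HAs|HAs]; [|subst; tauto]. destruct (Hop s) as [d [Hd H]]; auto.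
    set (s' := s - d / 2). assert (s <= s'); [|unfold s' in *; lra].
    apply Hs2. intros x [hx h]. apply Rnot_lt_le. intros hn. apply h.
    assert (x <= s) by (apply Hs1; split; auto). apply H. apply Rabs_def1; unfold s' in *; lra. }
  exists s. split; [|split; auto]. split; auto. destruct HsB as [|h]; auto. subst. tauto.
Qed.

Section Large.
Context {S : system}.

Lemma v_lipschitz : exists M, 0 < M /\ forall x s t, sol x -> Rabs (sv (x s) - sv (x t)) <= M * Rabs (s - t).
Proof.
  destruct W_bounds as (Wm & WM & HWm & HWM & HW). exists (2 * WM). split; [lra|]. intros x s t Hx.
  apply (derive_bounded_lipschitz (fun s => sv (x s)) (fun s => Fv (x s))).
  - intros u. apply sol_dv; auto.
  - intros u. destruct (P1_bounds _ (sol_P1 x u Hx)) as (h0 & h1 & h2 & h3). specialize (HW (sth (x u))).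
    unfold Fv. apply Rabs_le. lra.
Qed.

Lemma r_growth x K T : sol x -> 0 <= T -> (forall s, 0 <= s <= T -> Rabs (sv (x s)) <= K) ->
  forall s, 0 <= s <= T -> sr (x 0) * exp (- K * s) <= sr (x s) <= sr (x 0) * exp (K * s).
Proof.
  intros Hx HT HK s Hs.
  assert (Hco : forall u, 0 <= u <= T -> - K * sr (x u) <= Fr (x u) <= K * sr (x u)).
  { intros u Hu. specialize (HK u Hu). destruct (sol_P1 x u Hx) as [Hr _].
    unfold Fr. set (k := cos (sth (x u))). assert (hk : 0 <= k ^ 2 <= 1).
    { split; [apply pow2_ge_0|]. unfold k. pose proof (COS_bound (sth (x u))). nra. }
    assert (h : Rabs (sv (x u) * k ^ 2) <= K).
    { rewrite Rabs_mult, (Rabs_pos_eq (k ^ 2)) by lra. pose proof (Rabs_pos (sv (x u))).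
      assert (Rabs (sv (x u)) * k ^ 2 <= K * 1) by (apply Rmult_le_compat; lra). lra. }
    apply Rabs_le_between in h.
    replace (sr (x u) * sv (x u) * k ^ 2) with (sv (x u) * k ^ 2 * sr (x u)) by ring. split; apply Rmult_le_compat_r; lra. }
  split.
  - pose proof (gronwall_back (fun s => sr (x s)) (fun s => Fr (x s)) K 0 s ltac:(lra)) as G. cbv beta in G. rewrite Rminus_0_r in G.
    apply Rmult_le_reg_r with (exp (K * s)); [apply exp_pos|]. rewrite Rmult_assoc, <- exp_plus.
    replace (- K * s + K * s) with 0 by ring. rewrite exp_0, Rmult_1_r. apply G.
    + intros; apply sol_dr; auto.
    + intros; apply Hco; lra.
  - pose proof (gronwall (fun s => sr (x s)) (fun s => Fr (x s)) K 0 s ltac:(lra)) as G. cbv beta in G. rewrite Rminus_0_r in G.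
    apply G.
    + intros; apply sol_dr; auto.
    + intros; apply Hco; lra.
Qed.

(** For large [r] the fast oscillation about the collinear line prevents [w] from keeping its sign for half a unit of time. *)
Lemma no_linger Mv K : 0 < Mv -> 1 <= K -> exists R0, 0 < R0 /\ forall x a R1, sol x -> R0 <= R1 ->
  (forall s, a <= s <= a + / 2 -> R1 <= sr (x s) <= K * R1 /\ Rabs (sv (x s)) <= Mv /\ - (PI / 2) <= sth (x s) <= 0 /\ 0 <= sw (x s)) -> False.
Proof.
  intros HMv HK.
  destruct W_bounds as (Wm & WM & HWm & HWM & HWb). destruct c_bounds as (cm & cM & Hcm & HcM & Hcb).
  destruct (periodic_bounded c1) as [B1 [HB1 hc1]]; [apply c1_cont|apply c1_per|].
  destruct (periodic_bounded W1) as [BW [HBW hW1]]; [apply W1_cont|apply W1_per|].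
  destruct Fw_est as (KF & wM & HKF & HwM & HF).
  set (C := BW + Mv * wM + wM * wM * B1). assert (HC : 0 < C) by (unfold C; assert (0 < Mv * wM) by nra; assert (0 < wM * wM * B1) by pos; lra).
  set (C2 := 4 * wM + C). assert (HC2 : 0 < C2) by (unfold C2; lra).
  set (m := Rmin 1 (Wm / cM)). assert (Hm : 0 < m) by pos.
  assert (Hm1 : m <= 1) by apply Rmin_l. assert (Hm2 : m <= Wm / cM) by apply Rmin_r.
  assert (Hm3 : m * cM <= Wm). { replace Wm with (Wm / cM * cM) by (field; lra). apply Rmult_le_compat_r; lra. }
  set (X := 2 * (K + Mv * Mv) * (C2 * C2) / Wm). assert (HX : 0 < X).
  { unfold X. apply Rdiv_lt_0_compat; auto. apply Rmult_lt_0_compat; [nra|pos]. }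
  set (Y := 16 * C2 / (cm * m)). assert (HY : 0 < Y) by pos.
  exists (1 + 2 * WM + X + Y). split; [lra|]. intros x a R1 Hx HR1 H.
  assert (HR1p : 1 <= R1) by lra.
  set (k := fun s => cos (sth (x s))).
  assert (Hk : forall s, a <= s <= a + / 2 -> 0 <= k s <= 1 /\ sin (sth (x s)) <= - / 2).
  { intros s hs. destruct (H s hs) as (h1 & h2 & h3 & h4).
    assert (hk : 0 <= k s) by (apply cos_ge_0; lra). assert (hk1 : k s <= 1) by apply COS_bound. split; auto.
    assert (hsin : sin (sth (x s)) <= 0).
    { rewrite <- (Ropp_involutive (sth (x s))), sin_neg. assert (0 <= sin (- sth (x s))) by (apply sin_ge_0; lra). lra. }
    destruct (P1_bounds _ (sol_P1 x s Hx)) as (_ & _ & _ & h5). fold (k s) in h5. specialize (HWb (sth (x s))).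
    assert (hk2 : k s ^ 2 <= / 2).
    { apply Rmult_le_reg_l with R1; [lra|]. assert (R1 * k s ^ 2 <= sr (x s) * k s ^ 2) by (apply Rmult_le_compat_r; [apply pow2_ge_0|lra]). lra. }
    pose proof (sin2_cos2 (sth (x s))) as h6. unfold Rsqr in h6. fold (k s) in h6. clear - h6 hk2 hsin. nra. }
  assert (Hkd : forall s, is_derive k s (- sin (sth (x s)) * (sw (x s) * c (sth (x s))))).
  { intros s. unfold k. eapply is_derive_eq.
    { apply (is_derive_comp cos (fun s => sth (x s)) s (- sin (sth (x s))) (Fth (x s))); [auto_derive; auto; ring|apply sol_dth; auto]. }
    unfold scal; simpl; unfold mult, Fth; simpl. ring. }
  assert (Hkmono : forall u v, a <= u -> u <= v -> v <= a + / 2 -> k u <= k v).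
  { intros u v h1 h2 h3. apply (nondecr k _ u v h2 (fun s _ => Hkd s)). intros s hs.
    destruct (Hk s ltac:(lra)) as [_ h4]. destruct (H s ltac:(lra)) as (_ & _ & _ & h5). pose proof (c_pos (sth (x s))).
    apply Rmult_le_pos; [lra|pos]. }
  (* Two quarters of a unit of time conflict. In the second, [cos >= k1] pulls [w] down at rate
     [R1 * k1 - C], and the bound on [w] gives [k1 <= C2 / R1]. In the first, so small a [cos]
     leaves [w >= m] by energy, and [cos] grows to at least [cm * m / 8]. *)
  set (k1 := k (a + / 4)). assert (Hk1 : 0 <= k1) by (apply Hk; lra).
  assert (Hwdec : sw (x (a + / 2)) + (R1 * k1 - C) * (a + / 2) <= sw (x (a + / 4)) + (R1 * k1 - C) * (a + / 4)).
  { apply (nonincr (fun s => sw (x s) + (R1 * k1 - C) * s) (fun s => Fw (x s) + (R1 * k1 - C))); [lra| |].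
    - intros s _. apply (is_derive_plus (fun s => sw (x s)) (fun s => (R1 * k1 - C) * s)); [apply sol_dw; auto|auto_derive; auto; ring].
    - intros s hs. destruct (H s ltac:(lra)) as (h1 & h2 & h3 & h4). destruct (Hk s ltac:(lra)) as [h5 h6].
      destruct (HF (x s) (sol_P1 x s Hx)) as [_ h7]. rewrite Rabs_pos_eq in h7 by auto.
      assert (h8 : k1 <= k s) by (apply Hkmono; lra).
      specialize (hc1 (sth (x s))). specialize (hW1 (sth (x s))). apply Rabs_le_between in hc1, hW1, h2.
      unfold Fw. fold (k s). set (w := sw (x s)) in *. set (v := sv (x s)) in *. set (z := sin (sth (x s))) in *.
      assert (e1 : - / 2 * v * w * k s ^ 2 <= Mv * wM).
      { assert (hk2 : 0 <= k s ^ 2 <= 1) by (split; [apply pow2_ge_0|clear - h5; nra]).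
        assert (hvw : - (Mv * wM) <= v * w <= Mv * wM).
        { apply Rabs_le_between. rewrite Rabs_mult, (Rabs_pos_eq w) by auto. apply Rmult_le_compat; auto; [apply Rabs_pos|apply Rabs_le; lra]. }
        assert (0 <= Mv * wM) by pos.
        apply Rle_trans with (/ 2 * (Mv * wM) * k s ^ 2).
        - replace (- / 2 * v * w * k s ^ 2) with (/ 2 * (- (v * w)) * k s ^ 2) by ring. apply Rmult_le_compat_r; lra.
        - assert (/ 2 * (Mv * wM) * k s ^ 2 <= / 2 * (Mv * wM) * 1) by (apply Rmult_le_compat_l; lra). lra. }
      assert (e2 : - / 2 * w ^ 2 * c1 (sth (x s)) <= wM * wM * B1).
      { assert (hw2 : 0 <= w ^ 2 <= wM * wM) by (split; [apply pow2_ge_0|clear - h4 h7; nra]).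
        assert (w ^ 2 * (- c1 (sth (x s))) <= wM * wM * B1).
        { apply Rle_trans with (w ^ 2 * B1); [apply Rmult_le_compat_l; lra|apply Rmult_le_compat_r; lra]. }
        assert (0 <= wM * wM * B1) by pos. lra. }
      assert (e3 : k s * z * (2 * sr (x s) + v ^ 2) <= - (R1 * k1)).
      { assert (0 <= v ^ 2) by apply pow2_ge_0.
        assert (h9 : R1 * k1 <= k s * (- z) * (2 * sr (x s) + v ^ 2)).
        { apply Rle_trans with (k1 * / 2 * (2 * R1)); [right; field|].
          apply Rmult_le_compat; try lra. apply Rmult_le_compat; lra. }
        lra. }
      unfold C. lra. }
  assert (Hk1C : R1 * k1 <= C2).
  { destruct (H (a + / 2) ltac:(lra)) as (_ & _ & _ & h4).
    destruct (HF _ (sol_P1 x (a + / 4) Hx)) as [_ h7]. pose proof (Rle_abs (sw (x (a + / 4)))). unfold C2. lra. }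
  assert (Hsq : R1 * R1 * (k1 * k1) <= C2 * C2).
  { replace (R1 * R1 * (k1 * k1)) with ((R1 * k1) * (R1 * k1)) by ring. apply Rmult_le_compat; auto; pos. }
  assert (Hwlow : forall s, a <= s <= a + / 4 -> m <= sw (x s)).
  { intros s hs. destruct (H s ltac:(lra)) as (h1 & h2 & h3 & h4). destruct (Hk s ltac:(lra)) as [h5 h6].
    assert (h8 : k s <= k1) by (apply Hkmono; lra).
    pose proof (En_eq (x s) (sol_P1 x s Hx)) as e. fold (k s) in e. unfold En in e.
    specialize (HWb (sth (x s))). specialize (Hcb (sth (x s))).
    assert (hv2 : sv (x s) ^ 2 <= Mv * Mv) by (apply Rabs_le_between in h2; clear - h2; nra).
    assert (hE : sr (x s) + / 2 * sv (x s) ^ 2 <= (K + Mv * Mv) * R1).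
    { assert (0 <= Mv * Mv) by pos. assert (Mv * Mv * 1 <= Mv * Mv * R1) by (apply Rmult_le_compat_l; lra). lra. }
    assert (hkk : (sr (x s) + / 2 * sv (x s) ^ 2) * k s ^ 2 <= Wm / 2).
    { apply Rle_trans with ((K + Mv * Mv) * R1 * (k1 * k1)).
      - apply Rmult_le_compat; auto; [|apply pow2_ge_0|clear - h5 h8; nra].
        pose proof (pow2_ge_0 (sv (x s))). lra.
      - apply Rmult_le_reg_l with R1; [lra|].
        replace (R1 * ((K + Mv * Mv) * R1 * (k1 * k1))) with ((K + Mv * Mv) * (R1 * R1 * (k1 * k1))) by ring.
        apply Rle_trans with ((K + Mv * Mv) * (C2 * C2)); [apply Rmult_le_compat_l; [assert (0 <= Mv * Mv) by pos; lra|auto]|].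
        replace ((K + Mv * Mv) * (C2 * C2)) with (X * (Wm / 2)) by (unfold X; field; lra). apply Rmult_le_compat_r; lra. }
    assert (hw2 : Wm <= sw (x s) ^ 2 * cM).
    { assert (sw (x s) ^ 2 * c (sth (x s)) <= sw (x s) ^ 2 * cM) by (apply Rmult_le_compat_l; [apply pow2_ge_0|lra]). lra. }
    assert (hm2 : m <= sw (x s) ^ 2) by (apply Rmult_le_reg_r with cM; lra).
    clear - hm2 h4 Hm1 Hm. nra. }
  assert (Hkup : k a + / 2 * cm * m * (a + / 4) <= k (a + / 4) + / 2 * cm * m * a).
  { assert (k a - / 2 * cm * m * a <= k (a + / 4) - / 2 * cm * m * (a + / 4)); [|lra].
    apply (nondecr (fun s => k s - / 2 * cm * m * s) (fun s => - sin (sth (x s)) * (sw (x s) * c (sth (x s))) - / 2 * cm * m)); [lra| |].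
    - intros s _. apply (is_derive_minus k (fun s => / 2 * cm * m * s)); [apply Hkd|auto_derive; auto; ring].
    - intros s hs. destruct (Hk s ltac:(lra)) as [_ h6]. specialize (Hwlow s ltac:(lra)). specialize (Hcb (sth (x s))).
      assert (m * cm <= sw (x s) * c (sth (x s))) by (apply Rmult_le_compat; lra).
      assert (0 <= m * cm) by pos.
      assert (/ 2 * (m * cm) <= - sin (sth (x s)) * (sw (x s) * c (sth (x s)))) by (apply Rmult_le_compat; lra). lra. }
  assert (Hka : 0 <= k a) by (apply Hk; lra). fold k1 in Hkup.
  assert (hk1low : cm * m / 8 <= k1) by lra.
  assert (hcon : R1 * (cm * m / 8) <= C2) by (apply Rle_trans with (R1 * k1); auto; apply Rmult_le_compat_l; lra).
  assert (hY : Y * (cm * m / 8) = 2 * C2) by (unfold Y; field; split; lra).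
  assert (Y * (cm * m / 8) <= R1 * (cm * m / 8)) by (apply Rmult_le_compat_r; [|lra]; assert (0 < cm * m) by pos; lra).
  lra.
Qed.

Lemma hits_ths_energy x t : sol x -> sth (x t) = - ths -> sr (x t) <= V ths.
Proof.
  intros Hx Ht. destruct (V_ths_cases (- ths) ltac:(auto)) as (hV & _ & _ & hc).
  pose proof (En_le_V (x t) (sol_P1 x t Hx)) as h. rewrite Ht in h. specialize (h ltac:(lra)). rewrite hV in h.
  unfold En in h. pose proof (pow2_ge_0 (sv (x t))). lra.
Qed.

(** At [- ths] energy allows only [r <= V ths], and in one unit of time [r] changes by a bounded
    factor, so a large orbit stays before [- ths]. By [no_linger] it turns within half a unit, and
    the same lemma in reversed time bounds the way back. The bounds on [v] and [r] at the return
    permit iteration. *)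
Lemma large_ret M : 0 < M -> exists R K M', 0 < R /\ 0 < K /\ 0 < M' /\ forall p, sec p -> Rabs (sv p) <= M -> R <= sr p ->
  exists p', ret p p' /\ Rabs (sv p') <= M' /\ K * sr p <= sr p'.
Proof.
  intros HM. destruct v_lipschitz as [L [HL Hlip]]. destruct ths_int as [ht1 ht2].
  set (Mv := M + L). assert (HMv : 0 < Mv) by (unfold Mv; lra).
  assert (HX : 1 <= exp (2 * Mv)). { rewrite <- exp_0. left. apply exp_increasing. lra. }
  destruct (no_linger Mv (exp (2 * Mv)) HMv HX) as [R0 [HR0 Hlin]].
  set (k := exp (- Mv)). assert (Hk : 0 < k) by apply exp_pos.
  assert (HVp := V_ths_pos).
  exists ((R0 + V ths + 1) / k), k, Mv.
  split; [pos|]. split; auto. split; auto. intros p Hp Hv Hr.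
  assert (Hx := orb_sol p Hp). assert (H0 := orb_0 p Hp).
  set (R1 := sr p * k).
  assert (HR1 : R0 + V ths + 1 <= R1).
  { unfold R1. replace (R0 + V ths + 1) with ((R0 + V ths + 1) / k * k) by (field; lra). apply Rmult_le_compat_r; lra. }
  assert (Hrp : 0 < sr p). { apply Rmult_lt_reg_r with k; auto. fold R1. lra. }
  assert (HV : forall s, 0 <= s <= 1 -> Rabs (sv (flow p s)) <= Mv).
  { intros s hs. specialize (Hlip (flow p) s 0 Hx). rewrite H0, Rminus_0_r, (Rabs_pos_eq s) in Hlip by lra.
    replace (sv (flow p s)) with ((sv (flow p s) - sv p) + sv p) by ring. eapply Rle_trans; [apply Rabs_triang|].
    unfold Mv. assert (L * s <= L * 1) by (apply Rmult_le_compat_l; lra). lra. }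
  assert (HR : forall s, 0 <= s <= 1 -> R1 <= sr (flow p s) <= exp (2 * Mv) * R1).
  { intros s hs. pose proof (r_growth (flow p) Mv 1 Hx ltac:(lra) HV s hs) as [h1 h2]. rewrite H0 in h1, h2.
    assert (he : forall u v, u <= v -> exp u <= exp v) by (intros u v [h|h]; [left; apply exp_increasing; auto|right; now rewrite h]).
    split.
    - eapply Rle_trans; [|exact h1]. unfold R1, k. apply Rmult_le_compat_l; [lra|]. apply he. nra.
    - eapply Rle_trans; [exact h2|]. unfold R1, k. replace (exp (2 * Mv) * (sr p * exp (- Mv))) with (sr p * (exp (2 * Mv) * exp (- Mv))) by ring.
      rewrite <- exp_plus. apply Rmult_le_compat_l; [lra|]. apply he. nra. }
  assert (Hno : forall s, 0 <= s <= 1 -> sth (flow p s) <> - ths).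
  { intros s hs h. pose proof (hits_ths_energy (flow p) s Hx h). specialize (HR s hs). lra. }
  assert (Hth0 : sth (flow p 0) = - (PI / 2)) by (rewrite H0; apply Hp).
  assert (Hbelow : forall s, 0 <= s <= 1 -> sth (flow p s) < - ths).
  { intros s hs. apply Rnot_le_lt. intros hn.
    destruct (th_ivt (flow p) 0 s (- ths)) as [u [Hu1 [Hu2 Hu3]]]; auto; try lra.
    apply (Hno u); auto. lra. }
  assert (Hturn : exists t, turn (flow p) (- ths) t /\ t <= / 2).
  { destruct (classic (exists t, turn (flow p) (- ths) t /\ t <= / 2)) as [|hn]; auto. exfalso.
    assert (Hpos : forall s, 0 < s <= / 2 -> 0 < sw (flow p s)).
    { destruct (trichotomy p Hp Hrp) as [[t h]|[[t h]|h]].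
      - destruct (hits_whit_ths p t Hp h) as [u [(k1 & k2 & k3) hu]].
        assert (1 < u) by (destruct (Rlt_dec 1 u); auto; exfalso; apply (Hno u); auto; lra).
        intros s hs. apply k3; lra.
      - assert (/ 2 < t) by (destruct (Rlt_dec (/ 2) t); auto; exfalso; apply hn; exists t; split; auto; lra).
        destruct h as (k1 & k2 & k3 & k4). intros s hs. apply k4. lra.
      - intros s hs. apply h. lra. }
    apply (Hlin (flow p) 0 R1 Hx ltac:(lra)). intros s hs. split; [apply HR; lra|]. split; [apply HV; lra|].
    assert (hw : 0 <= sw (flow p s)).
    { destruct (Req_dec s 0) as [->|]; [rewrite H0; left; apply Hp|left; apply Hpos; lra]. }
    split; auto. split; [|left; eapply Rlt_trans; [apply Hbelow; lra|lra]].
    destruct (Req_dec s 0) as [->|]; [lra|]. rewrite <- Hth0. left. apply th_incr; auto; [lra|]. intros; apply Hpos; lra. }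
  destruct Hturn as [t [Ht Ht2]].
  destruct (turn_ret p Hp (ex_intro _ t Ht)) as [p' Hp']. exists p'. split; auto.
  destruct Hp' as (t1 & t2 & h1 & h2 & h3). rewrite (turn_unique _ _ _ _ Ht h1) in *. clear t Ht.
  destruct (turn_mirror p t1 Hp h1) as [Hy _].
  assert (Ht2' : t2 <= / 2).
  { apply Rnot_lt_le. intros hn.
    destruct h1 as (k1 & k2 & k3 & k4). destruct h2 as (l1 & l2 & l3). simpl in l2, l3.
    apply (Hlin (fun s => rev (flow p ((t1 + / 2) - s))) 0 R1 (sol_rev _ (t1 + / 2) Hx) ltac:(lra)).
    intros s hs. simpl. split; [apply HR; lra|]. split; [rewrite Rabs_Ropp; apply HV; lra|].
    set (u := / 2 - s). replace (t1 + / 2 - s) with (u + t1) by (unfold u; ring).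
    assert (hu : 0 <= u <= / 2) by (unfold u; lra).
    assert (hw : 0 <= - sw (flow p (u + t1))).
    { destruct (Req_dec u 0) as [->|]; [rewrite Rplus_0_l; lra|left; apply l3; lra]. }
    split; auto. split; [|left; eapply Rlt_trans; [apply Hbelow; lra|lra]].
    assert (hth : - sth (flow p (u + t1)) < - sth (flow p (t2 + t1))).
    { apply (th_incr (fun s => mir (flow p (s + t1))) u t2 Hy); [lra|]. intros; apply l3; lra. }
    lra. }
  destruct h1 as (k1 & _). destruct h2 as (l1 & _).
  replace (sv p') with (sv (shift p')) by reflexivity. replace (sr p') with (sr (shift p')) by reflexivity. rewrite h3. simpl.
  split; [apply HV; lra|]. rewrite Rmult_comm. apply HR. lra.
Qed.

Inductive retn : nat -> state -> state -> Prop :=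
| retn_O p : retn 0 p p
| retn_S k p p' p'' : retn k p p' -> ret p' p'' -> retn (Datatypes.S k) p p''.

Lemma retn_sec k p p' : sec p -> retn k p p' -> sec p'.
Proof. intros Hp H. induction H as [|k p p1 p2 h IH h2]; auto. exact (ret_sec _ _ (IH Hp) h2). Qed.

Lemma retn_r k p p' : sec p -> 0 < sr p -> retn k p p' -> 0 < sr p'.
Proof. intros Hp Hr H. induction H as [|k p p1 p2 h IH h2]; auto. exact (ret_r _ _ (retn_sec _ _ _ Hp h) h2 (IH Hp Hr)). Qed.

Lemma retn_unique k p p' p'' : sec p -> retn k p p' -> retn k p p'' -> p' = p''.
Proof.
  intros Hp H. revert p''. induction H as [|k p p1 p2 h IH h2]; intros p3 H3; inversion H3; subst; auto.
  rewrite <- (IH Hp _ H0) in H1. exact (ret_unique _ _ _ (retn_sec _ _ _ Hp h) h2 H1).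
Qed.

Lemma retn_cont k p p' : sec p -> retn k p p' -> forall e, 0 < e -> open_at p (fun q => exists q', retn k q q' /\ near e p' q').
Proof.
  intros Hp H. induction H as [p|k p p1 p2 h IH h2]; intros e He.
  - exists e. split; auto. intros q Hq Hn. exists q. split; auto. constructor.
  - assert (hs := retn_sec _ _ _ Hp h).
    destruct (ret_cont p1 p2 e hs h2 He) as [d1 [Hd1 H1]].
    destruct (IH Hp d1 Hd1) as [d [Hd H2]]. exists d. split; auto. intros q Hq Hn.
    destruct (H2 q Hq Hn) as [q1 [k1 k2]]. destruct (H1 q1 (retn_sec _ _ _ Hq k1) k2) as [q2 [k3 k4]].
    exists q2. split; auto. econstructor; eauto.
Qed.

Lemma large_retn N : forall M, 0 < M -> exists R, 0 < R /\ forall p, sec p -> Rabs (sv p) <= M -> R <= sr p ->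
  forall k, (k <= N)%nat -> exists p', retn k p p'.
Proof.
  (* [retn] adds returns at the end, whereas the induction on [N] peels off the first one. *)
  assert (Hcons : forall k p p' p'', ret p p' -> retn k p' p'' -> retn (Datatypes.S k) p p'').
  { intros k p p' p'' h H. revert p h. induction H as [q|k q q1 q2 H IH H2]; intros p h.
    - econstructor; [constructor|auto].
    - econstructor; [apply IH; auto|auto]. }
  induction N as [|N IH]; intros M HM.
  - exists 1. split; [lra|]. intros p Hp _ _ k Hk. replace k with 0%nat by lia. exists p. constructor.
  - destruct (large_ret M HM) as (R & K & M' & HR & HK & HM' & H).
    destruct (IH M' HM') as [R' [HR' H']].
    assert (HRK : 0 < R' / K) by pos.
    exists (R + R' / K). split; [lra|]. intros p Hp Hv Hr k Hk.
    destruct (H p Hp Hv ltac:(lra)) as [p' (h1 & h2 & h3)].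
    destruct k as [|k]; [exists p; constructor|].
    destruct (H' p') with (k := k) as [p'' h4]; auto; try lia.
    + eapply ret_sec; eauto.
    + eapply Rle_trans; [|exact h3]. replace R' with (K * (R' / K)) by (field; lra). apply Rmult_le_compat_l; lra.
    + exists p''. eapply Hcons; eauto.
Qed.
End Large.

(** * Shooting from the section *)

Section Chain.
Context {S : system} {B : branches}.

Definition At (k : nat) (A : state -> Prop) (r : R) : Prop := exists p, retn k (sig r 0) p /\ A p.

Lemma open_sig r A : 0 <= r -> open_at (sig r 0) A -> exists d, 0 < d /\ forall r', 0 <= r' -> Rabs (r' - r) < d -> A (sig r' 0).
Proof.
  intros Hr [d [Hd H]]. exists d. split; auto. intros r' Hr' h. apply H; [now apply sec_sig|].
  apply sec_near; auto; try now apply sec_sig.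
  - simpl. now rewrite Rabs_minus_sym.
  - simpl. rewrite Rminus_diag, Rabs_R0. auto.
Qed.

Lemma At_open k A r p : 0 < r -> retn k (sig r 0) p -> open_at p A ->
  exists d, 0 < d /\ forall r', Rabs (r' - r) < d -> 0 < r' /\ At k A r'.
Proof.
  intros Hr Hp [d [Hd H]].
  assert (Hs : sec (sig r 0)) by (apply sec_sig; lra).
  destruct (open_sig r _ ltac:(lra) (retn_cont k _ p Hs Hp d Hd)) as [d' [Hd' H']].
  exists (Rmin d' r). split; [pos|]. intros r' h.
  rmin d' r.
  assert (0 < r') by (apply Rabs_def2 in h; lra). split; auto.
  destruct (H' r' ltac:(lra) ltac:(lra)) as [p' [k1 k2]]. exists p'. split; auto.
  apply H; auto. apply (retn_sec _ _ _ (sec_sig r' 0 ltac:(lra)) k1).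
Qed.

Lemma At_both k A A' r : 0 < r -> At k A r -> At k A' r -> At k (fun p => A p /\ A' p) r.
Proof.
  intros Hr [p [h1 h2]] [p' [k1 k2]]. rewrite <- (retn_unique _ _ _ _ (sec_sig r 0 ltac:(lra)) h1 k1) in k2. now exists p.
Qed.

Lemma hitsP_hits Q p : hitsP Q p -> hits p.
Proof. intros [t [h _]]. now exists t. Qed.

Notation Pos := (hitsP (fun v => 0 < v)).

(** At the first parameter where [Pos] fails, openness excludes all outcomes but [v = 0]; near an asymptotic orbit, [v] is negative. *)
Lemma zero_between (Z : R -> state -> Prop) A C : A < C ->
  (forall r p, A < r <= C -> Z r p -> sec p /\ 0 < sr p) ->
  (forall r p p', A < r <= C -> Z r p -> Z r p' -> p = p') ->
  (forall r p e, A < r <= C -> Z r p -> 0 < e ->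
     exists d, 0 < d /\ forall r', A < r' <= C -> Rabs (r' - r) < d -> exists p', Z r' p' /\ near e p p') ->
  (forall r, A < r <= C -> exists p, Z r p) ->
  (exists e, 0 < e /\ forall r, A < r < A + e -> exists p, Z r p /\ Pos p) ->
  (forall p, Z C p -> ~ Pos p) ->
  exists r p, A < r <= C /\ Z r p /\ hitsP (fun v => v = 0) p.
Proof.
  intros HAC Hsec Hun Hcont Hex He HC.
  assert (Hopen : forall r p A', A < r <= C -> Z r p -> open_at p A' ->
    exists d, 0 < d /\ forall r', A < r' <= C -> Rabs (r' - r) < d -> exists p', Z r' p' /\ A' p').
  { intros r p A' Hr Hp [d [Hd H]]. destruct (Hcont r p d Hr Hp Hd) as [d' [Hd' H']]. exists d'. split; auto.
    intros r' Hr' h. destruct (H' r' Hr' h) as [p' [k1 k2]]. exists p'. split; auto. apply H; auto. apply (Hsec r' p' Hr' k1). }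
  destruct (first_change A C (fun r => exists p, Z r p /\ Pos p) HAC He) as [s [Hs [Hns Hbel]]].
  { intros [p [h1 h2]]. apply (HC p h1 h2). }
  { intros r Hr [p [h1 h2]]. assert (hr : A < r <= C) by lra.
    destruct (Hopen r p Pos hr h1) as [d [Hd H]].
    - apply hits_pos_open; auto. apply (Hsec r p hr h1).
    - set (d' := Rmin d (Rmin (r - A) (C - r))). assert (0 < d') by (unfold d'; pos).
      assert (d' <= d) by apply Rmin_l. assert (d' <= Rmin (r - A) (C - r)) by apply Rmin_r.
      rmin (r - A) (C - r).
      exists d'. split; auto. intros r' h. apply H; [|lra]. apply Rabs_def2 in h. lra. }
  destruct (Hex s Hs) as [p Hp]. destruct (Hsec s p Hs Hp) as [Hps Hpr].
  (* Parameters just below [s] satisfy [Pos], so no property open at [p] can be incompatible with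
     it. *)
  assert (Hcon : forall A', open_at p A' -> (forall p', sec p' -> A' p' -> Pos p' -> False) -> False).
  { intros A' h1 h2. destruct (Hopen s p A' Hs Hp h1) as [d [Hd H]].
    rminp d (s - A).
    set (r := s - Rmin d (s - A) / 2). assert (hr : A < r < s) by (unfold r; lra).
    destruct (H r ltac:(lra)) as [p' [h3 h4]]; [apply Rabs_def1; unfold r; lra|].
    destruct (Hbel r hr) as [p'' [h5 h6]]. rewrite (Hun r p'' p' ltac:(lra) h5 h3) in h6.
    apply (h2 p'); auto. apply (Hsec r p' ltac:(lra) h3). }
  exists s, p. split; auto. split; auto.
  destruct (trichotomy p Hps Hpr) as [[t h]|[h|h]].
  - exists t. split; auto. destruct (Rtotal_order (sv (flow p t)) 0) as [hv|[hv|hv]]; auto; exfalso.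
    + apply (Hcon (hitsP (fun v => v < 0))).
      * apply hits_neg_open; auto. exists t. auto.
      * intros p' k1 k2 k3. destruct (hits_unique _ _ _ k1 k2 k3) as [v hv']. cbv beta in hv'. lra.
    + apply Hns. exists p. split; auto. exists t. auto.
  - exfalso. apply (Hcon turns); [apply turns_open; auto|]. intros p' k1 k2 k3. apply (hits_not_turns p'); auto. eapply hitsP_hits; eauto.
  - exfalso. apply (Hcon _ (asym_no_pos p Hps Hpr h)). intros p' k1 k2 k3.
    destruct (hits_unique _ _ _ k1 (k2 (hitsP_hits _ _ k3)) k3) as [v hv']. cbv beta in hv'. lra.
Qed.

Lemma retn_zero k A C : 0 <= A < C -> (exists e, 0 < e /\ forall r, A < r < A + e -> At k Pos r) ->
  (forall r, A < r <= C -> exists p, retn k (sig r 0) p) -> ~ At k Pos C ->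
  exists r, A < r <= C /\ At k (hitsP (fun v => v = 0)) r.
Proof.
  intros HAC He Hret HC.
  destruct (zero_between (fun r p => retn k (sig r 0) p) A C) as (r & p & h1 & h2 & h3); auto; try lra.
  - intros r p Hr Hp. assert (hs : sec (sig r 0)) by (apply sec_sig; lra). assert (h0 : 0 < sr (sig r 0)) by (simpl; lra).
    split; [exact (retn_sec _ _ _ hs Hp)|exact (retn_r _ _ _ hs h0 Hp)].
  - intros r p p' Hr. apply retn_unique, sec_sig. lra.
  - intros r p e Hr Hp He'. destruct (open_sig r _ ltac:(lra) (retn_cont k _ p (sec_sig r 0 ltac:(lra)) Hp e He')) as [d [Hd H]].
    exists d. split; auto. intros r' Hr'. apply H. lra.
  - intros p h1 h2. apply HC. now exists p.
  - exists r. split; auto. now exists p.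
Qed.

(** For [k >= 1], [A] is the last parameter before [C] at which the preceding return point does not
    turn. That point is asymptotic, and just above [A] its turning neighbours come back close to
    [gam 0], hence meet the Euler line with [v > 0]. For [k = 0], [A = 0] and only the hit is known,
    not the sign of [v]. *)
Lemma window k C : 0 < C -> (forall j, (j <= Datatypes.S k)%nat -> exists p, retn j (sig C 0) p) ->
  exists A, 0 <= A < C /\ (forall r, A < r <= C -> exists p, retn k (sig r 0) p) /\
   (exists e, 0 < e /\ forall r, A < r < A + e -> At k hits r) /\
   ((1 <= k)%nat -> exists e, 0 < e /\ forall r, A < r < A + e -> At k Pos r).
Proof.
  intros HC. induction k as [|k IH]; intros Hret.
  - exists 0. split; [lra|]. split; [intros; eexists; constructor|]. split; [|lia].
    destruct small_hits as [d [Hd H]]. exists d. split; auto. intros r Hr. exists (sig r 0). split; [constructor|]. apply H. lra.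
  - destruct IH as (A & HA & H1 & [e [He H2]] & _); [intros; apply Hret; lia|].
    assert (Hnt : forall r, 0 < r -> At k hits r -> ~ At k turns r).
    { intros r Hr h1 h2. destruct (At_both k hits turns r Hr h1 h2) as [p [h3 [h4 h5]]].
      apply (hits_not_turns p); auto. apply (retn_sec _ _ _ (sec_sig r 0 ltac:(lra)) h3). }
    (* A parameter where the orbit hits and therefore does not turn, as [last_change] requires at
       its left end. *)
    set (A' := A + Rmin e (C - A) / 2).
    assert (HA' : A < A' < C /\ A' < A + e).
    { rminp e (C - A). unfold A'. lra. }
    destruct (last_change A' C (At k turns) ltac:(lra)) as [s [Hs [Hns Hab]]].
    + apply Hnt; [lra|]. apply H2. lra.
    + destruct (Hret (Datatypes.S k)) as [p Hp]; [lia|]. inversion Hp; subst. exists p'. split; auto. eapply ret_turns; eauto.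
    + intros r Hr [p [h1 h2]]. destruct (At_open k turns r p ltac:(lra) h1) as [d [Hd H]].
      * apply turns_open; auto. apply (retn_sec _ _ _ (sec_sig r 0 ltac:(lra)) h1).
      * exists d. split; auto. intros r' h. apply H; auto.
    + destruct (H1 s ltac:(lra)) as [p Hp].
      assert (Hps : sec p) by apply (retn_sec _ _ _ (sec_sig s 0 ltac:(lra)) Hp).
      assert (Hpr : 0 < sr p) by (assert (h0 : 0 < sr (sig s 0)) by (simpl; lra); exact (retn_r _ _ _ (sec_sig s 0 ltac:(lra)) h0 Hp)).
      assert (Hasym : asym p).
      { destruct (trichotomy p Hps Hpr) as [h|[h|h]]; auto; exfalso.
        - destruct (At_open k hits s p ltac:(lra) Hp (hits_open p Hps h)) as [d [Hd H]].
          rminp d (C - s).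
          destruct (H (s + Rmin d (C - s) / 2)) as [k1 k2]; [apply Rabs_def1; lra|].
          apply (Hnt _ k1 k2). apply Hab. lra.
        - apply Hns. now exists p. }
      destruct (At_open k _ s p ltac:(lra) Hp (asym_ret_pos p Hps Hpr Hasym)) as [d [Hd H]].
      assert (Hpos : forall r, s < r < s + Rmin d (C - s) -> At (Datatypes.S k) Pos r).
      { intros r Hr. rmin d (C - s).
        destruct (H r) as [k1 k2]; [apply Rabs_def1; lra|].
        destruct (At_both k _ _ r k1 k2 (Hab r ltac:(lra))) as [p' [k3 [k4 k5]]].
        destruct (turn_ret p' (retn_sec _ _ _ (sec_sig r 0 ltac:(lra)) k3) k5) as [p'' k6].
        exists p''. split; [econstructor; eauto|auto]. }
      exists s. split; [lra|]. split; [|split].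
      * intros r Hr. destruct (Hab r ltac:(lra)) as [p' [k1 k2]].
        destruct (turn_ret p' (retn_sec _ _ _ (sec_sig r 0 ltac:(lra)) k1) k2) as [p'' k3]. exists p''. econstructor; eauto.
      * exists (Rmin d (C - s)). split; [pos|]. intros r Hr.
        destruct (Hpos r Hr) as [p' [k1 k2]]. exists p'. split; auto. eapply hitsP_hits; eauto.
      * intros _. exists (Rmin d (C - s)). split; [pos|auto].
Qed.

Lemma chain_end k : exists C, 0 < C /\ (forall j, (j <= Datatypes.S k)%nat -> exists p, retn j (sig C 0) p) /\ At k turns C.
Proof.
  destruct (large_retn (Datatypes.S k) 1 ltac:(lra)) as [C [HC H]]. exists C. split; auto.
  assert (Hret : forall j, (j <= Datatypes.S k)%nat -> exists p, retn j (sig C 0) p).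
  { intros j. apply H; [apply sec_sig; lra| |simpl; lra]. simpl. rewrite Rabs_R0. lra. }
  split; auto. destruct (Hret (Datatypes.S k)) as [p Hp]; [lia|]. inversion Hp; subst. exists p'. split; auto. eapply ret_turns; eauto.
Qed.

Lemma not_pos_turns k C : 0 < C -> At k turns C -> ~ At k Pos C.
Proof.
  intros HC h1 h2. destruct (At_both k _ _ C HC h1 h2) as [p [h3 [h4 h5]]].
  apply (hits_not_turns p); auto; [apply (retn_sec _ _ _ (sec_sig C 0 ltac:(lra)) h3)|eapply hitsP_hits; eauto].
Qed.

Lemma zero_pos k : (1 <= k)%nat -> exists r, 0 < r /\ At k (hitsP (fun v => v = 0)) r.
Proof.
  intros Hk. destruct (chain_end k) as (C & HC & Hret & Hturn).
  destruct (window k C HC Hret) as (A & HA & H1 & _ & H2).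
  destruct (retn_zero k A C HA (H2 Hk) H1 (not_pos_turns k C HC Hturn)) as [r [Hr H]].
  exists r. split; auto. lra.
Qed.

(** At the first [b] whose orbit misses the Euler line the orbit is asymptotic, and [Pos] fails. A
    parameter below [b] with [v > 0] then gives a zero of [v] by [retn_zero]; in the absence of
    nonnegative values, the second alternative holds. *)
Lemma zero_or_neg : (exists r, 0 < r /\ hitsP (fun v => v = 0) (sig r 0)) \/
  exists b, 0 < b /\ asym (sig b 0) /\ forall r, 0 < r < b -> hitsP (fun v => v < 0) (sig r 0).
Proof.
  destruct (chain_end 0) as (C & HC & Hret & [p [Hp Hturn]]). inversion Hp; subst p. clear Hp.
  destruct small_hits as [d0 [Hd0 Hsmall]].
  destruct (first_change 0 C (fun r => hits (sig r 0)) HC) as [b [Hb [Hnb Hbel]]].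
  - exists d0. split; auto. intros r Hr. apply Hsmall. lra.
  - intros h. apply (hits_not_turns (sig C 0)); auto. apply sec_sig. lra.
  - intros r Hr h. assert (hs : sec (sig r 0)) by (apply sec_sig; lra).
    destruct (open_sig r hits ltac:(lra) (hits_open _ hs h)) as [d [Hd H]].
    exists (Rmin d r). split; [pos|]. rmin d r.
    intros r' h'. apply H; [apply Rabs_def2 in h'; lra|lra].
  - assert (hs : sec (sig b 0)) by (apply sec_sig; lra).
    assert (Hasym : asym (sig b 0)).
    { destruct (trichotomy (sig b 0) hs ltac:(simpl; lra)) as [h|[h|h]]; auto; [tauto|exfalso].
      destruct (open_sig b turns ltac:(lra) (turns_open _ hs h)) as [d [Hd H]].
      rminp d b.
      apply (hits_not_turns (sig (b - Rmin d b / 2) 0)); [apply sec_sig; lra|apply Hbel; lra|].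
      apply H; [lra|apply Rabs_def1; lra]. }
    destruct (classic (exists r, 0 < r < b /\ hitsP (fun v => 0 <= v) (sig r 0))) as [[r [Hr [t [ht hv]]]]|Hn].
    + left. destruct hv as [hv|hv]; [|exists r; split; [lra|exists t; auto]].
      destruct (retn_zero 0 r b) as [r' [Hr' [p [h1 h2]]]].
      * lra.
      * assert (hsr : sec (sig r 0)) by (apply sec_sig; lra).
        destruct (open_sig r _ ltac:(lra) (hits_pos_open _ hsr (ex_intro _ t (conj ht hv)))) as [d [Hd H]].
        exists d. split; auto. intros r' h. exists (sig r' 0). split; [constructor|]. apply H; [lra|apply Rabs_def1; lra].
      * intros; eexists; constructor.
      * intros [p [h1 h2]]. inversion h1; subst p. apply (asym_not_hits _ hs Hasym). eapply hitsP_hits; eauto.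
      * inversion h1; subst p. exists r'. split; [lra|auto].
    + right. exists b. split; [lra|]. split; auto. intros r Hr. destruct (Hbel r Hr) as [t ht]. exists t. split; auto.
      destruct (Rlt_dec (sv (flow (sig r 0) t)) 0) as [|hv]; auto. exfalso. apply Hn. exists r. split; auto. exists t. split; auto. lra.
Qed.
End Chain.

(** Gronwall is applied from the last zero on, where [f] is positive; the inequality is thus
    available exactly where it is assumed. *)
Lemma gronwall_sign (f f' : R -> R) (K a b : R) : a <= b -> (forall s, a <= s <= b -> is_derive f s (f' s)) ->
  (forall s, a < s < b -> 0 < f s -> f' s <= K * f s) -> f a <= 0 -> f b <= 0.
Proof.
  intros Hab Hd Hk Ha. apply Rnot_lt_le. intros hn.
  destruct (first_zero (fun s => - f (b - s)) 0 (b - a)) as [t [Ht1 [Ht2 Ht3]]].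
  - lra.
  - intros s hs. apply (continuous_opp (fun s => f (b - s))). apply (continuous_comp (fun s => b - s) f).
    + apply (continuous_minus (fun _ => b) (fun s => s)); [apply continuous_const|apply continuous_id].
    + eapply is_derive_continuous, Hd. lra.
  - rewrite Rminus_0_r. lra.
  - replace (b - (b - a)) with a by ring. lra.
  - cbv beta in Ht2.
    pose proof (gronwall f f' K (b - t) b ltac:(lra)) as G. assert (h : f b <= f (b - t) * exp (K * (b - (b - t)))).
    + apply G; [intros; apply Hd; lra|]. intros s hs. apply Hk; [lra|]. specialize (Ht3 (b - s) ltac:(lra)). cbv beta in Ht3.
      replace (b - (b - s)) with s in Ht3 by ring. lra.
    + replace (f (b - t)) with 0 in h by lra. lra.
Qed.

(** * The degenerate case *)

Section Ratios.
Context {S : system}.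

Lemma Fw_bounded M : exists K, 0 < K /\ forall x, P1 x -> Rabs (sr x) <= M -> Rabs (sv x) <= M -> Rabs (Fw x) <= K.
Proof.
  destruct (periodic_bounded c1) as [B1 [HB1 hc1]]; [apply c1_cont|apply c1_per|].
  destruct (periodic_bounded W1) as [BW [HBW hW1]]; [apply W1_cont|apply W1_per|].
  destruct Fw_est as (KF & wM & HKF & HwM & HF).
  exists (BW + Rabs M * wM + (2 * Rabs M + Rabs M * Rabs M) + wM * wM * B1 + 1).
  pose proof (Rabs_pos M) as hM. assert (0 <= Rabs M * wM) by pos. assert (0 <= Rabs M * Rabs M) by pos.
  assert (0 <= wM * wM * B1) by pos. split; [lra|].
  intros x Hx hr hv. destruct (HF x Hx) as [_ hw]. pose proof (Rle_abs M).
  specialize (hc1 (sth x)). specialize (hW1 (sth x)). pose proof (COS_bound (sth x)) as hk. pose proof (SIN_bound (sth x)) as hz.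
  assert (ek : Rabs (cos (sth x) ^ 2) <= 1) by (rewrite Rabs_pos_eq by apply pow2_ge_0; clear - hk; nra).
  assert (ew : Rabs (sw x ^ 2) <= wM * wM).
  { replace (sw x ^ 2) with (sw x * sw x) by ring. rewrite Rabs_mult. apply Rmult_le_compat; auto; apply Rabs_pos. }
  assert (ev : Rabs (sv x ^ 2) <= Rabs M * Rabs M).
  { replace (sv x ^ 2) with (sv x * sv x) by ring. rewrite Rabs_mult. apply Rmult_le_compat; try apply Rabs_pos; lra. }
  assert (e1 : Rabs (sv x * sw x * cos (sth x) ^ 2) <= Rabs M * wM).
  { rewrite !Rabs_mult. rewrite <- (Rmult_1_r (Rabs M * wM)). apply Rmult_le_compat; auto; try apply Rabs_pos.
    - apply Rmult_le_pos; apply Rabs_pos.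
    - apply Rmult_le_compat; try apply Rabs_pos; lra. }
  assert (e2 : Rabs (sw x ^ 2 * c1 (sth x)) <= wM * wM * B1) by (rewrite Rabs_mult; apply Rmult_le_compat; auto; apply Rabs_pos).
  assert (e3 : Rabs (cos (sth x) * sin (sth x) * (2 * sr x + sv x ^ 2)) <= 2 * Rabs M + Rabs M * Rabs M).
  { rewrite Rabs_mult. rewrite <- (Rmult_1_l (2 * Rabs M + _)). apply Rmult_le_compat; try apply Rabs_pos.
    - rewrite Rabs_mult. rewrite <- (Rmult_1_l 1). apply Rmult_le_compat; try apply Rabs_pos; apply Rabs_le; lra.
    - eapply Rle_trans; [apply Rabs_triang|]. rewrite Rabs_mult, (Rabs_pos_eq 2) by lra. lra. }
  apply Rabs_le_between in hW1, e1, e2, e3. unfold Fw. apply Rabs_le. lra.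
Qed.

(** A collision orbit run at the pace that keeps its angle equal to that of [x], recorded through
    its pointwise values and rates only. *)
Definition rides (x y : R -> state) (s : R) : Prop :=
  P1 (y s) /\ sr (y s) = 0 /\ sth (y s) = sth (x s) /\ 0 < sw (y s) /\
  is_derive (fun s => sv (y s)) s (/ 2 * c (sth (x s)) * sw (x s) * sw (y s)) /\
  is_derive (fun s => sw (y s)) s (sw (x s) / sw (y s) * Fw (y s)).

(** [y] is the point of the orbit [b] that has the angle of [a]. *)
Lemma ride a b p p' : sol a -> coll b -> p <= p' -> (forall s, p <= s <= p' -> 0 < sw (b s)) ->
  exists y, forall s, sth (b p) <= sth (a s) <= sth (b p') -> rides a y s /\ exists u, p <= u <= p' /\ y s = b u.
Proof.
  intros Ha Hb Hp Hw. assert (Hbs := coll_sol _ Hb). destruct (extend_positive b p p' Hbs Hp Hw) as [e [He Hw']].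
  destruct (coupling a b (p - e) (p' + e) Ha Hbs ltac:(lra) Hw') as [g Hg]. exists (fun s => b (g s)). intros s Hs.
  assert (hr : sth (b (p - e)) < sth (a s) < sth (b (p' + e))).
  { assert (sth (b (p - e)) < sth (b p)) by (apply th_incr; auto; [lra|intros; apply Hw'; lra]).
    assert (sth (b p') < sth (b (p' + e))) by (apply th_incr; auto; [lra|intros; apply Hw'; lra]). lra. }
  destruct (Hg s hr) as (h1 & h2 & h3). destruct (th_reach b p p' (sth (a s)) Hbs Hp Hs) as [u [h4 h5]].
  assert (hu : g s = u) by (apply (th_injective b (p - e) (p' + e)); auto; lra).
  assert (hw : 0 < sw (b (g s))) by (apply Hw'; lra).
  split; [|exists u; split; [auto|now rewrite hu]].
  split; [apply sol_P1; auto|]. split; [apply coll_r; auto|]. split; auto. split; auto. split.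
  - eapply is_derive_eq; [apply (is_derive_comp (fun u => sv (b u)) g); [apply sol_dv; auto|exact h3]|].
    unfold scal; simpl; unfold mult; simpl. rewrite Fv_eq, coll_r, h2 by (auto; apply sol_P1; auto). field. lra.
  - apply (is_derive_comp (fun u => sw (b u)) g); [apply sol_dw; auto|exact h3].
Qed.

(** At equal angles, the logarithmic derivative of [(vb - v) / (w + wb)] is [- (qq / k) / wb + w * X / k]:
    comparing two such ratios only involves the sign of [q]. *)
Lemma ratio_rate k X qq cc W' v w vb wb fw fb : 0 < k -> 0 < w -> 0 < wb ->
  cc * w ^ 2 = 2 * W' - v ^ 2 * k ^ 2 -> cc * wb ^ 2 = 2 * W' - vb ^ 2 * k ^ 2 ->
  k * fw = qq - / 2 * v * k ^ 3 * w - w ^ 2 * X ->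
  k * fb = qq - / 2 * vb * k ^ 3 * wb - wb ^ 2 * X ->
  let al := - / 2 * w * (v + vb) * k ^ 2 / (w + wb) in
  / 2 * cc * w * (wb - w) = al * (vb - v) /\
  fw + w / wb * fb = (w + wb) * (qq / k / wb + al - w * X / k).
Proof.
  intros Hk Hw Hwb E1 E2 F1 F2 al. split.
  - apply Rmult_eq_reg_r with (w + wb); [|lra].
    replace (/ 2 * cc * w * (wb - w) * (w + wb)) with (/ 2 * w * (cc * wb ^ 2 - cc * w ^ 2)) by ring.
    rewrite E1, E2. unfold al. field. lra.
  - replace fw with (k * fw / k) by (field; lra). replace fb with (k * fb / k) by (field; lra). rewrite F1, F2.
    unfold al. field. repeat split; lra.
Qed.

Lemma P1_pair x y : P1 x -> P1 y -> sr x = 0 -> sr y = 0 -> sth y = sth x -> 0 < cos (sth x) -> 0 < sw x -> 0 < sw y ->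
  exists al, al = - / 2 * sw x * (sv x + sv y) * cos (sth x) ^ 2 / (sw x + sw y) /\
    / 2 * c (sth x) * sw x * (sw y - sw x) = al * (sv y - sv x) /\
    Fw x + sw x / sw y * Fw y = (sw x + sw y) * (q (sth x) / cos (sth x) / sw y + al
       - sw x * (c (sth x) * sin (sth x) + / 2 * c1 (sth x) * cos (sth x)) / cos (sth x)).
Proof.
  intros Hx Hy rx ry Ht Hk hw hwy.
  eexists. split; [reflexivity|].
  pose proof (En_eq x Hx) as e1. pose proof (En_eq y Hy) as e2. pose proof (Fw_eq x Hx) as f1. pose proof (Fw_eq y Hy) as f2.
  rewrite Ht in *. unfold En in e1, e2. rewrite rx in e1. rewrite ry in e2.
  apply (ratio_rate (cos (sth x)) (c (sth x) * sin (sth x) + / 2 * c1 (sth x) * cos (sth x)) (q (sth x)) (c (sth x)) (W (sth x))); auto; lra.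
Qed.

Lemma coll_rides x s : coll x -> 0 < sw (x s) -> rides x x s.
Proof.
  intros Hx Hw. assert (Hs := coll_sol _ Hx). split; [apply sol_P1; auto|]. split; [apply coll_r; auto|]. split; auto. split; auto. split.
  - eapply is_derive_eq; [apply sol_dv; auto|]. rewrite Fv_eq, coll_r by (auto; apply sol_P1; auto). ring.
  - eapply is_derive_eq; [apply sol_dw; auto|]. field. lra.
Qed.

(** Cleared of denominators, the claim is that [(vz - vx) / (wx + wz)] dominates
    [(vx - vy) / (wx + wy)]. By [ratio_rate] the difference of their logarithmic derivatives is
    [- (q / cos) * (/ wz - / wy)], nonnegative when [q <= 0] and [wz <= wy]. *)
Lemma ratio_compare x y z a b M m : coll x -> a <= b -> 0 < m ->
  (forall s, a <= s <= b -> 0 < sw (x s) /\ rides x y s /\ rides x z s /\ m <= sw (y s) /\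
     Rabs (sv (x s)) <= M /\ Rabs (sv (y s)) <= M /\ Rabs (sv (z s)) <= M) ->
  (forall s, a < s < b -> 0 < cos (sth (x s)) /\ q (sth (x s)) <= 0 /\ sw (z s) <= sw (y s) /\ 0 <= sv (x s) - sv (y s)) ->
  0 <= (sv (z a) - sv (x a)) * (sw (x a) + sw (y a)) - (sv (x a) - sv (y a)) * (sw (x a) + sw (z a)) ->
  0 <= (sv (z b) - sv (x b)) * (sw (x b) + sw (y b)) - (sv (x b) - sv (y b)) * (sw (x b) + sw (z b)).
Proof.
  intros Hx Hab Hm H1 H2 Ha. assert (Hs := coll_sol _ Hx).
  destruct (Fw_bounded M) as [KF [HKF HF]]. destruct Fw_est as (K0 & wM & _ & HwM & HwMb).
  assert (HM : 0 <= M) by (destruct (H1 a ltac:(lra)) as (_ & _ & _ & _ & h & _); pose proof (Rabs_pos (sv (x a))); lra).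
  set (K := M + (KF + wM / m * KF) / m). assert (HK : 0 <= K).
  { unfold K. assert (0 <= wM / m * KF) by (apply Rmult_le_pos; [apply Rlt_le, Rdiv_lt_0_compat|]; lra).
    assert (0 <= (KF + wM / m * KF) / m) by pos. lra. }
  set (f := fun s => (sv (x s) - sv (y s)) * (sw (x s) + sw (z s)) - (sv (z s) - sv (x s)) * (sw (x s) + sw (y s))).
  assert (Hfb : f b <= 0); [|unfold f in Hfb; lra].
  set (vd := fun u s => / 2 * c (sth (x s)) * sw (x s) * sw (u s : state)).
  set (wd := fun u s => sw (x s) / sw (u s) * Fw (u s : state)).
  apply (gronwall_sign f (fun s => (vd x s - vd y s) * (sw (x s) + sw (z s)) + (sv (x s) - sv (y s)) * (wd x s + wd z s)
    - ((vd z s - vd x s) * (sw (x s) + sw (y s)) + (sv (z s) - sv (x s)) * (wd x s + wd y s))) K a b); auto; [| |unfold f; lra].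
  - intros s hs. destruct (H1 s hs) as (hw & (_ & _ & _ & _ & y1 & y2) & (_ & _ & _ & _ & z1 & z2) & _).
    destruct (coll_rides x s Hx hw) as (_ & _ & _ & _ & x1 & x2).
    apply (is_derive_minus (fun s => (sv (x s) - sv (y s)) * (sw (x s) + sw (z s))) (fun s => (sv (z s) - sv (x s)) * (sw (x s) + sw (y s)))).
    + apply (is_derive_mult (fun s => sv (x s) - sv (y s)) (fun s => sw (x s) + sw (z s))); [| |apply Rmult_comm].
      * apply (is_derive_minus (fun s => sv (x s)) (fun s => sv (y s))); auto.
      * apply (is_derive_plus (fun s => sw (x s)) (fun s => sw (z s))); auto.
    + apply (is_derive_mult (fun s => sv (z s) - sv (x s)) (fun s => sw (x s) + sw (y s))); [| |apply Rmult_comm].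
      * apply (is_derive_minus (fun s => sv (z s)) (fun s => sv (x s))); auto.
      * apply (is_derive_plus (fun s => sw (x s)) (fun s => sw (y s))); auto.
  - intros s hs hf. destruct (H1 s ltac:(lra)) as (hw & (py & ry & ty & wy & _) & (pz & rz & tz & wz & _) & hm & m0 & m1 & m2).
    destruct (H2 s hs) as (hk & hq & hzy & hB). assert (px := sol_P1 x s Hs). assert (rx := coll_r x s Hx).
    destruct (P1_pair (x s) (y s)) as (ay & ey0 & ey1 & ey2); auto.
    destruct (P1_pair (x s) (z s)) as (az & ez0 & ez1 & ez2); auto.
    assert (exx : wd x s = Fw (x s)) by (unfold wd; field; lra).
    assert (haz : az <= M).
    { apply Rabs_le_between in m0, m2. rewrite ez0.
      assert (h1 : 0 <= sw (x s) / (sw (x s) + sw (z s)) <= 1).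
      { split; [pos|]. apply Rmult_le_reg_r with (sw (x s) + sw (z s)); [lra|]. field_simplify; lra. }
      assert (h2 : 0 <= cos (sth (x s)) ^ 2 <= 1) by (pose proof (COS_bound (sth (x s))) as hc; clear - hc hk; nra).
      replace (- / 2 * sw (x s) * (sv (x s) + sv (z s)) * cos (sth (x s)) ^ 2 / (sw (x s) + sw (z s))) with
        (/ 2 * (- (sv (x s) + sv (z s))) * (sw (x s) / (sw (x s) + sw (z s)) * cos (sth (x s)) ^ 2)) by (field; lra).
      assert (h3 : 0 <= sw (x s) / (sw (x s) + sw (z s)) * cos (sth (x s)) ^ 2 <= 1 * 1) by (split; [pos|apply Rmult_le_compat; lra]).
      set (u := sw (x s) / (sw (x s) + sw (z s)) * cos (sth (x s)) ^ 2) in *.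
      apply Rle_trans with (M * u); [apply Rmult_le_compat_r; lra|]. assert (M * u <= M * 1) by (apply Rmult_le_compat_l; lra). lra. }
    (* [la] is the logarithmic derivative of [wx + wy], bounded by means of [m]. That of [wx + wz]
       is expanded rather than estimated, so that only the terms in [q] survive in the
       difference. *)
    set (la := (Fw (x s) + wd y s) / (sw (x s) + sw (y s))).
    assert (hla : la <= (KF + wM / m * KF) / m).
    { assert (k0 := HF (x s) px). rewrite rx, Rabs_R0 in k0. specialize (k0 HM m0).
      assert (k1 := HF (y s) py). rewrite ry, Rabs_R0 in k1. specialize (k1 HM m1).
      assert (h1 : wd y s <= wM / m * KF).
      { unfold wd. apply Rle_trans with (Rabs (sw (x s) / sw (y s) * Fw (y s))); [apply Rle_abs|]. rewrite Rabs_mult.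
        apply Rmult_le_compat; auto; try apply Rabs_pos. rewrite Rabs_pos_eq by (apply Rlt_le, Rdiv_lt_0_compat; lra).
        destruct (HwMb (x s) px) as [_ h]. rewrite Rabs_pos_eq in h by lra.
        apply Rmult_le_compat; try lra; [apply Rlt_le, Rinv_0_lt_compat; lra|apply Rinv_le_contravar; lra]. }
      assert (h2 : 0 <= wM / m * KF) by (apply Rmult_le_pos; [apply Rlt_le, Rdiv_lt_0_compat|]; lra).
      apply Rabs_le_between in k0. unfold la.
      apply Rle_trans with ((KF + wM / m * KF) / (sw (x s) + sw (y s))).
      - apply Rmult_le_compat_r; [apply Rlt_le, Rinv_0_lt_compat; lra|lra].
      - apply Rmult_le_compat_l; [lra|]. apply Rinv_le_contravar; lra. }
    assert (hla2 : Fw (x s) + wd y s = (sw (x s) + sw (y s)) * la) by (unfold la; field; lra).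
    set (qk := q (sth (x s)) / cos (sth (x s))) in *.
    set (X := sw (x s) * (c (sth (x s)) * sin (sth (x s)) + / 2 * c1 (sth (x s)) * cos (sth (x s))) / cos (sth (x s))) in *.
    assert (hla3 : la = qk / sw (y s) + ay - X).
    { apply Rmult_eq_reg_l with (sw (x s) + sw (y s)); [|lra]. rewrite <- hla2. exact ey2. }
    assert (hz : Fw (x s) + wd z s = (sw (x s) + sw (z s)) * (qk / sw (z s) + az - X)) by exact ez2.
    assert (vy : vd x s - vd y s = ay * (sv (x s) - sv (y s))) by (unfold vd; lra).
    assert (vz : vd z s - vd x s = az * (sv (z s) - sv (x s))) by (unfold vd; lra).
    rewrite exx, hla2, hz, vy, vz.
    apply Rle_trans with ((az + la) * f s).
    + unfold f. set (AA := sv (z s) - sv (x s)). set (BB := sv (x s) - sv (y s)) in *. set (PP := sw (x s) + sw (z s)). set (QQ := sw (x s) + sw (y s)).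
      assert (hfin : 0 <= BB * PP * (- qk * (/ sw (z s) - / sw (y s)))).
      { apply Rmult_le_pos; [apply Rmult_le_pos; [auto|unfold PP; lra]|]. apply Rmult_le_pos.
        - unfold qk. assert (0 <= (- q (sth (x s))) / cos (sth (x s))) by pos. unfold Rdiv in *. lra.
        - assert (/ sw (y s) <= / sw (z s)) by (apply Rinv_le_contravar; lra). lra. }
      assert (hid : (az + la) * (BB * PP - AA * QQ) - (ay * BB * PP + BB * (PP * (qk / sw (z s) + az - X)) - (az * AA * QQ + AA * (QQ * la)))
         = BB * PP * (- qk * (/ sw (z s) - / sw (y s)))).
      { rewrite hla3. unfold Rdiv. ring. }
      lra.
    + apply Rmult_le_compat_r; [lra|]. unfold K. lra.
Qed.
End Ratios.

(** * A product of ratios that is monotone where [q] has a sign *)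

Section Products.
Context {S : system}.

(** The product of the ratios of [ratio_rate] formed with [y] and with [z]. The factor [cos ^ 2 / c]
    has logarithmic derivative [- 2 * w * X / cos], with [X] as in [ratio_rate], and cancels the
    metric terms of both ratios; only [q] remains. *)
Definition prodr (x y z : state) : R :=
  (sv x - sv y) * (sv x - sv z) * cos (sth x) ^ 2 / (c (sth x) * ((sw x + sw y) * (sw x + sw z))).

Lemma prodr_derive x y z s : coll x -> 0 < sw (x s) -> rides x y s -> rides x z s -> 0 < cos (sth (x s)) ->
  is_derive (fun s => prodr (x s) (y s) (z s)) s
    (prodr (x s) (y s) (z s) * (- q (sth (x s)) / cos (sth (x s)) * (/ sw (y s) + / sw (z s)))).
Proof.
  intros Hx hw Hy Hz hk. assert (Hs := coll_sol _ Hx).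
  destruct (coll_rides x s Hx hw) as (px & rx & _ & _ & x1 & x2).
  destruct Hy as (py & ry & ty & wy & y1 & y2). destruct Hz as (pz & rz & tz & wz & z1 & z2).
  destruct (P1_pair (x s) (y s)) as (ay & _ & ey1 & ey2); auto.
  destruct (P1_pair (x s) (z s)) as (az & _ & ez1 & ez2); auto.
  assert (hc := c_pos (sth (x s))).
  assert (dk : is_derive (fun s => cos (sth (x s))) s (- sin (sth (x s)) * Fth (x s))).
  { eapply is_derive_eq; [apply (is_derive_comp cos (fun s => sth (x s)) s (- sin (sth (x s))) (Fth (x s))); [auto_derive; auto; ring|apply sol_dth; auto]|].
    unfold scal; simpl; unfold mult; simpl. ring. }
  assert (dc : is_derive (fun s => c (sth (x s))) s (c1 (sth (x s)) * Fth (x s))).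
  { eapply is_derive_eq; [apply (is_derive_comp c (fun s => sth (x s)) s (c1 (sth (x s))) (Fth (x s))); [apply c_d|apply sol_dth; auto]|].
    unfold scal; simpl; unfold mult; simpl. ring. }
  unfold prodr. eapply is_derive_eq.
  { apply is_derive_div.
    - apply (is_derive_mult (fun s => (sv (x s) - sv (y s)) * (sv (x s) - sv (z s))) (fun s => cos (sth (x s)) ^ 2)); [| |apply Rmult_comm].
      + apply (is_derive_mult (fun s => sv (x s) - sv (y s)) (fun s => sv (x s) - sv (z s))); [| |apply Rmult_comm].
        * apply (is_derive_minus (fun s => sv (x s)) (fun s => sv (y s))); [exact x1|exact y1].
        * apply (is_derive_minus (fun s => sv (x s)) (fun s => sv (z s))); [exact x1|exact z1].
      + apply (is_derive_pow (fun s => cos (sth (x s))) 2). exact dk.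
    - apply (is_derive_mult (fun s => c (sth (x s))) (fun s => (sw (x s) + sw (y s)) * (sw (x s) + sw (z s)))); [exact dc| |apply Rmult_comm].
      apply (is_derive_mult (fun s => sw (x s) + sw (y s)) (fun s => sw (x s) + sw (z s))); [| |apply Rmult_comm].
      * apply (is_derive_plus (fun s => sw (x s)) (fun s => sw (y s))); [exact x2|exact y2].
      * apply (is_derive_plus (fun s => sw (x s)) (fun s => sw (z s))); [exact x2|exact z2].
    - apply Rgt_not_eq. pos. }
  unfold plus, minus, mult, opp; simpl. unfold plus, minus, mult, opp; simpl. unfold Fth.
  replace (sw (x s) / sw (x s) * Fw (x s)) with (Fw (x s)) by (field; lra).
  set (k := cos (sth (x s))) in *. set (cc := c (sth (x s))) in *. set (z0 := sin (sth (x s))) in *. set (cp := c1 (sth (x s))) in *. set (qq := q (sth (x s))) in *.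
  set (w := sw (x s)) in *. set (w1 := sw (y s)) in *. set (w2 := sw (z s)) in *.
  set (f1 := Fw (x s) + w / w1 * Fw (y s)) in *. set (f2 := Fw (x s) + w / w2 * Fw (z s)) in *.
  rewrite ey2, ez2.
  replace (/ 2 * cc * w * w + - (/ 2 * cc * w * w1)) with (ay * (sv (x s) - sv (y s))) by lra.
  replace (/ 2 * cc * w * w + - (/ 2 * cc * w * w2)) with (az * (sv (x s) - sv (z s))) by lra.
  clearbody f1 f2. clear - hk hw wy wz hc. field. repeat split; lra.
Qed.
End Products.


Lemma lim_of_eps (f : R -> R) (l : R) : (forall e, 0 < e -> exists M, forall s, M <= s -> Rabs (f s - l) < e) -> is_lim f p_infty l.
Proof.
  intros H. apply is_lim_spec. intros e. destruct (H e (cond_pos e)) as [M HM]. exists M. intros s hs. apply HM. lra.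
Qed.

Lemma lim_mult (f g : R -> R) (lf lg : R) : is_lim f p_infty lf -> is_lim g p_infty lg -> is_lim (fun s => f s * g s) p_infty (lf * lg).
Proof. intros h1 h2. exact (is_lim_mult f g p_infty lf lg h1 h2 I). Qed.

Section Travel.
Context {S : system}.

Lemma whit_start x b t : sol x -> whit x b t -> exists eta, 0 < eta /\ forall s, 0 < s <= eta -> 0 < sw (x (s + t)).
Proof.
  intros Hx (h1 & h2 & h3). destruct (start_positive (fun s => x (s + t)) (sol_translate x t Hx)) as [eta [He H]].
  - rewrite Rplus_0_l. apply h3. lra.
  - exists eta. split; auto. intros s hs. apply H. lra.
Qed.

Lemma whit_ths_out x t : sol x -> whit x ths t -> exists t', whit x (PI / 2) t'.
Proof.
  intros Hx Ht. destruct ths_int as [ht1 ht2]. destruct (whit_start x ths t Hx Ht) as [eta [He H]].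
  destruct (push_collinear (fun s => x (s + t)) eta) as [t' Ht']; auto.
  - now apply sol_translate.
  - rewrite Rplus_0_l. destruct Ht as (_ & h & _). lra.
  - exists (t' + t). eapply whit_trans; eauto.
Qed.

Lemma ride_limit a b p p' l (u : R -> R) s0 : sol b -> tends a l -> p < p' -> sth (b p') = l ->
  (forall s, p <= s <= p' -> 0 < sw (b s)) -> (forall s, s0 <= s -> p <= u s <= p' /\ sth (b (u s)) = sth (a s)) ->
  is_lim (fun s => sv (b (u s))) p_infty (sv (b p')) /\ is_lim (fun s => sw (b (u s))) p_infty (sw (b p')).
Proof.
  intros Hb [Ht1 Ht2] Hp Hl Hw Hu.
  assert (H : forall e, 0 < e -> exists M, forall s, M <= s -> near e (b (u s)) (b p')).
  { intros e He. destruct (sol_local_near b p' e Hb He) as [d [Hd H]].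
    set (p2 := Rmax p (p' - d / 2)). assert (h1 : p <= p2) by apply Rmax_l. assert (h2 : p' - d / 2 <= p2) by apply Rmax_r.
    assert (h3 : p2 < p') by (apply Rmax_lub_lt; lra).
    assert (h4 : sth (b p2) < l) by (rewrite <- Hl; apply th_incr; auto; intros; apply Hw; lra).
    destruct (Ht2 (l - sth (b p2)) ltac:(lra)) as [s1 [Hs1 H1]].
    exists (Rmax s0 s1). intros s hs. pose proof (Rmax_l s0 s1). pose proof (Rmax_r s0 s1).
    destruct (Hu s ltac:(lra)) as [k1 k2]. destruct (H1 s ltac:(lra)) as [k3 _].
    assert (p2 < u s) by (apply (th_order b p p'); auto; lra).
    apply near_sym, H. apply Rabs_def1; lra. }
  split; apply lim_of_eps; intros e He; destruct (H e He) as [M HM]; exists M; intros s hs; apply (HM s hs).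
Qed.

Lemma coll_same a b s u : coll a -> coll b -> 0 < sw (a s) -> 0 < sw (b u) -> sth (b u) = sth (a s) -> sv (b u) = sv (a s) -> b u = a s.
Proof.
  intros Ha Hb h1 h2 h3 h4. apply state_eq; auto; [now rewrite !coll_r|].
  pose proof (coll_energy a s Ha) as e1. pose proof (coll_energy b u Hb) as e2. rewrite h3, h4 in e2.
  assert (h5 : c (sth (a s)) * (sw (b u) ^ 2 - sw (a s) ^ 2) = 0) by lra. pose proof (c_pos (sth (a s))) as hc.
  apply Rmult_integral in h5. destruct h5 as [h5|h5]; [lra|]. clear - h5 h1 h2. nra.
Qed.

(** The logarithmic derivative is [- q / cos] times a positive sum, and the product is positive
    because [x] has a larger [v] than both companions. *)
Lemma product_decr x b d p p' r r' sa sb ya yb za zb : coll x -> coll b -> coll d -> p <= p' -> r <= r' -> sa < sb ->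
  (forall s, p <= s <= p' -> 0 < sw (b s)) -> (forall s, r <= s <= r' -> 0 < sw (d s)) ->
  (forall s, sa <= s <= sb -> 0 < sw (x s) /\ 0 < cos (sth (x s)) /\ 0 < q (sth (x s))) ->
  (forall s u, sa <= s <= sb -> p <= u <= p' -> sth (b u) = sth (x s) -> sv (b u) < sv (x s)) ->
  (forall s u, sa <= s <= sb -> r <= u <= r' -> sth (d u) = sth (x s) -> sv (d u) < sv (x s)) ->
  p <= ya <= p' -> p <= yb <= p' -> r <= za <= r' -> r <= zb <= r' ->
  sth (b ya) = sth (x sa) -> sth (b yb) = sth (x sb) -> sth (d za) = sth (x sa) -> sth (d zb) = sth (x sb) ->
  prodr (x sb) (b yb) (d zb) < prodr (x sa) (b ya) (d za).
Proof.
  intros Hx Hb Hd Hp Hr Hs Hwb Hwd Hxq Hlb Hld hya hyb hza hzb eya eyb eza ezb.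
  assert (Hxs := coll_sol _ Hx). assert (Hbs := coll_sol _ Hb). assert (Hds := coll_sol _ Hd).
  destruct (ride x b p p' Hxs Hb Hp Hwb) as [y Hy]. destruct (ride x d r r' Hxs Hd Hr Hwd) as [z Hz].
  assert (Hth : forall s, sa <= s <= sb -> sth (x sa) <= sth (x s) <= sth (x sb)).
  { intros s h. split; apply th_mono; auto; try lra; intros; apply Hxq; lra. }
  assert (Hin : forall b p p' u, sol b -> (forall s, p <= s <= p' -> 0 < sw (b s)) -> p <= u <= p' -> sth (b p) <= sth (b u) <= sth (b p')).
  { intros f m n u hf hw hu. split; apply th_mono; auto; try lra; intros; apply hw; lra. }
  assert (Hyr : forall s, sa <= s <= sb -> rides x y s /\ exists u, p <= u <= p' /\ y s = b u).
  { intros s h. specialize (Hth s h). apply Hy. pose proof (Hin b p p' ya Hbs Hwb hya). pose proof (Hin b p p' yb Hbs Hwb hyb). lra. }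
  assert (Hzr : forall s, sa <= s <= sb -> rides x z s /\ exists u, r <= u <= r' /\ z s = d u).
  { intros s h. specialize (Hth s h). apply Hz. pose proof (Hin d r r' za Hds Hwd hza). pose proof (Hin d r r' zb Hds Hwd hzb). lra. }
  assert (Hbeq : forall s u, sa <= s <= sb -> p <= u <= p' -> sth (b u) = sth (x s) -> y s = b u).
  { intros s u h hu k. destruct (Hyr s h) as [(_ & _ & k' & _) [u' [h1 h2]]]. rewrite h2. f_equal.
    apply (th_injective b p p'); auto. rewrite <- h2. lra. }
  assert (Hdeq : forall s u, sa <= s <= sb -> r <= u <= r' -> sth (d u) = sth (x s) -> z s = d u).
  { intros s u h hu k. destruct (Hzr s h) as [(_ & _ & k' & _) [u' [h1 h2]]]. rewrite h2. f_equal.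
    apply (th_injective d r r'); auto. rewrite <- h2. lra. }
  rewrite <- (Hbeq sa ya), <- (Hbeq sb yb), <- (Hdeq sa za), <- (Hdeq sb zb) by (auto; lra).
  assert (Hdec : - prodr (x sa) (y sa) (z sa) < - prodr (x sb) (y sb) (z sb)); [|lra].
  apply (incr (fun s => - prodr (x s) (y s) (z s))
     (fun s => - (prodr (x s) (y s) (z s) * (- q (sth (x s)) / cos (sth (x s)) * (/ sw (y s) + / sw (z s))))) sa sb Hs).
  - intros s h. apply (is_derive_opp (fun s => prodr (x s) (y s) (z s))). apply prodr_derive; auto; [apply Hxq; lra|apply Hyr; lra|apply Hzr; lra|apply Hxq; lra].
  - intros s h. assert (h' : sa <= s <= sb) by lra. destruct (Hxq s h') as (k1 & k2 & k3).
    destruct (Hyr s h') as [(_ & _ & ty & wy & _) [u [hu ku]]]. destruct (Hzr s h') as [(_ & _ & tz & wz & _) [u' [hu' ku']]].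
    assert (l1 : sv (y s) < sv (x s)) by (rewrite ku in *; apply Hlb; auto).
    assert (l2 : sv (z s) < sv (x s)) by (rewrite ku' in *; apply Hld; auto).
    assert (hp : 0 < prodr (x s) (y s) (z s)).
    { unfold prodr. apply Rdiv_lt_0_compat.
      - pos.
      - apply Rmult_lt_0_compat; [apply c_pos|apply Rmult_lt_0_compat; lra]. }
    assert (hq : 0 < q (sth (x s)) / cos (sth (x s))) by pos.
    assert (hi : 0 < / sw (y s) + / sw (z s)) by (apply Rplus_lt_0_compat; apply Rinv_0_lt_compat; auto).
    replace (- (prodr (x s) (y s) (z s) * (- q (sth (x s)) / cos (sth (x s)) * (/ sw (y s) + / sw (z s)))))
      with (prodr (x s) (y s) (z s) * (q (sth (x s)) / cos (sth (x s)) * (/ sw (y s) + / sw (z s)))) by (unfold Rdiv; ring).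
    apply Rmult_lt_0_compat; auto. pos.
Qed.
End Travel.

Section Bad.
Context {S : system} {B : branches}.

Lemma gam'_sol : sol gam'.
Proof. eapply departure_sol, gam'_dep. Qed.

Lemma gam'_coll : coll gam'.
Proof. apply gam'_dep. Qed.

(** The flip of [gam'] arrives at the upper equilibrium at [ths] and starts on the Euler line with
    [v = - sv (gam' 0) > 0]. As [gam'] starts there with negative [v], [pass_below] applies to
    it. *)
Lemma gam'_out : exists t, whit gam' (PI / 2) t.
Proof.
  assert (Hd := gam'_dep). assert (Hs := gam'_sol). destruct ths_int as [ht1 ht2]. pose proof vs_pos. pose proof gam'_v as hv. pose proof gam'_th as hth.
  assert (HA : arrival (flip gam') (- - ths)) by (apply departure_arrival; auto; lra). rewrite Ropp_involutive in HA.
  assert (e0 : sth (flip gam' 0) = 0) by (simpl; rewrite Rminus_0_r; lra).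
  destruct (pass_below (flip gam') ths (or_introl eq_refl) HA) with (a := gam') as [t Ht].
  - rewrite e0. pose proof PI_RGT_0. lra.
  - rewrite e0. apply q_neg'.
  - apply Hd.
  - lra.
  - apply Hd. lra.
  - apply (departure_v _ _ Hd).
  - simpl. rewrite Rminus_0_r. lra.
  - apply (whit_ths_out gam' t Hs Ht).
Qed.

(** The Euler equilibria on the collision manifold are [(0, vE, 0, 0)] and [(0, - vE, 0, 0)]. *)
Definition vE := sqrt (2 * V 0).

Lemma V_0_pos : 0 < V 0.
Proof. pose proof (V_min_le 0) as h. pose proof V_ths_pos. pose proof PI_RGT_0. lra. Qed.

Lemma vE_sq : 0 < vE /\ vE * vE = 2 * V 0.
Proof. pose proof V_0_pos. split; [apply sqrt_lt_R0; lra|apply sqrt_sqrt; lra]. Qed.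

Lemma W_0 : W 0 = V 0.
Proof. rewrite (W_V 0), cos_0 by (rewrite cos_0; lra). ring. Qed.

Notation O0 := (flow (sig 0 0)).

Lemma O0_coll : coll O0.
Proof. apply sec_coll; [apply sec_sig; lra|auto]. Qed.

(** By [barrier] against [gam], a hit would occur with [v] above that of [gam], hence positive, and
    the same would hold for small [r > 0]. *)
Lemma O0_not_hits : (exists b, 0 < b /\ forall r, 0 < r < b -> hitsP (fun v => v < 0) (sig r 0)) -> ~ hits (sig 0 0).
Proof.
  intros [b [Hb H]] [t Ht]. assert (Hs : sec (sig 0 0)) by (apply sec_sig; lra). assert (Hc := O0_coll).
  destruct gam_hit as [u [Hu hv]]. pose proof gam_v. pose proof gam_th as hth.
  assert (HO : flow (sig 0 0) 0 = sig 0 0) by (apply orb_0; auto).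
  assert (Hlt : sv (gam u) < sv (O0 t)).
  { apply (barrier gam O0 0 u 0 t gam_sol Hc).
    - destruct Hu; lra.
    - destruct Ht; lra.
    - intros s h. destruct (Req_dec s 0) as [->|]; [left; apply gam_sec|left; apply Hu; lra].
    - intros s h. destruct (Req_dec s 0) as [->|]; [rewrite HO; apply w0_pos|apply Ht; lra].
    - rewrite HO. exact hth.
    - destruct Hu as (_ & -> & _), Ht as (_ & -> & _). auto.
    - rewrite HO. simpl. auto. }
  destruct (open_sig 0 (hitsP (fun v => 0 < v)) ltac:(lra)) as [d [Hd H1]].
  { apply hits_pos_open; auto. exists t. split; auto. lra. }
  rminp b d.
  destruct (hits_unique (sig (Rmin b d / 2) 0) (fun v => v < 0) (fun v => 0 < v)) as [v hv']; [apply sec_sig; lra|apply H; lra| |lra].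
  apply H1; [lra|]. rewrite Rminus_0_r, Rabs_pos_eq; lra.
Qed.

(** The orbit passes [- ths] by [coll_pass]; beyond it [push] offers only a hit or convergence to
    the Euler angle. *)
Lemma O0_tends : ~ hits (sig 0 0) -> (forall s, 0 <= s -> 0 < sw (O0 s)) /\ tends O0 0 /\ exists t, whit O0 (- ths) t.
Proof.
  intros Hn. assert (Hs : sec (sig 0 0)) by (apply sec_sig; lra). assert (Hx := orb_sol _ Hs). destruct ths_int as [ht1 ht2].
  assert (HO : flow (sig 0 0) 0 = sig 0 0) by (apply orb_0; auto).
  destruct (coll_pass (sig 0 0)) as [t Ht]; auto; [simpl; pose proof gam_v; pose proof vs_pos; lra|].
  destruct (whit_start _ _ _ Hx Ht) as [eta [He Heta]].
  destruct (push (fun s => O0 (s + t)) 0 eta) as [[u Hu]|(h1 & _ & _ & h2)]; auto.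
  - now apply sol_translate.
  - rewrite Rplus_0_l. destruct Ht as (_ & -> & _). lra.
  - pose proof PI_RGT_0. lra.
  - right. apply q_zero.
  - rewrite Rplus_0_l. destruct Ht as (_ & -> & _). intros z hz. apply q_pos. lra.
  - exfalso. apply Hn. exists (u + t). eapply whit_trans; eauto.
  - assert (Hw : forall s, 0 <= s -> 0 < sw (O0 s)).
    { intros s h. destruct (Req_dec s 0) as [->|]; [rewrite HO; apply w0_pos|].
      destruct (Rle_dec s t); [apply Ht; lra|]. replace s with (s - t + t) by ring. apply h1. lra. }
    split; auto. split; [|now exists t]. destruct h2 as [k1 k2]. split.
    + intros s h. destruct (Rle_dec t s).
      * replace s with (s - t + t) by ring. apply k1. lra.
      * assert (sth (O0 s) < sth (O0 t)) by (apply th_incr; auto; [lra|intros; apply Hw; lra]).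
        destruct Ht as (_ & h' & _). lra.
    + intros e he. destruct (k2 e he) as [s0 [h3 h4]]. exists (s0 + t). destruct Ht as (ht & _). split; [lra|].
      intros s h. replace s with (s - t + t) by ring. apply h4. lra.
Qed.

Lemma O0_limits : ~ hits (sig 0 0) -> is_lim (fun s => sv (O0 s)) p_infty vE /\ is_lim (fun s => sw (O0 s)) p_infty 0 /\
  is_lim (fun s => sth (O0 s)) p_infty 0 /\ (forall s, 0 <= s -> 0 <= sv (O0 s)).
Proof.
  intros Hn. destruct (O0_tends Hn) as (Hw & Ht & _). assert (Hc := O0_coll). assert (Hx := coll_sol _ Hc). destruct vE_sq as [h1 h2].
  assert (HO : flow (sig 0 0) 0 = sig 0 0) by (apply orb_0, sec_sig; lra).
  assert (Hv : forall s, 0 <= s -> 0 <= sv (O0 s)).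
  { intros s h. pose proof (coll_v_nondecr _ _ _ Hc h) as k. rewrite HO in k. exact k. }
  split; [|split; [|split]]; auto; apply lim_of_eps; intros e he.
  - destruct (tends_En O0 0 (e * vE / 2) Hx) as [s0 [k1 k2]]; auto.
    + intros s h. apply Hw. lra.
    + rewrite cos_0. lra.
    + assert (0 < e * vE) by pos. lra.
    + exists s0. intros s h. specialize (k2 s h). specialize (Hv s ltac:(lra)). unfold En in k2. rewrite coll_r in k2 by auto.
      apply Rmult_lt_reg_r with vE; auto. apply Rle_lt_trans with (Rabs ((sv (O0 s) - vE) * (sv (O0 s) + vE))).
      * rewrite Rabs_mult. apply Rmult_le_compat_l; [apply Rabs_pos|]. rewrite Rabs_pos_eq; lra.
      * replace ((sv (O0 s) - vE) * (sv (O0 s) + vE)) with (2 * (0 + / 2 * sv (O0 s) ^ 2 - V 0)) by (replace (V 0) with (/ 2 * (vE * vE)) by lra; field).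
        rewrite Rabs_mult, (Rabs_pos_eq 2) by lra. lra.
  - destruct Ht as [_ k]. destruct (k e he) as [s0 [k1 k2]]. exists s0. intros s h. specialize (Hw s ltac:(lra)). destruct (k2 s h).
    rewrite Rminus_0_r, Rabs_pos_eq; lra.
  - destruct Ht as [k' k]. destruct (k e he) as [s0 [k1 k2]]. exists s0. intros s h. specialize (k' s ltac:(lra)). destruct (k2 s h).
    rewrite Rminus_0_r. apply Rabs_def1; lra.
Qed.

Lemma gam'_energy : 0 < sw (gam' 0) /\ c 0 * sw (gam' 0) ^ 2 = vE * vE - sv (gam' 0) ^ 2 /\ sv (gam' 0) ^ 2 < vE * vE.
Proof.
  assert (hw : 0 < sw (gam' 0)) by (apply gam'_dep; lra). split; auto.
  pose proof (coll_energy gam' 0 gam'_coll) as e. rewrite gam'_th, cos_0, W_0 in e. destruct vE_sq as [_ h]. rewrite h.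
  pose proof (c_pos 0). assert (0 < c 0 * sw (gam' 0) ^ 2) by pos. lra.
Qed.

(** The reflection of [gam'] that travels from the line [- pi / 2] to the Euler line. *)
Definition gamU t4 (s : R) : state := flip gam' (s - t4).

Lemma gamU_coll t4 : coll (gamU t4).
Proof.
  assert (h : coll (flip gam')) by (apply flip_coll, gam'_coll).
  split; [apply (sol_translate (flip gam') (- t4)), h|]. unfold gamU. apply coll_r. auto.
Qed.

Lemma gamU_facts t4 : whit gam' (PI / 2) t4 -> sth (gamU t4 0) = - (PI / 2) /\ sv (gamU t4 0) = - sv (gam' t4) /\
  sth (gamU t4 t4) = 0 /\ sv (gamU t4 t4) = - sv (gam' 0) /\ sw (gamU t4 t4) = sw (gam' 0) /\ forall s, 0 <= s <= t4 -> 0 < sw (gamU t4 s).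
Proof.
  intros (h1 & h2 & h3). unfold gamU, flip. simpl. pose proof gam'_th.
  replace (0 - (0 - t4)) with t4 by ring. replace (0 - (t4 - t4)) with 0 by ring. repeat split; auto; try lra.
  intros s h. replace (0 - (s - t4)) with (t4 - s) by ring. rewrite Ropp_involutive.
  destruct (Req_dec s t4) as [->|]; [rewrite Rminus_diag; apply gam'_energy|apply h3; lra].
Qed.

(** A tie would identify the two orbits, although [gamU] hits the Euler line. If [gamU] were above,
    [barrier] would bound [v] on [O0] by [- sv (gam' 0) < vE], against its limit [vE]. *)
Lemma gamU_below t4 : ~ hits (sig 0 0) -> whit gam' (PI / 2) t4 -> forall s u, 0 <= s -> 0 <= u <= t4 ->
  sth (gamU t4 u) = sth (O0 s) -> sv (gamU t4 u) < sv (O0 s).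
Proof.
  intros Hn Ht4 s u Hs Hu Heq. destruct (O0_tends Hn) as (Hw & Ht & _). destruct (O0_limits Hn) as (Hlv & _ & _ & Hv).
  assert (Hc := O0_coll). assert (Hx := coll_sol _ Hc). assert (HU := gamU_coll t4). assert (HUs := coll_sol _ HU).
  destruct (gamU_facts t4 Ht4) as (f1 & f2 & f3 & f4 & f5 & f6).
  assert (hu : u < t4). { destruct (proj2 Hu) as [|h]; auto. subst u. destruct Ht as [Ht _]. specialize (Ht s Hs). lra. }
  destruct (Rtotal_order (sv (gamU t4 u)) (sv (O0 s))) as [h|[h|h]]; auto; exfalso.
  - assert (E : gamU t4 u = O0 s) by (apply coll_same; auto).
    apply Hn. exists (s + (t4 - u)).
    assert (Hall : forall z, gamU t4 (z + u) = O0 (z + s)).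
    { apply (sol_unique (fun z => gamU t4 (z + u)) (fun z => O0 (z + s)) 0); try apply sol_translate; auto. now rewrite !Rplus_0_l. }
    assert (E2 : O0 (s + (t4 - u)) = gamU t4 t4).
    { specialize (Hall (t4 - u)). rewrite (Rplus_comm s). rewrite <- Hall. f_equal. ring. }
    split; [lra|]. split; [now rewrite E2|]. intros z hz. apply Hw. lra.
  - assert (Hlt : forall s', s <= s' -> sv (O0 s') < - sv (gam' 0)).
    { intros s' h'. destruct Ht as [Ht1 _].
      assert (hm : sth (O0 s) <= sth (O0 s')). { apply th_mono; auto. intros; apply Hw; lra. }
      destruct (th_reach (gamU t4) u t4 (sth (O0 s')) HUs ltac:(lra)) as [u' [k1 k2]].
      { rewrite f3. specialize (Ht1 s' ltac:(lra)). lra. }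
      apply Rlt_le_trans with (sv (gamU t4 u')); [|rewrite <- f4; apply coll_v_nondecr; auto; lra].
      apply (barrier O0 (gamU t4) s s' u u'); auto; try lra.
      - intros z hz. left. apply Hw. lra.
      - intros z hz. apply f6. lra. }
    assert (hle : Rbar_le vE (- sv (gam' 0))).
    { apply (is_lim_le_loc (fun s => sv (O0 s)) (fun _ => - sv (gam' 0)) p_infty); auto; [|apply is_lim_const].
      exists s. intros z hz. left. apply Hlt. lra. }
    simpl in hle. destruct gam'_energy as (_ & _ & k). pose proof gam'_v. destruct vE_sq as [k' _].
    assert (vE * vE <= (- sv (gam' 0)) * (- sv (gam' 0))) by (apply Rmult_le_compat; lra). lra.
Qed.

Lemma abs_between a b x : a <= x <= b -> Rabs x <= Rabs a + Rabs b.
Proof.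
  intros h. pose proof (Rabs_pos a). pose proof (Rabs_pos b). pose proof (Rle_abs b). pose proof (Rle_abs (- a)) as k. rewrite Rabs_Ropp in k.
  apply Rabs_le. lra.
Qed.

(** This is [ratio_compare] for [O0] between [gamU] and [Gam1], in the limit at [- ths] where [Gam1]
    has [v = vs] and [w = 0]. On the section all three [w] equal [w0], so the initial inequality
    amounts to [sv (gam' t4) <= - sv (gam 0)]. *)
Lemma ratio_at_ths t4 ts u : ~ hits (sig 0 0) -> whit gam' (PI / 2) t4 -> whit O0 (- ths) ts -> sv (gam' t4) <= - sv (gam 0) ->
  0 <= u <= t4 -> sth (gamU t4 u) = - ths ->
  (sv (O0 ts) - sv (gamU t4 u)) * sw (O0 ts) <= (vs - sv (O0 ts)) * (sw (O0 ts) + sw (gamU t4 u)).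
Proof.
  intros Hn Ht4 Hts H41 Hu Hthu. destruct (O0_tends Hn) as (Hw & Ht & _). destruct (O0_limits Hn) as (_ & _ & _ & Hv).
  assert (Hc := O0_coll). assert (Hx := coll_sol _ Hc). assert (HU := gamU_coll t4). assert (HUs := coll_sol _ HU).
  destruct (gamU_facts t4 Ht4) as (f1 & f2 & f3 & f4 & f5 & f6). destruct ths_int as [ht1 ht2].
  assert (HO : flow (sig 0 0) 0 = sig 0 0) by (apply orb_0, sec_sig; lra).
  assert (Hth0 : sth (O0 0) = - (PI / 2)) by (now rewrite HO).
  assert (Hmono : forall s s', 0 <= s -> s <= s' -> sth (O0 s) <= sth (O0 s')).
  { intros; apply th_mono; auto; intros; apply Hw; lra. }
  destruct Hts as (Hts0 & Hts1 & _). assert (Ht40 : 0 < t4) by apply Ht4.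
  destruct (ride O0 (gamU t4) 0 t4 Hx HU ltac:(lra) f6) as [y Hy].
  assert (HyR : forall s, 0 <= s -> rides O0 y s /\ exists u, 0 <= u <= t4 /\ y s = gamU t4 u).
  { intros s h. apply Hy. rewrite f1, f3, <- Hth0. destruct Ht as [Ht _]. specialize (Ht s h). split; [apply Hmono; lra|lra]. }
  assert (Hyr : forall s, 0 <= s -> rides O0 y s) by (intros; now apply HyR).
  assert (Hyu : forall s, 0 <= s -> exists u, 0 <= u <= t4 /\ y s = gamU t4 u) by (intros; now apply HyR).
  assert (Hyeq : y ts = gamU t4 u).
  { destruct (Hyu ts ltac:(lra)) as [u' [h1 h2]]. rewrite h2. f_equal. apply (th_injective (gamU t4) 0 t4); auto.
    destruct (Hyr ts ltac:(lra)) as (_ & _ & k & _). rewrite h2 in k. lra. }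
  rewrite <- Hyeq.
  set (h := fun s => (sv (O0 s) - sv (y s)) * sw (O0 s) - (vs - sv (O0 s)) * (sw (O0 s) + sw (y s))).
  assert (Hcont : continuous h ts).
  { destruct (Hyr ts ltac:(lra)) as (_ & _ & _ & _ & d1 & d2). apply is_derive_continuous in d1. apply is_derive_continuous in d2.
    pose proof (sol_cv O0 ts Hx) as d3. pose proof (sol_cw O0 ts Hx) as d4.
    apply (continuous_minus (fun s => (sv (O0 s) - sv (y s)) * sw (O0 s)) (fun s => (vs - sv (O0 s)) * (sw (O0 s) + sw (y s)))).
    - apply (continuous_mult (fun s => sv (O0 s) - sv (y s)) (fun s => sw (O0 s))); auto.
      apply (continuous_minus (fun s => sv (O0 s)) (fun s => sv (y s))); auto.
    - apply (continuous_mult (fun s => vs - sv (O0 s)) (fun s => sw (O0 s) + sw (y s))); auto.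
      + apply (continuous_minus (fun s => vs) (fun s => sv (O0 s))); auto. apply continuous_const.
      + apply (continuous_plus (fun s => sw (O0 s)) (fun s => sw (y s))); auto. }
  (* [Gam1] does not reach [- ths], so a failure at [ts] is first moved by continuity to an earlier
     time [s1], where the comparison can be made. *)
  destruct (Rle_dec (h ts) 0) as [k|k]; [unfold h in k; lra|]. exfalso. apply Rnot_le_lt in k.
  destruct (sign_near h ts Hcont k) as [d [Hd Hpos]].
  rminp d ts.
  set (s1 := ts - Rmin d ts / 2). assert (hs1 : 0 < s1 < ts) by (unfold s1; lra).
  specialize (Hpos s1). assert (0 < h s1) by (apply Hpos, Rabs_def1; unfold s1; lra). clear Hpos.
  assert (Hths1 : sth (O0 s1) < - ths) by (rewrite <- Hts1; apply th_incr; auto; [lra|intros; apply Hw; lra]).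
  destruct Gam1_arrival as (HG & HGt & HGw & HGv). destruct Gam1_0 as [g1 g2]. assert (HGs := coll_sol _ HG).
  destruct HGt as [HGt1 HGt2]. assert (Hgap : 0 < - ths - sth (O0 s1)) by lra. destruct (HGt2 _ Hgap) as [p [Hp Hp']].
  set (p' := p + 1). assert (hp' : p <= p') by (unfold p'; lra). destruct (Hp' p' hp') as [hth' _].
  assert (g3 : forall s, 0 <= s <= p' -> 0 < sw (Gam1 s)) by (intros; apply HGw; lra).
  destruct (ride O0 Gam1 0 p' Hx HG ltac:(lra) g3) as [z Hz].
  assert (HzR : forall s, 0 <= s <= s1 -> rides O0 z s /\ exists u, 0 <= u <= p' /\ z s = Gam1 u).
  { intros s hs. apply Hz. rewrite g1, <- Hth0. pose proof (Hmono s s1 ltac:(lra) ltac:(lra)). split; [apply Hmono; lra|lra]. }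
  assert (Hzr : forall s, 0 <= s <= s1 -> rides O0 z s) by (intros; now apply HzR).
  assert (Hzu : forall s, 0 <= s <= s1 -> exists u, 0 <= u <= p' /\ z s = Gam1 u) by (intros; now apply HzR).
  assert (Hzv : forall s, 0 <= s <= s1 -> sv (O0 s) < sv (z s)).
  { intros s hs. destruct (Hzu s hs) as [u' [h1 h2]]. destruct (Hzr s hs) as (_ & _ & k1 & _). rewrite h2 in *. pose proof gam_v.
    apply (barrier O0 Gam1 0 s 0 u'); auto; try lra.
    - intros; left; apply Hw; lra.
    - intros; apply HGw; lra.
    - rewrite HO, g2. simpl. lra. }
  assert (Hyv : forall s, 0 <= s -> sv (y s) < sv (O0 s)).
  { intros s hs. destruct (Hyu s hs) as [u' [h1 h2]]. destruct (Hyr s hs) as (_ & _ & k1 & _). rewrite h2 in *. apply (gamU_below t4); auto. }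
  assert (Hyb : forall s, 0 <= s -> - sv (gam' t4) <= sv (y s) <= - sv (gam' 0)).
  { intros s hs. destruct (Hyu s hs) as [u' [h1 h2]]. rewrite h2, <- f2, <- f4. split; apply coll_v_nondecr; auto; lra. }
  assert (Hzb : forall s, 0 <= s <= s1 -> - sv (gam 0) <= sv (z s) <= vs).
  { intros s hs. destruct (Hzu s hs) as [u' [h1 h2]]. rewrite h2, <- g2. split; [apply coll_v_nondecr; auto; lra|].
    apply (arrival_v Gam1 (- ths)); auto using Gam1_arrival. lra. }
  destruct (continuous_min_pos (fun s => sw (gamU t4 s)) 0 t4) as [m [Hm Hmin]]; [lra|intros; apply sol_cw; auto|auto|].
  set (M := (Rabs (sv (O0 0)) + Rabs (sv (O0 s1))) + (Rabs (- sv (gam' t4)) + Rabs (- sv (gam' 0))) + (Rabs (- sv (gam 0)) + Rabs vs)).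
  assert (Hfin : 0 <= (sv (z s1) - sv (O0 s1)) * (sw (O0 s1) + sw (y s1)) - (sv (O0 s1) - sv (y s1)) * (sw (O0 s1) + sw (z s1))).
  { apply (ratio_compare O0 y z 0 s1 M m); auto; try lra.
    - intros s hs. split; [apply Hw; lra|]. split; [apply Hyr; lra|]. split; [apply Hzr; lra|].
      pose proof (abs_between _ _ _ (Hyb s ltac:(lra))) as a1. pose proof (abs_between _ _ _ (Hzb s ltac:(lra))) as a2.
      assert (a3 : Rabs (sv (O0 s)) <= Rabs (sv (O0 0)) + Rabs (sv (O0 s1))).
      { apply abs_between. split; apply coll_v_nondecr; auto; lra. }
      pose proof (Rabs_pos (sv (O0 s))). pose proof (Rabs_pos (sv (y s))). pose proof (Rabs_pos (sv (z s))).
      split; [destruct (Hyu s ltac:(lra)) as [u' [h1 ->]]; apply Hmin; auto|]. unfold M. lra.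
    - intros s hs. assert (hth : - (PI / 2) < sth (O0 s) < - ths).
      { split; [rewrite <- Hth0; apply th_incr; auto; [lra|intros; apply Hw; lra]|].
        pose proof (Hmono s s1 ltac:(lra) ltac:(lra)). lra. }
      split; [apply cos_pos; lra|]. split; [left; apply q_neg; lra|]. split; [|specialize (Hyv s); lra].
      specialize (Hyv s ltac:(lra)). specialize (Hzv s ltac:(lra)). specialize (Hyb s ltac:(lra)). specialize (Hzb s ltac:(lra)).
      destruct (Hyu s ltac:(lra)) as [u' [h1 h2]]. destruct (Hzu s ltac:(lra)) as [u2 [h3 h4]].
      destruct (Hyr s ltac:(lra)) as (_ & _ & ty & wy & _). destruct (Hzr s ltac:(lra)) as (_ & _ & tz & wz & _).
      pose proof (coll_energy (gamU t4) u' HU) as e1. pose proof (coll_energy Gam1 u2 HG) as e2. rewrite <- h2, ty in e1. rewrite <- h4, tz in e2.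
      assert (hvv : sv (y s) ^ 2 <= sv (z s) ^ 2) by (clear - Hyv Hzv Hyb Hzb H41; nra).
      assert (hvk : sv (y s) ^ 2 * cos (sth (O0 s)) ^ 2 <= sv (z s) ^ 2 * cos (sth (O0 s)) ^ 2) by (apply Rmult_le_compat_r; [apply pow2_ge_0|auto]).
      assert (hww : sw (z s) ^ 2 <= sw (y s) ^ 2).
      { apply Rmult_le_reg_l with (c (sth (O0 s))); [apply c_pos|lra]. }
      clear - hww wy wz. nra.
    - assert (wE : forall p, P1 p -> sth p = - (PI / 2) -> 0 < sw p -> sw p = w0) by (intros p0 k1 k2 k3; apply sec_w; split; auto).
      destruct (Hyr 0 ltac:(lra)) as (py & _ & ty & wy & _). destruct (Hzr 0 ltac:(lra)) as (pz & _ & tz & wz & _).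
      rewrite (wE (y 0)), (wE (z 0)), HO by (auto; lra). simpl.
      destruct (Hyu 0 ltac:(lra)) as [u' [h1 h2]]. destruct (Hzu 0 ltac:(lra)) as [u2 [h3 h4]].
      assert (u' = 0). { apply (th_injective (gamU t4) 0 t4); auto; try lra. rewrite <- h2. lra. }
      assert (u2 = 0). { apply (th_injective Gam1 0 p'); auto; try lra. rewrite <- h4. lra. }
      subst u' u2. rewrite h2, h4, f2, g2. pose proof w0_pos.
      assert (0 <= (- sv (gam 0) - sv (gam' t4)) * (w0 + w0)) by pos. lra. }
  specialize (Hzv s1 ltac:(lra)). specialize (Hyv s1 ltac:(lra)). specialize (Hzb s1 ltac:(lra)).
  destruct (Hyr s1 ltac:(lra)) as (_ & _ & ty & wy & _). destruct (Hzr s1 ltac:(lra)) as (_ & _ & tz & wz & _). specialize (Hw s1 ltac:(lra)).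
  unfold h in *.
  assert (l1 : (sv (z s1) - sv (O0 s1)) * (sw (O0 s1) + sw (y s1)) <= (vs - sv (O0 s1)) * (sw (O0 s1) + sw (y s1))) by (apply Rmult_le_compat_r; lra).
  assert (l2 : (sv (O0 s1) - sv (y s1)) * sw (O0 s1) <= (sv (O0 s1) - sv (y s1)) * (sw (O0 s1) + sw (z s1))) by (apply Rmult_le_compat_l; lra).
  lra.
Qed.
End Bad.

Section Exit.
Context {S : system} {B : branches}.
Notation O0 := (flow (sig 0 0)).

(** In the degenerate case where [O0] is asymptotic to the Euler equilibrium, the ratio of products [prodr] along [O0], the mirror image of [gam']
    and [gam'] would start below [1] at [- ths], decrease, and tend to [1] at the Euler line. *)
Lemma gam'_exit t4 : ~ hits (sig 0 0) -> whit gam' (PI / 2) t4 -> - sv (gam 0) < sv (gam' t4).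
Proof.
  intros Hn Ht4. destruct (Rlt_dec (- sv (gam 0)) (sv (gam' t4))) as [|H41]; auto. exfalso. apply Rnot_lt_le in H41.
  destruct (O0_tends Hn) as (Hw & Ht & [ts Hts]). destruct (O0_limits Hn) as (Lv & Lw & Lth & Hv).
  assert (Hc := O0_coll). assert (Hx := coll_sol _ Hc). assert (HU := gamU_coll t4). assert (HUs := coll_sol _ HU).
  destruct (gamU_facts t4 Ht4) as (f1 & f2 & f3 & f4 & f5 & f6). destruct ths_int as [ht1 ht2].
  assert (Hg := gam'_coll). assert (Hgs := gam'_sol). destruct gam'_dep as (_ & Hgw & Hgth & Hglim). destruct (departure_v _ _ gam'_dep) as [_ Hgv].
  assert (HO : flow (sig 0 0) 0 = sig 0 0) by (apply orb_0, sec_sig; lra).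
  assert (Hth0 : sth (O0 0) = - (PI / 2)) by (now rewrite HO).
  assert (Hmono : forall s s', 0 <= s -> s <= s' -> sth (O0 s) <= sth (O0 s')).
  { intros; apply th_mono; auto; intros; apply Hw; lra. }
  destruct Ht as [Hneg Htt].
  assert (Hts1 : 0 < ts /\ sth (O0 ts) = - ths) by (destruct Hts as (k1 & k2 & _); auto).
  assert (Hafter : forall s, ts < s -> - ths < sth (O0 s) < 0).
  { intros s h. split; [|apply Hneg; lra]. rewrite <- (proj2 Hts1). apply th_incr; auto. intros; apply Hw; lra. }
  assert (Ht40 : 0 < t4) by apply Ht4.
  assert (Hex1 : exists u1, forall s, 0 <= s -> 0 <= u1 s <= t4 /\ sth (gamU t4 (u1 s)) = sth (O0 s)).
  { exists (fun s => epsilon (inhabits 0) (fun u => 0 <= u <= t4 /\ sth (gamU t4 u) = sth (O0 s))). intros s hs.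
    apply epsilon_spec. apply th_reach; auto; [lra|]. rewrite f1, f3. pose proof (Hmono 0 s ltac:(lra) hs). specialize (Hneg s hs). lra. }
  destruct Hex1 as [u1 Hu1].
  assert (Hex2 : exists u2, forall s, ts < s -> u2 s <= 0 /\ sth (gam' (u2 s)) = sth (O0 s)).
  { exists (fun s => epsilon (inhabits 0) (fun u => u <= 0 /\ sth (gam' u) = sth (O0 s))). intros s hs. specialize (Hafter s hs).
    apply epsilon_spec. assert (hp : 0 < sth (O0 s) + ths) by lra. destruct (Hglim _ hp) as [s0 [k1 k2]].
    specialize (k2 s0 ltac:(lra)). apply near_elim in k2. change (sth (St 0 (- vs) (- ths) 0)) with (- ths) in k2.
    destruct (th_reach gam' s0 0 (sth (O0 s))) as [u [k3 k4]]; auto; [rewrite gam'_th; lra|]. exists u. split; [lra|auto]. }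
  destruct Hex2 as [u2 Hu2].
  assert (Hbelow : forall s, 0 <= s -> sv (gamU t4 (u1 s)) < sv (O0 s)).
  { intros s hs. destruct (Hu1 s hs). apply (gamU_below t4); auto. }
  assert (Hbelow' : forall s u, 0 <= s -> u <= 0 -> sv (gam' u) < sv (O0 s)).
  { intros s u hs hu. pose proof (coll_v_nondecr gam' u 0 Hg hu). pose proof gam'_v. specialize (Hv s hs). lra. }
  set (P := fun s => prodr (O0 s) (gamU t4 (u1 s)) (gam' (u2 s))).
  assert (HP : forall sa sb, ts < sa -> sa < sb -> P sb < P sa).
  { intros sa sb h1 h2. destruct (Hu1 sa ltac:(lra)) as [a1 a2]. destruct (Hu1 sb ltac:(lra)) as [b1 b2].
    destruct (Hu2 sa ltac:(lra)) as [a3 a4]. destruct (Hu2 sb ltac:(lra)) as [b3 b4].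
    rmin (u2 sa) (u2 sb).
    apply (product_decr O0 (gamU t4) gam' 0 t4 (Rmin (u2 sa) (u2 sb)) 0); auto; try lra.
    - intros s hs. apply Hgw. lra.
    - intros s hs. specialize (Hafter s ltac:(lra)). split; [apply Hw; lra|]. split; [apply cos_pos; lra|apply q_pos; lra].
    - intros s u hs hu e. apply (gamU_below t4); auto. lra.
    - intros s u hs hu e. apply Hbelow'; lra. }
  assert (Hden : forall s, ts < s -> 0 < c (sth (O0 s)) * ((sw (O0 s) + sw (gamU t4 (u1 s))) * (sw (O0 s) + sw (gam' (u2 s))))).
  { intros s hs. destruct (Hu1 s ltac:(lra)) as [h1 h2]. destruct (Hu2 s hs) as [h3 h4]. specialize (Hw s ltac:(lra)). specialize (f6 _ h1). specialize (Hgw _ h3).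
    apply Rmult_lt_0_compat; [apply c_pos|pos]. }
  assert (HPN : forall s, ts < s -> (sv (O0 s) - sv (gamU t4 (u1 s))) * (sv (O0 s) - sv (gam' (u2 s))) * cos (sth (O0 s)) ^ 2 =
     P s * (c (sth (O0 s)) * ((sw (O0 s) + sw (gamU t4 (u1 s))) * (sw (O0 s) + sw (gam' (u2 s)))))).
  { intros s hs. specialize (Hden s hs). unfold P, prodr. rewrite Rmult_comm. field. split; [|split]; intros k; rewrite k in Hden; lra. }
  assert (HP1 : forall s, ts < s -> P s <= 1).
  { intros s1 hs1. destruct (Rle_dec (P s1) 1) as [|hP]; auto. exfalso. apply Rnot_le_lt in hP.
    destruct (ride O0 (gamU t4) 0 t4 Hx HU ltac:(lra) f6) as [y Hy].
    assert (HyR : forall s, 0 <= s -> rides O0 y s /\ exists u, 0 <= u <= t4 /\ y s = gamU t4 u).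
    { intros s h. apply Hy. rewrite f1, f3, <- Hth0. specialize (Hneg s h). split; [apply Hmono; lra|lra]. }
    assert (Hyu : forall s, 0 <= s -> y s = gamU t4 (u1 s)).
    { intros s h. destruct (HyR s h) as [(_ & _ & k & _) [u' [h1 h2]]]. destruct (Hu1 s h) as [h3 h4].
      rewrite h2. f_equal. apply (th_injective (gamU t4) 0 t4); auto. rewrite h4, <- k, h2. auto. }
    (* Backwards, [gam'] only tends to [(0, - vs, - ths, 0)], so it gives no value of the product at
       [ts]. In [h] its [v] is replaced by [- vs] and its [w] by [0], which makes sense at [ts].
       There [h > 0] follows from [ratio_at_ths] and [c * w ^ 2 = (vs ^ 2 - v ^ 2) * cos ^ 2]. *)
    set (h := fun s => P s1 * (c (sth (O0 s)) * ((sw (O0 s) + sw (y s)) * sw (O0 s))) - (sv (O0 s) - sv (y s)) * (sv (O0 s) + vs) * cos (sth (O0 s)) ^ 2).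
    assert (Hcont : continuous h ts).
    { destruct (HyR ts ltac:(lra)) as [(_ & _ & _ & _ & d1 & d2) _]. apply is_derive_continuous in d1. apply is_derive_continuous in d2.
      pose proof (sol_cv O0 ts Hx) as d3. pose proof (sol_cw O0 ts Hx) as d4. pose proof (sol_cth O0 ts Hx) as d5.
      assert (d6 : continuous (fun s => c (sth (O0 s))) ts) by (apply (continuous_comp (fun s => sth (O0 s)) c); [exact d5|apply c_cont]).
      assert (d7 : continuous (fun s => cos (sth (O0 s))) ts) by (apply (continuous_comp (fun s => sth (O0 s)) cos); [exact d5|apply continuous_cos]).
      apply (continuous_minus (fun s => P s1 * (c (sth (O0 s)) * ((sw (O0 s) + sw (y s)) * sw (O0 s)))) (fun s => (sv (O0 s) - sv (y s)) * (sv (O0 s) + vs) * cos (sth (O0 s)) ^ 2)).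
      - apply (continuous_mult (fun _ => P s1) (fun s => c (sth (O0 s)) * ((sw (O0 s) + sw (y s)) * sw (O0 s)))); [apply continuous_const|].
        apply (continuous_mult (fun s => c (sth (O0 s))) (fun s => (sw (O0 s) + sw (y s)) * sw (O0 s))); auto.
        apply (continuous_mult (fun s => sw (O0 s) + sw (y s)) (fun s => sw (O0 s))); auto.
        apply (continuous_plus (fun s => sw (O0 s)) (fun s => sw (y s))); auto.
      - apply (continuous_mult (fun s => (sv (O0 s) - sv (y s)) * (sv (O0 s) + vs)) (fun s => cos (sth (O0 s)) ^ 2)).
        + apply (continuous_mult (fun s => sv (O0 s) - sv (y s)) (fun s => sv (O0 s) + vs)).
          * apply (continuous_minus (fun s => sv (O0 s)) (fun s => sv (y s))); auto.
          * apply (continuous_plus (fun s => sv (O0 s)) (fun s => vs)); auto. apply continuous_const.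
        + apply (continuous_comp (fun s => cos (sth (O0 s))) (fun k => k ^ 2)); auto.
          apply (ex_derive_continuous (fun k => k ^ 2)). auto_derive. auto. }
    assert (Hhts : 0 < h ts).
    { destruct (Hu1 ts ltac:(lra)) as [h1 h2]. destruct Hts1 as [h3 h4].
      pose proof (ratio_at_ths t4 ts (u1 ts) Hn Ht4 Hts H41 h1 ltac:(lra)) as hr.
      unfold h. rewrite (Hyu ts) by lra. pose proof (coll_energy _ ts Hc) as he. rewrite h4 in *.
      destruct (V_ths_cases (- ths) ltac:(auto)) as (hV & _ & _ & hk). rewrite (W_V (- ths)), hV in he by lra.
      pose proof vs_sq as hvs. pose proof vs_pos. specialize (Hv ts ltac:(lra)). specialize (Hw ts ltac:(lra)). specialize (f6 _ h1). pose proof (c_pos (- ths)) as hc.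
      set (k := cos (- ths)) in *. set (v := sv (O0 ts)) in *. set (w := sw (O0 ts)) in *. set (v1 := sv (gamU t4 (u1 ts))) in *. set (w1 := sw (gamU t4 (u1 ts))) in *.
      assert (l1 : (v - v1) * (v + vs) * k ^ 2 <= c (- ths) * ((w + w1) * w)).
      { apply Rmult_le_reg_r with w; auto.
        replace (c (- ths) * ((w + w1) * w) * w) with ((w + w1) * (c (- ths) * w ^ 2)) by ring. rewrite he.
        replace (2 * (V ths * k ^ 2) - v ^ 2 * k ^ 2) with ((2 * V ths - v ^ 2) * k ^ 2) by ring. rewrite <- hvs.
        replace ((w + w1) * ((vs * vs - v ^ 2) * k ^ 2)) with ((vs - v) * (w + w1) * ((v + vs) * k ^ 2)) by ring.
        replace ((v - v1) * (v + vs) * k ^ 2 * w) with ((v - v1) * w * ((v + vs) * k ^ 2)) by ring.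
        apply Rmult_le_compat_r; auto. apply Rmult_le_pos; [lra|apply pow2_ge_0]. }
      assert (l2 : 0 < c (- ths) * ((w + w1) * w)) by pos.
      assert (1 * (c (- ths) * ((w + w1) * w)) < P s1 * (c (- ths) * ((w + w1) * w))) by (apply Rmult_lt_compat_r; auto). lra. }
    destruct (sign_near h ts Hcont Hhts) as [d [Hd Hpos]].
    rminp d (s1 - ts).
    set (s := ts + Rmin d (s1 - ts) / 2). assert (hs : ts < s < s1) by (unfold s; lra).
    assert (hh : 0 < h s) by (apply Hpos, Rabs_def1; unfold s; lra).
    specialize (HPN s ltac:(lra)). specialize (HP s s1 ltac:(lra) ltac:(lra)). unfold h in hh. rewrite (Hyu s) in hh by lra.
    destruct (Hu1 s ltac:(lra)) as [h1 h2]. destruct (Hu2 s ltac:(lra)) as [h3 h4].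
    specialize (Hbelow s ltac:(lra)). specialize (Hgv _ h3). specialize (Hw s ltac:(lra)). specialize (f6 _ h1). specialize (Hgw _ h3). pose proof (c_pos (sth (O0 s))) as hc.
    set (k := cos (sth (O0 s))) in *. set (cc := c (sth (O0 s))) in *. set (v := sv (O0 s)) in *. set (w := sw (O0 s)) in *. set (v1 := sv (gamU t4 (u1 s))) in *. set (w1 := sw (gamU t4 (u1 s))) in *.
    set (v2 := sv (gam' (u2 s))) in *. set (w2 := sw (gam' (u2 s))) in *.
    assert (l1 : (v - v1) * (v - v2) * k ^ 2 <= (v - v1) * (v + vs) * k ^ 2).
    { apply Rmult_le_compat_r; [apply pow2_ge_0|]. apply Rmult_le_compat_l; lra. }
    assert (l2 : P s1 * (cc * ((w + w1) * w)) <= P s * (cc * ((w + w1) * (w + w2)))).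
    { apply Rmult_le_compat; [lra|apply Rlt_le, Rmult_lt_0_compat; [auto|pos]|lra|].
      apply Rmult_le_compat_l; [lra|]. apply Rmult_le_compat_l; lra. }
    lra. }
  assert (HP2 : P (ts + 2) < 1) by (apply Rlt_le_trans with (P (ts + 1)); [apply HP; lra|apply HP1; lra]).
  assert (L1 : is_lim (fun s => sv (gamU t4 (u1 s))) p_infty (- sv (gam' 0)) /\ is_lim (fun s => sw (gamU t4 (u1 s))) p_infty (sw (gam' 0))).
  { rewrite <- f4, <- f5. apply (ride_limit O0 (gamU t4) 0 t4 0 u1 0); auto. split; auto. }
  assert (L2 : is_lim (fun s => sv (gam' (u2 s))) p_infty (sv (gam' 0)) /\ is_lim (fun s => sw (gam' (u2 s))) p_infty (sw (gam' 0))).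
  { destruct (Hu2 (ts + 1) ltac:(lra)) as [k1 k2].
    assert (k3 : u2 (ts + 1) < 0).
    { destruct k1 as [|k1]; auto. rewrite k1, gam'_th in k2. specialize (Hneg (ts + 1) ltac:(lra)). lra. }
    apply (ride_limit O0 gam' (u2 (ts + 1)) 0 0 u2 (ts + 1)); auto; [split; auto|apply gam'_th|intros; apply Hgw; lra|].
    intros s hs. destruct (Hu2 s ltac:(lra)) as [k4 k5]. split; auto. split; auto.
    destruct (Rle_dec (u2 (ts + 1)) (u2 s)) as [|k6]; auto. exfalso.
    assert (sth (gam' (u2 s)) < sth (gam' (u2 (ts + 1)))) by (apply th_incr; auto; [lra|intros; apply Hgw; lra]).
    pose proof (Hmono (ts + 1) s ltac:(lra) hs). lra. }
  destruct L1 as [L1v L1w]. destruct L2 as [L2v L2w].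
  assert (Lcos : is_lim (fun s => cos (sth (O0 s)) ^ 2) p_infty 1).
  { replace 1 with (cos 0 * cos 0) by (rewrite cos_0; ring).
    apply (is_lim_ext (fun s => cos (sth (O0 s)) * cos (sth (O0 s)))); [intros; ring|].
    apply lim_mult; apply (is_lim_comp_continuous (fun s => sth (O0 s)) cos); auto; apply continuous_cos. }
  assert (Lc : is_lim (fun s => c (sth (O0 s))) p_infty (c 0)) by (apply (is_lim_comp_continuous (fun s => sth (O0 s)) c); auto; apply c_cont).
  destruct gam'_energy as (ew & ee & elt). set (v3 := sv (gam' 0)) in *. set (w3 := sw (gam' 0)) in *.
  assert (LN : is_lim (fun s => (sv (O0 s) - sv (gamU t4 (u1 s))) * (sv (O0 s) - sv (gam' (u2 s))) * cos (sth (O0 s)) ^ 2) p_infty ((vE - - v3) * (vE - v3) * 1)).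
  { apply lim_mult; auto. apply lim_mult; apply is_lim_minus'; auto. }
  assert (LD : is_lim (fun s => P (ts + 2) * (c (sth (O0 s)) * ((sw (O0 s) + sw (gamU t4 (u1 s))) * (sw (O0 s) + sw (gam' (u2 s)))))) p_infty
     (P (ts + 2) * (c 0 * ((0 + w3) * (0 + w3))))).
  { apply lim_mult; [apply is_lim_const|]. apply lim_mult; auto. apply lim_mult; apply is_lim_plus'; auto. }
  assert (hle := fun h => is_lim_le_loc _ _ p_infty _ _ h LN LD).
  (* The limit of the product is [(vE ^ 2 - v3 ^ 2) / (c 0 * w3 ^ 2)], which energy makes equal to
     [1], while monotonicity makes it at most [P (ts + 2) < 1]. *)
  assert (hle' : (vE - - v3) * (vE - v3) * 1 <= P (ts + 2) * (c 0 * ((0 + w3) * (0 + w3)))).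
  { apply hle. exists (ts + 2). intros s hs. rewrite HPN by lra. apply Rmult_le_compat_r; [left; apply Hden; lra|]. left. apply HP; lra. }
  assert (hpos : 0 < c 0 * w3 ^ 2) by pos.
  assert (hlt : P (ts + 2) * (c 0 * w3 ^ 2) < 1 * (c 0 * w3 ^ 2)) by (apply Rmult_lt_compat_r; auto).
  replace (c 0 * ((0 + w3) * (0 + w3))) with (c 0 * w3 ^ 2) in hle' by ring.
  replace ((vE - - v3) * (vE - v3) * 1) with (vE * vE - v3 ^ 2) in hle' by ring. lra.
Qed.
End Exit.

(** * Orbits of small radius beyond the Euler line *)

Section Thin.
Context {S : system} {B : branches}.
Notation O0 := (flow (sig 0 0)).

Lemma W_ge_V t : - (PI / 2) <= t <= 3 * (PI / 2) -> V ths * cos t ^ 2 <= W t.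
Proof.
  assert (H : forall t, - (PI / 2) <= t <= PI / 2 -> V ths * cos t ^ 2 <= W t).
  { intros u hu. destruct (Req_dec (cos u) 0) as [h|h].
    - rewrite h. pose proof (W_pos u). lra.
    - assert (u <> - (PI / 2)) by (intros ->; apply h, cos_mPI2). assert (u <> PI / 2) by (intros ->; apply h, cos_PI2).
      rewrite (W_V u h). apply Rmult_le_compat_r; [apply pow2_ge_0|]. apply V_min_le. lra. }
  intros ht. destruct (Rle_dec t (PI / 2)); [apply H; lra|].
  specialize (H (t - PI) ltac:(lra)). rewrite <- (W_per (t - PI)) in H. replace (t - PI + PI) with t in H by ring.
  replace (cos (t - PI)) with (- cos t) in H; [lra|]. replace t with (t - PI + PI) at 1 by ring. rewrite neg_cos. ring.
Qed.

(** The time reversal of the mirror image of an orbit that starts slightly above [gam 0] on the section. *)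
Lemma barrier_orbit : exists b p pe, coll b /\ p < 0 < pe /\ (forall s, p <= s <= pe -> 0 < sw (b s)) /\
  sth (b 0) = 0 /\ sth (b pe) = PI - ths /\ - vE < sv (b p) /\ sv (b pe) < vs.
Proof. pose proof gam_v as hv. pose proof vs_pos as hvp.
  destruct (hits_pos_open (gam 0) gam_sec gam_pos) as [d [Hd Hop]].
  (* A start above [gam 0] by [mu < d] still hits the Euler line with [v > 0]. Reversal turns this
     start into one below the threshold of [coll_pass], so the reversed orbit goes on to
     [PI - ths]. *)
  set (mu := Rmin d vs / 2). assert (hmu : 0 < mu /\ mu < d /\ mu < vs).
  { rminp d vs. unfold mu. lra. }
  set (p0 := sig 0 (sv (gam 0) + mu)). assert (hp0 : sec p0) by (apply sec_sig; lra).
  destruct (Hop p0 hp0) as [tg [Htg hvg]].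
  { apply sec_near; auto; try apply gam_sec; simpl; [rewrite gam_r, Rminus_0_r, Rabs_R0; lra|]. apply Rabs_def1; lra. }
  set (g := flow p0) in *. assert (hg : coll g) by (apply sec_coll; auto). assert (hg0 : g 0 = p0) by (apply orb_0; auto).
  set (p1 := sig 0 (- (sv (gam 0) + mu))). assert (hp1 : sec p1) by (apply sec_sig; lra).
  destruct (coll_pass p1 hp1) as [tp Htp]; [auto|simpl; lra|].
  assert (hf : coll (flip g)) by (apply flip_coll; auto).
  assert (hfl : forall s, flip g s = shift (flow p1 s)).
  { apply (sol_unique _ _ 0); [apply hf|apply sol_shift, orb_sol; auto|]. unfold flip. rewrite Rminus_0_r, hg0, (orb_0 p1) by auto.
    apply state_eq; simpl; lra. }
  set (b := fun s => flip g (s + - tg)). assert (hb : coll b).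
  { split; [apply (sol_translate (flip g) (- tg)), hf|]. unfold b. apply coll_r; auto. }
  assert (hbs := coll_sol _ hb).
  destruct Htg as (a1 & a2 & a3). destruct Htp as (c1' & c2' & c3').
  assert (hb0 : b 0 = rev (mir (g tg))) by (unfold b, flip; f_equal; f_equal; f_equal; ring).
  assert (hbe : b (tp + tg) = shift (flow p1 tp)) by (unfold b; rewrite hfl; do 2 f_equal; ring).
  assert (hw : forall s, 0 <= s <= tp + tg -> 0 < sw (b s)).
  { intros s hs. destruct (Rlt_dec tg s) as [h|h].
    - unfold b. rewrite hfl. simpl. apply c3'. lra.
    - unfold b, flip. simpl. rewrite Ropp_involutive. replace (0 - (s + - tg)) with (tg - s) by ring.
      destruct (Req_dec s tg) as [->|]; [rewrite Rminus_diag, hg0; apply w0_pos|apply a3; lra]. }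
  destruct (extend_positive b 0 (tp + tg) hbs ltac:(lra) hw) as [e [He hw']].
  destruct vE_sq as [hE1 hE2].
  assert (hv0 : - vE < sv (b 0)).
  { pose proof (coll_energy b 0 hb) as h. assert (h0 : sth (b 0) = 0) by (rewrite hb0; simpl; lra). rewrite h0, cos_0, W_0 in h.
    assert (0 < c 0 * sw (b 0) ^ 2) by (apply Rmult_lt_0_compat; [apply c_pos|apply pow_lt, hw; lra]).
    apply Rnot_le_lt. intros hn. nra. }
  destruct (sign_near (fun s => sv (b s) + vE) 0) as [d' [Hd' Hn]].
  { apply (continuous_plus (fun s => sv (b s)) (fun _ => vE)); [apply sol_cv; auto|apply continuous_const]. }
  { cbv beta. lra. }
  rminp d' e.
  exists b, (- (Rmin d' e / 2)), (tp + tg). split; auto. split; [lra|]. split; [intros; apply hw'; lra|]. split; [|split; [|split]].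
  - rewrite hb0. simpl. lra.
  - rewrite hbe. simpl. lra.
  - specialize (Hn (- (Rmin d' e / 2))). cbv beta in Hn. rewrite Rminus_0_r, Rabs_Ropp, Rabs_pos_eq in Hn by lra. lra.
  - pose proof (coll_energy b (tp + tg) hb) as h. assert (ht : sth (b (tp + tg)) = - ths + PI) by (rewrite hbe; simpl; lra).
    rewrite ht, W_per, neg_cos in h. destruct (V_ths_cases (- ths) ltac:(auto)) as (k1 & _ & _ & k2). rewrite (W_V (- ths)), k1 in h by lra.
    assert (0 < c (- ths + PI) * sw (b (tp + tg)) ^ 2) by (apply Rmult_lt_0_compat; [apply c_pos|apply pow_lt, hw; lra]).
    pose proof vs_sq as hsq. apply Rnot_le_lt. intros hn.
    set (v := sv (b (tp + tg))) in *. set (k := cos (- ths)) in *.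
    assert (vs * vs * k ^ 2 <= v ^ 2 * k ^ 2) by (apply Rmult_le_compat_r; [apply pow2_ge_0|clear - hn hvp; nra]).
    replace (v ^ 2 * (- k) ^ 2) with (v ^ 2 * k ^ 2) in h by ring. rewrite hsq in *. lra.
Qed.

(** An orbit of tiny radius that leaves a neighbourhood of [(0, - vE, 0, 0)] cannot turn between [PI / 2] and [PI - ths]:
    its energy would have to exceed [V ths] while [v] stays below the barrier orbit. *)
Lemma thin_no_turn : exists e, 0 < e /\ forall x s3 t, sol x -> s3 < t -> near e (x s3) (St 0 (- vE) 0 0) ->
  (forall s, s3 <= s < t -> 0 < sw (x s)) -> sw (x t) = 0 -> PI / 2 < sth (x t) < PI - ths -> False.
Proof.
  destruct barrier_orbit as (b & p & pe & Hb & Hp & Hwb & Hb0 & Hbe & Hvp & Hve). assert (Hbs := coll_sol _ Hb).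
  destruct ths_int as [ht1 ht2]. pose proof vs_pos as hvp. pose proof vs_sq as hsq. destruct vE_sq as [hE1 hE2].
  assert (hV0 : V ths < V 0) by (apply V_min; lra).
  assert (hvE : vs < vE) by (clear - hvp hsq hE1 hE2 hV0; nra).
  set (vb := Rmax (sv (b pe)) (3 * vs / 4)). assert (hvb : sv (b pe) <= vb /\ 3 * vs / 4 <= vb /\ vb < vs).
  { split; [apply Rmax_l|split; [apply Rmax_r|apply Rmax_lub_lt; lra]]. }
  (* While [r <= m] and [v] lies between [- vb] and [vb], energy gives [Fv >= 2 * m * cos ^ 2],
     whereas [Fr <= vb * r * cos ^ 2]. So the logarithm of [r] grows at most [K = vb / (2 * m)]
     times as fast as [v], and a radius below [e3] stays below [m]. *)
  set (m := (V ths - / 2 * (vb * vb)) / 4). assert (hm : 0 < m).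
  { unfold m. assert (vb * vb < vs * vs) by (clear - hvp hvb; nra). lra. }
  set (K := vb / (2 * m)). assert (hK : 0 < K) by pos.
  assert (hKm : K * (2 * m) = vb) by (unfold K; field; lra).
  assert (hexp : 0 < exp (K * (2 * vs))) by apply exp_pos.
  assert (Hbp : sth (b p) < 0) by (rewrite <- Hb0; apply th_incr; auto; [lra|intros; apply Hwb; lra]).
  set (e1 := Rmin (- sth (b p)) (sv (b p) + vE)). set (e2 := Rmin ths (vs / 2)). set (e3 := m / exp (K * (2 * vs))).
  assert (he3 : 0 < e3) by pos.
  set (e := Rmin e1 (Rmin e2 e3) / 2).
  assert (he : 0 < e /\ e < - sth (b p) /\ e < sv (b p) + vE /\ e < ths /\ e < vs / 2 /\ e < e3).
  { assert (0 < Rmin e1 (Rmin e2 e3)) by (unfold e1, e2; pos).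
    rmin e1 (Rmin e2 e3). rmin e2 e3.
    assert (e1 <= - sth (b p)) by apply Rmin_l. assert (e1 <= sv (b p) + vE) by apply Rmin_r. assert (e2 <= ths) by apply Rmin_l. assert (e2 <= vs / 2) by apply Rmin_r.
    unfold e. lra. }
  exists e. split; [apply he|]. intros x s3 t Hx Hst Hn Hw Hwt Htht. apply near_elim in Hn. simpl in Hn.
  assert (Hmono : forall u v, s3 <= u -> u <= v -> v <= t -> sth (x u) <= sth (x v)).
  { intros u v h1 h2 h3; apply th_mono; auto; intros; apply Hw; lra. }
  assert (Hup : forall s, s3 <= s <= t -> sv (x s) <= vb).
  { intros s hs. pose proof (Hmono s3 s ltac:(lra) ltac:(lra) ltac:(lra)). pose proof (Hmono s t ltac:(lra) ltac:(lra) ltac:(lra)).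
    destruct (th_reach b p pe (sth (x s3)) Hbs) as [u3 [k1 k2]]; [lra|lra|].
    destruct (th_reach b u3 pe (sth (x s)) Hbs) as [u [k3 k4]]; [lra|lra|].
    apply Rle_trans with (sv (b u)); [left|apply Rle_trans with (sv (b pe)); [apply coll_v_nondecr; auto; lra|apply hvb]].
    apply (barrier x b s3 s u3 u); auto; try lra.
    - intros z hz. destruct (Req_dec z t) as [->|]; [lra|left; apply Hw; lra].
    - intros z hz. apply Hwb. lra.
    - assert (sv (b p) <= sv (b u3)) by (apply coll_v_nondecr; auto; lra). lra. }
  assert (Hr : forall s, 0 <= sr (x s)) by (intros; apply (sol_P1 x s Hx)).
  assert (HWx : forall s, s3 <= s <= t -> V ths * cos (sth (x s)) ^ 2 <= W (sth (x s))).
  { intros s hs. apply W_ge_V. pose proof (Hmono s3 s ltac:(lra) ltac:(lra) ltac:(lra)). pose proof (Hmono s t ltac:(lra) ltac:(lra) ltac:(lra)). lra. }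
  assert (hct : cos (sth (x t)) <> 0) by (apply Rlt_not_eq, cos_lt_0; lra).
  (* Either [v] rises to [- vs / 2], from where the bound on [r] applies, or [v] stays nonpositive
     and [En] does not increase: it is at most [V ths] when the orbit crosses [ths], too little for
     a turn later. *)
  destruct (classic (exists s, s3 <= s <= t /\ - (vs / 2) <= sv (x s))) as [[s6 [Hs6 Hv6]]|Hall].
  - destruct (ivt (fun s => sv (x s)) s3 s6 (- (vs / 2))) as [s5 [k1 [k2 k3]]]; try lra.
    { intros; apply sol_cv; auto. }
    cbv beta in k2. assert (Hr5 : sr (x s5) <= sr (x s3)).
    { apply r_nonincr; auto; [lra|]. intros z hz. specialize (k3 z ltac:(lra)). cbv beta in k3. lra. }
    assert (Hstep : forall s', s5 <= s' <= t -> (forall s, s5 <= s < s' -> sr (x s) <= m) -> - vb < sv (x s') /\ sr (x s') < m).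
    { intros s' hs' hrm.
      assert (hdv : forall s, s5 <= s < s' -> - vb <= sv (x s) -> 2 * m * cos (sth (x s)) ^ 2 <= Fv (x s)).
      { intros s hs h. specialize (Hup s ltac:(lra)). specialize (HWx s ltac:(lra)).
        pose proof (sol_P1 x s Hx) as hP. rewrite (Fv_eq _ hP). pose proof (En_eq _ hP) as hE. unfold En in hE.
        assert (hv2 : sv (x s) ^ 2 <= vb * vb) by (clear - h Hup; nra).
        set (k := cos (sth (x s)) ^ 2) in *. assert (hk : 0 <= k) by apply pow2_ge_0.
        assert (l1 : (4 * m) * k <= (V ths - / 2 * sv (x s) ^ 2) * k) by (apply Rmult_le_compat_r; auto; unfold m; lra).
        assert (l2 : sr (x s) * k <= m * k) by (apply Rmult_le_compat_r; auto). lra. }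
      assert (hvb' : forall s, s5 <= s <= s' -> - vb < sv (x s)).
      { intros s hs. apply Rnot_le_lt. intros hn.
        destruct (first_zero (fun s => - vb - sv (x s)) s5 s) as [z [h1 [h2 h3]]]; try lra.
        { intros u _. apply (continuous_minus (fun _ => - vb) (fun s => sv (x s))); [apply continuous_const|apply sol_cv; auto]. }
        cbv beta in h2. assert (sv (x s5) <= sv (x z)); [|lra].
        apply (nondecr (fun s => sv (x s)) (fun s => Fv (x s))); [lra|intros; apply sol_dv; auto|].
        intros u hu. specialize (h3 u ltac:(lra)). cbv beta in h3. specialize (hdv u ltac:(lra) ltac:(lra)).
        assert (0 <= 2 * m * cos (sth (x u)) ^ 2) by pos. lra. }
      split; [apply hvb'; lra|].
      assert (hdec : sr (x s') * exp (- K * sv (x s')) <= sr (x s5) * exp (- K * sv (x s5))).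
      { apply (nonincr (fun s => sr (x s) * exp (- K * sv (x s)))
           (fun s => Fr (x s) * exp (- K * sv (x s)) + sr (x s) * (- K * Fv (x s) * exp (- K * sv (x s))))); [lra| |].
        - intros s hs. apply (is_derive_mult (fun s => sr (x s)) (fun s => exp (- K * sv (x s)))); [apply sol_dr; auto| |apply Rmult_comm].
          eapply is_derive_eq.
          { apply (is_derive_comp exp (fun s => - K * sv (x s))); [auto_derive; [auto|reflexivity]|].
            apply (is_derive_scal (fun s => sv (x s)) s (- K)). apply sol_dv; auto. }
          unfold scal; simpl; unfold mult; simpl. ring.
        - intros s hs. specialize (hvb' s ltac:(lra)). specialize (hdv s ltac:(lra) ltac:(lra)). specialize (Hup s ltac:(lra)).
          pose proof (exp_pos (- K * sv (x s))) as he'. set (E := exp (- K * sv (x s))) in *. unfold Fr. set (k := cos (sth (x s)) ^ 2) in *.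
          assert (hk : 0 <= k) by apply pow2_ge_0.
          assert (l1 : sv (x s) * k <= vb * k) by (apply Rmult_le_compat_r; auto).
          assert (l2 : K * (2 * m * k) <= K * Fv (x s)) by (apply Rmult_le_compat_l; lra).
          replace (K * (2 * m * k)) with (vb * k) in l2 by (rewrite <- hKm; ring).
          replace (sr (x s) * sv (x s) * k * E + sr (x s) * (- K * Fv (x s) * E)) with (- (sr (x s) * E * (K * Fv (x s) - sv (x s) * k))) by ring.
          assert (0 <= sr (x s) * E * (K * Fv (x s) - sv (x s) * k)); [|lra]. apply Rmult_le_pos; [apply Rmult_le_pos; auto; lra|lra]. }
      assert (hbd : sr (x s') <= sr (x s5) * exp (K * (sv (x s') - sv (x s5)))).
      { apply Rmult_le_reg_r with (exp (- K * sv (x s'))); [apply exp_pos|]. rewrite Rmult_assoc, <- exp_plus.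
        replace (K * (sv (x s') - sv (x s5)) + - K * sv (x s')) with (- K * sv (x s5)) by ring. exact hdec. }
      specialize (Hup s' ltac:(lra)).
      assert (hx1 : exp (K * (sv (x s') - sv (x s5))) <= exp (K * (2 * vs))).
      { destruct (Req_dec (K * (sv (x s') - sv (x s5))) (K * (2 * vs))) as [->|hne]; [lra|]. left. apply exp_increasing.
        assert (K * (sv (x s') - sv (x s5)) <= K * (2 * vs)) by (apply Rmult_le_compat_l; lra). lra. }
      apply Rle_lt_trans with (sr (x s5) * exp (K * (sv (x s') - sv (x s5)))); auto.
      apply Rle_lt_trans with (sr (x s3) * exp (K * (2 * vs))).
      { apply Rmult_le_compat; auto. left. apply exp_pos. }
      replace m with (e3 * exp (K * (2 * vs))) by (unfold e3; field; lra). apply Rmult_lt_compat_r; auto. lra. }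
    assert (Hrm : forall s, s5 <= s <= t -> sr (x s) <= m).
    { intros s hs. apply Rnot_lt_le. intros hn.
      destruct (Hstep s5) as [_ h0]; [lra|intros; lra|].
      destruct (first_zero (fun s => sr (x s) - m) s5 s) as [z [h1 [h2 h3]]]; try lra.
      { intros u _. apply (continuous_minus (fun s => sr (x s)) (fun _ => m)); [apply sol_cr; auto|apply continuous_const]. }
      cbv beta in h2. destruct (Hstep z) as [_ h4]; [lra| |lra]. intros u hu. specialize (h3 u hu). cbv beta in h3. lra. }
    destruct (Hstep t) as [h1 h2]; [lra|intros; apply Hrm; lra|].
    specialize (Hup t ltac:(lra)). specialize (HWx t ltac:(lra)). pose proof (En_eq _ (sol_P1 x t Hx)) as hE. rewrite Hwt in hE.
    assert (hv2 : sv (x t) ^ 2 <= vb * vb) by (clear - h1 Hup; nra).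
    assert (hk : 0 < cos (sth (x t)) ^ 2) by (apply pow2_gt_0; auto).
    assert (En (x t) < V ths) by (unfold En; unfold m in *; lra).
    assert (En (x t) * cos (sth (x t)) ^ 2 < V ths * cos (sth (x t)) ^ 2) by (apply Rmult_lt_compat_r; auto). lra.
  - assert (Hneg : forall s, s3 <= s <= t -> sv (x s) <= 0).
    { intros s hs. apply Rnot_lt_le. intros hn. apply Hall. exists s. split; auto. lra. }
    destruct (th_ivt x s3 t ths) as [s5 [k1 [k2 _]]]; auto; try lra. destruct (V_ths_cases ths ltac:(auto)) as (_ & _ & _ & hcp).
    pose proof (En_le_V (x s5) (sol_P1 x s5 Hx)) as hE. rewrite k2 in hE.
    assert (hdec : En (x t) <= En (x s5)).
    { apply En_nonincr; auto; [lra|]. intros; apply Hneg; lra. }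
    pose proof (En_turn (x t) (sol_P1 x t Hx) hct Hwt) as hEt.
    assert (hV : V ths < V (sth (x t))); [|lra].
    assert (hVs : V (sth (x t)) = V (sth (x t) - PI)).
    { unfold V. rewrite <- (W_per (sth (x t) - PI)). replace (sth (x t) - PI + PI) with (sth (x t)) by ring.
      replace (cos (sth (x t))) with (- cos (sth (x t) - PI)); [f_equal; ring|]. rewrite <- neg_cos. f_equal. ring. }
    rewrite hVs. apply V_min; lra.
Qed.
End Thin.

(** * The homothetic Euler orbit and its neighbours *)

Section Apex.
Context {S : system} {B : branches}.
Notation O0 := (flow (sig 0 0)).

(** The point of largest radius on the homothetic orbit along [theta = 0], which descends from there
    to the lower Euler equilibrium. *)
Definition apex : state := St (V 0) 0 0 0.

Lemma apex_P1 : P1 apex.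
Proof. split; [left; apply V_0_pos|]. unfold energy, apex. simpl. rewrite cos_0, W_0. ring. Qed.

(** The mirror symmetry fixes the apex, hence its orbit, so [theta = w = 0] throughout. Then [v]
    decreases at rate [r] while [En = V 0] is constant, which forces [r] to become small. *)
Lemma apex_falls e : 0 < e -> exists tau, 0 <= tau /\ near e (flow apex tau) (St 0 (- vE) 0 0) /\
  forall s, sth (flow apex s) = 0.
Proof.
  intros He. destruct (flow_spec _ apex_P1) as [h0 Hh]. destruct vE_sq as [hE1 hE2].
  assert (Hm : forall s, mir (flow apex s) = flow apex s).
  { apply (sol_unique _ _ 0); [apply sol_mir; auto|auto|]. rewrite h0. apply state_eq; simpl; lra. }
  assert (Hth : forall s, sth (flow apex s) = 0) by (intros s; pose proof (f_equal sth (Hm s)) as k; simpl in k; lra).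
  assert (Hw : forall s, sw (flow apex s) = 0) by (intros s; pose proof (f_equal sw (Hm s)) as k; simpl in k; lra).
  assert (HE : forall s, sr (flow apex s) + / 2 * sv (flow apex s) ^ 2 = V 0).
  { intros s. pose proof (En_turn _ (sol_P1 _ s Hh)) as k. unfold En in k. rewrite Hth, cos_0, Hw in k. apply k; lra. }
  assert (HF : forall s, Fv (flow apex s) = - sr (flow apex s)).
  { intros s. rewrite (Fv_eq _ (sol_P1 _ s Hh)), Hw, Hth, cos_0. ring. }
  assert (Hr : forall s, 0 <= sr (flow apex s)) by (intros s; apply (sol_P1 _ s Hh)).
  assert (Hv : forall s, 0 <= s -> sv (flow apex s) <= 0).
  { intros s hs. replace 0 with (sv (flow apex 0)) by (rewrite h0; auto).
    apply (nonincr (fun s => sv (flow apex s)) (fun s => Fv (flow apex s))); auto; [intros; apply sol_dv; auto|].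
    intros u _. rewrite HF. specialize (Hr u). lra. }
  set (eta := Rmin e (e * vE / 2)). assert (heta : 0 < eta).
  { apply Rmin_glb_lt; auto. assert (0 < e * vE) by pos. lra. }
  assert (Hex : exists tau, 0 <= tau /\ sr (flow apex tau) < eta).
  { set (T := (vE + 1) / eta). assert (hT : 0 < T) by pos.
    destruct (classic (exists tau, 0 <= tau /\ sr (flow apex tau) < eta)) as [|hn]; auto. exfalso.
    assert (h : sv (flow apex T) + eta * T <= sv (flow apex 0) + eta * 0).
    { apply (nonincr (fun s => sv (flow apex s) + eta * s) (fun s => Fv (flow apex s) + eta)); [lra| |].
      - intros s _. apply (is_derive_plus (fun s => sv (flow apex s)) (fun s => eta * s)); [apply sol_dv; auto|auto_derive; auto; ring].
      - intros s hs. rewrite HF. destruct (Rlt_dec (sr (flow apex s)) eta); [|lra]. exfalso. apply hn. exists s. split; auto. lra. }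
    rewrite h0 in h. simpl in h. assert (hTe : eta * T = vE + 1) by (unfold T; field; lra).
    specialize (HE T). specialize (Hr T). nra. }
  destruct Hex as [tau [ht hr]]. exists tau. split; auto. split; auto.
  assert (eta <= e) by apply Rmin_l. assert (eta <= e * vE / 2) by apply Rmin_r.
  specialize (HE tau). specialize (Hr tau).
  split; [|split; [|split]]; simpl.
  - apply Rabs_def1; lra.
  - replace (sv (flow apex tau) - - vE) with (sv (flow apex tau) + vE) by ring. apply sq_close; auto; [lra|]. apply Rabs_def1; lra.
  - rewrite Hth. apply Rabs_def1; lra.
  - rewrite Hw. apply Rabs_def1; lra.
Qed.

(** For small [r] the orbit follows [O0] to the vicinity of the upper Euler equilibrium, with
    [v > 0]. It meets the Euler line with [v < 0], so [v] vanishes in between. Until then [En] does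
    not decrease, so it is close to [V 0]; with [v = 0] and [theta] near [0] this puts [r] near
    [V 0] and [w] near [0]. *)
Lemma reach_apex b0 d : ~ hits (sig 0 0) -> 0 < b0 -> (forall r, 0 < r < b0 -> hitsP (fun v => v < 0) (sig r 0)) -> 0 < d ->
  exists r s t, 0 < r < b0 /\ 0 < s < t /\ whit (flow (sig r 0)) 0 t /\ near d apex (flow (sig r 0) s).
Proof.
  intros Hn Hb0 Hneg Hd. destruct (O0_tends Hn) as (Hw & Ht & _). destruct (O0_limits Hn) as (_ & _ & _ & Hv).
  assert (Hc := O0_coll). assert (Hx := coll_sol _ Hc). pose proof V_0_pos as hV0. destruct c_bounds as (cm & cM & hcm & hcM & hcb).
  set (k0 := Rmin d (Rmin (cm * d * d / 4) (V 0))). assert (hcd : 0 < cm * d * d) by pos.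
  assert (hk0 : 0 < k0) by (unfold k0; pos).
  assert (hk0' : k0 <= d /\ k0 <= cm * d * d / 4 /\ k0 <= V 0).
  { rmin d (Rmin (cm * d * d / 4) (V 0)).
    rmin (cm * d * d / 4) (V 0). unfold k0. lra. }
  destruct (continuous_eps V 0) with (e := k0 / 2) as [d1 [hd1 HV]]; [apply V_cont; rewrite cos_0; lra|lra|].
  set (d2 := Rmin (Rmin d d1) 1). assert (hd2 : 0 < d2) by (unfold d2; pos).
  assert (hd2' : d2 <= d /\ d2 <= d1 /\ d2 <= 1).
  { rmin (Rmin d d1) 1. rmin d d1. unfold d2. lra. }
  destruct Ht as [Ht1 Ht2]. destruct (Ht2 d2 hd2) as [sa [hsa Hsa]].
  destruct (tends_En O0 0 (k0 / 4) Hx) as [sb [hsb Hsb]]; [intros; apply Hw; lra|rewrite cos_0; lra|split; auto|lra|].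
  set (s1 := Rmax sa sb). assert (h1 : sa <= s1) by apply Rmax_l. assert (h2 : sb <= s1) by apply Rmax_r.
  specialize (Hsa s1 h1). specialize (Hsb s1 h2). specialize (Ht1 s1 ltac:(lra)). specialize (Hv s1 ltac:(lra)).
  unfold En in Hsb. rewrite coll_r in Hsb by auto. apply Rabs_def2 in Hsb.
  set (v1 := sv (O0 s1)) in *. assert (hv1 : 0 < v1).
  { destruct Hv as [|h]; auto. rewrite <- h in Hsb. lra. }
  set (e1 := k0 / (4 * v1)). assert (he1 : 0 < e1) by pos. assert (he1v : v1 * e1 = k0 / 4) by (unfold e1; field; lra).
  set (e := Rmin (Rmin (- sth (O0 s1)) (sth (O0 s1) + d2)) (Rmin v1 e1)).
  assert (he : 0 < e) by (unfold e; pos).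
  assert (he' : e <= - sth (O0 s1) /\ e <= sth (O0 s1) + d2 /\ e <= v1 /\ e <= e1).
  { set (u1 := - sth (O0 s1)) in *. set (u2 := sth (O0 s1) + d2) in *. rmin (Rmin u1 u2) (Rmin v1 e1).
    rmin u1 u2. rmin v1 e1. unfold e. lra. }
  destruct (continuous_dependence O0 s1 e Hx ltac:(lra) he) as [d3 [hd3 Hdep]].
  assert (hr0 : 0 < Rmin d3 b0) by pos. rmin d3 b0.
  set (r := Rmin d3 b0 / 2). assert (hr : 0 < r < b0 /\ r < d3) by (unfold r; lra).
  assert (Hs0 : sec (sig 0 0)) by (apply sec_sig; lra). assert (Hsr : sec (sig r 0)) by (apply sec_sig; lra).
  set (x := flow (sig r 0)). assert (Hxr : sol x) by (apply orb_sol; auto).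
  assert (Hnear : forall s, 0 <= s <= s1 -> near e (O0 s) (x s)).
  { intros s hs. apply Hdep; auto; [|rewrite Rabs_pos_eq; lra]. unfold x. rewrite !orb_0 by auto. apply sec_near; auto; simpl; apply Rabs_def1; lra. }
  assert (Hthneg : forall s, 0 <= s <= s1 -> sth (x s) < 0).
  { intros s hs. specialize (Hnear s hs). apply near_elim in Hnear.
    assert (sth (O0 s) <= sth (O0 s1)) by (apply th_mono; auto; [lra|intros; apply Hw; lra]). lra. }
  destruct (Hneg r ltac:(lra)) as [t [Hwt Hvt]]. destruct Hwt as (t0 & t1 & t2). fold x in Hvt, t1, t2.
  assert (hts : s1 < t). { apply Rnot_le_lt. intros hn. specialize (Hthneg t ltac:(lra)). lra. }
  pose proof (Hnear s1 ltac:(lra)) as hn1. apply near_elim in hn1. fold v1 in hn1.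
  destruct (first_zero (fun s => - sv (x s)) s1 t) as [s2 [k1 [k2 k3]]]; try lra.
  { intros u _. apply (continuous_opp (fun s => sv (x s))). apply sol_cv; auto. }
  cbv beta in k2. assert (hs2t : s2 < t). { destruct (proj2 k1) as [|k]; auto. rewrite k in k2. lra. }
  exists r, s2, t. split; [lra|]. split; [lra|]. split; [split; auto|].
  assert (hEn : En (x s1) <= En (x s2)).
  { apply En_nondecr; auto; [lra|]. intros u hu. specialize (k3 u ltac:(lra)). cbv beta in k3. lra. }
  assert (hr1 : 0 <= sr (x s1)) by (apply (sol_P1 x s1 Hxr)).
  assert (hEs1 : V 0 - k0 / 2 < En (x s1)).
  { unfold En. assert (hve : v1 * e <= v1 * e1) by (apply Rmult_le_compat_l; lra).
    assert (hsq : (v1 - e) * (v1 - e) <= sv (x s1) * sv (x s1)) by (apply Rmult_le_compat; lra).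
    assert (0 < e * e) by pos. replace (sv (x s1) ^ 2) with (sv (x s1) * sv (x s1)) by ring.
    replace (v1 ^ 2) with (v1 * v1) in Hsb by ring. lra. }
  assert (hth2 : - d2 < sth (x s2) <= 0).
  { assert (sth (x s1) < sth (x s2)) by (apply th_incr; auto; [lra|intros; apply t2; lra]).
    assert (sth (x s2) < sth (x t)) by (apply th_incr; auto; intros; apply t2; lra). lra. }
  assert (hcos : cos (sth (x s2)) <> 0) by (apply Rgt_not_eq, cos_pos; pose proof PI2_1; lra).
  pose proof (sol_P1 x s2 Hxr) as hP. pose proof (En_le_V _ hP hcos) as hle. pose proof (En_V _ hP hcos) as hEV. assert (hVk : Rabs (V (sth (x s2)) - V 0) < k0 / 2) by (apply HV; rewrite Rminus_0_r; apply Rabs_def1; lra). apply Rabs_def2 in hVk.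
  assert (hE2 : En (x s2) = sr (x s2)) by (unfold En; replace (sv (x s2)) with 0 by lra; ring).
  assert (hww : sw (x s2) ^ 2 < d ^ 2).
  { assert (hcc : 0 <= cos (sth (x s2)) ^ 2 <= 1) by (split; [apply pow2_ge_0|pose proof (COS_bound (sth (x s2))) as hc; clear - hc; nra]).
    assert (l1 : (V (sth (x s2)) - En (x s2)) * cos (sth (x s2)) ^ 2 <= k0 * 1) by (apply Rmult_le_compat; lra).
    assert (l2 : sw (x s2) ^ 2 * cm <= sw (x s2) ^ 2 * c (sth (x s2))) by (apply Rmult_le_compat_l; [apply pow2_ge_0|apply hcb]).
    apply Rmult_lt_reg_r with cm; auto. replace (d ^ 2 * cm) with (cm * d * d) by ring. lra. }
  assert (hw2 : 0 < sw (x s2)) by (apply t2; lra).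
  fold x. apply near_intro; simpl; try lra. split; [|lra]. clear - hww hw2 Hd. nra.
Qed.

Definition through (r : R) : Prop := exists t, whit (flow (sig r 0)) (PI / 2) t /\ turns (unshift (flow (sig r 0) t)).

Lemma flow_unshift x t s : sol x -> flow (unshift (x t)) s = unshift (x (s + t)).
Proof.
  intros Hx. assert (hP : P1 (unshift (x t))) by (apply P1_unshift, sol_P1; auto). destruct (flow_spec _ hP) as [h1 h2].
  rewrite <- (unshift_shift (flow (unshift (x t)) s)). f_equal.
  apply (sol_unique (fun s => shift (flow (unshift (x t)) s)) (fun s => x (s + t)) 0); [apply sol_shift; auto|apply sol_translate; auto|].
  rewrite h1, shift_unshift, Rplus_0_l. auto.
Qed.

(** An orbit that comes near the apex is carried down to the lower Euler equilibrium, from where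
    [thin_no_turn] forbids a turn beyond [PI / 2]. *)
Lemma left_end b0 : ~ hits (sig 0 0) -> 0 < b0 -> (forall r, 0 < r < b0 -> hitsP (fun v => v < 0) (sig r 0)) ->
  exists r, 0 < r < b0 /\ ~ through r.
Proof.
  intros Hn Hb Hneg. destruct thin_no_turn as [e [He Hthin]]. destruct (apex_falls (e / 2) ltac:(lra)) as (tau & htau & hnear & hth).
  destruct (flow_spec _ apex_P1) as [h0 Hh].
  destruct (continuous_dependence (flow apex) tau (Rmin (e / 2) 1) Hh htau) as [d [Hd Hdep]]; [pos|].
  destruct (reach_apex b0 d Hn Hb Hneg Hd) as (r & s & t & hr & hs & Ht & hns). exists r. split; auto. intros (tq & Htq & [u Hu]).
  assert (Hsr : sec (sig r 0)) by (apply sec_sig; lra). set (x := flow (sig r 0)) in *. assert (Hx : sol x) by (apply orb_sol; auto).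
  destruct Ht as (a1 & a2 & a3). destruct Htq as (b1 & b2 & b3). pose proof PI2_1 as hpi.
  assert (htq : t < tq).
  { apply Rnot_le_lt. intros hn. destruct (Req_dec t tq) as [->|]; [lra|].
    assert (sth (x tq) < sth (x t)) by (apply th_incr; auto; [lra|intros; apply a3; lra]). lra. }
  assert (Hy : forall z, 0 <= z <= tau -> near (Rmin (e / 2) 1) (flow apex z) (x (z + s))).
  { intros z hz. apply (Hdep (fun z => x (z + s))); [apply sol_translate; auto|rewrite h0, Rplus_0_l; auto|rewrite Rabs_pos_eq; lra]. }
  assert (h3 : tau + s < tq).
  { apply Rnot_le_lt. intros hn. specialize (Hy (tq - s) ltac:(lra)). apply (near_weaken _ 1) in Hy; [|apply Rmin_r].
    apply near_elim in Hy. replace (tq - s + s) with tq in Hy by ring. rewrite hth in Hy. lra. }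
  destruct Hu as (u1 & u2 & u3 & u4). rewrite !flow_unshift, ?Rplus_0_l in * by auto. simpl in u2, u3.
  apply (Hthin x (tau + s) (u + tq)); auto; try lra.
  - apply near_weaken with (e / 2 + e / 2); [lra|]. apply near_trans with (flow apex tau); auto. apply near_sym.
    apply near_weaken with (Rmin (e / 2) 1); [apply Rmin_l|]. apply Hy. lra.
  - intros z hz. destruct (Rle_dec z tq); [apply b3; lra|]. specialize (u4 (z - tq) ltac:(lra)). rewrite flow_unshift in u4 by auto. simpl in u4.
    replace (z - tq + tq) with z in u4 by ring. auto.
Qed.
End Apex.

(** * Shooting beyond the Euler line in the degenerate case *)

Section Excursion.
Context {S : system} {B : branches}.
Notation Pos := (hitsP (fun v => 0 < v)).

Lemma unshift_sec x t : sol x -> whit x (PI / 2) t -> sec (unshift (x t)).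
Proof.
  intros Hx (h1 & h2 & h3). split; [apply P1_unshift, sol_P1; auto|]. split; simpl; [lra|apply h3; lra].
Qed.

Lemma near_unshift e x y : near e x y -> near e (unshift x) (unshift y).
Proof. intros h. apply near_shift. now rewrite !shift_unshift. Qed.

Lemma out_open r t A : 0 <= r -> whit (flow (sig r 0)) (PI / 2) t -> open_at (unshift (flow (sig r 0) t)) A ->
  exists d, 0 < d /\ forall r', 0 <= r' -> Rabs (r' - r) < d -> exists t', whit (flow (sig r' 0)) (PI / 2) t' /\ A (unshift (flow (sig r' 0) t')).
Proof.
  intros Hr Ht [d [Hd H]]. assert (Hs : sec (sig r 0)) by now apply sec_sig.
  destruct (open_sig r _ Hr (sec_whit_near (sig r 0) (PI / 2) t d Hs Ht Hd)) as [d' [Hd' H']].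
  exists d'. split; auto. intros r' Hr' h. destruct (H' r' Hr' h) as [t' [k1 k2]]. exists t'. split; auto.
  apply H; [|apply near_unshift; auto]. apply unshift_sec; auto. apply orb_sol, sec_sig; auto.
Qed.

Definition out r p := exists t, whit (flow (sig r 0)) (PI / 2) t /\ ret (unshift (flow (sig r 0) t)) p.

(** Just below [b0] orbits follow [gam'] to [PI / 2], where [gam'_exit] puts [gam'] above the
    threshold of [coll_turn]. As [v] does not decrease along a collision orbit, the return point is
    above the threshold as well and turns again; both turns persist for nearby orbits with
    [r > 0]. *)
Lemma out_end b0 : 0 < b0 -> asym (sig b0 0) -> (forall r, 0 < r < b0 -> hitsP (fun v => v < 0) (sig r 0)) ->
  exists r p, 0 < r < b0 /\ out r p /\ turns p.
Proof.
  intros Hb Ha Hneg. assert (Hn : ~ hits (sig 0 0)) by (apply O0_not_hits; exists b0; auto).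
  destruct gam'_out as [t4 Ht4]. pose proof (gam'_exit t4 Hn Ht4) as Hex. assert (Hg := gam'_sol). assert (Hgc := gam'_coll).
  set (z := unshift (gam' t4)). assert (Hz : sec z) by (apply unshift_sec; auto).
  assert (Hzr : sr z = 0) by (unfold z; simpl; apply coll_r; auto).
  destruct (turn_ret z Hz) as [z' Hz']; [apply coll_turn; auto|].
  assert (Hz's := ret_sec _ _ Hz Hz'). assert (Hzc := sec_coll _ Hz Hzr).
  assert (Hz't : turns z').
  { destruct Hz' as (t1 & t2 & h1 & (h2 & _) & h3). destruct h1 as (h1 & _).
    apply coll_turn; auto.
    - replace (sr z') with (sr (shift z')) by reflexivity. rewrite h3. simpl. apply coll_r; auto.
    - replace (sv z') with (sv (shift z')) by reflexivity. rewrite h3. simpl.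
      assert (sv (flow z 0) <= sv (flow z (t2 + t1))) by (apply coll_v_nondecr; auto; lra). rewrite (orb_0 z Hz) in H. simpl in H. lra. }
  assert (HA : open_at z (fun q => exists q', ret q q' /\ turns q')).
  { destruct (turns_open z' Hz's Hz't) as [d [Hd H]]. destruct (ret_cont z z' d Hz Hz' Hd) as [d' [Hd' H']]. exists d'. split; auto.
    intros q Hq hq. destruct (H' q Hq hq) as [q' [k1 k2]]. exists q'. split; auto. apply H; auto. apply (ret_sec _ _ Hq k1). }
  destruct HA as [d [Hd HA]]. destruct (whit_near gam' (PI / 2) t4 d Hg Ht4 Hd) as [d' [Hd' Hwn]].
  assert (Hsb : sec (sig b0 0)) by (apply sec_sig; lra).
  destruct (open_sig b0 _ ltac:(lra) (asym_hits (sig b0 0) d' Hsb Hb Ha Hd')) as [d2 [Hd2 H2]].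
  rminp d2 b0.
  set (r := b0 - Rmin d2 b0 / 2). assert (hr : 0 < r < b0) by (unfold r; lra).
  destruct (Hneg r hr) as [t [Ht _]]. assert (Hsr : sec (sig r 0)) by (apply sec_sig; lra). assert (Hx := orb_sol _ Hsr).
  assert (hn : near d' (gam' 0) (flow (sig r 0) t)) by (apply (H2 r); auto; [lra|apply Rabs_def1; unfold r; lra]).
  destruct (Hwn (fun s => flow (sig r 0) (s + t))) as [k1 k2]; [apply sol_translate; auto|now rewrite Rplus_0_l|].
  destruct k2 as [ty Hty]; [apply gam'_dep; lra|]. destruct (k1 ty Hty) as [k3 _].
  assert (Hw : whit (flow (sig r 0)) (PI / 2) (ty + t)) by (eapply whit_trans; eauto).
  destruct (HA (unshift (flow (sig r 0) (ty + t)))) as [p [h1 h2]]; [apply unshift_sec; auto|apply near_unshift; auto|].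
  exists r, p. split; auto. split; auto. exists (ty + t). auto.
Qed.

Lemma through_open r : 0 < r -> through r -> exists d, 0 < d /\ forall r', Rabs (r' - r) < d -> through r'.
Proof.
  intros Hr [t [Ht Hz]]. assert (Hx : sol (flow (sig r 0))) by (apply orb_sol, sec_sig; lra).
  destruct (out_open r t turns ltac:(lra) Ht (turns_open _ (unshift_sec _ _ Hx Ht) Hz)) as [d [Hd H]].
  exists (Rmin d r). split; [pos|]. intros r' h. rmin d r.
  apply H; [apply Rabs_def2 in h; lra|lra].
Qed.

Lemma whit_between x a b t : sol x -> - (PI / 2) <= sth (x 0) < a -> a < b -> whit x b t -> exists t', whit x a t' /\ t' < t.
Proof.
  intros Hx h0 hab (h1 & h2 & h3). destruct (th_ivt x 0 t a) as [u [k1 [k2 k3]]]; auto; try lra. assert (u <> t) by (intros ->; lra). exists u. split; [|lra]. split; [lra|]. split; auto. intros; apply h3; lra.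
Qed.

(** Shooting between orbits of small radius, which are not [through], and those near [b0], for which the point of return to [PI / 2] turns again. *)
Lemma excursion b0 : 0 < b0 -> asym (sig b0 0) -> (forall r, 0 < r < b0 -> hitsP (fun v => v < 0) (sig r 0)) ->
  exists r p, 0 < r /\ out r p /\ hitsP (fun v => v = 0) p.
Proof.
  intros Hb Ha Hneg. destruct (out_end b0 Hb Ha Hneg) as (C & pC & hC & HoC & HtC).
  assert (Hn : ~ hits (sig 0 0)) by (apply O0_not_hits; exists b0; auto). destruct ths_int as [ht1 ht2].
  destruct (left_end C Hn ltac:(lra)) as [r0 [hr0 Hnr0]]; [intros; apply Hneg; lra|].
  assert (HthC : through C) by (destruct HoC as [t [k1 k2]]; exists t; split; auto; eapply ret_turns; eauto).
  destruct (last_change r0 C through ltac:(lra) Hnr0 HthC) as [d [hd [Hnd Hab]]].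
  { intros r hr. apply through_open. lra. }
  assert (Hs : sec (sig d 0)) by (apply sec_sig; lra). set (x := flow (sig d 0)). assert (Hx : sol x) by (apply orb_sol; auto).
  assert (Hx0 : x 0 = sig d 0) by (apply orb_0; auto).
  assert (Hright : forall A, (exists e, 0 < e /\ forall r, 0 <= r -> Rabs (r - d) < e -> A r) -> exists r, d < r <= C /\ A r /\ through r).
  { intros A [e [He H]]. rminp e (C - d).
    exists (d + Rmin e (C - d) / 2). split; [lra|]. split; [apply H; [lra|apply Rabs_def1; lra]|apply Hab; lra]. }
  assert (Hdx : forall r, d < r <= C -> sec (sig r 0) /\ sol (flow (sig r 0)) /\ flow (sig r 0) 0 = sig r 0).
  { intros r hr. assert (hs : sec (sig r 0)) by (apply sec_sig; lra). split; auto. split; [apply orb_sol|apply orb_0]; auto. }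
  destruct (Hneg d ltac:(lra)) as [t [Ht _]]. fold x in Ht. destruct (whit_start x 0 t Hx Ht) as [eta [He Heta]].
  (* Parameters just above [d] are [through]. A turn of [x] before [ths] would persist for them; if
     [x] were asymptotic to [ths], they would follow the shifted [gam] to [PI / 2] and then hit the
     next Euler line instead of turning. *)
  assert (Hout : exists tq, whit x (PI / 2) tq).
  { destruct (fall (fun s => x (s + t)) ths eta) as [[u Hu]|[[u Hu]|(k1 & k2 & k3)]]; auto.
    - now apply sol_translate.
    - rewrite Rplus_0_l. destruct Ht as (_ & -> & _). lra.
    - lra.
    - apply q_ths'.
    - rewrite Rplus_0_l. destruct Ht as (_ & -> & _). apply q_neg'.
    - apply (whit_ths_out x (u + t)); auto. eapply whit_trans; eauto.
    - exfalso. assert (hy : sol (fun s => x (s + t))) by now apply sol_translate.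
      assert (hq : 0 < sth (x (u + t)) < ths).
      { destruct Hu as (_ & _ & hh & _). rewrite Rplus_0_l in hh. destruct Ht as (_ & h' & _). lra. }
      destruct (turn_near (fun s => x (s + t)) ths u 1 hy) as [d1 [Hd1 H1]]; auto; try lra.
      + rewrite Rplus_0_l. apply Ht. destruct Ht; lra.
      + rewrite Rplus_0_l. destruct Ht as (_ & -> & _). lra.
      + apply q_neg'. auto.
      + destruct (open_sig d _ ltac:(lra) (sec_whit_near (sig d 0) 0 t d1 Hs Ht Hd1)) as [d2 [Hd2 H2]].
        destruct (Hright _ (ex_intro _ d2 (conj Hd2 H2))) as [r [hr [[t' [k1 k2]] [tq [k3 _]]]]].
        destruct (Hdx r hr) as (k4 & k5 & k6).
        destruct (H1 (fun s => flow (sig r 0) (s + t'))) as [ty [k7 _]]; [now apply sol_translate|rewrite !Rplus_0_l; auto|].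
        destruct (whit_between _ ths (PI / 2) tq k5) as [u' [k8 _]]; auto; [rewrite k6; simpl; lra|].
        assert (ht' : t' < u').
        { apply Rnot_le_lt. intros hn. destruct k1 as (j1 & j2 & j3). destruct k8 as (i1 & i2 & i3).
          destruct (Req_dec u' t') as [->|]; [lra|]. assert (sth (flow (sig r 0) u') < sth (flow (sig r 0) t')) by (apply th_incr; auto; [lra|intros; apply j3; lra]). lra. }
        apply (turn_not_whit (fun s => flow (sig r 0) (s + t')) ths ty (u' - t')); auto; [|now apply sol_translate].
        destruct k8 as (i1 & i2 & i3). split; [lra|]. split; [replace (u' - t' + t') with u' by ring; auto|]. intros z hz. apply i3. destruct k1. lra.
    - exfalso. assert (hw : forall s, 0 < s -> 0 < sw (x s)).
      { intros s hs. destruct (Rle_dec s t); [apply Ht; lra|]. replace s with (s - t + t) by ring. apply k1. lra. }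
      assert (hten : tends x ths).
      { destruct k3 as [j1 j2]. destruct Ht as (i1 & i2 & i3). split.
        - intros s hs. destruct (Rle_dec t s); [replace s with (s - t + t) by ring; apply j1; lra|].
          assert (sth (x s) < sth (x t)) by (apply th_incr; auto; [lra|intros; apply i3; lra]). lra.
        - intros e he. destruct (j2 e he) as [s0 [j3 j4]]. exists (s0 + t). split; [lra|]. intros s hs. replace s with (s - t + t) by ring. apply j4. lra. }
      assert (hb0 : sth ((fun s => shift (gam s)) 0) = PI / 2) by (simpl; rewrite gam_th; lra).
      destruct (hits_open (gam 0) gam_sec) as [d1 [Hd1 H1]]; [eapply hitsP_hits, gam_pos|].
      destruct (exit_follow x ths (fun s => shift (gam s)) Hx hw hten) with (e := d1) as [d2 [Hd2 H2]]; auto.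
      + rewrite Hx0. simpl. lra.
      + apply gam_dep.
      + apply gam_v.
      + rewrite hb0. lra.
      + rewrite hb0. intros z hz. left. apply q_pos'. lra.
      + destruct (Hright (fun r => near d2 (sig d 0) (sig r 0))) as [r [hr [k4 [tq [k5 k6]]]]].
        { exists d2. split; auto. intros r hr h. apply sec_near; auto; [apply sec_sig; auto| |]; simpl; [now rewrite Rabs_minus_sym|rewrite Rminus_0_r, Rabs_R0; auto]. }
        destruct (Hdx r hr) as (k7 & k8 & k9). rewrite hb0 in H2. simpl in H2.
        destruct (H2 (flow (sig r 0)) k8) with (t := tq) as [l1 l2]; auto; [now rewrite Hx0, k9|].
        assert (hz : sec (unshift (flow (sig r 0) tq))) by (apply unshift_sec; auto).
        apply (hits_not_turns (unshift (flow (sig r 0) tq))); auto. apply H1; auto.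
        assert (0 <= sr (flow (sig r 0) tq)) by apply (sol_P1 _ tq k8).
        apply sec_near; auto; try apply gam_sec; simpl; [rewrite gam_r; apply Rabs_def1; lra|rewrite Rabs_minus_sym; auto]. }
  destruct Hout as [tq Htq]. set (z := unshift (x tq)). assert (Hz : sec z) by (apply unshift_sec; auto).
  assert (Hzr : 0 < sr z) by (unfold z; simpl; apply (r_pos x 0); auto; rewrite Hx0; simpl; lra).
  (* A hit would persist above [d], where orbits turn; a turn would make [d] itself [through]. *)
  assert (Hza : asym z).
  { destruct (trichotomy z Hz Hzr) as [h|[h|h]]; auto; exfalso.
    - destruct (Hright _ (out_open d tq hits ltac:(lra) Htq (hits_open z Hz h))) as [r [hr [[t1 [k1 k2]] [t2 [k3 k4]]]]].
      destruct (Hdx r hr) as (k7 & k8 & k9). rewrite (whit_unique _ _ _ _ k8 k3 k1) in k4.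
      apply (hits_not_turns _ (unshift_sec _ _ k8 k1) k2 k4).
    - apply Hnd. exists tq. auto. }
  destruct (out_open d tq _ ltac:(lra) Htq (asym_ret_pos z Hz Hzr Hza)) as [e [he Hpos]].
  destruct (zero_between out d C) as (r & p & h1 & h2 & h3); auto; try lra.
  - intros r p hr [t1 [k1 k2]]. destruct (Hdx r hr) as (k7 & k8 & k9). assert (hz := unshift_sec _ _ k8 k1).
    split; [apply (ret_sec _ _ hz k2)|apply (ret_r _ _ hz k2)]. simpl. apply (r_pos _ 0); auto. rewrite k9. simpl. lra.
  - intros r p p' hr [t1 [k1 k2]] [t2 [k3 k4]]. destruct (Hdx r hr) as (k7 & k8 & k9).
    rewrite (whit_unique _ _ _ _ k8 k3 k1) in k4. apply (ret_unique _ _ _ (unshift_sec _ _ k8 k1) k2 k4).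
  - intros r p e' hr [t1 [k1 k2]] he'. destruct (Hdx r hr) as (k7 & k8 & k9).
    destruct (out_open r t1 _ ltac:(lra) k1 (ret_cont _ p e' (unshift_sec _ _ k8 k1) k2 he')) as [d' [Hd' H']].
    exists d'. split; auto. intros r' hr' h'. destruct (H' r' ltac:(lra) h') as [t' [j1 [p' [j2 j3]]]]. exists p'. split; auto. exists t'. auto.
  - intros r hr. destruct (Hab r ltac:(lra)) as [t1 [k1 k2]]. destruct (Hdx r hr) as (k7 & k8 & k9).
    destruct (turn_ret _ (unshift_sec _ _ k8 k1) k2) as [p k3]. exists p, t1. auto.
  - exists (Rmin e (C - d)). split; [pos|]. intros r hr. rmin e (C - d).
    destruct (Hdx r ltac:(lra)) as (k7 & k8 & k9). destruct (Hab r ltac:(lra)) as [t1 [k1 k2]].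
    destruct (turn_ret _ (unshift_sec _ _ k8 k1) k2) as [p k3]. exists p. split; [exists t1; auto|].
    destruct (Hpos r ltac:(lra)) as [t2 [k4 k5]]; [apply Rabs_def1; lra|]. rewrite (whit_unique _ _ _ _ k8 k4 k1) in k5. auto.
  - intros p [t1 [k1 k2]] hp. destruct HoC as [t2 [k3 k4]]. destruct (Hdx C ltac:(lra)) as (k7 & k8 & k9).
    rewrite (whit_unique _ _ _ _ k8 k3 k1) in k4. rewrite (ret_unique _ _ _ (unshift_sec _ _ k8 k1) k2 k4) in hp.
    apply (hits_not_turns pC); auto; [apply (ret_sec _ _ (unshift_sec _ _ k8 k1) k4)|eapply hitsP_hits; eauto].
  - exists r, p. split; [lra|auto].
Qed.
End Excursion.

(** * Periodic orbits *)

Section Periodic.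
Context {S : system}.

(** Reflection about the line [- PI / 2]. *)
Definition refl (x : state) : state := mir (shift x).

Lemma refl_refl x : refl (refl x) = x.
Proof. apply state_eq; simpl; ring. Qed.

Lemma sol_refl x : sol x -> sol (fun s => refl (x s)).
Proof. intros H. apply sol_mir, sol_shift, H. Qed.

(** Each return is described in a frame reflected once more; only the parity of the number of
    reflections matters. *)
Definition refln (k : nat) (x : state) : state := if Nat.even k then x else refl x.

Lemma refln_S k x : refln k (refl x) = refln (Datatypes.S k) x.
Proof. unfold refln. rewrite Nat.even_succ, <- Nat.negb_even. destruct (Nat.even k); simpl; auto. apply refl_refl. Qed.

Lemma refln_th k x : sth (refln k x) = - (PI / 2) <-> sth x = - (PI / 2).
Proof. unfold refln. destruct (Nat.even k); simpl; [tauto|]. split; lra. Qed.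

Lemma ret_path p p' : sec p -> ret p p' -> exists t, 0 < t /\ (forall s, flow p (s + t) = refl (flow p' s)) /\
  sth (flow p t) = - (PI / 2) /\ forall s, 0 < s < t -> - (PI / 2) < sth (flow p s).
Proof.
  intros Hp Hr. assert (Hp' := ret_sec _ _ Hp Hr). assert (Hx := orb_sol _ Hp). assert (Hx0 := orb_0 _ Hp).
  destruct Hr as (t1 & t2 & (a1 & a2 & a3 & a4) & (b1 & b2 & b3) & h3).
  assert (E : flow p (t2 + t1) = refl p').
  { unfold refl. rewrite h3. apply state_eq; simpl; ring. }
  exists (t2 + t1). split; [lra|]. split; [|split].
  - apply (sol_unique (fun s => flow p (s + (t2 + t1))) (fun s => refl (flow p' s)) 0).
    + apply (sol_translate (flow p)); auto.
    + apply sol_refl, orb_sol; auto.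
    + now rewrite Rplus_0_l, (orb_0 p').
  - rewrite E. simpl. destruct Hp' as (_ & -> & _). lra.
  - intros s hs. assert (h0 : sth (flow p 0) = - (PI / 2)) by (rewrite Hx0; apply Hp).
    destruct (Rle_dec s t1).
    + rewrite <- h0. apply th_incr; auto; [lra|]. intros; apply a4; lra.
    + assert (h : sth (mir (flow p (s - t1 + t1))) < sth (mir (flow p (t2 + t1)))).
      { apply (th_incr (fun s => mir (flow p (s + t1)))); [apply (sol_mir (fun s => flow p (s + t1))), (sol_translate (flow p)); auto|lra|]. intros; apply b3; lra. }
      cbv beta in b2. rewrite b2 in h. simpl in h. replace (s - t1 + t1) with s in h by ring. lra.
Qed.

Lemma whit_th p b t s : sec p -> whit (flow p) b t -> 0 < s <= t -> - (PI / 2) < sth (flow p s) <= b.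
Proof.
  intros Hp (h1 & h2 & h3) hs. assert (Hx := orb_sol _ Hp). assert (h0 : sth (flow p 0) = - (PI / 2)) by (rewrite (orb_0 _ Hp); apply Hp).
  split.
  - rewrite <- h0. apply th_incr; auto; [lra|]. intros; apply h3; lra.
  - rewrite <- h2. destruct (proj2 hs) as [h|h]; [left; apply th_incr; auto; intros; apply h3; lra|right; now rewrite h].
Qed.

Lemma retn_path k p p' : sec p -> retn k p p' -> exists t l, 0 <= t /\ NoDup l /\ length l = k /\
  (forall s, In s l <-> 0 < s <= t /\ sth (flow p s) = - (PI / 2)) /\
  forall s, flow p (s + t) = refln k (flow p' s).
Proof.
  intros Hp H. induction H as [p|k p p1 p2 H IH H2].
  - exists 0, nil. split; [lra|]. split; [constructor|]. split; auto. split.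
    + intros s. simpl. split; [tauto|]. intros [h _]. lra.
    + intros s. now rewrite Rplus_0_r.
  - destruct (IH Hp) as (t & l & h1 & h2 & h3 & h4 & h5).
    destruct (ret_path p1 p2 (retn_sec _ _ _ Hp H) H2) as (t' & k1 & k2 & k3 & k4).
    exists (t' + t), ((t' + t) :: l). split; [lra|]. split; [|split; [|split]].
    + constructor; auto. intros h. apply h4 in h. lra.
    + simpl. now rewrite h3.
    + intros s. simpl. split.
      * intros [<-|h].
        -- split; [lra|]. rewrite h5. now apply refln_th.
        -- apply h4 in h. split; [lra|apply h].
      * intros [j1 j2]. destruct (Rle_dec s t) as [j3|j3]; [right; apply h4; split; auto; lra|].
        destruct (Req_dec s (t' + t)) as [j4|j4]; [left; auto|exfalso].
        specialize (k4 (s - t) ltac:(lra)). replace s with (s - t + t) in j2 by ring. rewrite h5 in j2. apply refln_th in j2. lra.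
    + intros s. rewrite <- Rplus_assoc, h5, k2. apply refln_S.
Qed.

Definition quarter (k : nat) (x : R -> state) (t : R) : Prop :=
  sol x /\ (forall s, 0 < sr (x s)) /\ 0 < t /\ sth (x 0) = - (PI / 2) /\ sv (x 0) = 0 /\ sv (x t) = 0 /\
  sth (x t) = (if Nat.even k then 0 else - PI) /\
  exists l, NoDup l /\ length l = k /\ forall s, In s l <-> 0 < s < t /\ sth (x s) = - (PI / 2).

Lemma quarter_sig r : 0 < r -> sec (sig r 0) /\ sol (flow (sig r 0)) /\ flow (sig r 0) 0 = sig r 0 /\ forall s, 0 < sr (flow (sig r 0) s).
Proof.
  intros Hr. assert (hs : sec (sig r 0)) by (apply sec_sig; lra). assert (hx := orb_sol _ hs). assert (h0 := orb_0 _ hs).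
  split; auto. split; auto. split; auto. apply (r_pos _ 0); auto. rewrite h0. simpl. auto.
Qed.

Lemma quarter_chain k r p : 0 < r -> retn k (sig r 0) p -> hitsP (fun v => v = 0) p -> exists t, quarter k (flow (sig r 0)) t.
Proof.
  intros Hr Hp [t [Ht Hv]]. destruct (quarter_sig r Hr) as (hs & hx & h0 & hr).
  assert (Hps := retn_sec _ _ _ hs Hp).
  destruct (retn_path k _ _ hs Hp) as (t0 & l & h1 & h2 & h3 & h4 & h5).
  assert (ht : 0 < t) by apply Ht.
  exists (t + t0). split; auto. split; auto. split; [lra|]. rewrite h0. split; auto. split; auto. rewrite h5. split; [|split].
  - unfold refln. destruct (Nat.even k); simpl; auto.
  - destruct Ht as (_ & h & _). unfold refln. destruct (Nat.even k); simpl; rewrite h; ring.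
  - exists l. split; auto. split; auto. intros s. rewrite h4. split; intros [k1 k2]; (split; [|auto]); [lra|].
    split; [lra|]. apply Rnot_lt_le. intros hn.
    replace s with (s - t0 + t0) in k2 by ring. rewrite h5 in k2. apply refln_th in k2.
    pose proof (whit_th p 0 t (s - t0) Hps Ht ltac:(lra)). lra.
Qed.

Lemma quarter_excursion r p : 0 < r -> out r p -> hitsP (fun v => v = 0) p -> exists t, quarter 0 (flow (sig r 0)) t.
Proof.
  intros Hr [t1 [Ht1 Hz]] [t [Ht Hv]]. destruct (quarter_sig r Hr) as (hs & hx & h0 & hr). pose proof PI_RGT_0 as hpi.
  set (x := flow (sig r 0)) in *. set (z := unshift (x t1)) in *. assert (Hzs : sec z) by (apply unshift_sec; auto).
  assert (Hps := ret_sec _ _ Hzs Hz). destruct (ret_path z p Hzs Hz) as (t2 & k1 & k2 & k3 & k4).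
  assert (E : forall s, x (s + t1) = shift (flow z s)).
  { intros s. unfold z. rewrite flow_unshift, shift_unshift by auto. reflexivity. }
  (* The excursion is a return to [PI / 2], so its reflection is about that line: the point of angle
     [0] for [p] is sent to [- PI] and the shift brings it back to [0], the final angle required for
     [k = 0]. *)
  assert (E2 : forall s, x (s + (t2 + t1)) = shift (refl (flow p s))).
  { intros s. rewrite <- Rplus_assoc, E, k2. reflexivity. }
  assert (ht : 0 < t) by apply Ht. assert (ht1 : 0 < t1) by apply Ht1.
  exists (t + (t2 + t1)). split; auto. split; auto. split; [lra|]. rewrite h0. split; auto. split; auto. rewrite E2. split; [auto|split].
  - destruct Ht as (_ & h & _). simpl. rewrite h. ring.
  - exists nil. split; [constructor|]. split; auto. intros s. simpl. split; [tauto|]. intros [j1 j2].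
    destruct (Rle_dec s t1) as [j3|j3].
    + pose proof (whit_th (sig r 0) (PI / 2) t1 s hs Ht1 ltac:(lra)). fold x in H. lra.
    + destruct (Rle_dec s (t2 + t1)) as [j4|j4].
      * replace s with (s - t1 + t1) in j2 by ring. rewrite E in j2. simpl in j2.
        destruct (Req_dec (s - t1) t2) as [j5|j5]; [rewrite j5, k3 in j2; lra|]. specialize (k4 (s - t1) ltac:(lra)). lra.
      * replace s with (s - (t2 + t1) + (t2 + t1)) in j2 by ring. rewrite E2 in j2. simpl in j2.
        pose proof (whit_th p 0 t (s - (t2 + t1)) Hps Ht ltac:(lra)). lra.
Qed.

(** The two reversors, about the starting line and about the final line, compose to a translation of [theta]. *)
Lemma quarter_periodic k x t : quarter k x t -> forall s,
  sr (x (s + 4 * t)) = sr (x s) /\ sv (x (s + 4 * t)) = sv (x s) /\ sw (x (s + 4 * t)) = sw (x s) /\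
  sth (x (s + 4 * t)) = sth (x s) + 2 * PI * IZR (if Nat.even k then 1 else -1).
Proof.
  intros (hx & _ & _ & h1 & h2 & h3 & h4 & _).
  assert (E0 : forall s, rev (refl (x (0 - s))) = x s).
  { apply (sol_unique (fun s => rev (refl (x (0 - s)))) x 0); auto.
    - apply (sol_rev (fun s => refl (x s)) 0), sol_refl; auto.
    - rewrite Rminus_0_r. apply state_eq; simpl; lra. }
  (* The reflection about the final line, [0] or [- PI]. Followed by [rev] it fixes the state at
     time [t], because [v] vanishes there. *)
  set (sg := fun y : state => if Nat.even k then mir y else mir (shift (shift y))).
  assert (hsg : sol (fun s => sg (x s))).
  { unfold sg. destruct (Nat.even k); [apply sol_mir; auto|apply sol_mir, (sol_shift (fun s => shift (x s))), sol_shift; auto]. }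
  assert (E1 : forall s, rev (sg (x (2 * t - s))) = x s).
  { apply (sol_unique (fun s => rev (sg (x (2 * t - s)))) x t); auto.
    - apply (sol_rev (fun s => sg (x s)) (2 * t)); auto.
    - replace (2 * t - t) with t by ring. unfold sg. destruct (Nat.even k); apply state_eq; simpl; lra. }
  assert (E2 : forall s, x (s + 2 * t) = rev (sg (rev (refl (x s))))).
  { intros s. rewrite <- (E1 (s + 2 * t)). do 2 f_equal. rewrite <- (E0 (2 * t - (s + 2 * t))). do 4 f_equal. ring. }
  intros s. replace (s + 4 * t) with (s + 2 * t + 2 * t) by ring. rewrite !E2. unfold sg. destruct (Nat.even k); simpl.
  - split; [auto|split; [ring|split; ring]].
  - split; [auto|split; [ring|split; ring]].
Qed.

(** Energy forbids [w = 0] on a collinear line, so the angle is strictly monotone through every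
    visit. *)
Lemma crosses_collinear x a s : sol x -> cos a = 0 -> crosses (fun s => sth (x s)) a s <-> sth (x s) = a.
Proof.
  intros Hx Ha. split; [intros [h _]; auto|]. intros h. split; auto.
  assert (main : forall y b u, sol y -> sth (y u) = b -> 0 < sw (y u) -> exists e, 0 < e /\ forall h, 0 < h < e -> sth (y (u - h)) - b < 0 < sth (y (u + h)) - b).
  { intros y b u Hy hb hw. destruct (sign_near (fun s => sw (y s)) u) as [d [Hd H]]; auto; [apply sol_cw; auto|].
    exists d. split; auto. intros z hz.
    assert (sth (y (u - z)) < sth (y u)) by (apply th_incr; auto; [lra|]; intros v hv; apply H, Rabs_def1; lra).
    assert (sth (y u) < sth (y (u + z))) by (apply th_incr; auto; [lra|]; intros v hv; apply H, Rabs_def1; lra). lra. }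
  pose proof (w_nonzero_collinear (x s) (sol_P1 x s Hx)) as hw. rewrite h in hw.
  destruct (Rlt_dec 0 (sw (x s))) as [hp|hp].
  - destruct (main x a s Hx h hp) as [e [he H]]. exists e. split; auto. intros z hz. specialize (H z hz).
    assert (0 < - (sth (x (s - z)) - a) * (sth (x (s + z)) - a)) by pos. lra.
  - destruct (main (fun s => mir (x s)) (- a) s (sol_mir x Hx)) as [e [he H]]; [simpl; lra|simpl; lra|]. exists e. split; auto. intros z hz. specialize (H z hz). simpl in H.
    assert (0 < (sth (x (s - z)) - a) * - (sth (x (s + z)) - a)) by pos. lra.
Qed.

Lemma quarter_exists {B : branches} k : exists x t, quarter k x t.
Proof.
  assert (Hz : (exists r p, 0 < r /\ retn k (sig r 0) p /\ hitsP (fun v => v = 0) p) -> exists x t, quarter k x t).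
  { intros (r & p & h1 & h2 & h3). exists (flow (sig r 0)). apply (quarter_chain k r p); auto. }
  destruct k as [|k].
  - destruct zero_or_neg as [[r [h1 h2]]|(b & h1 & h2 & h3)].
    + apply Hz. exists r, (sig r 0). split; auto. split; auto. constructor.
    + destruct (excursion b h1 h2 h3) as (r & p & k1 & k2 & k3). exists (flow (sig r 0)). apply (quarter_excursion r p); auto.
  - destruct (zero_pos (Datatypes.S k)) as [r [h1 [p [h2 h3]]]]; [lia|]. apply Hz. exists r, p. auto.
Qed.
End Periodic.

(** * From the hypotheses of the theorem to the abstract setting *)

Lemma metric_coefficient c : c = c_a \/ c = c_b -> exists c1 c2, (forall t, is_derive c t (c1 t)) /\ (forall t, is_derive c1 t (c2 t)) /\
  (forall t, continuous c2 t) /\ (forall t, 0 < c t) /\ (forall t, c (t + PI) = c t) /\ forall t, c (- t) = c t.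
Proof.
  intros [-> | ->].
  - exists (fun t => (1 + sin t ^ 2) * sin t * cos t), (fun t => 2 * sin t ^ 2 * cos t ^ 2 + (1 + sin t ^ 2) * (cos t ^ 2 - sin t ^ 2)).
    unfold c_a. split; [|split; [|split; [|split; [|split]]]].
    + intros t. auto_derive; auto. field.
    + intros t. auto_derive; auto. ring.
    + intros t. apply (ex_derive_continuous (fun t => 2 * sin t ^ 2 * cos t ^ 2 + (1 + sin t ^ 2) * (cos t ^ 2 - sin t ^ 2))). auto_derive. auto.
    + intros t. apply Rmult_lt_0_compat; [lra|]. apply pow_lt. pose proof (pow2_ge_0 (sin t)). lra.
    + intros t. rewrite neg_sin. ring.
    + intros t. rewrite sin_neg. ring.
  - exists (fun t => - 2 * cos t * sin t), (fun t => - 2 * (cos t ^ 2 - sin t ^ 2)).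
    unfold c_b. split; [|split; [|split; [|split; [|split]]]].
    + intros t. auto_derive; auto. ring.
    + intros t. auto_derive; auto. ring.
    + intros t. apply (ex_derive_continuous (fun t => - 2 * (cos t ^ 2 - sin t ^ 2))). auto_derive. auto.
    + intros t. pose proof (pow2_ge_0 (cos t)). lra.
    + intros t. rewrite neg_cos. ring.
    + intros t. rewrite cos_neg. ring.
Qed.

(** The collinear angles are isolated. This carries the symmetries of [V], assumed off these angles,
    over to [W] everywhere. *)
Lemma continuous_eq_off_collinear (f g : R -> R) : (forall t, continuous f t) -> (forall t, continuous g t) ->
  (forall t, cos t <> 0 -> f t = g t) -> forall t, f t = g t.
Proof.
  assert (main : forall f g : R -> R, (forall t, continuous f t) -> (forall t, continuous g t) -> (forall t, cos t <> 0 -> f t = g t) ->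
    forall t, ~ f t < g t).
  { intros f0 g0 hf hg h t hlt. destruct (sign_near (fun t => g0 t - f0 t) t) as [d [hd H]]; [apply (continuous_minus g0 f0); auto|lra|].
    destruct (Req_dec (cos t) 0) as [hc|hc]; [|rewrite (h t hc) in hlt; lra].
    assert (hm : 0 < Rmin d 1) by pos. rmin d 1. pose proof PI2_1.
    set (e := Rmin d 1 / 2). assert (he : 0 < e < 1) by (unfold e; lra).
    specialize (H (t + e)). cbv beta in H. rewrite h in H.
    - assert (0 < g0 (t + e) - g0 (t + e)); [|lra]. apply H. replace (t + e - t) with e by ring. rewrite Rabs_pos_eq; unfold e in *; lra.
    - rewrite cos_plus, hc. assert (0 < sin e) by (apply sin_gt_0; lra). pose proof (sin2_cos2 t) as hs. unfold Rsqr in hs. rewrite hc in hs.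
      intros k. assert (k' : sin t * sin e = 0) by lra. apply Rmult_integral in k'. destruct k' as [k'|k']; [rewrite k' in hs|]; lra. }
  intros hf hg h t. destruct (Rtotal_order (f t) (g t)) as [k|[k|k]]; auto; exfalso; [apply (main f g hf hg h t k)|].
  apply (main g f hg hf) with t; auto. intros u hu. symmetry. auto.
Qed.

(** On [(- PI / 2, 0)] the function [q = cos ^ 3 * V'] vanishes only at [- ths]. To the left its
    sign is that at [- PI / 2], where [q = - 2 * W]; nondegeneracy gives [q] a nonzero derivative at
    [- ths], positive by the sign on the left, so [q > 0] on the right. *)
Lemma system_exists c0 V0 W0 ths0 : c0 = c_a \/ c0 = c_b -> shape_potential V0 W0 ths0 ->
  exists S : system, @c S = c0 /\ @W S = W0 /\ @ths S = ths0 /\ @V S ths0 = V0 ths0.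
Proof.
  intros Hc (sV & pV & eV & perV & sW & pW & WV & ti & crit & nd & _).
  destruct (metric_coefficient c0 Hc) as (c1 & c2 & h1 & h2 & h3 & h4 & h5 & h6).
  assert (dW : forall t, is_derive W0 t (Derive W0 t)) by (intros t; apply Derive_correct, (sW 1%nat t)).
  assert (dW1 : forall t, is_derive (Derive W0) t (Derive_n W0 2 t)) by (intros t; apply (Derive_correct (Derive W0)), (sW 2%nat t)).
  assert (cW2 : forall t, continuous (Derive_n W0 2) t) by (intros t; apply (ex_derive_continuous (Derive_n W0 2)), (sW 3%nat t)).
  assert (cW : forall t, continuous W0 t) by (intros t; eapply is_derive_continuous, dW).
  assert (perW : forall t, W0 (t + PI) = W0 t).
  { apply continuous_eq_off_collinear; auto.
    - intros t. apply (continuous_comp (fun t : R => t + PI) W0); auto. apply (ex_derive_continuous (fun t : R => t + PI)). auto_derive. auto.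
    - intros t hc. rewrite !WV, perV, neg_cos; auto; [ring|]. rewrite neg_cos. lra. }
  assert (evW : forall t, W0 (- t) = W0 t).
  { apply continuous_eq_off_collinear; auto.
    - intros t. apply (continuous_comp (fun t : R => - t) W0); auto. apply (ex_derive_continuous (fun t : R => - t)). auto_derive. auto.
    - intros t hc. rewrite !WV, eV, cos_neg; auto. rewrite cos_neg. auto. }
  assert (cosp : forall t, - (PI / 2) < t < PI / 2 -> 0 < cos t) by (intros t ht; apply cos_gt_0; lra).
  set (q := fun t => cos t * Derive W0 t + 2 * sin t * W0 t).
  assert (dV : forall t, cos t <> 0 -> is_derive V0 t (Derive V0 t)) by (intros t ht; apply Derive_correct, (sV 1%nat t ht)).
  assert (hloc : forall t, - (PI / 2) < t < PI / 2 -> locally t (fun u => - (PI / 2) < u < PI / 2)).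
  { intros t ht. assert (hd : 0 < Rmin (t + PI / 2) (PI / 2 - t)) by pos. exists (mkposreal _ hd). intros u hu.
    assert (hb : Rabs (u - t) < Rmin (t + PI / 2) (PI / 2 - t)) by exact hu. apply Rabs_def2 in hb.
    rmin (t + PI / 2) (PI / 2 - t). lra. }
  assert (qV : forall t, - (PI / 2) < t < PI / 2 -> q t = cos t ^ 3 * Derive V0 t).
  { intros t ht. assert (hc := cosp t ht).
    assert (hd : is_derive W0 t (- 2 * cos t * sin t * V0 t + cos t ^ 2 * Derive V0 t)).
    { apply (is_derive_ext_loc (fun u => cos u ^ 2 * V0 u)).
      - destruct (hloc t ht) as [d Hd]. exists d. intros u hu. symmetry. apply WV. apply Rgt_not_eq, cosp, Hd, hu.
      - eapply is_derive_eq; [apply (is_derive_mult (fun u => cos u ^ 2) V0 t (- 2 * cos t * sin t) (Derive V0 t)); [auto_derive; auto; ring|apply dV; lra|apply Rmult_comm]|].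
        unfold plus, mult; simpl; unfold mult; simpl. ring. }
    apply is_derive_unique in hd. unfold q. rewrite hd, (WV t) by lra. ring. }
  assert (dq : forall t, is_derive q t (- sin t * Derive W0 t + cos t * Derive_n W0 2 t + (2 * cos t * W0 t + 2 * sin t * Derive W0 t))).
  { intros t. apply (is_derive_plus (fun t => cos t * Derive W0 t) (fun t => 2 * sin t * W0 t)).
    - apply (is_derive_mult cos (Derive W0)); [auto_derive; auto; ring|apply dW1|apply Rmult_comm].
    - apply (is_derive_mult (fun t => 2 * sin t) W0); [auto_derive; auto; ring|apply dW|apply Rmult_comm]. }
  assert (cq : forall t, continuous q t) by (intros t; eapply is_derive_continuous, dq).
  assert (q0 : forall t, - (PI / 2) < t < PI / 2 -> q t = 0 -> t = - ths0 \/ t = 0 \/ t = ths0).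
  { intros t ht h. apply crit; auto. rewrite qV in h by auto. apply Rmult_integral in h. destruct h as [h|h]; auto. exfalso.
    assert (0 < cos t ^ 3) by (apply pow_lt; auto). lra. }
  assert (qneg : forall t, - (PI / 2) <= t < - ths0 -> q t < 0).
  { intros t ht. apply Rnot_le_lt. intros hn.
    assert (hm : q (- (PI / 2)) < 0). { unfold q. rewrite cos_neg, cos_PI2, sin_neg, sin_PI2. pose proof (pW (- (PI / 2))). lra. }
    destruct (first_zero q (- (PI / 2)) t) as [u [k1 [k2 k3]]]; auto; try lra. destruct (q0 u) as [k|[k|k]]; lra. }
  set (l := - sin (- ths0) * Derive W0 (- ths0) + cos (- ths0) * Derive_n W0 2 (- ths0) + (2 * cos (- ths0) * W0 (- ths0) + 2 * sin (- ths0) * Derive W0 (- ths0))).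
  assert (hq : q (- ths0) = 0). { rewrite qV by lra. assert (hh : Derive V0 (- ths0) = 0) by (apply crit; lra). rewrite hh. ring. }
  assert (hl : l <> 0).
  { assert (hd : is_derive q (- ths0) (cos (- ths0) ^ 3 * Derive_n V0 2 (- ths0))).
    { apply (is_derive_ext_loc (fun u => cos u ^ 3 * Derive V0 u)).
      - destruct (hloc (- ths0) ltac:(lra)) as [d Hd]. exists d. intros u hu. symmetry. apply qV, Hd, hu.
      - assert (hc : cos (- ths0) <> 0) by (apply Rgt_not_eq, cosp; lra).
        eapply is_derive_eq; [apply (is_derive_mult (fun u => cos u ^ 3) (Derive V0) (- ths0) (- 3 * cos (- ths0) ^ 2 * sin (- ths0)) (Derive_n V0 2 (- ths0)));
          [auto_derive; auto; ring|apply (Derive_correct (Derive V0)), (sV 2%nat _ hc)|apply Rmult_comm]|].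
        assert (hh : Derive V0 (- ths0) = 0) by (apply crit; lra). unfold plus, mult; simpl; unfold mult; simpl. rewrite hh. ring. }
    apply is_derive_unique in hd. pose proof (is_derive_unique _ _ _ (dq (- ths0))) as hd2. fold l in hd2. rewrite <- hd2, hd.
    apply Rmult_integral_contrapositive. split; auto. apply Rgt_not_eq, pow_lt, cosp. lra. }
  assert (hl' : 0 < l).
  { destruct (Rtotal_order l 0) as [k|[k|k]]; [exfalso|tauto|auto].
    destruct (deriv_neg_right (fun u => - q (- ths0 - u)) 0 l) as [d [Hd H]]; auto.
    - rewrite Rminus_0_r, hq. ring.
    - eapply is_derive_eq; [apply (is_derive_opp (fun u => q (- ths0 - u)))|].
      + apply (is_derive_reflect q (- ths0) 0). rewrite Rminus_0_r. apply dq.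
      + apply Ropp_involutive.
    - assert (hm : 0 < Rmin d (PI / 2 - ths0)) by pos. rmin d (PI / 2 - ths0).
      set (u := Rmin d (PI / 2 - ths0) / 2). specialize (H u ltac:(unfold u; lra)). cbv beta in H.
      pose proof (qneg (- ths0 - u) ltac:(unfold u; lra)). lra. }
  assert (qpos : forall t, - ths0 < t < 0 -> 0 < q t).
  { intros t ht. apply Rnot_le_lt. intros hn.
    destruct (deriv_neg_right (fun u => - q u) (- ths0) (- l)) as [d [Hd H]]; [lra|apply (is_derive_opp q), dq|lra|].
    assert (hm : 0 < Rmin d (t + ths0)) by pos. rmin d (t + ths0).
    set (u := - ths0 + Rmin d (t + ths0) / 2). specialize (H u ltac:(unfold u; lra)). cbv beta in H.
    destruct (first_zero (fun s => - q s) u t) as [z [k1 [k2 k3]]]; try (unfold u in *; lra).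
    - intros s _. apply (continuous_opp q). auto.
    - cbv beta in k2. destruct (q0 z) as [k|[k|k]]; unfold u in *; lra. }
  exists {| c := c0; c1 := c1; c2 := c2; W := W0; W1 := Derive W0; W2 := Derive_n W0 2; ths := ths0;
    c_d := h1; c1_d := h2; c2_cont := h3; W_d := dW; W1_d := dW1; W2_cont := cW2; c_pos := h4; W_pos := pW; c_per := h5; W_per := perW;
    c_even := h6; W_even := evW; ths_int := ti; q_neg := qneg; q_pos := qpos |}.
  split; auto. split; auto. split; auto. unfold V. simpl.
  assert (hc : 0 < cos ths0) by (apply cosp; lra). rewrite (WV ths0) by lra. field. lra.
Qed.

Section Unstable.
Context {S : system}.

Lemma sol_reg r v th w : reg_solution c W r v th w -> on_P1 c W r v th w -> sol (fun s => St (r s) (v s) (th s) (w s)).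
Proof.
  intros H H'. assert (ec : forall t, Derive c t = c1 t) by (intros t; apply is_derive_unique, c_d).
  assert (eW : forall t, Derive W t = W1 t) by (intros t; apply is_derive_unique, W_d).
  split.
  - intros s. destruct (H s) as (h1 & h2 & h3 & h4). rewrite ec, eW in h4. split; [exact h1|split; [exact h2|split; [exact h3|exact h4]]].
  - intros s. destruct (H' s) as [h1 h2]. split; auto. unfold energy. simpl sv. simpl sth. simpl sw. simpl sr. lra.
Qed.

Lemma reg_sol x : sol x -> reg_solution c W (fun s => sr (x s)) (fun s => sv (x s)) (fun s => sth (x s)) (fun s => sw (x s)) /\
  on_P1 c W (fun s => sr (x s)) (fun s => sv (x s)) (fun s => sth (x s)) (fun s => sw (x s)).
Proof.
  intros [H H']. assert (ec : forall t, Derive c t = c1 t) by (intros t; apply is_derive_unique, c_d).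
  assert (eW : forall t, Derive W t = W1 t) by (intros t; apply is_derive_unique, W_d).
  split.
  - intros s. destruct (H s) as (h1 & h2 & h3 & h4). rewrite ec, eW. split; [exact h1|split; [exact h2|split; [exact h3|exact h4]]].
  - intros s. destruct (H' s) as [h1 h2]. split; auto. unfold energy in h2. lra.
Qed.

Lemma equilibrium v l : l = ths \/ l = - ths -> v * v = vs * vs -> sol (fun _ => St 0 v l 0).
Proof.
  intros Hl Hv. destruct (V_ths_cases l Hl) as (hV & _ & hq & hk). rewrite vs_sq, <- hV in Hv.
  assert (hW : W l = / 2 * (v * v) * cos l ^ 2) by (rewrite (W_V l), Hv by lra; field).
  split.
  - intros s. unfold motion, Fr, Fv, Fth, Fw. simpl sr. simpl sv. simpl sth. simpl sw. unfold q in hq.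
    assert (hW1 : W1 l + cos l * sin l * (v * v) = 0).
    { apply Rmult_eq_reg_l with (cos l); [|lra]. rewrite Rmult_0_r, <- hq, hW. field. }
    split; [|split; [|split]]; (eapply is_derive_eq; [apply (is_derive_const (_ : R))|]); unfold zero; simpl; try ring.
    + rewrite hW. ring.
    + replace 0 with (W1 l + cos l * sin l * (v * v)) at 1. ring.
  - intros s. split; [simpl; lra|]. unfold energy. simpl sr. simpl sv. simpl sth. simpl sw. rewrite hW. ring.
Qed.

Lemma w_dips x t : sol x -> sw (x t) = 0 -> 0 < cos (sth (x t)) -> 0 < q (sth (x t)) ->
  exists d, 0 < d /\ forall s, t - d < s < t -> sw (x s) < 0.
Proof.
  intros Hx Hw Hk Hq. pose proof (Fw_eq _ (sol_P1 x t Hx)) as e. rewrite Hw in e.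
  assert (hF : 0 < Fw (x t)). { apply Rmult_lt_reg_l with (cos (sth (x t))); auto. lra. }
  destruct (deriv_neg_right (fun u => sw (x (t - u))) 0 (- Fw (x t))) as [d [Hd H]]; [now rewrite Rminus_0_r| |lra|].
  - apply (is_derive_reflect (fun s => sw (x s)) t 0). rewrite Rminus_0_r. apply sol_dw; auto.
  - exists d. split; auto. intros s hs. specialize (H (t - s) ltac:(lra)). cbv beta in H. replace (t - (t - s)) with s in H by ring. auto.
Qed.

(** The branch leaves the equilibrium and keeps moving to the right, because the force pushes to the right up to the angle [a]. *)
Lemma unstable_departure x l a s1 : l = ths \/ l = - ths -> coll x -> (q a = 0 \/ cos a = 0) -> l < a <= PI / 2 ->
  (forall t, l < t < a -> 0 < q t) ->
  (forall e, 0 < e -> exists s0, forall s, s <= s0 -> near e (x s) (St 0 (- vs) l 0)) ->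
  ~ (forall s, x s = St 0 (- vs) l 0) -> (exists s0, forall s, s <= s0 -> 0 <= sw (x s)) ->
  sth (x s1) = a -> (forall s, s < s1 -> sth (x s) <> a) -> departure (fun s => x (s + s1)) l.
Proof.
  intros Hl Hc Ha Hla Hq Hlim Hne [s0 Hs0] H1 Hbef. assert (Hx := coll_sol _ Hc). destruct (V_ths_cases l Hl) as (hV & hl & hql & hkl).
  assert (Hlt : forall s, s < s1 -> sth (x s) < a).
  { intros s hs. apply Rnot_le_lt. intros hn.
    destruct (Hlim (a - l) ltac:(lra)) as [u Hu]. specialize (Hu (Rmin u (s - 1)) (Rmin_l _ _)). apply near_elim in Hu. simpl in Hu.
    pose proof (Rmin_r u (s - 1)).
    destruct (th_ivt x (Rmin u (s - 1)) s a) as [z [k1 [k2 k3]]]; auto; try lra.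
    apply (Hbef z); auto. lra. }
  assert (Hge : forall t, (forall s, s < t -> 0 <= sw (x s)) -> l <= sth (x t)).
  { intros t Ht. apply Rnot_lt_le. intros hn.
    destruct (Hlim (l - sth (x t)) ltac:(lra)) as [u Hu]. specialize (Hu (Rmin u t) (Rmin_l _ _)). apply near_elim in Hu. simpl in Hu.
    assert (sth (x (Rmin u t)) <= sth (x t)); [|lra].
    apply (nondecr (fun s => sth (x s)) (fun s => Fth (x s))); [apply Rmin_r|intros; apply sol_dth; auto|].
    intros s hs. apply Rmult_le_pos; [apply Ht; lra|left; apply c_pos]. }
  (* At the angle [l] with [w = 0] energy forces [v = vs] or [v = - vs], hence a constant solution:
     the first contradicts the limit at minus infinity, the second the assumption that the branch is
     not the equilibrium. *)
  assert (Hgt : forall t, (forall s, s < t -> 0 <= sw (x s)) -> 0 <= sw (x t) -> l < sth (x t) \/ 0 < sw (x t)).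
  { intros t Ht hw. destruct (Hge t Ht) as [|h]; [left; auto|]. destruct hw as [|hw]; [right; auto|]. exfalso.
    pose proof (coll_energy x t Hc) as e. rewrite <- h, <- hw, (W_V l), hV in e by lra.
    assert (hv : sv (x t) * sv (x t) = vs * vs).
    { rewrite vs_sq. apply Rmult_eq_reg_r with (cos l ^ 2); [lra|]. apply Rgt_not_eq, pow_lt; auto. }
    assert (hcst : forall s, x s = St 0 (sv (x t)) l 0).
    { apply (sol_unique x (fun _ => St 0 (sv (x t)) l 0) t); auto; [apply equilibrium; auto|].
      apply state_eq; simpl; auto. apply coll_r; auto. }
    apply Hne. intros s. rewrite hcst. f_equal.
    assert (hh : (sv (x t) - vs) * (sv (x t) + vs) = 0) by lra. apply Rmult_integral in hh. destruct hh as [hh|hh]; [|lra].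
    exfalso. destruct (Hlim vs vs_pos) as [u Hu]. specialize (Hu u ltac:(lra)). rewrite hcst in Hu. apply near_elim in Hu. simpl in Hu. lra. }
  assert (Hpos : forall t, t < s1 -> (forall s, s < t -> 0 <= sw (x s)) -> 0 <= sw (x t) -> 0 < sw (x t)).
  { intros t hts Ht hw. destruct (Hgt t Ht hw) as [h|h]; auto. destruct hw as [|hw]; auto. exfalso.
    specialize (Hlt t hts). destruct (w_dips x t Hx) as [d [Hd H]]; auto; [apply cos_pos; lra|].
    specialize (H (t - d / 2) ltac:(lra)). specialize (Ht (t - d / 2) ltac:(lra)). lra. }
  assert (Hall : forall t, t < s1 -> 0 < sw (x t)).
  { intros t hts. destruct (Rle_dec t s0) as [h|h].
    - apply Hpos; auto. intros s hs. apply Hs0. lra.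
    - apply Rnot_le_lt. intros hn.
      set (u := Rmin s0 (t - 1)). assert (hu : u <= s0) by apply Rmin_l.
      assert (hwu : 0 < sw (x u)) by (apply Hpos; [lra| |apply Hs0; lra]; intros s hs; apply Hs0; lra).
      destruct (w_stop x u t) as [z [k1 [k2 k3]]]; auto; try lra.
      assert (hz : 0 < sw (x z)); [|lra]. apply Hpos; [lra| |lra].
      intros s hs. destruct (Rle_dec s u); [apply Hs0; lra|left; apply k3; lra]. }
  assert (Hs1 : 0 < sw (x s1)).
  { assert (h0 : 0 <= sw (x s1)).
    { apply Rnot_lt_le. intros hn.
      destruct (sign_near (fun s => - sw (x s)) s1) as [d [Hd H]]; [apply (continuous_opp (fun s => sw (x s))), sol_cw; auto|lra|]. cbv beta in H. specialize (Hall (s1 - d / 2) ltac:(lra)).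
      assert (0 < - sw (x (s1 - d / 2))) by (apply H; apply Rabs_def1; lra). lra. }
    destruct h0 as [|h0]; auto. exfalso. destruct (Req_dec (cos a) 0) as [hc|hc].
    - apply (w_nonzero_collinear (x s1) (sol_P1 x s1 Hx)); rewrite ?H1; auto.
    - destruct Ha as [Ha|Ha]; [|tauto]. destruct (no_stop x s1 a Hx Ha hc H1 (eq_sym h0)) as [d [Hd H]].
      specialize (H (s1 - d) ltac:(lra)). specialize (Hall (s1 - d) ltac:(lra)). lra. }
  assert (Hw : forall s, s <= s1 -> 0 < sw (x s)) by (intros s [h| ->]; auto).
  split; [split; [apply (sol_translate x); auto|apply coll_r; auto]|]. split; [|split].
  - intros s hs. apply Hw. lra.
  - intros s hs. apply Rle_lt_trans with (sth (x (s + s1 - 1))).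
    + apply Hge. intros u hu. left. apply Hw. lra.
    + apply th_incr; auto; [lra|]. intros; apply Hw; lra.
  - intros e he. destruct (Hlim e he) as [u Hu]. exists (Rmin 0 (u - s1)). split; [apply Rmin_l|]. intros s hs. apply Hu.
    pose proof (Rmin_r 0 (u - s1)). lra.
Qed.

Lemma unstable_state v0 th0 r v th w : unstable_branch_wpos c W v0 th0 r v th w ->
  coll (fun s => St (r s) (v s) (th s) (w s)) /\
  (forall e, 0 < e -> exists s0, forall s, s <= s0 -> near e (St (r s) (v s) (th s) (w s)) (St 0 v0 th0 0)) /\
  ~ (forall s, St (r s) (v s) (th s) (w s) = St 0 v0 th0 0) /\ exists s0, forall s, s <= s0 -> 0 <= w s.
Proof.
  intros (h1 & h2 & h3 & h4 & h5 & h6 & h7 & h8). split; [split; [now apply sol_reg|apply h3]|]. split; [|split; auto].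
  - intros e he. apply is_lim_spec in h4, h5, h6. destruct (h4 (mkposreal e he)) as [M1 k1]. destruct (h5 (mkposreal e he)) as [M2 k2]. destruct (h6 (mkposreal e he)) as [M3 k3].
    simpl in k1, k2, k3. exists (Rmin (Rmin M1 M2) M3 - 1). intros s hs.
    rmin (Rmin M1 M2) M3. rmin M1 M2.
    split; [|split; [|split]]; simpl; [rewrite h3, Rminus_0_r, Rabs_R0; auto|apply k1; lra|apply k2; lra|].
    apply k3. lra.
  - intros h. apply h7. intros s. specialize (h s). injection h. auto.
Qed.

(** Beyond the line [- PI / 2] the branch cannot stop before the Euler line: a stop would force [v > vs], which prevents it from passing [- ths]. *)
Lemma whit_Euler x t : coll x -> sth (x 0) = - (PI / 2) -> 0 < sw (x 0) -> - vs < sv (x 0) -> 0 < t -> sth (x t) = 0 ->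
  (forall s, s < t -> sth (x s) <> 0) -> whit x 0 t.
Proof.
  intros Hc H0 Hw0 Hv0 Ht Hth Hbef. assert (Hx := coll_sol _ Hc). destruct ths_int as [ht1 ht2]. pose proof vs_pos as hvp. pose proof vs_sq as hsq.
  split; auto. split; auto. intros s Hs. apply Rnot_le_lt. intros hn.
  destruct (w_stop x 0 s) as [z [k1 [hwz hpos]]]; auto; try lra.
  assert (hth : - (PI / 2) < sth (x z)) by (rewrite <- H0; apply th_incr; auto; [lra|]; intros; apply hpos; lra).
  assert (hth0 : sth (x z) <= 0).
  { apply Rnot_lt_le. intros h.
    destruct (th_ivt x 0 z 0) as [u [j1 [j2 _]]]; auto; try lra. assert (u <> z) by (intros ->; lra). apply (Hbef u); auto. lra. }
  assert (hnost : forall b, sth (x z) = b -> q b = 0 -> cos b <> 0 -> False).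
  { intros b hb hq hc. destruct (no_stop x z b Hx hq hc hb hwz) as [d [Hd H]].
    rminp d z.
    specialize (H (z - Rmin d z / 2) ltac:(lra)). specialize (hpos (z - Rmin d z / 2) ltac:(lra)). lra. }
  assert (hcz : 0 < cos (sth (x z))) by (apply cos_pos; lra).
  assert (hlow : sth (x z) < - ths).
  { destruct (Rtotal_order (sth (x z)) (- ths)) as [h|[h|h]]; auto; exfalso.
    - apply (hnost _ h q_ths). rewrite h in hcz. lra.
    - destruct hth0 as [h'|h'].
      + destruct (w_dips x z Hx hwz hcz) as [d [Hd H]]; [apply q_pos; lra|].
        rminp d z.
        specialize (H (z - Rmin d z / 2) ltac:(lra)). specialize (hpos (z - Rmin d z / 2) ltac:(lra)). lra.
      + apply (hnost 0 h' q_zero). rewrite cos_0. lra. }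
  pose proof (En_turn _ (sol_P1 x z Hx) ltac:(lra) hwz) as hE. unfold En in hE. rewrite coll_r in hE by auto.
  assert (hV : V ths < V (sth (x z))) by (apply V_min; lra).
  assert (hvz : sv (x 0) <= sv (x z)) by (apply coll_v_nondecr; auto; lra).
  assert (hvs : vs < sv (x z)).
  { apply Rnot_le_lt. intros h.
    assert (sv (x z) ^ 2 <= vs * vs) by (clear - h hvz Hv0; nra). lra. }
  destruct (th_ivt x z t (- ths)) as [u [j1 [j2 _]]]; auto; try lra. assert (hvu : sv (x z) <= sv (x u)) by (apply coll_v_nondecr; auto; lra).
  destruct (V_ths_cases (- ths) ltac:(auto)) as (hV' & _ & _ & hk).
  pose proof (En_le_V _ (sol_P1 x u Hx)) as hEu. rewrite j2, hV' in hEu. unfold En in hEu. rewrite coll_r in hEu by auto.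
  assert (vs * vs < sv (x u) ^ 2) by (clear - hvu hvs hvp; nra). lra.
Qed.

Lemma branches_exist rg vg thg wg rg' vg' thg' wg' s1 s2 s3 :
  unstable_branch_wpos c W (- vs) (ths - PI) rg vg thg wg -> unstable_branch_wpos c W (- vs) (- ths) rg' vg' thg' wg' ->
  first_hit thg (- (PI / 2)) s1 -> vg s1 < 0 -> first_hit thg 0 s2 -> 0 < vg s2 -> first_hit thg' 0 s3 -> vg' s3 < 0 -> branches.
Proof.
  intros Hg Hg' [f1 f1'] v1 [f2 f2'] v2 [f3 f3'] v3.
  destruct (unstable_state _ _ _ _ _ _ Hg) as (a1 & a2 & a3 & a4). destruct (unstable_state _ _ _ _ _ _ Hg') as (b1 & b2 & b3 & b4).
  set (x := fun s => St (rg s) (vg s) (thg s) (wg s)) in *. set (y := fun s => St (rg' s) (vg' s) (thg' s) (wg' s)) in *.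
  assert (Hx := coll_sol _ a1). destruct ths_int as [ht1 ht2].
  assert (Hdep : departure (fun s => shift (x (s + s1))) ths).
  { apply (unstable_departure (fun s => shift (x s)) ths (PI / 2) s1); auto.
    - split; [apply sol_shift; auto|]. apply (coll_r x 0 a1).
    - right. apply cos_PI2.
    - lra.
    - intros t ht. apply q_pos'. lra.
    - intros e he. destruct (a2 e he) as [s0 H]. exists s0. intros s hs. specialize (H s hs). apply near_elim in H. apply near_intro; simpl in *; lra.
    - intros h. apply a3. intros s. rewrite <- (unshift_shift (St _ _ _ _)). fold (x s). rewrite h. apply state_eq; simpl; lra.
    - simpl. rewrite f1. lra.
    - simpl. intros s hs h. apply (f1' s hs). lra. }
  assert (Hdep' : departure (fun s => y (s + s3)) (- ths)).
  { apply (unstable_departure y (- ths) 0 s3); auto.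
    - left. apply q_zero.
    - lra.
    - intros t ht. apply q_pos. lra. }
  (* The branch starts near [ths - PI < - (PI / 2)], so it meets [- (PI / 2)] before [0]. *)
  assert (h12 : s1 < s2).
  { apply Rnot_le_lt. intros hn. assert (hgap : 0 < PI / 2 - ths) by lra. destruct (a2 _ hgap) as [s0 H].
    specialize (H (Rmin s0 (s2 - 1)) (Rmin_l _ _)). apply near_elim in H. simpl in H. pose proof (Rmin_r s0 (s2 - 1)).
    destruct (th_ivt x (Rmin s0 (s2 - 1)) s2 (- (PI / 2))) as [u [j1 [j2 _]]]; auto; try (simpl; lra). simpl in j2. assert (u <> s2) by (intros ->; lra). apply (f1' u); auto. lra. }
  assert (Hgc : coll (fun s => x (s + s1))) by (split; [apply (sol_translate x); auto|apply coll_r; auto]).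
  refine {| gam := fun s => x (s + s1); gam' := fun s => y (s + s3); gam_dep := Hdep; gam_sol := proj1 Hgc; gam'_dep := Hdep' |}.
  - rewrite Rplus_0_l. exact f1.
  - rewrite Rplus_0_l. exact v1.
  - exists (s2 - s1). split.
    + apply whit_Euler; auto; rewrite ?Rplus_0_l; auto; try lra.
      * destruct Hdep as (_ & h & _). specialize (h 0 ltac:(lra)). change (0 < sw (x (0 + s1))) in h. rewrite Rplus_0_l in h. exact h.
      * pose proof (proj1 (departure_v _ _ Hdep)) as h. change (- vs < sv (x (0 + s1))) in h. rewrite Rplus_0_l in h. exact h.
      * replace (s2 - s1 + s1) with s2 by ring. exact f2.
      * intros s hs h. apply (f2' (s + s1)); auto. lra.
    + replace (s2 - s1 + s1) with s2 by ring. exact v2.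
  - rewrite Rplus_0_l. exact f3.
  - rewrite Rplus_0_l. exact v3.
Qed.
End Unstable.

Theorem theorem3p3 (c V W : R -> R) (ths : R)
  (rg vg thg wg rg' vg' thg' wg' : R -> R) :
  (c = c_a \/ c = c_b) ->
  shape_potential V W ths ->
  unstable_branch_wpos c W (- sqrt (2 * V ths)) (ths - PI) rg vg thg wg ->
  unstable_branch_wpos c W (- sqrt (2 * V ths)) (- ths) rg' vg' thg' wg' ->
  (exists s1, first_hit thg (- (PI / 2)) s1 /\ vg s1 < 0) ->
  (exists s2, first_hit thg 0 s2 /\ 0 < vg s2) ->
  (exists s3, first_hit thg' 0 s3 /\ vg' s3 < 0) ->
  forall k : nat,
  exists (T : R) (r v th w : R -> R),
    0 < T /\
    reg_solution c W r v th w /\ on_P1 c W r v th w /\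
    (forall s, 0 < r s) /\
    (exists m : Z, forall s,
        r (s + T) = r s /\ v (s + T) = v s /\ w (s + T) = w s /\
        th (s + T) = th s + 2 * PI * IZR m) /\
    th 0 = - (PI / 2) /\ v 0 = 0 /\
    (exists l : list R, NoDup l /\ length l = k /\
       forall s, In s l <-> (0 < s < T / 4 /\ crosses th (- (PI / 2)) s)) /\
    v (T / 4) = 0 /\
    th (T / 4) = (if Nat.even k then 0 else - PI).
Proof.
  intros Hc HV Hg Hg' [s1 [f1 v1]] [s2 [f2 v2]] [s3 [f3 v3]] k.
  (* The potential of the abstract system is the quotient [W / cos ^ 2]; [eV] identifies it with the
     given [V] at [ths], where the hypotheses on the branches evaluate it. *)
  destruct (system_exists c V W ths Hc HV) as (S & <- & <- & <- & eV). rewrite <- eV in Hg, Hg'. fold vs in Hg, Hg'.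
  assert (B := branches_exist _ _ _ _ _ _ _ _ s1 s2 s3 Hg Hg' f1 v1 f2 v2 f3 v3).
  destruct (quarter_exists k) as (x & t & Hq). pose proof (quarter_periodic k x t Hq) as Hper.
  destruct Hq as (hx & hr & ht & h1 & h2 & h3 & h4 & l & h5 & h6 & h7). destruct (reg_sol x hx) as [k1 k2].
  exists (4 * t), (fun s => sr (x s)), (fun s => sv (x s)), (fun s => sth (x s)), (fun s => sw (x s)).
  replace (4 * t / 4) with t by field. split; [lra|]. split; auto. split; auto. split; auto. split; [eexists; exact Hper|].
  split; auto. split; auto. split; [|split; auto].
  exists l. split; auto. split; auto. intros s. rewrite h7, (crosses_collinear x _ s hx cos_mPI2). tauto.
Qed.
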